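(* Let $N\geq3$ and $2<q<\frac4N+2$. For each $\gamma>0$, every minimizer $u$ of the problem $$u\in\Gamma,\ u\text{ radial},\qquad E(u)=\min\{E(z):z\in\Gamma,\ z\text{ radial}\}$$ behaves at the origin like $|x|^{-(N-2)/2}$, i.e. the limit $\lim_{|x|\to0}|x|^{\frac{N-2}{2}}u(x)$ exists, is finite and is nonzero.
   Context: Functions are complex-valued and Hilbert spaces are regarded as real Hilbert spaces. Space $H$: the completion of $\{|x|^{-\frac{N-2}{2}}v: v\in C_0^\infty(\mathbb{R}^N)\}$ under the norm $\|u\|_H^2=\int_{\mathbb{R}^N}|x|^{-(N-2)}|\nabla(|x|^{\frac{N-2}{2}}u)|^2dx+\int_{\mathbb{R}^N}|u|^2dx$. Energy: $E(u)=\frac12\lim_{\varepsilon\downarrow0}(I_{B_\varepsilon^c}(u)-\Lambda_\varepsilon(u))-\frac1q\int_{\mathbb{R}^N}|u|^qdx$, where $B_\varepsilon^c$ is the complement of the ball of radius $\varepsilon$ centered at the origin, $I_{B_\varepsilon^c}(u)=\int_{B_\varepsilon^c}|\nabla u|^2dx-\left(\frac{N-2}{2}\right)^2\int_{B_\varepsilon^c}\frac{|u|^2}{|x|^2}dx$ and $\Lambda_\varepsilon(u)=\frac{N-2}{2}\varepsilon^{-1}\int_{|x|=\varepsilon}|u|^2dS$; the limit equals $\int_{\mathbb{R}^N}|x|^{-(N-2)}|\nabla(|x|^{\frac{N-2}{2}}u)|^2dx$. $\Gamma=\{u\in H:\int_{\mathbb{R}^N}|u|^2dx=\gamma\}$.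 *)

(* Defs.v *)
From HB Require Import structures.
From mathcomp Require Import all_boot all_order all_algebra.
From mathcomp Require Import all_classical all_reals all_analysis.
From mathcomp Require Export complex.
Set Implicit Arguments.
Unset Strict Implicit.
Unset Printing Implicit Defensive.
Import Order.TTheory GRing.Theory Num.Theory.
Import numFieldNormedType.Exports.
Import ComplexField.Normc.
Local Open Scope classical_set_scope.
Local Open Scope ring_scope.
Local Open Scope complex_scope.

Definition rV_display : measure_display.
Proof. exact: default_measure_display. Qed.

Section rV_measurable.
Context {R : realType} (n : nat).

Let coord : 'I_n -> 'rV[R]_n -> R := fun i x => x ord0 i.

Let rV_set0 : g_sigma_preimage coord set0.
Proof. exact: sigma_algebra0. Qed.

Let rV_setC A : g_sigma_preimage coord A -> g_sigma_preimage coord (~` A).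
Proof. exact: sigma_algebraC. Qed.

Let rV_bigcup (F : _^nat) : (forall i, g_sigma_preimage coord (F i)) ->
  g_sigma_preimage coord (\bigcup_i (F i)).
Proof. exact: sigma_algebra_bigcup. Qed.

(* The sigma-algebra generated by the coordinates, i.e. the Borel sets; same
   construction as the library's on [n.-tuple T]. *)
HB.instance Definition _ := @isMeasurable.Build rV_display
  'rV[R]_n (g_sigma_preimage coord) rV_set0 rV_setC rV_bigcup.

Lemma measurable_coord (i : 'I_n) :
  measurable_fun [set: 'rV[R]_n] (fun x : 'rV[R]_n => x ord0 i).
Proof.
move=> _ Y mY; rewrite setTI; apply: sub_sigma_algebra => /=.
rewrite -bigcup_seq/=; exists i => /=; first by rewrite mem_index_enum.
by exists Y => //; rewrite setTI.
Qed.

Lemma measurable_fun_coordP d (T : measurableType d) (f : T -> 'rV[R]_n) :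
  (forall i, measurable_fun [set: T] (fun t => f t ord0 i)) ->
  measurable_fun [set: T] f.
Proof.
move=> mf _ Y mY; rewrite setTI.
suff H : g_sigma_preimage coord `<=` [set A | measurable (f @^-1` A)].
  exact: H.
apply: smallest_sub.
  split => /=; first by rewrite preimage_set0.
    by move=> A mA; rewrite setTD preimage_setC; exact: measurableC.
  by move=> F mF; rewrite preimage_bigcup; exact: bigcup_measurable.
move=> A; rewrite -bigcup_seq => -[i _ [B mB <-]] /=.
by rewrite setTI -comp_preimage -[X in measurable X]setTI; exact: mf.
Qed.

End rV_measurable.

Section lebesgue_rV.
Context {R : realType}.
Local Open Scope ereal_scope.

Definition rV_cons n (p : R * 'rV[R]_n) : 'rV[R]_n.+1 :=
  \row_(i < n.+1) oapp (p.2 ord0) p.1 (unlift ord0 i).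

Lemma rV_cons0 n (p : R * 'rV[R]_n) : rV_cons p ord0 ord0 = p.1.
Proof. by rewrite mxE unlift_none. Qed.

Lemma rV_consS n (p : R * 'rV[R]_n) (i : 'I_n) :
  rV_cons p ord0 (lift ord0 i) = p.2 ord0 i.
Proof. by rewrite mxE liftK. Qed.

Lemma measurable_rV_cons n : measurable_fun setT (@rV_cons n).
Proof.
apply: measurable_fun_coordP => i.
case: (unliftP ord0 i) => [j ->|->].
  under eq_fun do rewrite rV_consS.
  exact: (measurableT_comp (measurable_coord j) measurable_snd).
under eq_fun do rewrite rV_cons0.
exact: measurable_fst.
Qed.

Section step.
Context {n : nat} (mu : {sigma_finite_measure set 'rV[R]_n -> \bar R}).

Definition lebesgue_step : set 'rV[R]_n.+1 -> \bar R :=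
  pushforward (lebesgue_measure \x mu) (@rV_cons n).

Let step0 : lebesgue_step set0 = 0.
Proof. by rewrite /lebesgue_step /pushforward preimage_set0 measure0. Qed.

Let step_ge0 A : 0 <= lebesgue_step A.
Proof. by rewrite /lebesgue_step /pushforward measure_ge0. Qed.

Let step_sigma_additive : semi_sigma_additive lebesgue_step.
Proof.
apply: (@measure_semi_sigma_additive _ _ _
  (measure_function_pushforward__canonical__measure_function_Measure
    (lebesgue_measure \x mu)%E (@measurable_rV_cons n))).
Qed.

HB.instance Definition _ := isMeasure.Build _ _ _ lebesgue_step
  step0 step_ge0 step_sigma_additive.

Let step_sigma_finite : sigma_finite setT lebesgue_step.
Proof.
have /sigma_finiteP[A [AT ndA Aoo]] := sigma_finiteT (@lebesgue_measure R).
have /sigma_finiteP[B [BT ndB Boo]] := sigma_finiteT mu.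
pose F k := A k `*` B k.
have FT : setT = \bigcup_k F k.
  rewrite -setXTT AT BT predeqE => -[x y]; split.
    move=> [/= [i _ Ax] [j _ By]]; exists (maxn i j) => //; split.
    - by move: x Ax; exact/subsetPset/ndA/leq_maxl.
    - by move: y By; exact/subsetPset/ndB/leq_maxr.
  by move=> [i _ []/= ? ?]; split; exists i.
have mF k : measurable (F k) /\ (lebesgue_measure \x mu) (F k) < +oo.
  have [? ?] := Aoo k; have [? ?] := Boo k.
  split; first exact: measurableX.
  by rewrite product_measure1E// lte_mul_pinfty// ge0_fin_numE.
pose g (x : 'rV[R]_n.+1) : R * 'rV[R]_n :=
  (x ord0 ord0, \row_i x ord0 (lift ord0 i)).
have gK : cancel (@rV_cons n) g.
  move=> [a x]; rewrite /g rV_cons0; congr pair.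
  by apply/rowP => i; rewrite mxE rV_consS.
have mg : measurable_fun setT g.
  apply/measurable_fun_pairP; split; first exact: measurable_coord.
  apply: measurable_fun_coordP => i /=.
  under eq_fun do rewrite mxE.
  exact: measurable_coord.
exists (fun k => g @^-1` F k); first by rewrite -preimage_bigcup -FT.
move=> k; have [mFk Fkoo] := mF k; split.
  by rewrite -[X in measurable X]setTI; exact: mg.
rewrite /lebesgue_step /pushforward -comp_preimage.
suff -> : g \o @rV_cons n = id by rewrite preimage_id.
exact/funext.
Qed.

HB.instance Definition _ := Measure_isSigmaFinite.Build _ _ _ lebesgue_step
  step_sigma_finite.

End step.

(* R^(n+1) is identified with R x R^n. *)
Fixpoint lebesgue_rV n : {sigma_finite_measure set 'rV[R]_n -> \bar R} :=
  match n return {sigma_finite_measure set 'rV[R]_n -> \bar R} with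
  | 0%N => dirac (0%R : 'rV[R]_0)
  | n'.+1 => lebesgue_step (lebesgue_rV n')
  end.

End lebesgue_rV.

Section functions.
Context {R : realType} {N : nat}.
Implicit Types (x : 'rV[R]_N) (f phi : 'rV[R]_N -> R) (u v : 'rV[R]_N -> R[i]).

(* The library's norm on ['rV[R]_N] is the sup norm. *)
Definition enorm x : R := Num.sqrt (\sum_(i < N) x ord0 i ^+ 2).

Definition Re_fun u : 'rV[R]_N -> R := fun x => complex.Re (u x).
Definition Im_fun u : 'rV[R]_N -> R := fun x => complex.Im (u x).

Definition cmeasurable (D : set 'rV[R]_N) u : Prop :=
  measurable_fun D (Re_fun u) /\ measurable_fun D (Im_fun u).

Definition partial (i : 'I_N) f : 'rV[R]_N -> R :=
  fun x => 'D_(delta_mx ord0 i) f x.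

Fixpoint Ck (k : nat) f : Prop :=
  match k with
  | 0%N => continuous f
  | k'.+1 => continuous f /\
      forall i : 'I_N, (forall x, derivable f x (delta_mx ord0 i)) /\
                       Ck k' (partial i f)
  end.

(* C_c^infty(O; R) and C_c^infty(O; C). *)
Definition test_fun (O : set 'rV[R]_N) phi : Prop :=
  (forall k, Ck k phi) /\
  exists K : set 'rV[R]_N,
    [/\ compact K, K `<=` O & forall x, ~ K x -> phi x = 0].

Definition ctest_fun (O : set 'rV[R]_N) v : Prop :=
  test_fun O (Re_fun v) /\ test_fun O (Im_fun v).

Definition punctured : set 'rV[R]_N := ~` [set 0].

Definition locally_integrable (O : set 'rV[R]_N) f : Prop :=
  forall K, compact K -> K `<=` O ->
    (lebesgue_rV N).-integrable K (EFin \o f).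

(* [g] is the weak gradient of [f] on R^N minus the origin. *)
Definition is_wgrad f (g : 'rV[R]_N -> 'rV[R]_N) : Prop :=
  [/\ locally_integrable punctured f,
      forall i, locally_integrable punctured (fun x => g x ord0 i) &
      forall phi, test_fun punctured phi -> forall i,
        \int[lebesgue_rV N]_x (f x * partial i phi x) =
        - \int[lebesgue_rV N]_x (g x ord0 i * phi x)].

Definition wdifferentiable u : Prop :=
  (exists g, is_wgrad (Re_fun u) g) /\ (exists g, is_wgrad (Im_fun u) g).

(* Determined up to a null set when [f] is weakly differentiable. *)
Definition wgrad f : 'rV[R]_N -> 'rV[R]_N := xget (fun=> 0) (is_wgrad f).

Definition grad_sq u x : R :=
  enorm (wgrad (Re_fun u) x) ^+ 2 + enorm (wgrad (Im_fun u) x) ^+ 2.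

(* The integral of [h] over |x| = eps for the surface measure dS. In polar
   coordinates, the integral of h(eps x/|x|) over |x| < eps is eps/N times it. *)
Definition sphere_integral (eps : R) (h : 'rV[R]_N -> \bar R) : \bar R :=
  ((N%:R / eps)%:E *
   \int[lebesgue_rV N]_(x in [set x | (0 < enorm x < eps)%R])
     h ((eps / enorm x) *: x)%R)%E.

End functions.

Definition hardy_exp (R : realType) (N : nat) : R := (N%:R - 2) / 2.

Section spaceH.
Context {R : realType} {N : nat}.
Implicit Types (u g : 'rV[R]_N -> R[i]) (w : nat -> 'rV[R]_N -> R[i]).

Definition ground u : 'rV[R]_N -> R[i] :=
  fun x => (enorm x `^ hardy_exp R N)%:C * u x.

Definition normH2 u : \bar R :=
  (\int[lebesgue_rV N]_x (enorm x `^ (- (N%:R - 2)) * grad_sq (ground u) x)%:E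
   + \int[lebesgue_rV N]_x (normc (u x) ^+ 2)%:E)%E.

Definition coreH u : Prop :=
  exists v : 'rV[R]_N -> R[i], ctest_fun setT v /\
    forall x, u x = (enorm x `^ (- hardy_exp R N))%:C * v x.

Definition approxH w u : Prop :=
  (forall k, coreH (w k)) /\
  normH2 (fun x => w k x - u x) @[k --> \oo] --> 0%E.

(* The completion of [coreH], realized as its closure in the space of all [u]
   for which [normH2 u] makes sense and is finite; the latter space is complete
   (modulo equality a.e.) because weak gradients pass to limits. *)
Definition spaceH u : Prop :=
  [/\ cmeasurable setT u, wdifferentiable (ground u), (normH2 u < +oo)%E &
      exists w, approxH w u].

(* The trace on |x| = eps, i.e. the continuous extension to H of the restriction
   map from [coreH] to L^2(|x| = eps). *)
Definition is_trace (eps : R) u g : Prop :=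
  cmeasurable [set x | enorm x = eps] g /\
  exists w, approxH w u /\
    sphere_integral eps (fun x => (normc (w k x - g x) ^+ 2)%:E)
      @[k --> \oo] --> 0%E.

Definition trace (eps : R) u : 'rV[R]_N -> R[i] :=
  xget (fun=> 0) (is_trace eps u).

End spaceH.

Section energy.
Context {R : realType} {N : nat}.
Implicit Types (u z : 'rV[R]_N -> R[i]).
Local Open Scope ereal_scope.

Definition I_ext (eps : R) u : \bar R :=
  \int[lebesgue_rV N]_(x in [set x | (eps <= enorm x)%R]) (grad_sq u x)%:E
  - ((hardy_exp R N) ^+ 2)%:E *
    \int[lebesgue_rV N]_(x in [set x | (eps <= enorm x)%R])
      (normc (u x) ^+ 2 / enorm x ^+ 2)%:E.

Definition Lambda (eps : R) u : \bar R :=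
  (hardy_exp R N * eps^-1)%:E *
  sphere_integral eps (fun x => (normc (trace eps u x) ^+ 2)%:E).

Definition energy (q : R) u : \bar R :=
  (2^-1)%:E * lim (I_ext eps u - Lambda eps u @[eps --> (0%R : R)^'+])
  - (q^-1)%:E * \int[lebesgue_rV N]_x (normc (u x) `^ q)%:E.

Definition Gamma (gamma : R) u : Prop :=
  spaceH u /\ \int[lebesgue_rV N]_x (normc (u x) ^+ 2)%:E = gamma%:E.

Definition radial u : Prop :=
  exists f : R -> R[i], {ae lebesgue_rV N, forall x, u x = f (enorm x)}.

Definition radial_minimizer (q gamma : R) u : Prop :=
  [/\ Gamma gamma u, radial u &
      forall z, Gamma gamma z -> radial z -> energy q u <= energy q z].

End energy.

(* Main.v *)
(* Writing [f = |x|^((N-2)/2) u] turns the energy into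
   [1/2 \int |x|^(-(N-2)) |grad f|^2 - 1/q \int |u|^q]: the boundary terms of the
   integration by parts cancel [Lambda]. A radial [f] has an absolutely continuous
   profile [F] on ]0, +oo[, and in the radial variable the problem is two-dimensional:
   [\int r (F'^2 + F^2) dr] is finite. Comparing a minimizer with
   [k (u + t |x|^(-(N-2)/2) eta(|x|))], with [k] restoring the mass, gives
   [(r F')' = - (r^s |F|^(q-2) + lambda r) F] with [s = N - 1 - q (N-2)/2], and
   [q < 4/N + 2] makes [s > -1]. Since [F = O(r^(-d))] for every [d > 0], the right-hand
   side is integrable at [0], so [r F'] has a limit there; the limit is [0] because
   [\int r F'^2 dr] is finite, and then [F] has a limit [c] as well. If [c = 0], the
   integral equation is a contraction near [0] and Gronwall's inequality
   propagates [F = 0] to the half-line, contradicting [\int |u|^2 = gamma > 0]. *)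
Require Import Defs.
From mathcomp Require Import all_boot all_order all_algebra.
From mathcomp Require Import all_classical all_reals all_analysis.
From mathcomp Require Import measurable_realfun ring lra.
Import Order.TTheory GRing.Theory Num.Theory.
Import numFieldNormedType.Exports.
Import ComplexField.Normc.
Local Open Scope classical_set_scope.
Local Open Scope ring_scope.
Local Open Scope complex_scope.
Set Implicit Arguments.
Unset Strict Implicit.
Unset Printing Implicit Defensive.

(** Weak gradients and traces are chosen elements, fixed only up to null sets, so every fact about
    them has to be extracted from test functions and Fubini. Two estimates carry the analysis.
    [acp_pointwise] bounds a profile at a point by the weighted energy beyond it; it identifies the
    traces and makes [F] vanish at infinity. [acp_near0] gives the growth bound r^(-d). The L^q term
    is not differentiated along the competitors. Convexity bounds it below by an affine function of
    t; as it enters the energy with a minus sign, the energy of the competitors is bounded above by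
    an explicit function of t that touches it at t = 0, and that function is the one shown to be
    stationary. Complex values are treated as two real components, varied independently but coupled
    through |F|^2. No sign or phase is assumed, so the limit is a pair [c], and uniqueness has to be
    proved for the pair. *)

Ltac mfun1 := lazymatch goal with
  | |- measurable_fun _ (fun x => (@?f x + @?g x)%R) => apply: measurable_funD
  | |- measurable_fun _ (fun x => (- @?f x)%R) => apply: measurable_funN
  | |- measurable_fun _ (fun x => (@?f x * @?g x)%R) => apply: measurable_funM
  | |- measurable_fun _ (fun x => (@?f x ^+ _)%R) => apply: measurable_funX
  | |- measurable_fun _ (fun x => \sum_(i <- _) _)%R => apply: measurable_sum => ?
  | |- measurable_fun _ (fun x => (_)%:E) => apply/measurable_EFinP
  end.
Ltac mfun := repeat (first
  [ assumption | done
  | exact: measurable_cst | exact: measurable_id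
  | exact: measurable_coord
  | exact: measurable_fst | exact: measurable_snd
  | exact: measurable_rV_cons | mfun1 ]).

(** * Lebesgue measure on row vectors *)

Section lebesgue_rV_theory.
Context {R : realType}.
Local Open Scope ereal_scope.
Notation leb := (@lebesgue_measure R).

Lemma integral_rVS n (F : 'rV[R]_n.+1 -> \bar R) :
  measurable_fun setT F -> (forall x, 0 <= F x) ->
  \int[lebesgue_rV n.+1]_x F x =
  \int[leb]_a \int[lebesgue_rV n]_y F (rV_cons (a, y)).
Proof.
move=> mF F0.
transitivity (\int[pushforward (leb \x lebesgue_rV n) (@rV_cons R n)]_x F x) => //.
rewrite ge0_integral_pushforward//; last exact: measurable_rV_cons.
rewrite preimage_setT fubini_tonelli1//; last by move=> x; exact: F0.
exact: measurableT_comp mF (@measurable_rV_cons R n).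
Qed.

(** s times the image of [leb] under a |-> s a + b agrees with [leb] on half-open intervals;
    uniqueness of Lebesgue measure does the rest. *)
Lemma lebesgue_affine (s b : R) (A : set R) : (0 < s)%R -> measurable A ->
  leb A = s%:E * leb ((fun a => s * a + b)%R @^-1` A).
Proof.
move=> s0 mA.
have mf : measurable_fun setT (fun a : measurableTypeR R => (s * a + b)%R : measurableTypeR R).
  by mfun.
pose m := mscale (NngNum (ltW s0)) (measure_function_pushforward__canonical__measure_function_Measure leb mf).
rewrite (@lebesgue_measure_unique R m)// => X [[p r]] /= pr <-.
rewrite /m /mscale/= /pushforward.
have -> : (fun a => (s * a + b)%R) @^-1` `]p, r] = `](p - b) / s, (r - b) / s]%classic%R.
  apply/seteqP; split=> a /=; rewrite !in_itv/= ltr_pdivrMr// ler_pdivlMr//;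
    by rewrite ltrBlDr lerBrDr (mulrC a).
rewrite !lebesgue_measure_itv/= !lte_fin ltr_pM2r ?invr_gt0// ltrD2r.
case: ifPn => _; last by rewrite mule0.
rewrite -!EFinB -EFinM; congr EFin.
by field; rewrite gt_eqF.
Qed.

Lemma integral_affine (s b : R) (F : R -> \bar R) : (0 < s)%R ->
  measurable_fun setT F -> (forall x, 0 <= F x) ->
  \int[leb]_x F x = s%:E * \int[leb]_x F (s * x + b)%R.
Proof.
move=> s0 mF F0.
have mf : measurable_fun setT (fun a : measurableTypeR R => (s * a + b)%R : measurableTypeR R).
  by mfun.
pose m := mscale (NngNum (ltW s0)) (measure_function_pushforward__canonical__measure_function_Measure leb mf).
transitivity (\int[m]_x F x).
  by apply: eq_measure_integral => A mA _; exact: lebesgue_affine.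
rewrite ge0_integral_mscale// ge0_integral_pushforward//.
Qed.

Lemma rV_cons_affine n (s : R) (b x : 'rV[R]_n.+1) a y : x = rV_cons (a, y) ->
  (s *: x + b = rV_cons (s * a + b ord0 ord0, s *: y + \row_i b ord0 (lift ord0 i)))%R.
Proof.
move=> ->; apply/rowP => i; rewrite !mxE.
by case: (unliftP ord0 i) => [j ->|->]; rewrite ?liftK ?unlift_none/= ?mxE.
Qed.

Lemma measurable_affine_rV n (s : R) (b : 'rV[R]_n) :
  measurable_fun setT (fun x : 'rV[R]_n => (s *: x + b)%R).
Proof.
apply: measurable_fun_coordP => i.
under eq_fun do rewrite !mxE.
by apply: measurable_funD; mfun.
Qed.

Lemma measurable_scale_rV d (T : measurableType d) n (s : T -> R) (g : T -> 'rV[R]_n) :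
  measurable_fun setT s -> measurable_fun setT g ->
  measurable_fun setT (fun t => s t *: g t)%R.
Proof.
move=> ms mg; apply: measurable_fun_coordP => i; under eq_fun do rewrite mxE.
by apply: measurable_funM => //; exact: (measurableT_comp (measurable_coord i) mg).
Qed.

(** Induction on n: the tail is rescaled inside the integral over the first coordinate, which then
    contributes the last factor s. *)
Lemma integral_rV_affine n (s : R) (b : 'rV[R]_n) (F : 'rV[R]_n -> \bar R) : (0 < s)%R ->
  measurable_fun setT F -> (forall x, 0 <= F x) ->
  \int[lebesgue_rV n]_x F x = (s ^+ n)%:E * \int[lebesgue_rV n]_x F (s *: x + b)%R.
Proof.
move=> s0; elim: n b F => [|n IH] b F mF F0.
  rewrite expr0 mul1e; apply: eq_integral => x _.
  by congr F; apply/rowP => -[].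
rewrite integral_rVS//.
transitivity (\int[leb]_a ((s ^+ n)%:E * \int[lebesgue_rV n]_y
     F (rV_cons (a, s *: y + \row_i b ord0 (lift ord0 i))%R))).
  apply: eq_integral => a _.
  rewrite (IH (\row_i b ord0 (lift ord0 i))%R)//.
  apply: measurableT_comp => //.
  apply: (measurableT_comp (@measurable_rV_cons R n)).
  exact: measurable_pair1.
have mG : measurable_fun setT (fun p : R * 'rV[R]_n =>
    F (rV_cons (p.1, s *: p.2 + \row_i b ord0 (lift ord0 i))%R)).
  apply: measurableT_comp => //.
  apply: (measurableT_comp (@measurable_rV_cons R n)).
  apply/measurable_fun_pairP; split => /=; first exact: measurable_fst.
  exact: (measurableT_comp (measurable_affine_rV _ _) measurable_snd).
have mH : measurable_fun setT (fun a : measurableTypeR R => \int[lebesgue_rV n]_y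
     F (rV_cons (a, s *: y + \row_i b ord0 (lift ord0 i))%R)).
  exact: (@measurable_fun_fubini_tonelli_F _ _ _ _ _ (lebesgue_rV n) _ mG).
rewrite ge0_integralZl//; last 2 first.
- by move=> a _; apply: integral_ge0.
- by rewrite lee_fin exprn_ge0// ltW.
rewrite (integral_affine (b ord0 ord0) s0)//; last first.
  by move=> a; apply: integral_ge0.
rewrite muleA -EFinM -exprSr; congr (_ * _).
rewrite (integral_rVS (measurableT_comp mF (measurable_affine_rV s b))); last first.
  by move=> x; exact: F0.
apply: eq_integral => a _; apply: eq_integral => y _.
by congr F; rewrite (rV_cons_affine _ _ erefl).
Qed.

(** In dimension 0 the measure is a Dirac mass, hence the condition on n. Otherwise the indicator of
    the origin splits off the indicator of 0 in the first coordinate, which is null. *)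
Lemma lebesgue_rV0 n : (0 < n)%N -> lebesgue_rV n [set 0%R : 'rV[R]_n] = 0.
Proof.
case: n => [//|n] _.
have m0 : measurable [set (0%R : 'rV[R]_n.+1)].
  have -> : [set (0%R : 'rV[R]_n.+1)] =
     \bigcap_(i : 'I_n.+1) ((fun x : 'rV[R]_n.+1 => x ord0 i) @^-1` [set 0%R]).
    apply/seteqP; split=> [x -> i _ /=|x H]; first by rewrite mxE.
    by apply/rowP => i; rewrite mxE; exact: (H i).
  apply: fin_bigcap_measurable => [|i _]; first exact: finite_finset.
  by rewrite -[X in measurable X]setTI; exact: measurable_coord.
rewrite -[X in lebesgue_rV n.+1 X]setIT -integral_indic// integral_rVS//; last first.
  by apply/measurable_EFinP; exact: measurable_indic.
transitivity (\int[leb]_a ((\1_[set (0%R : R)] a)%:E *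
    \int[lebesgue_rV n]_y (\1_[set (0%R : 'rV[R]_n)] y)%:E)).
  apply: eq_integral => a _; rewrite !indicE.
  have -> : (a \in [set (0%R : R)]) = (a == 0%R).
    by apply/idP/eqP; rewrite inE.
  case: eqVneq => [->|a0]; rewrite /= ?mul1e ?mul0e.
    apply: eq_integral => y _; rewrite !indicE; congr ((nat_of_bool _)%:R%:E).
    apply/idP/idP; rewrite !inE/= => h.
      by apply/rowP => i; rewrite -(rV_consS (0%R, y)) h !mxE.
    by rewrite h; apply/rowP => i; rewrite !mxE; case: unlift => //= ?; rewrite mxE.
  apply: integral0_eq => y _; rewrite indicE; case: (boolP (_ \in _)) => //.
  rewrite inE/= => /rowP/(_ ord0); rewrite rV_cons0 mxE/= => /eqP.
  by rewrite (negbTE a0).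
rewrite ge0_integralZr//.
- by rewrite integral_indic//= setIT lebesgue_measure_set1 mul0e.
- by apply/measurable_EFinP; apply: measurable_indic.
- by apply: integral_ge0 => y _; rewrite lee_fin.
Qed.

Lemma measurable_enorm n : measurable_fun setT (@enorm R n).
Proof.
have -> : @enorm R n = (fun x => Num.sqrt x) \o (fun x : 'rV[R]_n => \sum_(i < n) x ord0 i ^+ 2)%R by [].
apply: measurableT_comp; last by mfun.
exact: continuous_measurable_fun (@sqrt_continuous R).
Qed.

Lemma measurable_box k (M : R) : measurable [set x : 'rV[R]_k | forall i, (`|x ord0 i| <= M)%R].
Proof.
have -> : [set x : 'rV[R]_k | forall i, (`|x ord0 i| <= M)%R] =
   \bigcap_(i : 'I_k) ((fun x : 'rV[R]_k => `|x ord0 i|%R) @^-1` `]-oo, M]).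
  apply/seteqP; split=> [x h i _ /=|x H i]; first by rewrite in_itv/= h.
  by have := H i I; rewrite /= in_itv.
apply: fin_bigcap_measurable => [|i _]; first exact: finite_finset.
rewrite -[X in measurable X]setTI.
by apply: (measurableT_comp (@normr_measurable R setT) (measurable_coord i)).
Qed.

Lemma lebesgue_box_fin n (M : R) :
  lebesgue_rV n [set x : 'rV[R]_n | forall i, (`|x ord0 i| <= M)%R] < +oo.
Proof.
elim: n => [|n IH].
  by rewrite /= diracE; case: (_ \in _); rewrite /= ltey.
have mB k := @measurable_box k M.
rewrite -[X in lebesgue_rV n.+1 X]setIT -integral_indic//; last exact: (mB n.+1).
rewrite integral_rVS//; last by apply/measurable_EFinP; apply: measurable_indic; exact: (mB n.+1).
set B := [set x : 'rV[R]_n | _] in IH.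
apply: (@le_lt_trans _ _ (\int[leb]_a ((\1_[set` `[- M, M]%R] a)%:E *
    \int[lebesgue_rV n]_y (\1_B y)%:E))).
  apply: ge0_le_integral => //.
  - move=> a _; exact: integral_ge0.
  - apply: (@measurable_fun_fubini_tonelli_F _ _ _ _ _ (lebesgue_rV n) (fun p => (\1_[set x : 'rV[R]_n.+1 | forall i, (`|x ord0 i| <= M)%R] (rV_cons p))%:E)).
    apply/measurable_EFinP; apply: (measurableT_comp _ (@measurable_rV_cons R n)).
    by apply: measurable_indic; exact: (mB n.+1).
  - by move=> x; rewrite lee_fin.
  - apply: emeasurable_funM; last exact: measurable_cst.
    by apply/measurable_EFinP; apply: measurable_indic.
  - move=> a _; rewrite [in leRHS]indicE; case: (boolP (a \in _)) => aM /=; rewrite ?mul1e ?mul0e.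
      apply: ge0_le_integral => //.
      + apply/measurable_EFinP.
        have := measurableT_comp (@measurable_indic _ _ R setT _ (mB n.+1)) (@measurable_rV_cons R n).
        by move/measurable_fun_pair2; apply.
      + by apply/measurable_EFinP; exact: (measurable_indic (mB n)).
      + move=> y _; rewrite lee_fin !indicE ler_nat.
        case: (boolP (rV_cons _ \in _)) => //; rewrite inE/= => h.
        by rewrite mem_set// => i; rewrite -(rV_consS (a, y)).
    rewrite integral0_eq// => y _; rewrite indicE; case: (boolP (_ \in _)) => //.
    rewrite inE/= => /(_ ord0); rewrite rV_cons0/= ler_norml => h.
    by move: aM; rewrite mem_setE in_itv/= h.
rewrite ge0_integralZr//.
- rewrite integral_indic//= integral_indic; last 2 first.
  - exact: measurableT.
  - exact: (mB n).
  rewrite !setIT lebesgue_measure_itv/=.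
  case: ifPn => h; last by rewrite mul0e.
  by rewrite lte_mul_pinfty// -EFinB lee_fin subr_ge0 ltW.
- by apply/measurable_EFinP; apply: measurable_indic.
- by apply: integral_ge0 => y _; rewrite lee_fin.
Qed.

(** The measurable sets come from the coordinates, not from the topology. Rational cubes are
    measurable and countable in number, and an open set is the union of those that it contains. *)
Lemma open_measurable_rV n (A : set 'rV[R]_n) : open A -> measurable A.
Proof.
move=> oA.
pose q2 (p : 'rV[rat]_n * rat) := [set x : 'rV[R]_n | forall i, (`|x ord0 i - ratr (p.1 ord0 i)| < ratr p.2)%R].
have mq2 p : measurable (q2 p).
  have -> : q2 p =
     \bigcap_(i : 'I_n) ((fun x : 'rV[R]_n => `|x ord0 i - ratr (p.1 ord0 i)|%R) @^-1` `]-oo, (ratr p.2)[).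
    apply/seteqP; split=> [x h i _ /=|x H i]; first by rewrite in_itv/= h.
    by have := H i I; rewrite /= in_itv.
  apply: fin_bigcap_measurable => [|i _]; first exact: finite_finset.
  rewrite -[X in measurable X]setTI.
  by apply: (measurableT_comp (@normr_measurable R setT)) => //; mfun.
have -> : A = \bigcup_(p in [set p | q2 p `<=` A]) q2 p.
  apply/seteqP; split => [x Ax|x [p /= h]]; last exact: h.
  have /nbhs_ballP[e /= e0 xe] : nbhs x A by exact: open_nbhs_nbhs.
  have [r /andP[r0 re]] : exists r : rat, (0 < (ratr r : R) < e / 2)%R.
    have [|r] := @rat_in_itvoo R 0%R (e / 2)%R; first by rewrite divr_gt0.
    by rewrite in_itv/= => ?; exists r.
  have hc i : exists c : rat, (`|x ord0 i - ratr c| < ratr r)%R.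
    have [|c] := @rat_in_itvoo R (x ord0 i - ratr r)%R (x ord0 i + ratr r)%R.
      by rewrite ltrBlDr -addrA ltrDl addr_gt0.
    by rewrite in_itv/= => h; exists c; rewrite ltr_distlC.
  have [c hc'] := choice hc.
  exists (\row_i c i, r) => /= [y hy|i]; last by rewrite mxE.
  apply: xe; split=> // i j; rewrite (ord1 i) {i}; have := hy j; rewrite /= mxE => h.
  have := hc' j; rewrite distrC => h2; rewrite /ball/= -(subrKA (ratr (c j))).
  rewrite (le_lt_trans (ler_normD _ _))// [ltRHS]splitr ltrD//.
    by rewrite distrC (lt_trans _ re)// distrC.
  by rewrite distrC (lt_trans h).
rewrite bigcup_mkcond; apply: countable_bigcupT_measurable => [|p].
  exact: countableP.
by case: ifP.
Qed.

Lemma coord_le_norm n (x : 'rV[R]_n) i : (`|x ord0 i| <= `|x|)%R.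
Proof.
rewrite [leRHS]mx_normrE.
exact: (le_bigmax _ (fun ij : 'I_1 * 'I_n => `|x ij.1 ij.2|%R) (ord0, i)).
Qed.

Lemma compact_measurable_rV n (K : set 'rV[R]_n) : compact K -> measurable K.
Proof.
move=> cK; rewrite -(setCK K); apply: measurableC; apply: open_measurable_rV.
by apply: closed_openC; apply: compact_closed => //; exact: norm_hausdorff.
Qed.

Lemma compact_lebesgue_fin n (K : set 'rV[R]_n) : compact K -> lebesgue_rV n K < +oo.
Proof.
move=> cK; have /compact_bounded[M [_ hM]] := cK.
apply: le_lt_trans (lebesgue_box_fin n (M + 1)); apply: le_measure.
- by rewrite inE; exact: compact_measurable_rV.
- by rewrite inE; exact: measurable_box.
- move=> x Kx i; have := hM (M + 1)%R; rewrite ltrDl ltr01 => /(_ isT x Kx)/=.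
  by apply: le_trans; exact: coord_le_norm.
Qed.

Lemma continuous_measurable_rV n (f : 'rV[R]_n -> R) : continuous f ->
  measurable_fun setT f.
Proof.
move=> cf; apply: (measurability _ (RGenOpens.measurableE R)) => _ [_ [a [b ->] <-]].
rewrite setTI; apply: open_measurable_rV.
by apply: open_comp => // x _; exact: cf.
Qed.

(** * The Euclidean norm *)

Lemma enorm_ge0 n (x : 'rV[R]_n) : (0 <= enorm x)%R.
Proof. exact: sqrtr_ge0. Qed.

Lemma enormZ n (s : R) (x : 'rV[R]_n) : (enorm (s *: x) = `|s| * enorm x)%R.
Proof.
rewrite /enorm; under eq_bigr do rewrite mxE exprMn.
by rewrite -mulr_sumr sqrtrM ?sqr_ge0// sqrtr_sqr.
Qed.

Lemma sqr_enorm n (x : 'rV[R]_n) : (enorm x ^+ 2 = \sum_(i < n) x ord0 i ^+ 2)%R.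
Proof. by rewrite sqr_sqrtr// sumr_ge0// => i _; exact: sqr_ge0. Qed.

Lemma coord_le_enorm n (x : 'rV[R]_n) i : (`|x ord0 i| <= enorm x)%R.
Proof.
rewrite -sqrtr_sqr ler_wsqrtr// (bigD1 i)//= lerDl sumr_ge0// => j _.
exact: sqr_ge0.
Qed.

Lemma enorm_eq0 n (x : 'rV[R]_n) : (enorm x == 0%R) = (x == 0%R).
Proof.
apply/eqP/eqP => [h|->]; last first.
  by rewrite /enorm big1 ?sqrtr0// => i _; rewrite mxE expr0n.
apply/rowP => i; rewrite mxE; apply/normr0_eq0/eqP.
by rewrite eq_le normr_ge0 -h coord_le_enorm.
Qed.

Lemma enorm_gt0 n (x : 'rV[R]_n) : (0 < enorm x)%R = (x != 0%R).
Proof. by rewrite lt_def enorm_ge0 andbT enorm_eq0. Qed.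

Lemma continuous_bigsum (T : topologicalType) (I : Type) (r : seq I) (f : I -> T -> R) :
  (forall i, continuous (f i)) -> continuous (fun x => \sum_(i <- r) f i x)%R.
Proof.
move=> cf; elim: r => [|i r IH] x.
  by under eq_fun do rewrite big_nil; exact: cvg_cst.
rewrite /continuous_at big_cons; under eq_fun do rewrite big_cons.
by apply: cvgD; [exact: cf|exact: IH].
Qed.

Lemma continuous_enorm n : continuous (@enorm R n).
Proof.
move=> x; apply: (@continuous_comp _ _ _ (fun x : 'rV[R]_n => \sum_(i < n) x ord0 i ^+ 2)%R (@Num.sqrt R)).
  apply: continuous_bigsum => i {}x.
  rewrite /continuous_at expr2; under eq_fun do rewrite expr2.
  have hc : {for x, continuous (fun M : 'rV[R]_n => M ord0 i)} by exact: coord_continuous.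
  exact: (cvgM hc hc).
exact: sqrt_continuous.
Qed.

(** The identity 1/x = x (x^2)^(-1) also holds at 0, where both sides are 0, and reduces the claim
    to real powers. *)
Lemma measurable_inv : measurable_fun setT (fun x : R => x^-1)%R.
Proof.
have -> : (fun x : R => x^-1)%R = (fun x => x * (x ^+ 2) `^ (-1))%R.
  apply/funext => x; rewrite powR_inv1 ?sqr_ge0//.
  have [->|x0] := eqVneq x 0%R; first by rewrite invr0 mul0r.
  by rewrite expr2 invfM mulrA divff// mul1r.
apply: measurable_funM; first exact: measurable_id.
by apply: (measurableT_comp (measurable_powR _)); mfun.
Qed.

Lemma is_derive_exprN (n : nat) (x : R) : (x != 0)%R ->
  is_derive x 1%R (fun t : R => t ^- n)%R (- (n%:R * x ^- n.+1))%R.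
Proof.
move=> x0.
have -> : (- (n%:R * x ^- n.+1) = - (x ^+ n) ^- 2 *: (n%:R * x ^+ n.-1))%R.
  case: n => [|n]; first by rewrite !mul0r scaler0 oppr0.
  rewrite scaleNr [X in _ = (- X)%R]mulrCA; congr (- (_ * _))%R => /=.
  rewrite !exprS expr0 !mulr1.
  by move: (x ^+ n)%R (expf_neq0 n x0) => y y0; field; rewrite ?x0 ?y0.
apply: (@is_deriveV _ (fun t : R => t ^+ n)%R); first by rewrite expf_neq0.
have -> : (fun t : R => t ^+ n)%R = (@id R ^+ n)%R.
  by apply/funext => t; rewrite exprfctE.
by apply: is_derive_eq; rewrite /= scaler1.
Qed.

(** The normalisation behind [polar]: for x != 0, the weight n |x|^n s^(-n-1) has integral 1 over s
    > |x|. *)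
Lemma integral_powN (n : nat) (a : R) : (0 < n)%N -> (0 < a)%R ->
  \int[leb]_(s in `]a, +oo[) (n%:R * s ^- n.+1)%:E = (a ^- n)%:E.
Proof.
move=> n0 a0.
have h (x : R) (x0 : (x != 0)%R) := is_deriveN (is_derive_exprN n x0).
rewrite integral_itv_obnd_cbnd.
  rewrite (@ge0_continuous_FTC2y _ _ (fun t => - t ^- n)%R a 0%R) ?sub0e ?EFinN ?oppeK//.
  - move=> x ax; have x0 : (0 < x)%R by exact: lt_le_trans ax.
    by rewrite mulr_ge0// invr_ge0 exprn_ge0// ltW.
  - apply: continuous_in_subspaceT => x; rewrite inE/= in_itv/= andbT => ax.
    have x0 : (x != 0)%R by rewrite gt_eqF// (lt_le_trans a0).
    apply: cvgM; first exact: cvg_cst.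
    by apply: cvgV; [rewrite expf_neq0|exact: exprn_continuous].
  - rewrite -[X in _ --> X]oppr0; apply: cvgN.
    apply/gtr0_cvgV0.
      by near=> t; rewrite exprn_gt0//; near: t; exact: nbhs_pinfty_gt.
    apply: (@ger_cvgy _ _ _ _ id _ _) => //; near=> t => /=.
    by apply: ler_eXnr => //; near: t; exact: nbhs_pinfty_ge.
  - move=> x ax; have x0 : (x != 0)%R by rewrite gt_eqF// (lt_trans a0).
    by have [] := h x x0.
  - apply: cvg_at_right_filter; apply: cvgN; apply: cvgV.
      by rewrite expf_neq0// gt_eqF.
    exact: exprn_continuous.
  - move=> x; rewrite in_itv/= andbT => ax; rewrite derive1E.
    have [_ ->] := h x (negbT (gt_eqF (lt_trans a0 ax))).
    by rewrite opprK.
apply/measurable_EFinP; apply: measurable_funTS; mfun.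
by apply: (measurableT_comp measurable_inv); mfun.
Unshelve. all: by end_near. Qed.

Lemma tonelli_rV_R n (f : 'rV[R]_n -> R -> \bar R) :
  measurable_fun setT (fun p : 'rV[R]_n * R => f p.1 p.2) ->
  (forall x s, 0 <= f x s) ->
  \int[lebesgue_rV n]_x \int[leb]_s f x s = \int[leb]_s \int[lebesgue_rV n]_x f x s.
Proof.
move=> mf f0.
exact: (@fubini_tonelli _ _ _ _ R (lebesgue_rV n) leb (fun p => f p.1 p.2) mf (fun p => f0 p.1 p.2)).
Qed.

(** Polar coordinates without a surface measure: directions are represented by points y of the unit
    ball. Multiply F(x) by 1, written as the integral of n |x|^n s^(-n-1) over s > |x|, exchange the
    integrals, scale x = s y for fixed s so that |y| < 1, exchange back, and substitute r = s |y|.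
    The proof runs through this chain from its end. *)
Lemma polar n (F : 'rV[R]_n -> \bar R) : (0 < n)%N ->
  measurable_fun setT F -> (forall x, 0 <= F x) ->
  \int[lebesgue_rV n]_x F x =
  \int[lebesgue_rV n]_(y in [set y | (0 < enorm y < 1)%R])
    \int[leb]_(r in `]0%R, +oo[) ((n%:R * r ^+ n.-1)%:E * F (r / enorm y *: y)%R).
Proof.
move=> n0 mF F0; symmetry.
(* [c] weights the pairs (y, s) and [d] the pairs (x, s) with x = s y; the Jacobian relates them by
   s^n d(s y, s) = c(y, s). *)
pose W (x : 'rV[R]_n) (s : R) := ((0 < enorm x) && (enorm x < s))%R.
pose c y s : R := ((W y 1 && (0 < s))%:R * (n%:R * s ^+ n.-1 * enorm y ^+ n))%R.
pose d x s : R := ((W x s)%:R * (n%:R * s ^- n.+1 * enorm x ^+ n))%R.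
have mb d1 (T : measurableType d1) (P : T -> bool) : measurable_fun setT P ->
    measurable_fun setT (fun x => (P x)%:R : R)%R.
  move=> mP; have -> : (fun x => (P x)%:R : R)%R = \1_(P @^-1` [set true]).
    apply/funext => x; rewrite indicE; congr (nat_of_bool _)%:R.
    by apply/idP/idP; rewrite inE.
  by apply: measurable_indic; rewrite -[X in measurable X]setTI; exact: mP.
have mscal : measurable_fun setT (fun p : 'rV[R]_n * R => (p.2 *: p.1)%R).
  by apply: measurable_scale_rV; mfun.
have me : measurable_fun setT (fun p : 'rV[R]_n * R => enorm p.1).
  exact: (measurableT_comp (@measurable_enorm n) measurable_fst).
have mc : measurable_fun setT (fun p : 'rV[R]_n * R => (c p.1 p.2)%:E * F (p.2 *: p.1)%R).
  apply: emeasurable_funM; last exact: measurableT_comp mF mscal.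
  apply/measurable_EFinP; apply: measurable_funM; last by mfun.
  apply: mb; apply: measurable_and; first apply: measurable_and;
    by apply: measurable_fun_ltr => //; mfun.
have md1 : measurable_fun setT (fun p : 'rV[R]_n * R => (d p.1 p.2)%:E).
  apply/measurable_EFinP; apply: measurable_funM.
    by apply: mb; apply: measurable_and; apply: measurable_fun_ltr => //; mfun.
  mfun.
  by apply: (measurableT_comp measurable_inv); mfun.
have md : measurable_fun setT (fun p : 'rV[R]_n * R => (d p.1 p.2)%:E * F p.1).
  by apply: emeasurable_funM md1 _; exact: measurableT_comp mF measurable_fst.
have c0 y s : (0 <= c y s)%R.
  rewrite /c; case: andP => [[_ s0]|_]; last by rewrite mul0r.
  by rewrite !mulr_ge0// exprn_ge0 ?enorm_ge0// ltW.
have d0 y s : (0 <= d y s)%R.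
  rewrite /d /W; case: andP => [[y0 ys]|_]; last by rewrite mul0r.
  by rewrite !mulr_ge0 ?invr_ge0 ?exprn_ge0 ?enorm_ge0// ltW// (lt_trans y0).
transitivity (\int[lebesgue_rV n]_y \int[leb]_s ((c y s)%:E * F (s *: y)%R)).
  rewrite integral_mkcond; apply: eq_integral => y _.
  rewrite patchE; case: ifPn => [|yW].
    rewrite inE/= => yW; have /andP[y0 y1] := yW.
    have mG : measurable_fun setT (fun r : R => F (r / enorm y *: y)%R).
      by apply: (measurableT_comp mF); apply: measurable_scale_rV; mfun.
    rewrite integral_mkcond; set G := (G in \int[_]_x G x).
    have mG' : measurable_fun setT G.
      apply/(measurable_restrictT _ (measurable_itv _)); apply: measurable_funTS.
      by apply: emeasurable_funM mG; mfun.
    have G0 r : 0 <= G r.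
      rewrite /G patchE mem_setE in_itv/= andbT; case: ifPn => // r0.
      by rewrite mule_ge0// lee_fin mulr_ge0// exprn_ge0// ltW.
    have mG2 : measurable_fun setT (fun x : measurableTypeR R => G (enorm y * x + 0)%R).
      by apply: (measurableT_comp mG'); apply: measurable_funD; mfun.
    rewrite (integral_affine 0%R y0 mG' G0) -(ge0_integralZl _ _ mG2) ?lee_fin ?enorm_ge0//.
    rewrite /G.
    apply: eq_integral => s _; rewrite patchE mem_setE in_itv/= andbT addr0 pmulr_rgt0//.
    case: ifPn => s0.
      rewrite muleA -EFinM /c /W yW s0 mul1r mulrAC divff ?gt_eqF// mul1r.
      have en : (enorm y ^+ n = enorm y * enorm y ^+ n.-1)%R by rewrite -exprS prednK.
      by congr (_%:E * _); rewrite exprMn en; ring.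
    by rewrite /c (negbTE s0) andbF mul0r mul0e mule0.
  rewrite integral0_eq// => s _; rewrite /c.
  suff -> : W y 1%R = false by rewrite mul0r mul0e.
  by apply: contraNF yW; rewrite inE.
rewrite (@tonelli_rV_R n (fun y s => (c y s)%:E * F (s *: y)%R) mc); last first.
  by move=> x s; rewrite mule_ge0// lee_fin.
transitivity (\int[leb]_s \int[lebesgue_rV n]_x ((d x s)%:E * F x)).
  apply: eq_integral => s _ /=; have [s0|s0] := ltP 0%R s; last first.
    rewrite !integral0_eq// => y _; last first.
      by rewrite /c ltNge s0 andbF mul0r mul0e.
    rewrite /d; suff -> : W y s = false by rewrite mul0r mul0e.
    by apply: contraNF (_ : ~~ (0 < s)%R) => [/andP[a b]|]; rewrite -?leNgt// (lt_trans a).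
  rewrite (integral_rV_affine 0%R s0 (F := fun x => (d x s)%:E * F x)); last 2 first.
  - exact: (measurable_fun_pair1 s md).
  - by move=> x; rewrite mule_ge0// lee_fin.
  rewrite -ge0_integralZl//; first last.
  - by rewrite lee_fin exprn_ge0 ?ltW.
  - by move=> x _; rewrite mule_ge0// lee_fin.
  - have := measurableT_comp (measurable_fun_pair1 s md) (measurable_affine_rV s 0%R).
    by [].
  apply: eq_integral => y _; rewrite addr0 muleA -EFinM; congr (_%:E * _).
  rewrite /c /d /W enormZ gtr0_norm// pmulr_rgt0// gtr_pMr// s0 andbT.
  rewrite [RHS]mulrCA; congr (_ * _)%R.
  have pS (z : R) : (z ^+ n = z * z ^+ n.-1)%R by rewrite -exprS prednK.
  rewrite !exprMn exprS !pS.
  move: (s ^+ n.-1)%R (expf_neq0 n.-1 (lt0r_neq0 s0)) => a a0.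
  by field; rewrite a0 gt_eqF.
rewrite -(@tonelli_rV_R n (fun x s => (d x s)%:E * F x) md); last first.
  by move=> x s; rewrite mule_ge0// lee_fin.
apply: ge0_ae_eq_integral => //.
- have := @measurable_fun_fubini_tonelli_F _ _ _ (measurableTypeR R) R leb (fun p => (d p.1 p.2)%:E * F p.1).
  apply => //; by case=> x s; rewrite mule_ge0// lee_fin.
- by move=> x _; apply: integral_ge0 => s _; rewrite mule_ge0// lee_fin.
(* At x = 0 the weight [d] vanishes instead of integrating to 1; this single point is null. *)
exists [set 0%R]; split.
- exact: compact_measurable_rV (@compact_set1 _ _).
- exact: lebesgue_rV0.
move=> x /= h; apply: contrapT => /eqP x0; apply: h => _.
have mdx : measurable_fun setT (fun s => (d x s)%:E).
  by have := measurable_fun_pair2 x md1.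
rewrite ge0_integralZr//; last by move=> s _; rewrite lee_fin.
suff -> : \int[leb]_s (d x s)%:E = 1 by rewrite mul1e.
rewrite -enorm_gt0 in x0.
transitivity ((enorm x ^+ n)%:E * \int[leb]_(s in `](enorm x), +oo[) (n%:R * s ^- n.+1)%:E).
  rewrite -ge0_integralZl//; last 3 first.
  - apply/measurable_EFinP; apply: measurable_funTS; mfun.
    by apply: (measurableT_comp measurable_inv); mfun.
  - move=> s /=; rewrite in_itv/= andbT => xs; rewrite lee_fin mulr_ge0// invr_ge0.
    by rewrite exprn_ge0// ltW// (lt_trans x0).
  - by rewrite lee_fin exprn_ge0// ltW.
  rewrite [RHS]integral_mkcond; apply: eq_integral => s _.
  rewrite patchE mem_setE in_itv/= andbT /d /W x0/=; case: ifPn => xs.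
    by rewrite mul1r mulrC EFinM.
  by rewrite mul0r.
by rewrite integral_powN// -EFinM divff// expf_neq0// gt_eqF.
Qed.
End lebesgue_rV_theory.

(** * Smooth functions *)

Section smooth.
Context {R : realType}.

(** Relative to a set, because real powers are smooth only on ]0, +oo[. *)
Fixpoint Cn (U : set R) (k : nat) (f : R -> R) : Prop :=
  match k with
  | 0%N => forall x, U x -> {for x, continuous f}
  | k'.+1 => (forall x, U x -> derivable f x 1) /\ Cn U k' (f^`())%classic
  end.

Definition smooth (U : set R) f := forall k, Cn U k f.

(** The localised form of [Ck]: |x| is smooth only off the origin, and test functions are glued from
    pieces defined on different open sets. *)
Fixpoint Ck_on n (O : set 'rV[R]_n) (k : nat) (f : 'rV[R]_n -> R) : Prop :=
  match k with
  | 0%N => forall x, O x -> {for x, continuous f}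
  | k'.+1 => (forall x, O x -> {for x, continuous f}) /\
      forall i : 'I_n, (forall x, O x -> derivable f x (delta_mx ord0 i)) /\
                       Ck_on O k' (partial i f)
  end.

Lemma eq_on_near (T : topologicalType) (S : Type) (U : set T) (f g : T -> S) x : open U -> U x ->
  (forall y, U y -> f y = g y) -> {near x, f =1 g}.
Proof.
move=> oU Ux fg; near=> y; apply: fg; near: y; exact: open_nbhs_nbhs.
Unshelve. all: by end_near. Qed.

Lemma continuous_near (T S : topologicalType) (f g : T -> S) x :
  {near x, f =1 g} -> {for x, continuous f} -> {for x, continuous g}.
Proof.
move=> fg cf; rewrite /prop_for /continuous_at -(nbhs_singleton fg).
by apply: cvg_trans cf; apply: near_eq_cvg; exact: fg.
Unshelve. all: by end_near. Qed.

Lemma Cn_ext U k f g : open U -> (forall x, U x -> f x = g x) -> Cn U k f -> Cn U k g.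
Proof.
move=> oU; elim: k f g => [|k IH] f g fg /=.
  move=> cf x Ux; apply: (continuous_near (eq_on_near oU Ux fg)); exact: cf.
move=> [df cf]; split.
  by move=> x Ux; apply: (near_eq_derivable (eq_on_near oU Ux fg)); exact: df.
apply: IH cf => x Ux; rewrite !derive1E.
exact: (near_eq_derive _ (eq_on_near oU Ux fg)).
Qed.

Lemma Cn_continuous U k f : Cn U k f -> forall x, U x -> {for x, continuous f}.
Proof.
case: k => //= k [df _] x Ux.
by apply: differentiable_continuous; apply/derivable1_diffP; exact: df.
Qed.

Lemma CnS U k f : Cn U k.+1 f -> Cn U k f.
Proof.
elim: k f => [|k IH] f; first exact: (@Cn_continuous _ 1).
by move=> [df cf]; split => //; exact: IH.
Qed.

Lemma CnD U k f g : open U -> Cn U k f -> Cn U k g -> Cn U k (fun x => f x + g x).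
Proof.
move=> oU; elim: k f g => [|k IH] f g /=.
  by move=> cf cg x Ux; apply: cvgD; [exact: cf|exact: cg].
move=> [df cf] [dg cg]; split=> [x Ux|]; first by apply: derivableD; [exact: df|exact: dg].
apply: Cn_ext (IH _ _ cf cg) => // x Ux; rewrite !derive1E.
by rewrite (@deriveD _ _ _ f g x 1 (df _ Ux) (dg _ Ux)).
Qed.

Lemma CnM U k f g : open U -> Cn U k f -> Cn U k g -> Cn U k (fun x => f x * g x).
Proof.
move=> oU; elim: k f g => [|k IH] f g.
  by move=> cf cg x Ux; apply: cvgM; [exact: cf|exact: cg].
move=> cf cg; have [df cf'] := cf; have [dg cg'] := cg.
split=> [x Ux|]; first by apply: derivableM; [exact: df|exact: dg].
apply: Cn_ext (CnD oU (IH _ _ (CnS cf) cg') (IH _ _ (CnS cg) cf')) => // x Ux.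
by rewrite !derive1E (@deriveM _ _ f g x 1 (df _ Ux) (dg _ Ux)).
Qed.

Lemma smooth_cst U (c : R) : smooth U (fun=> c).
Proof.
move=> k; elim: k c => [|k IH] c /=; first by move=> x _; exact: cvg_cst.
split=> [x _|]; first exact: derivable_cst.
have -> : ((fun=> c)^`())%classic = (fun=> 0 : R); last exact: IH.
by apply/funext => x; rewrite derive1E derive_cst.
Qed.

Lemma smoothM U f g : open U -> smooth U f -> smooth U g -> smooth U (fun x => f x * g x).
Proof. by move=> oU sf sg k; apply: CnM. Qed.

Lemma smoothD U f g : open U -> smooth U f -> smooth U g -> smooth U (fun x => f x + g x).
Proof. by move=> oU sf sg k; apply: CnD. Qed.

Lemma smooth_derive U f : smooth U f -> smooth U (f^`())%classic.
Proof. by move=> sf k; have [] := sf k.+1. Qed.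

Lemma smooth_derivable U f x : smooth U f -> U x -> derivable f x 1.
Proof. by move=> /(_ 1%N)[+ _]; exact. Qed.

Lemma smooth_affine U (a b : R) f : open U -> smooth setT f -> smooth U (fun x => f (a * x + b)).
Proof.
move=> oU + k; elim: k f => [|k IH] f sf /=.
  move=> x _; apply: (@continuous_comp _ _ _ (fun x => a * x + b) f).
    apply: cvgD; last exact: cvg_cst.
    by apply: cvgM; [exact: cvg_cst|exact: cvg_id].
  exact: (sf 0%N).
have haff (x : R) : is_derive x 1 (fun t : R => a * t + b) a.
  have h := is_deriveD (is_deriveZ a (is_derive_id x 1)) (is_derive_cst b x 1).
  by apply: (is_derive_eq h); rewrite addr0 /GRing.scale/= mulr1.
have hf (x : R) : is_derive x 1 (fun t : R => f (a * t + b)) ((f^`())%classic (a * x + b) * a).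
  apply: (@is_derive1_comp _ f (fun t => a * t + b)) => //.
  by rewrite derive1E; apply: DeriveDef => //; exact: (smooth_derivable sf).
split=> [x Ux|]; first by have [] := hf x.
apply: (@Cn_ext U k (fun x => (f^`())%classic (a * x + b) * a)) => //.
  by move=> x Ux; rewrite [RHS]derive1E; have [_ ->] := hf x.
by apply: CnM => //; [exact: IH (smooth_derive sf)|exact: smooth_cst].
Qed.

Lemma smooth_powR (a : R) : smooth [set x | 0 < x] (fun x => x `^ a).
Proof.
move=> k; elim: k a => [|k IH] a /=.
  move=> x x0; apply: differentiable_continuous; apply/derivable1_diffP.
  by apply: derivable_powR; rewrite in_itv/= andbT.
split=> [x x0|]; first by apply: derivable_powR; rewrite in_itv/= andbT.
apply: (@Cn_ext _ k (fun x => a * x `^ (a - 1))).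
- exact: open_gt.
- by move=> x /= x0; rewrite derive1E; have [_ ->] := is_derive1_powR a x0.
by apply: CnM; [exact: open_gt|exact: smooth_cst|exact: IH].
Qed.

(* The powers [t ^- m] make the family stable under differentiation. *)
Definition bump (m : nat) (t : R) : R := if 0 < t then t ^- m * expR (- t^-1) else 0.

(** From e^(1/t) >= (1/t)^(m+2) / (m+2)!. A quadratic bound forces the derivative at 0 to be 0, for
    the whole family at once. *)
Lemma bump_le (m : nat) (t : R) : 0 < t -> bump m t <= (m.+2)`!%:R * t ^+ 2.
Proof.
move=> t0; rewrite /bump t0 expRN.
have ti : 0 <= t^-1 by rewrite invr_ge0 ltW.
have := expR_ge1Dxn m.+1 ti; set e := expR _; set f := _%:R => h.
have f0 : 0 < f by rewrite ltr0n fact_gt0.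
have e0 : 0 < e by exact: expR_gt0.
rewrite ler_pdivrMr// -[t ^- m]mulr1 ler_pdivrMl ?exprn_gt0//.
have h2 : t^-1 ^+ m.+2 / f <= e by apply: le_trans h; rewrite lerDr.
rewrite mulrCA -ler_pdivrMl//.
apply: le_trans (ler_wpM2l (exprn_ge0 m (ltW t0)) h2).
rewrite mulr1 exprVn -[m.+2]addn2 exprD !invfM !mulrA divff ?mul1r ?expf_neq0 ?gt_eqF//.
  by rewrite -mulrA mulrC.
by rewrite mulr_gt0// exprn_gt0.
Qed.

Lemma is_derive_quadratic (f : R -> R) (x C : R) :
  (forall h, `|f (h + x) - f x| <= C * h ^+ 2) -> is_derive x 1 f 0.
Proof.
move=> hf.
have h0 : h^-1 *: ((f \o shift x) (h *: (1 : R)) - f x) @[h --> 0^'] --> (0 : R).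
  apply/cvgr0Pnorm_le => e e0; near=> h.
  have hn0 : h != 0 by near: h; exact: nbhs_dnbhs_neq.
  have h1 : `|h| <= e / (`|C| + 1).
    near: h; apply: dnbhs0_le; by rewrite divr_gt0// ltr_wpDl.
  have C1 : 0 < `|C| + 1 by rewrite ltr_wpDl.
  rewrite normrZ normfV ler_pdivrMl ?normr_gt0// /= /GRing.scale/= mulr1.
  rewrite (le_trans (hf h))// -real_normK ?num_real// expr2 mulrCA ler_wpM2l//.
  rewrite (le_trans (ler_wpM2r (normr_ge0 h) (ler_norm C)))//.
  move: h1; rewrite ler_pdivlMr// => /(le_trans _); apply.
  by rewrite mulrC ler_wpM2l// lerDl.
apply: DeriveDef; first by apply/cvg_ex; exists 0.
by apply: cvg_lim h0; exact: Rhausdorff.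
Unshelve. all: by end_near. Qed.

Lemma is_derive_near (V W : normedModType R) (f g : V -> W) (x v : V) (d : W) :
  {near x, f =1 g} -> is_derive x v f d -> is_derive x v g d.
Proof.
move=> fg [df <-]; apply: DeriveDef; first exact: near_eq_derivable df.
by rewrite (near_eq_derive _ fg).
Qed.

(** Reduces directional derivatives to one variable, where the chain rule and the mean value theorem
    are available. *)
Lemma is_derive_line (V W : normedModType R) (f : V -> W) (x v : V) (d : W) :
  is_derive x v f d <-> is_derive (0 : R) 1 (fun t : R => f (t *: v + x)) d.
Proof.
have E : (fun h : R => h^-1 *: (((fun t : R => f (t *: v + x)) \o shift 0) (h *: 1) - f (0 *: v + x))) =
   (fun h => h^-1 *: ((f \o shift x) (h *: v) - f x)).
  by apply/funext => h /=; rewrite addr0 scale0r add0r /GRing.scale/= mulr1.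
split=> -[df ef]; apply: DeriveDef.
- by rewrite /derivable E.
- by rewrite -ef /derive E.
- by move: df; rewrite /derivable E.
- by rewrite -ef /derive E.
Qed.

Lemma is_derive_bump m (t : R) : is_derive t 1 (bump m) (bump m.+2 t - m%:R * bump m.+1 t).
Proof.
have [t0|t0|->] := ltgtP t 0.
- apply: (@is_derive_near _ _ (cst 0)).
    near=> s; rewrite /bump ltNge; suff -> : s <= 0 by [].
    by apply: ltW; near: s; exact: lt_nbhsl.
  by rewrite /bump !ltNge !(ltW t0)/= mulr0 subr0; exact: is_derive_cst.
- apply: (@is_derive_near R^o R^o (fun t : R => t ^- m * expR (- t^-1))).
    near=> s; rewrite /bump; suff -> : 0 < s by [].
    by near: s; exact: lt_nbhsr.
  rewrite /bump t0.
  have t1 : t != 0 by rewrite gt_eqF.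
  have h1 : is_derive t 1 (fun s : R => - s^-1) (- - (1 / t ^+ 2)).
    exact: is_deriveN (is_derive_exprN 1 t1).
  have h2 := @is_derive1_comp _ expR (fun s : R => - s^-1) _ _ _ (is_derive_expR (- t^-1)) h1.
  have h3 := is_deriveM (is_derive_exprN m t1) h2.
  apply: (is_derive_eq h3); rewrite /= /GRing.scale/= opprK mul1r.
  rewrite !exprSr !expr0 mul1r !invfM.
  by move: (t ^+ m)^-1 => y; field.
- rewrite /bump ltxx mulr0 subr0; apply: (@is_derive_quadratic _ _ (m.+2)`!%:R) => h.
  rewrite addr0 ltxx subr0; case: ifPn => h0; last by rewrite normr0 mulr_ge0// sqr_ge0.
  have := bump_le m h0; rewrite /bump h0; apply: le_trans; rewrite ger0_norm//.
  by rewrite mulr_ge0 ?invr_ge0 ?exprn_ge0 ?expR_ge0// ltW.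
Unshelve. all: by end_near. Qed.

Lemma smooth_bump m : smooth setT (bump m).
Proof.
move=> k; elim: k m => [|k IH] m /=.
  move=> x _; apply: differentiable_continuous; apply/derivable1_diffP.
  by have [] := is_derive_bump m x.
split=> [x _|]; first by have [] := is_derive_bump m x.
apply: (@Cn_ext _ k (fun x => bump m.+2 x + (- m%:R) * bump m.+1 x)).
- exact: openT.
- by move=> x _; rewrite derive1E; have [_ ->] := is_derive_bump m x; rewrite mulNr.
by apply: CnD => //; [exact: openT|apply: CnM => //; [exact: openT|exact: smooth_cst]].
Qed.

(** * Smoothness in several variables *)

Lemma Ck_on_ext n (O : set 'rV[R]_n) k f g : open O -> (forall x, O x -> f x = g x) ->
  Ck_on O k f -> Ck_on O k g.
Proof.
move=> oO; elim: k f g => [|k IH] f g fg /=.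
  move=> cf x Ox; apply: (continuous_near (eq_on_near oO Ox fg)); exact: cf.
move=> [cf df]; split=> [x Ox|i].
  by apply: (continuous_near (eq_on_near oO Ox fg)); exact: cf.
have [dfi cfi] := df i; split=> [x Ox|].
  by apply: (near_eq_derivable (eq_on_near oO Ox fg)); exact: dfi.
apply: IH cfi => x Ox; exact: (near_eq_derive _ (eq_on_near oO Ox fg)).
Qed.

Lemma Ck_on_continuous n (O : set 'rV[R]_n) k f : Ck_on O k f ->
  forall x, O x -> {for x, continuous f}.
Proof. by case: k => //= k []. Qed.

Lemma Ck_onS n (O : set 'rV[R]_n) k f : Ck_on O k.+1 f -> Ck_on O k f.
Proof.
elim: k f => [|k IH] f; first exact: (@Ck_on_continuous _ _ 1).
move=> [cf df]; split=> // i; have [dfi cfi] := df i.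
by split=> //; exact: IH.
Qed.

Lemma Ck_on_sub n (O O' : set 'rV[R]_n) k f : O' `<=` O -> Ck_on O k f -> Ck_on O' k f.
Proof.
move=> sO; elim: k f => [|k IH] f /=; first by move=> cf x /sO; exact: cf.
move=> [cf df]; split=> [x /sO|i]; first exact: cf.
by have [dfi cfi] := df i; split=> [x /sO|]; [exact: dfi|exact: IH].
Qed.

Lemma Ck_on_glue n (O O' : set 'rV[R]_n) k f : O `|` O' = setT ->
  Ck_on O k f -> Ck_on O' k f -> Ck_on setT k f.
Proof.
move=> OO; have oo x : O x \/ O' x by have : setT x by []; rewrite -OO.
elim: k f => [|k IH] f /=; first by move=> h1 h2 x _; case: (oo x); [exact: h1|exact: h2].
move=> [c1 d1] [c2 d2]; split=> [x _|i]; first by case: (oo x); [exact: c1|exact: c2].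
have [e1 f1] := d1 i; have [e2 f2] := d2 i.
by split=> [x _|]; [case: (oo x); [exact: e1|exact: e2]|exact: IH].
Qed.

Lemma Ck_on_setT n k (f : 'rV[R]_n -> R) : Ck_on setT k f <-> Ck k f.
Proof.
elim: k f => [|k IH] f /=.
  by split=> [h x|h x _]; [exact: h|exact: h].
split=> [[c d]|[c d]].
  split=> [x|i]; first exact: c.
  by have [d1 d2] := d i; split=> [x|]; [exact: d1|apply/IH].
split=> [x _|i]; first exact: c.
by have [d1 d2] := d i; split=> [x _|]; [exact: d1|apply/IH].
Qed.

Lemma Ck_onD n (O : set 'rV[R]_n) k f g : open O -> Ck_on O k f -> Ck_on O k g ->
  Ck_on O k (fun x => f x + g x).
Proof.
move=> oO; elim: k f g => [|k IH] f g /=.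
  by move=> cf cg x Ox; exact: (cvgD (cf _ Ox) (cg _ Ox)).
move=> [cf df] [cg dg]; split=> [x Ox|i].
  exact: (cvgD (cf _ Ox) (cg _ Ox)).
have [dfi cfi] := df i; have [dgi cgi] := dg i.
split=> [x Ox|]; first by apply: derivableD; [exact: dfi|exact: dgi].
apply: Ck_on_ext (IH _ _ cfi cgi) => // x Ox.
by rewrite /partial (@deriveD _ _ _ f g x _ (dfi _ Ox) (dgi _ Ox)).
Qed.

Lemma Ck_onM n (O : set 'rV[R]_n) k f g : open O -> Ck_on O k f -> Ck_on O k g ->
  Ck_on O k (fun x => f x * g x).
Proof.
move=> oO; elim: k f g => [|k IH] f g.
  by move=> cf cg x Ox; exact: (cvgM (cf _ Ox) (cg _ Ox)).
move=> hf hg; have [cf df] := hf; have [cg dg] := hg; split=> [x Ox|i].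
  exact: (cvgM (cf _ Ox) (cg _ Ox)).
have [dfi cfi] := df i; have [dgi cgi] := dg i.
split=> [x Ox|]; first by apply: derivableM; [exact: dfi|exact: dgi].
apply: Ck_on_ext (Ck_onD oO (IH _ _ (Ck_onS hf) cgi) (IH _ _ (Ck_onS hg) cfi)) => // x Ox.
by rewrite /partial (@deriveM _ _ f g x _ (dfi _ Ox) (dgi _ Ox)).
Qed.

Lemma Ck_on_cst n (O : set 'rV[R]_n) k (c : R) : Ck_on O k (fun=> c).
Proof.
elim: k c => [|k IH] c /=; first by move=> x _; exact: (@cst_continuous _ _ c x).
split=> [x _|i]; first exact: (@cst_continuous _ _ c x).
split=> [x _|]; first exact: derivable_cst.
have -> : partial i (fun=> c) = (fun=> 0 : R); last exact: IH.
by apply/funext => x; rewrite /partial derive_cst.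
Qed.

Lemma is_derive_coord n (x v : 'rV[R]_n) j : is_derive x v (fun x : 'rV[R]_n => x ord0 j) (v ord0 j).
Proof.
apply/is_derive_line.
have -> : (fun t : R => (t *: v + x) ord0 j) = (fun t => v ord0 j * t + x ord0 j).
  by apply/funext => t; rewrite !mxE mulrC.
have h := is_deriveD (is_deriveZ (v ord0 j) (is_derive_id (0 : R) 1)) (is_derive_cst (x ord0 j) (0 : R) 1).
by apply: (is_derive_eq h); rewrite addr0 /GRing.scale/= mulr1.
Qed.

Lemma Ck_on_coord n (O : set 'rV[R]_n) k (j : 'I_n) : Ck_on O k (fun x => x ord0 j).
Proof.
case: k => [|k] /=; first by move=> x _; exact: coord_continuous.
split=> [x _|i]; first exact: coord_continuous.
split=> [x _|]; first by have [] := is_derive_coord x (delta_mx ord0 i) j.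
have -> : partial i (fun x : 'rV[R]_n => x ord0 j) = (fun=> (delta_mx ord0 i : 'rV[R]_n) ord0 j); last exact: Ck_on_cst.
apply/funext => x; rewrite /partial.
by have [_ ->] := is_derive_coord x (delta_mx ord0 i) j.
Qed.

Lemma is_derive_comp1 n (f : 'rV[R]_n -> R) (g : R -> R) x v df dg :
  is_derive x v f df -> is_derive (f x) 1 g dg ->
  is_derive x v (fun y => g (f y)) (dg * df).
Proof.
move=> /is_derive_line hf hg; apply/is_derive_line.
by apply: (is_derive1_comp (f := g) _ hf); rewrite scale0r add0r.
Qed.

Lemma Ck_on_comp n (O : set 'rV[R]_n) (U : set R) f g : open O ->
  (forall x, O x -> U (f x)) -> (forall k, Ck_on O k f) -> smooth U g ->
  forall k, Ck_on O k (fun x => g (f x)).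
Proof.
move=> oO OU Cf + k; elim: k g => [|k IH] g sg.
  by move=> x Ox; apply: continuous_comp; [exact: (Cf 0%N)|exact: (sg 0%N) (OU _ Ox)].
split=> [x Ox|i].
  by apply: continuous_comp; [exact: (Cf 0%N)|exact: (sg 0%N) (OU _ Ox)].
have [dfi cfi] := (Cf k.+1).2 i.
have hd x : O x -> is_derive x (delta_mx ord0 i) (fun y => g (f y)) ((g^`())%classic (f x) * partial i f x).
  move=> Ox; apply: is_derive_comp1; first by apply: DeriveDef => //; exact: dfi.
  by rewrite derive1E; apply: DeriveDef => //; apply: smooth_derivable sg (OU _ Ox).
split=> [x /hd[]//|].
apply: (@Ck_on_ext _ _ _ (fun x => (g^`())%classic (f x) * partial i f x)) => //.
  by move=> x /hd[_ <-].
by apply: Ck_onM => //; apply: IH; exact: smooth_derive.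
Qed.

Lemma Ck_on_sum n (O : set 'rV[R]_n) k (I : Type) (r : seq I) (f : I -> 'rV[R]_n -> R) :
  open O -> (forall i, Ck_on O k (f i)) -> Ck_on O k (fun x => \sum_(i <- r) f i x).
Proof.
move=> oO cf; elim: r => [|i r IH].
  apply: (@Ck_on_ext _ _ _ (fun=> 0)) => //; last exact: Ck_on_cst.
  by move=> x _; rewrite big_nil.
apply: (@Ck_on_ext _ _ _ (fun x => f i x + \sum_(i <- r) f i x)) => //.
  by move=> x _; rewrite big_cons.
exact: Ck_onD.
Qed.

Lemma Ck_on_prod n (O : set 'rV[R]_n) k (I : Type) (r : seq I) (f : I -> 'rV[R]_n -> R) :
  open O -> (forall i, Ck_on O k (f i)) -> Ck_on O k (fun x => \prod_(i <- r) f i x).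
Proof.
move=> oO cf; elim: r => [|i r IH].
  apply: (@Ck_on_ext _ _ _ (fun=> 1)) => //; last exact: Ck_on_cst.
  by move=> x _; rewrite big_nil.
apply: (@Ck_on_ext _ _ _ (fun x => f i x * \prod_(i <- r) f i x)) => //.
  by move=> x _; rewrite big_cons.
exact: Ck_onM.
Qed.

Lemma open_punctured n : open (@punctured R n).
Proof. by apply: closed_openC; apply: compact_closed; [exact: norm_hausdorff|exact: compact_set1]. Qed.

Lemma Ck_on_enorm n k : Ck_on (@punctured R n) k (@enorm R n).
Proof.
pose s (x : 'rV[R]_n) := \sum_(i < n) x ord0 i * x ord0 i.
apply: (@Ck_on_ext _ _ _ (fun x => (s x) `^ (2^-1))).
- exact: open_punctured.
- move=> x _; rewrite /s powR12_sqrt; last by apply: sumr_ge0 => i _; rewrite -expr2 sqr_ge0.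
  by congr Num.sqrt; apply: eq_bigr => i _; rewrite expr2.
apply: (Ck_on_comp (U := [set x | 0 < x]) (g := fun x => x `^ 2^-1)).
- exact: open_punctured.
- move=> x /eqP; rewrite -enorm_gt0 => x0 /=.
  have -> : s x = enorm x ^+ 2 by rewrite sqr_enorm; apply: eq_bigr => i _; rewrite expr2.
  by rewrite exprn_gt0.
- move=> {}k; apply: Ck_on_sum; first exact: open_punctured.
  by move=> i; apply: Ck_onM; [exact: open_punctured|exact: Ck_on_coord|exact: Ck_on_coord].
- exact: smooth_powR.
Qed.

Lemma Ck_on_radial n (f : R -> R) k : smooth [set x | 0 < x] f ->
  Ck_on (@punctured R n) k (fun x => f (enorm x)).
Proof.
move=> sf; apply: Ck_on_comp sf _; [exact: open_punctured| |].
  by move=> x /eqP; rewrite /= enorm_gt0.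
by move=> {}k; exact: Ck_on_enorm.
Qed.

Lemma partial_enorm n i (x : 'rV[R]_n) : x != 0 ->
  is_derive x (delta_mx ord0 i) (@enorm R n) (x ord0 i / enorm x).
Proof.
rewrite -enorm_gt0 => x0.
have S0 : 0 < \sum_(i < n) x ord0 i ^+ 2 by rewrite -sqr_enorm exprn_gt0.
have hS : is_derive x (delta_mx ord0 i) (fun x : 'rV[R]_n => \sum_(i < n) x ord0 i ^+ 2) (x ord0 i *+ 2).
  have -> : (fun x : 'rV[R]_n => \sum_(i < n) x ord0 i ^+ 2) =
     (\sum_(j < n) (fun x : 'rV[R]_n => x ord0 j) ^+ 2).
    by apply/funext => y; rewrite fct_sumE.
  have h j : is_derive x (delta_mx ord0 i) ((fun x : 'rV[R]_n => x ord0 j) ^+ 2)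
      ((2%:R * x ord0 j ^+ 1) *: (delta_mx ord0 i : 'rV[R]_n) ord0 j).
    by apply: is_deriveX; exact: is_derive_coord.
  apply: is_derive_eq.
  rewrite (bigD1 i)//= big1 => [|j /negbTE ji]; last by rewrite mxE ji andbF scaler0.
  by rewrite mxE !eqxx addr0 expr1 /GRing.scale/= mulr1 mulr_natl.
apply: (is_derive_eq (is_derive_comp1 hS (is_derive1_sqrt S0))).
by rewrite -mulr_natr -/(enorm x); field; rewrite gt_eqF.
Qed.

End smooth.

(** * The fundamental lemma of the calculus of variations *)

Section dubois.
Context {R : realType}.
Notation leb := (@lebesgue_measure R).
Local Open Scope ereal_scope.

(** The sets over which f has integral 0 form a Dynkin class; closure under complements is where the
    integral over the whole space enters. So a generating pi-system decides, and an integrable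
    function with all integrals 0 vanishes almost everywhere. *)
Lemma integral0_generated d (T : measurableType d) (mu : {measure set T -> \bar R})
    (f : T -> R) (G : set (set T)) :
  d.-measurable = <<s G >> -> setI_closed G -> mu.-integrable setT (EFin \o f) ->
  (forall A, G A -> \int[mu]_(x in A) (f x)%:E = 0) -> \int[mu]_x (f x)%:E = 0 ->
  {ae mu, forall x, f x = 0%R}.
Proof.
move=> mG GI intf G0 T0.
have G0' A : measurable A -> \int[mu]_(x in A) (f x)%:E = 0.
  move=> mA; have : <<s G >> A by rewrite -mG.
  rewrite -setI_closed_g_dynkin_g_sigma_algebra// => /(_ [set A | measurable A /\ \int[mu]_(x in A) (f x)%:E = 0]).
  case=> //; split; last first.
    by move=> B GB; split; [rewrite mG; exact: sub_sigma_algebra|exact: G0].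
  split=> /=; first by split.
    move=> B [mB B0]; split; first exact: measurableC.
    have := @integral_setU_EFin _ _ _ mu B (~` B) f mB (measurableC mB).
    rewrite setUv T0 B0 add0e => ->//.
      by apply/measurable_EFinP; exact: measurable_int intf.
    by rewrite disj_set2E setICr.
  move=> F tF hF; split; first by apply: bigcup_measurable => k _; have [] := hF k.
  rewrite integral_bigcup//.
  - by apply: eseries0 => k _ _; have [] := hF k.
  - by move=> k; have [] := hF k.
  - apply: integrableS intf => //.
    by apply: bigcup_measurable => k _; have [] := hF k.
have : ae_eq mu setT (EFin \o f) (cst 0).
  by apply: integral_ae_eq => // E _ mE; rewrite G0'// integral_cst ?mul0e.
by apply: filterS => x /(_ I)/= [].
Qed.

(** The indicators of the generators are bounded pointwise limits of functions orthogonal to f, and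
    |f| dominates. *)
Lemma ae0_of_tests d (T : measurableType d) (mu : {measure set T -> \bar R})
    (f : T -> R) (G : set (set T)) :
  d.-measurable = <<s G >> -> setI_closed G -> mu.-integrable setT (EFin \o f) ->
  (forall A, G A -> exists phi : nat -> T -> R,
    [/\ forall k, measurable_fun setT (phi k), forall k x, (`|phi k x| <= 1)%R,
      forall x, phi k x @[k --> \oo] --> (\1_A x : R) &
      forall k, \int[mu]_x (f x * phi k x)%:E = 0]) ->
  \int[mu]_x (f x)%:E = 0 ->
  {ae mu, forall x, f x = 0%R}.
Proof.
move=> mG GI intf H T0; apply: (integral0_generated mG GI intf) => // A GA.
have mA : measurable A by rewrite mG; exact: sub_sigma_algebra.
have [phi [mphi phi1 cphi phi0]] := H _ GA.
have mf : measurable_fun setT f by apply/measurable_EFinP; exact: measurable_int intf.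
have [] := @dominated_convergence _ _ _ mu setT measurableT
  (fun k x => (f x * phi k x)%:E) (fun x => (f x * \1_A x)%:E) (fun x => `|f x|%:E).
- by move=> k; apply/measurable_EFinP; exact: measurable_funM.
- by apply/measurable_EFinP; apply: measurable_funM => //; exact: measurable_indic.
- apply/aeW => x _; apply: cvg_EFin; first by near=> k.
  by apply: cvgM; [exact: cvg_cst|exact: cphi].
- by have /integrable_abse := intf.
- by apply/aeW => x k _; rewrite lee_fin normrM ler_piMr.
move=> _ _ h; transitivity (\int[mu]_x (f x * \1_A x)%:E).
  rewrite integral_mkcond; apply: eq_integral => x _.
  by rewrite patchE indicE; case: ifPn => _; rewrite ?mulr1 ?mulr0.
rewrite -(cvg_lim _ h)//; under eq_fun do rewrite phi0.
exact: lim_cst.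
Unshelve. all: by end_near. Qed.

Lemma bump_bound (t : R) : (`|bump 0 t| <= 1)%R.
Proof.
rewrite /bump; case: ifPn => t0; last by rewrite normr0.
rewrite expr0 invr1 mul1r ger0_norm ?expR_ge0// -expR0 ler_expR oppr_le0 invr_ge0.
exact: ltW.
Qed.

Lemma bump_gt0 (t : R) : (0 < bump 0 t)%R = (0 < t)%R.
Proof.
by rewrite /bump; case: ifPn => t0; rewrite ?ltxx// expr0 invr1 mul1r expR_gt0.
Qed.

Lemma bump_le0 m (t : R) : (t <= 0)%R -> bump m t = 0%R.
Proof. by move=> t0; rewrite /bump ltNge t0. Qed.

Lemma cvg_bump (t : R) : bump 0 (k.+1%:R * t) @[k --> \oo] --> ((0 < t)%R%:R : R).
Proof.
have [t0|t0] := leP t 0%R.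
  under eq_fun do rewrite bump_le0 ?mulr_ge0_le0//.
  exact: cvg_cst.
have -> : (fun k => bump 0 (k.+1%:R * t)) = (fun k => expR (- (t^-1 * harmonic k)))%R.
  apply/funext => k; rewrite /bump mulr_gt0// expr0 invr1 mul1r /harmonic/=.
  by rewrite invfM mulrC.
have h : (- (t^-1 * harmonic k) @[k --> \oo] --> (0 : R))%R.
  rewrite -oppr0; apply: cvgN; rewrite -(mulr0 t^-1)%R; apply: cvgM; first exact: cvg_cst.
  exact: cvg_harmonic.
rewrite -[X in _ --> X]expR0.
exact: (cvg_comp _ _ h (@continuous_expR R 0%R)).
Qed.

Lemma cvg_bigprod (I : Type) (r : seq I) (f : I -> nat -> R) (l : I -> R) :
  (forall i, f i k @[k --> \oo] --> l i) ->
  (\prod_(i <- r) f i k)%R @[k --> \oo] --> (\prod_(i <- r) l i)%R.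
Proof.
move=> cf; elim: r => [|i r IH].
  by under eq_fun do rewrite big_nil; rewrite big_nil; exact: cvg_cst.
under eq_fun do rewrite big_cons.
by rewrite big_cons; apply: cvgM.
Qed.

(** C_c^infty(]0, +oo[), extended by zero to the line so that integrals and derivatives carry no
    domain. The case b < a is allowed and means the zero function. *)
Definition test1 (eta : R -> R) : Prop :=
  smooth setT eta /\
  exists a b : R, (0 < a)%R /\ (forall t, ~~ (a <= t <= b)%R -> eta t = 0%R).

Lemma Cn_sub (U V : set R) k f : V `<=` U -> Cn U k f -> Cn V k f.
Proof.
move=> VU; elim: k f => [|k IH] f /=; first by move=> h x /VU; exact: h.
by move=> [d c]; split; [move=> x /VU; exact: d|exact: IH].
Qed.

Lemma enorm0 n : enorm (0 : 'rV[R]_n) = 0%R.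
Proof. by apply/eqP; rewrite enorm_eq0. Qed.

Lemma norm_le_enorm n (x : 'rV[R]_n) : (`|x| <= enorm x)%R.
Proof.
rewrite [leLHS]mx_normrE; apply: bigmax_le; first exact: enorm_ge0.
by move=> [i j] _ /=; rewrite (ord1 i); exact: coord_le_enorm.
Qed.

Lemma compact_annulus n (a b : R) : compact [set x : 'rV[R]_n | (a <= enorm x <= b)%R].
Proof.
apply: bounded_closed_compact; last first.
  have -> : [set x : 'rV[R]_n | (a <= enorm x <= b)%R] = @enorm R n @^-1` `[a, b].
    by apply/seteqP; split => x; rewrite /= in_itv.
  apply: closed_comp; last exact: itv_closed.
  by move=> x _; exact: continuous_enorm.
exists b; split; first exact: num_real.
move=> M bM x /= /andP[_ xb]; rewrite (le_trans (norm_le_enorm x))// (le_trans xb)//.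
exact: ltW.
Qed.

(** Off the origin |x| is smooth; on the ball |x| < a, where it is not, the composite is identically
    0. *)
Lemma test1_radial n (eta : R -> R) : test1 eta ->
  test_fun (@punctured R n) (fun x => eta (enorm x)).
Proof.
move=> [seta [a [b [a0 hab]]]]; split.
  move=> k; apply/Ck_on_setT.
  apply: (@Ck_on_glue _ _ (@punctured R n) [set x | (enorm x < a)%R]).
  - apply/seteqP; split => // x _; have [->|x0] := eqVneq x 0%R; last by left; apply/eqP.
    by right; rewrite /= enorm0.
  - by apply: Ck_on_radial => j; apply: Cn_sub (seta j).
  - apply: (@Ck_on_ext _ _ _ _ (fun=> 0%R)); last exact: Ck_on_cst.
      have -> : [set x : 'rV[R]_n | (enorm x < a)%R] = @enorm R n @^-1` [set t | (t < a)%R] by [].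
      by apply: open_comp; [move=> x _; exact: continuous_enorm|exact: open_lt].
    by move=> x /= xa; rewrite hab// leNgt xa.
exists [set x | (a <= enorm x <= b)%R]; split.
- exact: compact_annulus.
- by move=> x /= /andP[ax _] x0; move: ax; rewrite x0 enorm0 leNgt a0.
- by move=> x /negP; exact: hab.
Qed.

Lemma test_funM n (O : set 'rV[R]_n) phi f : open O -> test_fun O phi -> (forall k, Ck_on O k f) ->
  test_fun O (fun x => f x * phi x)%R.
Proof.
move=> oO [sphi [K [cK KO phi0]]] sf; split; last first.
  by exists K; split=> // x /phi0 ->; rewrite mulr0.
have cl : closed K by apply: compact_closed => //; exact: norm_hausdorff.
move=> k; apply/Ck_on_setT; apply: (@Ck_on_glue _ _ O (~` K)).
- apply/seteqP; split => // x _; have [/KO|] := pselect (K x); [by left|by right].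
- by apply: Ck_onM => //; apply: Ck_on_sub (proj2 (Ck_on_setT _ _) (sphi k)).
- apply: (@Ck_on_ext _ _ _ _ (fun=> 0%R)); [exact: closed_openC| |exact: Ck_on_cst].
  by move=> x /= /phi0 ->; rewrite mulr0.
Qed.

(** Smooth cutoffs, positive exactly on ]1/(m+1), m+1[. They make locally integrable functions
    integrable, and their countably many positivity sets exhaust the half-line. *)
Definition chi (m : nat) (t : R) : R := (bump 0 (t - m.+1%:R^-1) * bump 0 (m.+1%:R - t))%R.

Lemma test1_chi m : test1 (chi m).
Proof.
split.
  apply: smoothM => //; first exact: openT.
    have := @smooth_affine R setT 1 (- m.+1%:R^-1)%R (bump 0) (@openT _) (smooth_bump 0).
    by under eq_fun do rewrite mul1r.
  have := @smooth_affine R setT (-1) (m.+1%:R)%R (bump 0) (@openT _) (smooth_bump 0).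
  by under eq_fun do rewrite mulN1r addrC.
exists (m.+1%:R^-1)%R, (m.+1%:R)%R; split=> // t.
rewrite negb_and -!ltNge /chi => /orP[h|h].
  by rewrite [X in (X * _)%R]bump_le0 ?mul0r// subr_le0 ltW.
by rewrite [X in (_ * X)%R]bump_le0 ?mulr0// subr_le0 ltW.
Qed.

Lemma chi_gt0 m (t : R) : (0 < chi m t)%R = (m.+1%:R^-1 < t < m.+1%:R)%R.
Proof.
rewrite /chi; have [h|h] := ltP m.+1%:R^-1%R t; last first.
  by rewrite [X in (X * _)%R]bump_le0 ?mul0r ?ltxx// subr_le0.
by rewrite pmulr_rgt0 bump_gt0 subr_gt0.
Qed.

Lemma chi_neq0 (t : R) : (0 < t)%R -> exists m, (0 < chi m t)%R.
Proof.
move=> t0; have h : (0 <= t + t^-1)%R by rewrite addr_ge0 ?invr_ge0// ltW.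
exists (Num.bound (t + t^-1)); rewrite chi_gt0.
have hb : (t + t^-1 < (Num.bound (t + t^-1)).+1%:R)%R.
  by rewrite (lt_trans (archi_boundP h))// ltr_nat.
rewrite -ltf_pV2 ?posrE ?invr_gt0// invrK; apply/andP; split; apply: le_lt_trans hb.
  by rewrite lerDr ltW.
by rewrite lerDl invr_ge0 ltW.
Qed.

Definition upper_orthant n (a : 'I_n -> R) := [set x : 'rV[R]_n | forall i, (a i < x ord0 i)%R].

(** Orthants are stable under intersection and their indicators are limits of products of
    one-variable bumps, which makes them generators suited to [ae0_of_tests]. *)
Lemma rV_generated n : rV_display.-measurable = <<s range (@upper_orthant n) >>.
Proof.
have mo a : measurable (@upper_orthant n a).
  have -> : upper_orthant a =
     \bigcap_(i : 'I_n) ((fun x : 'rV[R]_n => x ord0 i) @^-1` `]a i, +oo[).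
    apply/seteqP; split=> [x h i _ /=|x H i]; first by rewrite in_itv/= h.
    by have := H i I; rewrite /= in_itv/= andbT.
  apply: fin_bigcap_measurable => [|i _]; first exact: finite_finset.
  by rewrite -[X in measurable X]setTI; exact: measurable_coord.
apply/seteqP; split; last first.
  apply: smallest_sub; last by move=> _ [a _ <-].
  by split; [exact: measurable0|move=> A mA; rewrite setTD; exact: measurableC|
    move=> F mF; exact: bigcupT_measurable].
apply: smallest_sub; first exact: smallest_sigma_algebra.
move=> A; rewrite -bigcup_seq => -[i _ [B mB <-]] /=; rewrite setTI.
have : (R.-ocitv.-measurable).-sigma.-measurable B by exact: mB.
rewrite RGenOInfty.measurableE.
have [S0 SC SU] := smallest_sigma_algebra (@setT 'rV[R]_n) (range (@upper_orthant n)).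
move: B {mB}; apply: smallest_sub.
  split => /=; first by rewrite preimage_set0.
    by move=> B h; rewrite setTD preimage_setC -setTD; exact: SC.
  by move=> F h; rewrite preimage_bigcup; exact: SU.
move=> _ [c ->] /=.
have -> : (fun x : 'rV[R]_n => x ord0 i) @^-1` `]c, +oo[ =
   \bigcup_k upper_orthant (fun j => if j == i then c else (- k%:R)%R).
  apply/seteqP; split=> [x|x [k _ /(_ i)]]; rewrite /= in_itv/= andbT ?eqxx//.
  move=> cx; exists (Num.bound `|x|) => // j.
  case: ifP => [/eqP->//|_]; rewrite ltrNl (le_lt_trans (ler_norm _))// normrN.
  by rewrite (le_lt_trans (coord_le_norm _ _))// archi_boundP.
by apply: SU => k; apply: sub_sigma_algebra; eexists.
Qed.

Lemma upper_orthant_setI n : setI_closed (range (@upper_orthant n)).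
Proof.
move=> _ _ [a _ <-] [b _ <-]; exists (fun i => Num.max (a i) (b i)) => //.
apply/seteqP; split=> [x h|x [h1 h2] i].
  by split => i; have := h i; rewrite gt_max => /andP[].
by rewrite gt_max h1 h2.
Qed.

Lemma integrable_restrictM d (T : measurableType d) (mu : {measure set T -> \bar R})
    (K : set T) (f g : T -> R) (C : R) :
  measurable K -> mu.-integrable K (EFin \o f) -> measurable_fun K g ->
  (forall x, (`|g x| <= C)%R) -> (forall x, ~ K x -> g x = 0%R) ->
  mu.-integrable setT (fun x => (f x * g x)%:E).
Proof.
move=> mK intf mg gC g0.
have -> : (fun x => (f x * g x)%:E) = (fun x => (f x * g x)%:E) \_ K.
  apply/funext => x; rewrite patchE; case: ifPn => //; rewrite notin_setE => /g0 ->.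
  by rewrite mulr0.
rewrite -integrable_mkcond//.
have mf : measurable_fun K f by apply/measurable_EFinP; exact: measurable_int intf.
apply: (le_integrable mK _ _ (integrableZl mK C (integrable_abse intf))).
  by apply/measurable_EFinP; exact: measurable_funM.
move=> x Kx /=; rewrite lee_fin normrM [leRHS]ger0_norm.
  by rewrite mulrC ler_wpM2r.
by rewrite mulr_ge0// (le_trans _ (gC x)).
Qed.

Lemma test_fun_bounded n (O : set 'rV[R]_n) phi : test_fun O phi ->
  exists C : R, forall x, (`|phi x| <= C)%R.
Proof.
move=> [sphi [K [cK KO phi0]]].
have cphi : continuous phi := sphi 0%N.
have : bounded_set (phi @` K).
  apply: compact_bounded; apply: continuous_compact => //.
  by apply: continuous_subspaceT => x; exact: cphi.
move=> [M [_ hM]]; exists (Num.max 0 (M + 1))%R => x.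
rewrite le_max; have [Kx|Kx] := pselect (K x); last by rewrite phi0// normr0 lexx.
by apply/orP; right; apply: hM; [rewrite ltrDl|exists x].
Qed.

Lemma test_fun_measurable n (O : set 'rV[R]_n) phi : test_fun O phi ->
  measurable_fun setT phi.
Proof. by move=> [sphi _]; apply: continuous_measurable_rV; exact: (sphi 0%N). Qed.

Lemma integrable_test n (O : set 'rV[R]_n) f phi : Defs.locally_integrable O f ->
  test_fun O phi -> (lebesgue_rV n).-integrable setT (fun x => (f x * phi x)%:E).
Proof.
move=> lf tphi; have [C hC] := test_fun_bounded tphi.
have mphi := test_fun_measurable tphi.
have [sphi [K [cK KO phi0]]] := tphi.
by apply: (integrable_restrictM (compact_measurable_rV cK) (lf K cK KO) (measurable_funTS mphi) hC).
Qed.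

Lemma Rintegral_eq0 d (T : measurableType d) (mu : {measure set T -> \bar R}) (f : T -> R) :
  mu.-integrable setT (EFin \o f) -> (\int[mu]_x f x = 0)%R -> \int[mu]_x (f x)%:E = 0.
Proof.
by move=> intf; rewrite /Rintegral => h; rewrite -[LHS]fineK ?h// integrable_fin_num.
Qed.

(** Localise first: f times [chi m] of |x| is integrable, and its product with a smooth function is
    f times an admissible test function. The products of [bump 0] of (k+1)(x_i - a_i) then
    approximate the indicators of orthants. Finally the countably many exceptional sets are united,
    since every x != 0 lies where some [chi m] is positive. *)
Lemma dubois_rV n (f : 'rV[R]_n -> R) : (0 < n)%N ->
  Defs.locally_integrable (@punctured R n) f ->
  (forall phi, test_fun (@punctured R n) phi -> (\int[lebesgue_rV n]_x (f x * phi x) = 0)%R) ->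
  {ae lebesgue_rV n, forall x, f x = 0%R}.
Proof.
move=> n0 lf H.
have hm m : {ae lebesgue_rV n, forall x, (f x * chi m (enorm x) = 0)%R}.
  have tchi := test1_radial n (test1_chi m).
  apply: (ae0_of_tests (rV_generated n) (@upper_orthant_setI n)).
  - exact: integrable_test tchi.
  - move=> _ [a _ <-].
    pose phi (k : nat) (x : 'rV[R]_n) := (\prod_(i < n) bump 0 (k.+1%:R * (x ord0 i - a i)))%R.
    have Ckphi (O : set 'rV[R]_n) (oO : open O) k j : Ck_on O j (phi k).
      apply: Ck_on_prod => [|i] //.
      apply: (@Ck_on_comp _ _ O setT (fun x => x ord0 i)
        (fun t => bump 0 (k.+1%:R * (t - a i)))) => //.
        by move=> {}j; exact: Ck_on_coord.
      under eq_fun do rewrite mulrBr.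
      by apply: smooth_affine; [exact: openT|exact: smooth_bump].
    exists phi; split.
    + move=> k; apply: continuous_measurable_rV => x.
      by apply: (Ck_on_continuous (Ckphi setT openT k 0%N)).
    + move=> k x; rewrite /phi normr_prod; apply: prodr_ile1 => i _.
      by rewrite normr_ge0 bump_bound.
    + move=> x; rewrite indicE.
      have -> : (x \in upper_orthant a)%:R = (\prod_(i < n) (0 < x ord0 i - a i)%R%:R)%R :> R.
        have [xa|xa] := boolP (x \in upper_orthant a).
          by move: xa; rewrite inE => xa; rewrite big1// => i _; rewrite subr_gt0 xa.
        have : ~ upper_orthant a x by move: xa; rewrite notin_setE.
        move=> /existsNP[i /negP]; rewrite -subr_gt0 => /negbTE h.
        by rewrite (bigD1 i)//= h mul0r.
      by apply: cvg_bigprod => i; exact: cvg_bump.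
    + move=> k; have tk := test_funM (@open_punctured R n) tchi (Ckphi _ (@open_punctured R n) k).
      apply: Rintegral_eq0; last first.
        by under eq_Rintegral do rewrite -mulrA [(chi _ _ * _)%R]mulrC; apply: H.
      have := integrable_test lf tk; apply: eq_integrable => // x _ /=.
      by rewrite -mulrA [(chi _ _ * _)%R]mulrC.
  - by apply: Rintegral_eq0; [exact: integrable_test tchi|exact: H].
have h0 : {ae lebesgue_rV n, forall x : 'rV[R]_n, x != 0%R}.
  exists [set (0%R : 'rV[R]_n)]; split; [exact: compact_measurable_rV (@compact_set1 _ _)|exact: lebesgue_rV0|].
  by move=> x /= /negP; rewrite negbK => /eqP.
have : {ae lebesgue_rV n, forall x m, (f x * chi m (enorm x) = 0)%R}.
  exact/ae_foralln.
apply: filter_app; apply: filterS h0 => x x0 hx.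
rewrite -enorm_gt0 in x0; have [m cm] := chi_neq0 x0.
by have /eqP := hx m; rewrite mulf_eq0 (gt_eqF cm) orbF => /eqP.
Qed.

Lemma ae_leb_imp (P Q : R -> Prop) : (forall x, P x -> Q x) ->
  {ae leb, forall x, P x} -> {ae leb, forall x, Q x}.
Proof.
move=> PQ [A [mA A0 hA]]; exists A; split => // x /= h; apply: hA => /= hP.
exact/h/PQ.
Qed.

(** Local integrability on the open half-line: nothing is demanded up to 0, where profiles and their
    derivatives may blow up. *)
Definition locint (f : R -> R) := forall a b : R, (0 < a)%R -> leb.-integrable `[a, b] (EFin \o f).

Lemma integrable_test1 f eta : locint f -> test1 eta -> leb.-integrable setT (fun x => (f x * eta x)%:E).
Proof.
move=> lf [seta [a [b [a0 hab]]]].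
have ceta : continuous eta by move=> x; exact: (seta 0%N).
have : bounded_set (eta @` `[a, b]).
  apply: compact_bounded; apply: continuous_compact; last exact: segment_compact.
  by apply: continuous_subspaceT => x; exact: ceta.
move=> [M [_ hM]]; apply: (@integrable_restrictM _ _ leb `[a, b]%classic f eta (Num.max 0 (M + 1))%R) => //.
- exact: lf.
- by apply: measurable_funTS; exact: continuous_measurable_fun.
- move=> t; rewrite le_max; have [tab|tab] := boolP (a <= t <= b)%R; last by rewrite hab// normr0 lexx.
  by apply/orP; right; apply: hM; [rewrite ltrDl|exists t => //=; rewrite in_itv].
- by move=> t /= /negP; rewrite in_itv/=; exact: hab.
Qed.

Lemma test1M eta f : test1 eta -> smooth setT f -> test1 (fun x => f x * eta x)%R.
Proof.
move=> [seta [a [b [a0 hab]]]] sf; split; first by apply: smoothM => //; exact: openT.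
by exists a, b; split => // t /hab ->; rewrite mulr0.
Qed.

Lemma dubois0 (f : R -> R) : locint f ->
  (forall eta, test1 eta -> (\int[leb]_x (f x * eta x) = 0)%R) ->
  {ae leb, forall x, (0 < x)%R -> f x = 0%R}.
Proof.
move=> lf H.
have hm m : {ae leb, forall x, (f x * chi m x = 0)%R}.
  have tchi := test1_chi m.
  apply: (@ae0_of_tests _ _ leb _ (@RGenOInfty.G R)).
  - exact: RGenOInfty.measurableE.
  - move=> _ _ [a ->] [b ->]; exists (Num.max a b).
    by apply/seteqP; split=> x; rewrite /= !in_itv/= !andbT gt_max => /andP.
  - exact: integrable_test1.
  - move=> _ [a ->].
    pose phi (k : nat) (x : R) := bump 0 (k.+1%:R * (x - a))%R.
    have sphi k : smooth setT (phi k).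
      rewrite /phi; under eq_fun do rewrite mulrBr.
      by apply: smooth_affine; [exact: openT|exact: smooth_bump].
    exists phi; split.
    + by move=> k; apply: continuous_measurable_fun => x; exact: (sphi k 0%N).
    + by move=> k x; exact: bump_bound.
    + move=> x; rewrite indicE.
      have -> : (x \in `]a, +oo[%classic) = (0 < x - a)%R.
        by rewrite mem_setE in_itv/= andbT subr_gt0.
      exact: cvg_bump.
    + move=> k; have tk := test1M tchi (sphi k).
      apply: Rintegral_eq0; last first.
        by under eq_Rintegral do rewrite -mulrA [(chi _ _ * _)%R]mulrC; apply: H.
      have := integrable_test1 lf tk; apply: eq_integrable => // x _ /=.
      by rewrite -mulrA [(chi _ _ * _)%R]mulrC.
  - by apply: Rintegral_eq0; [exact: integrable_test1|exact: H].
have /ae_foralln : forall m, {ae leb, forall x, (f x * chi m x = 0)%R} by [].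
apply: filterS => x hx x0; have [m cm] := chi_neq0 x0.
by have /eqP := hx m; rewrite mulf_eq0 (gt_eqF cm) orbF => /eqP.
Qed.

Lemma locint_cst (c : R) : locint (fun=> c).
Proof.
move=> a b a0; apply: measurable_bounded_integrable => //.
- by rewrite /= lebesgue_measure_itv/=; case: ifPn => _; rewrite -?EFinB ltry.
- by exists `|c|%R; split; [exact: num_real|move=> M cM x _ /=; exact: ltW].
Qed.

Lemma test1_integrable (eta : R -> R) : test1 eta -> leb.-integrable setT (EFin \o eta).
Proof.
move=> te; have := integrable_test1 (locint_cst 1%R) te.
by apply: eq_integrable => // x _ /=; rewrite mul1r.
Qed.

Lemma test1D f g : test1 f -> test1 g -> test1 (fun x => f x + g x)%R.
Proof.
move=> [sf [a [b [a0 hf]]]] [sg [a' [b' [a0' hg]]]]; split.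
  by apply: smoothD => //; exact: openT.
exists (Num.min a a'), (Num.max b b'); split; first by rewrite lt_min a0.
move=> t; rewrite ge_min le_max negb_and !negb_or -!ltNge => h.
by rewrite hf ?hg ?addr0// negb_and -!ltNge; case/orP: h => /andP[h1 h2]; rewrite ?h1 ?h2 ?orbT.
Qed.

(** The primitive from -oo vanishes before the support and equals the total integral after it; mean
    zero makes it compactly supported. *)
Lemma test1_primitive theta : test1 theta -> (\int[leb]_x theta x = 0)%R ->
  exists2 eta, test1 eta & (eta^`())%classic = theta.
Proof.
move=> [stheta [a [b [a0 hab]]]] T0.
pose eta x := (\int[leb]_(t in `]-oo, x]) theta t)%R.
have inttheta : leb.-integrable setT (EFin \o theta).
  have := integrable_test1 (locint_cst 1%R) (conj stheta (ex_intro _ a (ex_intro _ b (conj a0 hab)))).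
  by apply: eq_integrable => // x _ /=; rewrite mul1r.
have de (x : R) : is_derive x 1%R eta (theta x).
  have [] := @continuous_FTC1 R theta -oo%O x (x + 1)%R.
  - by rewrite ltrDl.
  - exact: integrableS inttheta.
  - first [exact: ltNybnd | exact: ltNyBRight | by rewrite ltNyb | by rewrite /Order.lt/= | by rewrite itv_boundlr | by apply/bnd_simp ].
  - exact: (stheta 0%N).
  by move=> d1 d2; apply: DeriveDef; [exact: d1|rewrite -derive1E; exact: d2].
have e1 : (eta^`())%classic = theta.
  by apply/funext => x; rewrite derive1E; have [_ ->] := de x.
exists eta => //; split.
  move=> [|k]; first move=> x _.
    by apply: differentiable_continuous; apply/derivable1_diffP; have [] := de x.
  by split; [move=> x _; have [] := de x|rewrite e1; exact: stheta].
exists a, b; split=> // t; rewrite negb_and -!ltNge => /orP[ta|tb]; rewrite /eta.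
  rewrite /Rintegral integral0_eq// => x /=; rewrite in_itv/= => xt.
  by rewrite hab// leNgt (le_lt_trans xt).
rewrite -[RHS]T0 /Rintegral [in RHS]integral_mkcond [in LHS]integral_mkcond.
congr fine; apply: eq_integral => x _; rewrite !patchE mem_setE in_itv/= in_setT.
by case: ifPn => //; rewrite -ltNge => tx; rewrite hab// negb_and -!ltNge (lt_trans tb)// orbT.
Qed.

(** Subtracting from a test function the multiple of [chi 1] with the same integral leaves a
    derivative of a test function, on which f vanishes by hypothesis. Hence f acts as the constant
    [c], its mean weighted by [chi 1], and [dubois0] applies to f - c. *)
Lemma dubois1 (f : R -> R) : locint f ->
  (forall eta, test1 eta -> (\int[leb]_x (f x * (eta^`())%classic x) = 0)%R) ->
  exists c : R, {ae leb, forall x, (0 < x)%R -> f x = c}.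
Proof.
move=> lf H.
pose c0 : R := (\int[leb]_x chi 1 x)%R.
(* [chi 1] is nonnegative and positive on ]1/2, 2[, an interval of positive measure. *)
have c0n : c0 != 0%R.
  apply/eqP => h; have ichi := test1_integrable (test1_chi 1).
  have chi0 x : (0 <= chi 1 x)%R.
    by rewrite /chi mulr_ge0// /bump; case: ifPn => // _; rewrite expr0 invr1 mul1r expR_ge0.
  have mchi : measurable_fun setT (EFin \o chi 1) := measurable_int _ ichi.
  have [+ _] := ae_eq_integral_abs leb measurableT mchi.
  case=> [|A [mA A0 hA]].
    rewrite -[RHS](Rintegral_eq0 ichi h); apply: eq_integral => x _ /=.
    by rewrite ger0_norm.
  have : leb `]2%:R^-1%R, 2%R[%classic = 0.
    apply: (subset_measure0 _ mA _ A0) => //.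
    move=> x /=; rewrite in_itv/= -(chi_gt0 1) => x0; apply: hA => /= /(_ I)[].
    by apply/eqP; rewrite gt_eqF.
  rewrite lebesgue_measure_itv/= lte_fin; have -> : (2%:R^-1 < 2 :> R)%R by lra.
  by rewrite -EFinB => -[] /eqP; rewrite gt_eqF//; lra.
pose c := (c0^-1 * \int[leb]_x (f x * chi 1 x))%R.
have lc := locint_cst.
exists c; suff : {ae leb, forall x, (0 < x)%R -> (f x - c = 0)%R}.
  by apply: ae_leb_imp => x h x0; apply/subr0_eq/h.
apply: dubois0 => [a b a0|theta ttheta].
  have -> : EFin \o (fun x => f x - c)%R = (EFin \o f) \- (EFin \o (fun=> c)) by [].
  by apply: integrableB => //; [exact: lf|exact: lc].
pose th x := (theta x - c0^-1 * (\int[leb]_y theta y) * chi 1 x)%R.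
have tth : test1 th.
  rewrite /th; under eq_fun do rewrite -mulNr.
  apply: test1D => //; apply: test1M; first exact: test1_chi.
  exact: smooth_cst.
have int1 := test1_integrable.
have [eta teta eeta] : exists2 eta, test1 eta & (eta^`())%classic = th.
  apply: test1_primitive tth _; rewrite RintegralB//.
  - rewrite RintegralZl//; last exact/int1/test1_chi.
    by rewrite -/c0 mulrAC mulVf// mul1r subrr.
  - exact: int1.
  - have := integrableZl measurableT (c0^-1 * (\int[leb]_y theta y))%R (int1 _ (test1_chi 1)).
    by apply: eq_integrable => //.
have := H _ teta; rewrite eeta /th.
under eq_Rintegral do rewrite mulrBr.
rewrite RintegralB//; last 2 first.
- exact: integrable_test1.
- have := integrableZl measurableT (c0^-1 * (\int[leb]_y theta y))%R (integrable_test1 lf (test1_chi 1)).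
  by apply: eq_integrable => // x _; rewrite /= -EFinM mulrCA.
move=> h; under eq_Rintegral do rewrite mulrBl.
rewrite RintegralB//; last 2 first.
- exact: integrable_test1.
- exact: integrable_test1 (lc c) ttheta.
rewrite RintegralZl//; last exact: int1.
rewrite -[RHS]h; congr (_ - _)%R.
under [RHS]eq_Rintegral do rewrite mulrCA.
rewrite RintegralZl//; last exact: integrable_test1 (test1_chi 1).
by rewrite /c; ring.
Qed.

End dubois.

(** * Weak gradients *)

Section wgrad.
Context {R : realType}.
Notation leb := (@lebesgue_measure R).

Lemma integral_rV_translate n (b : 'rV[R]_n) (f : 'rV[R]_n -> \bar R) : measurable_fun setT f ->
  (\int[lebesgue_rV n]_x f (x + b)%R = \int[lebesgue_rV n]_x f x)%E.
Proof.
move=> mf; rewrite integralE [RHS]integralE.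
have h (F : 'rV[R]_n -> \bar R) : measurable_fun setT F -> (forall x, 0 <= F x)%E ->
    (\int[lebesgue_rV n]_x F (x + b)%R = \int[lebesgue_rV n]_x F x)%E.
  move=> mF F0; rewrite [RHS](integral_rV_affine b (@ltr01 R))// expr1n mul1e.
  by under [RHS]eq_integral do rewrite scale1r.
have hp : (forall x, 0 <= f^\+ x)%E by [].
have hn : (forall x, 0 <= f^\- x)%E by [].
rewrite -(h f^\+%E (measurable_funepos mf) hp) -(h f^\-%E (measurable_funeneg mf) hn).
by congr (_ - _)%E; apply: eq_integral => x _; rewrite ?funeposE ?funenegE.
Qed.

Lemma test_fun_partial n (O : set 'rV[R]_n) phi i : test_fun O phi -> test_fun O (partial i phi).
Proof.
move=> [sphi [K [cK KO phi0]]]; split.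
  by move=> k; have [_ /(_ i)[]] := sphi k.+1.
exists K; split=> // x Kx.
have oK : open (~` K).
  by apply: closed_openC; apply: compact_closed => //; exact: norm_hausdorff.
rewrite /partial (near_eq_derive (g := cst 0)) ?derive_cst//.
exact: (eq_on_near oK Kx phi0).
Qed.

Lemma test_fun_sub n (O O' : set 'rV[R]_n) phi : O `<=` O' -> test_fun O phi -> test_fun O' phi.
Proof.
move=> sO [sphi [K [cK KO phi0]]]; split => //; exists K; split=> //.
exact: subset_trans sO.
Qed.

Lemma test_derivable n (O : set 'rV[R]_n) phi i x : test_fun O phi ->
  derivable phi x (delta_mx ord0 i).
Proof. by move=> [/(_ 1%N)[_ /(_ i)[+ _]] _]; exact. Qed.

Lemma integrable_test_fun n (O : set 'rV[R]_n) phi : test_fun O phi ->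
  (lebesgue_rV n).-integrable setT (EFin \o phi).
Proof.
move=> tphi; have tphi' := test_fun_sub (@subsetT _ O) tphi.
have l1 : Defs.locally_integrable setT (fun _ : 'rV[R]_n => 1 : R).
  move=> K cK _; apply: measurable_bounded_integrable.
  - exact: compact_measurable_rV.
  - exact: compact_lebesgue_fin.
  - exact: measurable_cst.
  - by exists 1; split; [exact: num_real|move=> M cM x _ /=; rewrite normr1 ltW].
have := integrable_test l1 tphi'.
by apply: eq_integrable => // x _ /=; rewrite mul1r.
Qed.

(** By translation invariance every difference quotient of phi has integral 0. The quotients
    converge pointwise to the partial derivative and, by the mean value theorem, are bounded by its
    maximum on a fixed box, so dominated convergence applies. *)
Lemma integral_partial n (phi : 'rV[R]_n -> R) i : test_fun setT phi ->
  \int[lebesgue_rV n]_x partial i phi x = 0.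
Proof.
move=> tphi.
have mphi := test_fun_measurable tphi.
have tdphi := test_fun_partial i tphi.
have iphi := integrable_test_fun tphi.
have [C hC] := test_fun_bounded tdphi.
have [sphi [K [cK _ phi0]]] := tphi.
have /compact_bounded[M [_ hM]] := cK.
(* The support lies in the box of half-side M + 1, and the quotients move points by at most 1. *)
pose B := [set x : 'rV[R]_n | forall j, `|x ord0 j| <= M + 2].
pose e : 'rV[R]_n := delta_mx ord0 i.
pose D (k : nat) (x : 'rV[R]_n) := k.+1%:R * (phi (x + k.+1%:R^-1 *: e) - phi x).
have tr (b : 'rV[R]_n) : measurable_fun setT (fun x : 'rV[R]_n => phi (x + b)).
  have := measurableT_comp mphi (measurable_affine_rV 1 b).
  by apply: eq_measurable_fun => x _ /=; rewrite scale1r.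
have itr (b : 'rV[R]_n) : (lebesgue_rV n).-integrable setT (fun x : 'rV[R]_n => (phi (x + b))%:E).
  apply/integrableP; split; first exact/measurable_EFinP.
  have /integrableP[_] := iphi; rewrite -(integral_rV_translate b)//.
  by apply/measurable_EFinP; exact: measurableT_comp.
have D0 k : (\int[lebesgue_rV n]_x (D k x)%:E = 0)%E.
  rewrite /D; under eq_integral do rewrite EFinM EFinB.
  rewrite integralZl//; last exact: integrableB.
  rewrite integralB//.
  rewrite (integral_rV_translate _ (f := fun x => (phi x)%:E)); last exact/measurable_EFinP.
  by rewrite subee ?mule0// integrable_fin_num.
have mv (k : nat) x : exists2 t, 0 < t < k.+1%:R^-1 & D k x = partial i phi (x + t *: e).
  have k0 : 0 < k.+1%:R^-1 :> R by rewrite invr_gt0.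
  pose g t := phi (x + t *: e).
  have dg (t : R) : is_derive t 1 g (partial i phi (x + t *: e)).
    apply/is_derive_line => /=.
    have /is_derive_line : is_derive (x + t *: e) e phi (partial i phi (x + t *: e)).
      by apply: DeriveDef => //; exact: test_derivable tphi.
    congr (is_derive _ _ _ _); apply/funext => s; rewrite /g; congr phi.
    by rewrite [s *: 1]mulr1 scalerDl addrCA.
  have [|t] := @MVT _ g (fun t => partial i phi (x + t *: e)) 0 k.+1%:R^-1 k0 (fun t _ => dg t).
    apply: derivable_within_continuous => t _; by have [] := dg t.
  rewrite in_itv/= => t01; rewrite /g scale0r addr0 subr0 => h.
  by exists t => //; rewrite /D h mulrCA mulfV ?mulr1// pnatr_eq0.
have DB k x : `|D k x| <= C * \1_B x.
  have [xB|xB] := boolP (x \in B); rewrite indicE.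
    by rewrite xB mulr1; have [t _ ->] := mv k x.
  rewrite (negbTE xB) mulr0 /D.
  have notK (y : 'rV[R]_n) : (forall j, `|y ord0 j - x ord0 j| <= 1) -> phi y = 0.
    move=> yx; apply: phi0 => Ky; move: xB => /negP; apply; rewrite inE => j.
    have := hM (M + 1); rewrite ltrDl ltr01 => /(_ isT _ Ky) /= yM.
    have := yx j; rewrite distrC => h.
    rewrite -(subrK (y ord0 j) (x ord0 j)) (le_trans (ler_normD _ _))//.
    have := le_trans (coord_le_norm y j) yM.
    by move: h; set a := `| _ - _|; set b := `| _ |; lra.
  rewrite !notK ?subrr ?mulr0 ?normr0// => j; first by rewrite subrr normr0.
  rewrite !mxE [_ + _ - _]addrAC subrr add0r eqxx /=; case: eqP => _; rewrite ?mulr0 ?normr0// mulr1.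
  by rewrite ger0_norm ?invr_ge0// invf_le1// ler1n.
have cD x : D k x @[k --> \oo] --> partial i phi x.
  have cp : {for x, continuous (partial i phi)} by case: tdphi => /(_ 0%N)/= + _; exact.
  have /boolp.choice[t ht] : forall k, exists t : R, 0 < t < k.+1%:R^-1 /\ D k x = partial i phi (x + t *: e).
    by move=> k; have [t h1 h2] := mv k x; exists t.
  have t0 : t k @[k --> \oo] --> (0 : R).
    apply: (@squeeze_cvgr _ _ _ _ (fun=> 0) (@harmonic R)); [|exact: cvg_cst|exact: cvg_harmonic].
    by near=> k; have [/andP[/ltW -> /ltW ->]] := ht k.
  have hx : (x + t k *: e) @[k --> \oo] --> x.
    rewrite -[X in _ --> X]addr0; apply: cvgD; first exact: cvg_cst.
    by rewrite -(scale0r e); apply: cvgZr_tmp.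
  under eq_fun => k do rewrite (ht k).2.
  exact: (cvg_comp _ _ hx cp).
have mB : measurable B := @measurable_box R n (M + 2).
have [] := @dominated_convergence _ _ _ (lebesgue_rV n) setT measurableT
  (fun k x => (D k x)%:E) (fun x => (partial i phi x)%:E) (fun x => (C * \1_B x)%:E).
- move=> k; apply/measurable_EFinP; apply: measurable_funM; first exact: measurable_cst.
  by apply: measurable_funB => //; exact: tr.
- by apply/measurable_EFinP; exact: test_fun_measurable tdphi.
- by apply/aeW => x _; apply: cvg_EFin; [near=> k|exact: cD].
- have -> : (fun x => (C * \1_B x)%:E) = (fun x => C%:E * (\1_B x)%:E)%E by [].
  apply: integrableZl => //; apply/integrableP; split.
    by apply/measurable_EFinP; exact: measurable_indic.
  under eq_integral do rewrite gee0_abs ?lee_fin//.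
  by rewrite integral_indic// setIT; exact: lebesgue_box_fin.
- by apply/aeW => x k _; rewrite lee_fin.
move=> _ _ h; rewrite /Rintegral -(cvg_lim _ h)//; under eq_fun do rewrite D0.
by rewrite lim_cst.
Unshelve. all: by end_near. Qed.

Definition grad n (v : 'rV[R]_n -> R) (x : 'rV[R]_n) : 'rV[R]_n := \row_i partial i v x.

Lemma continuous_on_measurable n (O : set 'rV[R]_n) (f : 'rV[R]_n -> R) : open O ->
  (forall x, O x -> {for x, continuous f}) -> measurable_fun O f.
Proof.
move=> oO cf; apply: (measurability _ (RGenOpens.measurableE R)) => _ [_ [a [b ->] <-]].
apply: open_measurable_rV; rewrite openE => x [Ox fx].
have : nbhs x (O `&` f @^-1` `]a, b[%classic).
  apply: filterI; first exact: open_nbhs_nbhs.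
  by apply: (cf x Ox); apply: open_nbhs_nbhs; split=> //; exact: interval_open.
by [].
Qed.

Lemma bounded_on_compact n (O K : set 'rV[R]_n) (f : 'rV[R]_n -> R) :
  (forall x, O x -> {for x, continuous f}) -> compact K -> K `<=` O ->
  exists C, forall x, K x -> `|f x| <= C.
Proof.
move=> cf cK KO; have : bounded_set (f @` K).
  apply: compact_bounded; apply: continuous_compact => //.
  by apply: continuous_in_subspaceT => x; rewrite inE => /KO; exact: cf.
move=> [M [_ hM]]; exists (M + 1) => x Kx; apply: hM; first by rewrite ltrDl.
by exists x.
Qed.

Lemma locally_integrableM n (O : set 'rV[R]_n) (a f : 'rV[R]_n -> R) : open O ->
  (forall x, O x -> {for x, continuous a}) -> Defs.locally_integrable O f ->
  Defs.locally_integrable O (fun x => a x * f x).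
Proof.
move=> oO ca lf K cK KO; have [C hC] := bounded_on_compact ca cK KO.
have mK := compact_measurable_rV cK; have intf := lf K cK KO.
apply: (le_integrable mK _ _ (integrableZl mK C intf)).
  apply/measurable_EFinP; apply: measurable_funM.
    by apply: measurable_funS (continuous_on_measurable oO ca) => //; exact: open_measurable_rV.
  by apply/measurable_EFinP; exact: measurable_int intf.
by move=> x Kx /=; rewrite lee_fin !normrM ler_wpM2r// (le_trans (hC _ Kx))// ler_norm.
Qed.

Lemma locally_integrableD n (O : set 'rV[R]_n) (f g : 'rV[R]_n -> R) :
  Defs.locally_integrable O f -> Defs.locally_integrable O g ->
  Defs.locally_integrable O (fun x => f x + g x).
Proof.
move=> lf lg K cK KO; have mK := compact_measurable_rV cK.
have -> : EFin \o (fun x => f x + g x) = ((EFin \o f) \+ (EFin \o g))%E by [].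
by apply: integrableD => //; [exact: lf|exact: lg].
Qed.

Lemma locally_integrableZ n (O : set 'rV[R]_n) (c : R) (f : 'rV[R]_n -> R) :
  Defs.locally_integrable O f -> Defs.locally_integrable O (fun x => c * f x).
Proof.
move=> lf K cK KO; have mK := compact_measurable_rV cK.
have -> : EFin \o (fun x => c * f x) = (fun x => c%:E * (EFin \o f) x)%E by [].
by apply: integrableZl => //; exact: lf.
Qed.

Lemma locally_integrable_cst n (O : set 'rV[R]_n) (c : R) : Defs.locally_integrable O (fun=> c).
Proof.
move=> K cK _; apply: measurable_bounded_integrable.
- exact: compact_measurable_rV.
- exact: compact_lebesgue_fin.
- exact: measurable_cst.
- by exists `|c|; split; [exact: num_real|move=> M cM x _ /=; rewrite ltW].
Qed.

Lemma locally_integrable_ext n (O : set 'rV[R]_n) (f g : 'rV[R]_n -> R) :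
  (forall x, O x -> f x = g x) -> Defs.locally_integrable O f -> Defs.locally_integrable O g.
Proof.
move=> fg lf K cK KO; have mK := compact_measurable_rV cK.
have := lf K cK KO; apply: eq_integrable => // x; rewrite inE => /KO Ox /=.
by rewrite fg.
Qed.

Context (n : nat).
Context (n0 : (0 < n)%N).
Implicit Types (f : 'rV[R]_n -> R) (g : 'rV[R]_n -> 'rV[R]_n).
Notation P := (@punctured R n).
Notation mu := (lebesgue_rV n : {sigma_finite_measure set 'rV[R]_n -> \bar R}).

Lemma test_punctured0 phi : test_fun P phi -> phi 0 = 0.
Proof. by move=> [_ [K [_ KP phi0]]]; apply: phi0 => /KP/(_ erefl). Qed.

(** Values at the origin are invisible: a test function on the punctured space vanishes there
    together with its partial derivatives. *)
Lemma is_wgrad_ext f f' g g' : (forall x, x != 0 -> f x = f' x) ->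
  (forall x, x != 0 -> g x = g' x) -> is_wgrad f g -> is_wgrad f' g'.
Proof.
move=> ff gg [lf lg H]; split.
- by apply: locally_integrable_ext lf => x /eqP; exact: ff.
- by move=> i; apply: locally_integrable_ext (lg i) => x /eqP /gg ->.
- move=> phi tphi i; rewrite -[LHS](_ : \int[mu]_x (f x * partial i phi x) = _).
    rewrite H//; congr (- _); apply: eq_Rintegral => x _.
    by have [->|x0] := eqVneq x 0; [rewrite test_punctured0// !mulr0|rewrite gg].
  apply: eq_Rintegral => x _.
  have [->|x0] := eqVneq x 0; last by rewrite ff.
  by rewrite (test_punctured0 (test_fun_partial i tphi)) !mulr0.
Qed.

Lemma is_wgrad_lin a b f f' g g' : is_wgrad f g -> is_wgrad f' g' ->
  is_wgrad (fun x => a * f x + b * f' x) (fun x => a *: g x + b *: g' x).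
Proof.
move=> [lf lg H] [lf' lg' H']; split.
- by apply: locally_integrableD; exact: locally_integrableZ.
- move=> i; apply: (locally_integrable_ext (f := fun x => a * g x ord0 i + b * g' x ord0 i)).
    by move=> x _; rewrite !mxE.
  by apply: locally_integrableD; exact: locally_integrableZ.
- move=> phi tphi i.
  have t' := test_fun_partial i tphi.
  under eq_Rintegral do rewrite mulrDl -!mulrA.
  under [in RHS]eq_Rintegral do rewrite !mxE mulrDl -!mulrA.
  have iZ c (h : 'rV[R]_n -> R) psi : Defs.locally_integrable P h -> test_fun P psi ->
      mu.-integrable setT (EFin \o (fun x => c * (h x * psi x))).
    move=> lh tpsi.
    have -> : EFin \o (fun x => c * (h x * psi x)) = (fun x => c%:E * (h x * psi x)%:E)%E by [].
    by apply: integrableZl => //; exact: integrable_test lh tpsi.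
  rewrite RintegralD//; [|exact: iZ|exact: iZ].
  rewrite RintegralD//; [|exact: (iZ _ (fun x => g x ord0 i))|exact: (iZ _ (fun x => g' x ord0 i))].
  rewrite !RintegralZl//; first last.
  - exact: integrable_test lf t'.
  - exact: integrable_test lf' t'.
  - exact: integrable_test (lg i) tphi.
  - exact: integrable_test (lg' i) tphi.
  by rewrite H// H'// !mulrN opprD.
Qed.

Lemma is_wgrad_uniq f g g' : is_wgrad f g -> is_wgrad f g' -> {ae mu, forall x, g x = g' x}.
Proof.
move=> hg hg'; have [lf lg H] := is_wgrad_lin 1 (- 1) hg hg'.
have h i : {ae mu, forall x, g x ord0 i = g' x ord0 i}.
  have : {ae mu, forall x, (1 *: g x + (-1) *: g' x) ord0 i = 0}.
    apply: dubois_rV => // phi tphi.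
    have := H phi tphi i; under eq_Rintegral do rewrite mul1r mulN1r subrr mul0r.
    by rewrite Rintegral_cst// mul0r => /esym/eqP; rewrite oppr_eq0 => /eqP.
  by apply: filterS => x; rewrite !mxE mul1r mulN1r => /subr0_eq.
have : {ae mu, forall x, forall i : 'I_n, g x ord0 i = g' x ord0 i}.
  by apply: filter_forall => i; exact: h.
by apply: filterS => x gx; apply/rowP.
Qed.

Lemma wgradE f g : is_wgrad f g -> {ae mu, forall x, wgrad f x = g x}.
Proof.
move=> hg; have h : is_wgrad f (wgrad f) by apply: xgetPex; exists g.
exact: is_wgrad_uniq h hg.
Qed.

Lemma partialM (a b : 'rV[R]_n -> R) i x : derivable a x (delta_mx ord0 i) ->
  derivable b x (delta_mx ord0 i) ->
  partial i (fun x => a x * b x) x = a x * partial i b x + b x * partial i a x.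
Proof. by move=> da db; rewrite /partial (@deriveM _ _ a b x _ da db). Qed.

(** a phi is again a test function, also when a is singular at the origin; the weak gradient of f is
    tested against it. *)
Lemma is_wgrad_mul a f g : (forall k, Ck_on P k a) -> is_wgrad f g ->
  is_wgrad (fun x => a x * f x) (fun x => a x *: g x + f x *: grad a x).
Proof.
move=> sa [lf lg H]; have ca := sa 0%N.
have sda i k : Ck_on P k (partial i a) by have [_ /(_ i)[]] := sa k.+1.
have cda i := sda i 0%N; have oP := @open_punctured R n.
split.
- exact: locally_integrableM.
- move=> i; apply: (locally_integrable_ext (f := fun x => a x * g x ord0 i + partial i a x * f x)).
    by move=> x _; rewrite !mxE [f x * _]mulrC.
  apply: locally_integrableD; first exact: (locally_integrableM oP ca (lg i)).
  exact: (locally_integrableM oP (cda i) lf).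
- move=> phi tphi i.
  have taphi := test_funM oP tphi sa.
  have tdaphi := test_funM oP tphi (sda i).
  have E x : a x * f x * partial i phi x =
      f x * partial i (fun x => a x * phi x) x - f x * (partial i a x * phi x).
    have [->|x0] := eqVneq x 0.
      rewrite (test_punctured0 tphi) (test_punctured0 (test_fun_partial i tphi)).
      by rewrite (test_punctured0 (test_fun_partial i taphi)) !mulr0 subr0.
    have Px : P x by apply/eqP.
    rewrite partialM; first by ring.
      by have [_ /(_ i)[+ _]] := sa 1%N; exact.
    exact: test_derivable tphi.
  under eq_Rintegral do rewrite E.
  rewrite RintegralB//; first last.
  - exact: integrable_test lf tdaphi.
  - exact: integrable_test lf (test_fun_partial i taphi).
  rewrite H//.
  under [in RHS]eq_Rintegral do rewrite !mxE mulrDl -mulrA [a _ * _]mulrC -!mulrA [phi _ * _]mulrC.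
  rewrite [in RHS]RintegralD//; first last.
  - exact: integrable_test lf tdaphi.
  - exact: integrable_test (lg i) taphi.
  by rewrite opprD.
Qed.

Lemma is_wgrad_cst (c : R) : is_wgrad (fun _ : 'rV[R]_n => c) (fun=> 0).
Proof.
split.
- exact: locally_integrable_cst.
- move=> i; apply: (locally_integrable_ext (f := fun=> 0)); last exact: locally_integrable_cst.
  by move=> x _; rewrite mxE.
- move=> phi tphi i; have t' := test_fun_sub (@subsetT _ P) tphi.
  rewrite RintegralZl//; last exact: integrable_test_fun (test_fun_partial i tphi).
  rewrite integral_partial// mulr0; under eq_Rintegral do rewrite mxE mul0r.
  by rewrite Rintegral_cst// mul0r oppr0.
Qed.

(** Classical and weak gradients agree off the origin. This is the product rule applied to v times
    the constant 1, whose weak gradient is 0 by [integral_partial]; a singularity of v at the origin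
    is thus harmless. *)
Lemma is_wgrad_smooth v : (forall k, Ck_on P k v) -> is_wgrad v (grad v).
Proof.
move=> sv; apply: is_wgrad_ext (is_wgrad_mul sv (is_wgrad_cst 1)) => x _.
  by rewrite mulr1.
by rewrite scaler0 add0r scale1r.
Qed.

End wgrad.

(** * Absolutely continuous functions on the half-line *)

Section ac.
Context {R : realType}.
Notation leb := (@lebesgue_measure R).
Implicit Types (F G f g eta : R -> R).

Lemma Rint_chasles f a b c : leb.-integrable `[a, c] (EFin \o f) -> a <= b -> b <= c ->
  \int[leb]_(t in `[a, c]) f t = \int[leb]_(t in `[a, b]) f t + \int[leb]_(t in `[b, c]) f t.
Proof.
move=> intf ab bc.
have := @Rintegral_itvB R f (BLeft a) (BRight c) b intf.
rewrite !bnd_simp => /(_ ab bc).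
rewrite Rintegral_itv_obnd_cbnd => [<-|]; first by rewrite addrC subrK.
by apply: integrableS intf => //; apply: subset_itv; rewrite bnd_simp.
Qed.

(* [F] is locally absolutely continuous on ]0, +oo[ with derivative [G]. *)
Definition acp F G := locint G /\ forall a b, 0 < a -> a <= b ->
  F b - F a = \int[leb]_(t in `[a, b]) G t.

(** The primitive is based at 1, because [G] need not be integrable up to 0. *)
Definition lint G (r : R) : R :=
  if 1 <= r then \int[leb]_(t in `[1, r]) G t else - \int[leb]_(t in `[r, 1]) G t.

Lemma acp_lint G : locint G -> acp (lint G) G.
Proof.
move=> lG; split=> // a b a0 ab; rewrite /lint.
have b0 := lt_le_trans a0 ab.
case: ifPn => b1; case: ifPn => a1.
- by rewrite (@Rint_chasles G 1 a b)//; [rewrite addrC addKr|exact: lG].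
- rewrite opprK addrC (@Rint_chasles G a 1 b)//; first exact: lG.
  by rewrite leNgt; move: a1; rewrite -ltNge => /ltW; rewrite leNgt.
- by have := le_trans a1 ab; rewrite (negbTE b1).
- rewrite (@Rint_chasles G a b 1)//; first by ring.
    exact: lG.
  by move: b1; rewrite -ltNge => /ltW.
Qed.

Lemma acp_continuous F G x : acp F G -> 0 < x -> {for x, continuous F}.
Proof.
move=> [lG H] x0.
have a0 : 0 < x / 2 by rewrite divr_gt0.
have ax : x / 2 < x by rewrite ltr_pdivrMr// ltr_pMr// ltr1n.
have xb : x < x + 1 by rewrite ltrDl.
have ab : x / 2 <= x + 1 by rewrite ltW// (lt_trans ax).
have := parameterized_integral_continuous ab (lG _ (x + 1) a0).
move=> /(continuous_within_itvP _ (lt_trans ax xb))[+ _ _].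
move=> /(_ x); rewrite in_itv/= ax xb => /(_ isT) c.
have : {for x, continuous (fun y => F (x / 2) + parameterized_integral leb (x / 2) y G)}.
  by apply: cvgD; [exact: cvg_cst|exact: c].
apply: continuous_near; near=> y.
rewrite /parameterized_integral -H//; first by rewrite addrC subrK.
by apply: ltW; near: y; exact: lt_nbhsr.
Unshelve. all: by end_near. Qed.

Lemma continuous_locint F : (forall x, 0 < x -> {for x, continuous F}) -> locint F.
Proof.
move=> cF a b a0; apply: continuous_compact_integrable; first exact: segment_compact.
apply: continuous_in_subspaceT => x; rewrite inE/= in_itv/= => /andP[ax _].
exact: cF (lt_le_trans a0 ax).
Qed.

Lemma acp_locint F G : acp F G -> locint F.
Proof. by move=> h; apply: continuous_locint => x; exact: acp_continuous h. Qed.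

Lemma acp_C1 F G : (forall x : R, 0 < x -> is_derive x 1 F (G x)) ->
  (forall x, 0 < x -> {for x, continuous G}) -> acp F G.
Proof.
move=> dF cG; split; first exact: continuous_locint.
move=> a b a0; rewrite le_eqVlt => /orP[/eqP <-|ab].
  by rewrite subrr set_itv1 Rintegral_set1.
have cF x : 0 < x -> {for x, continuous F}.
  by move=> x0; apply: differentiable_continuous; apply/derivable1_diffP; have [] := dF x x0.
rewrite /Rintegral (@continuous_FTC2 _ G F)//.
- apply: continuous_in_subspaceT => x; rewrite inE/= in_itv/= => /andP[ax _].
  exact: cG (lt_le_trans a0 ax).
- split.
  + by move=> x; rewrite in_itv/= => /andP[ax _]; have [] := dF x (lt_trans a0 ax).
  + by apply: cvg_at_right_filter; exact: cF.
  + by apply: cvg_at_left_filter; exact: cF (lt_trans a0 ab).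
- move=> x; rewrite in_itv/= => /andP[ax _]; rewrite derive1E.
  by have [_ ->] := dF x (lt_trans a0 ax).
Qed.

Lemma locintM_cont f g : (forall x, 0 < x -> {for x, continuous f}) -> locint g ->
  locint (fun x => f x * g x).
Proof.
move=> cf lg a b a0.
have cfab : {within `[a, b], continuous f}.
  apply: continuous_in_subspaceT => x; rewrite inE/= in_itv/= => /andP[ax _].
  exact: cf (lt_le_trans a0 ax).
have : bounded_set (f @` `[a, b]).
  by apply: compact_bounded; apply: continuous_compact => //; exact: segment_compact.
move=> [M [_ hM]]; have intg := lg a b a0.
apply: (le_integrable _ _ _ (integrableZl _ (M + 1) intg)) => //.
  apply/measurable_EFinP; apply: measurable_funM.
    by apply: subspace_continuous_measurable_fun => //; exact: measurable_itv.
  by apply/measurable_EFinP; exact: measurable_int intg.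
move=> x xab /=; rewrite lee_fin !normrM ler_wpM2r//.
apply: le_trans (ler_norm _); apply: hM; first by rewrite ltrDl.
by exists x.
Qed.

Lemma locintD f g : locint f -> locint g -> locint (fun x => f x + g x).
Proof.
move=> lf lg a b a0.
have -> : EFin \o (fun x => f x + g x) = ((EFin \o f) \+ (EFin \o g))%E by [].
by apply: integrableD => //; [exact: lf|exact: lg].
Qed.

Lemma locintZ c f : locint f -> locint (fun x => c * f x).
Proof.
move=> lf a b a0.
have -> : EFin \o (fun x => c * f x) = (fun x => c%:E * (EFin \o f) x)%E by [].
by apply: integrableZl => //; exact: lf.
Qed.

Lemma Rintegral0_eq d (T : measurableType d) (mu : {measure set T -> \bar R}) (D : set T) (f : T -> R) :
  (forall x, D x -> f x = 0) -> \int[mu]_(x in D) f x = 0.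
Proof. by move=> f0; rewrite /Rintegral integral0_eq// => x Dx; rewrite f0. Qed.

Lemma Rintegral_fine d (T : measurableType d) (mu : {measure set T -> \bar R}) (h : T -> \bar R) :
  measurable_fun setT h -> {ae mu, forall x, h x \is a fin_num} ->
  \int[mu]_x fine (h x) = fine (\int[mu]_x h x)%E.
Proof.
move=> mh fh; rewrite /Rintegral; congr fine; apply: ae_eq_integral => //.
  by apply/measurable_EFinP; apply: measurableT_comp.
by apply: filterS fh => x hx _ /=; rewrite fineK.
Qed.

Section Rfubini.
Context d1 d2 (T1 : measurableType d1) (T2 : measurableType d2)
  (m1 : {sigma_finite_measure set T1 -> \bar R})
  (m2 : {sigma_finite_measure set T2 -> \bar R}) (f : T1 * T2 -> R).
Context (intf : (m1 \x m2)%E.-integrable setT (EFin \o f)).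

Lemma Rintegral12 : \int[m1]_x \int[m2]_y f (x, y) = fine (\int[(m1 \x m2)%E]_z (f z)%:E)%E.
Proof.
have mF := measurable_fubini_F intf.
rewrite -(integral12_prod_meas1 intf) -Rintegral_fine//.
by apply: filterS (ae_integrable1 intf) => x; exact: integrable_fin_num.
Qed.

Lemma Rintegral21 : \int[m2]_y \int[m1]_x f (x, y) = fine (\int[(m1 \x m2)%E]_z (f z)%:E)%E.
Proof.
have mG := measurable_fubini_G intf.
rewrite -(integral21_prod_meas1 intf) -Rintegral_fine//.
by apply: filterS (ae_integrable2 intf) => x; exact: integrable_fin_num.
Qed.

End Rfubini.

(** Both sides integrate g(t) k(s) over the triangle a <= t <= s <= b. *)
Lemma triangle_fubini (g k : R -> R) a b : leb.-integrable `[a, b] (EFin \o g) ->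
  leb.-integrable `[a, b] (EFin \o k) ->
  \int[leb]_(t in `[a, b]) (g t * \int[leb]_(s in `[t, b]) k s) =
  \int[leb]_(s in `[a, b]) (k s * \int[leb]_(t in `[a, s]) g t).
Proof.
move=> ig ik; set D : set R := `[a, b]%classic.
have mD : measurable D by exact: measurable_itv.
have ig' : leb.-integrable setT (EFin \o (g \_ D)).
  by rewrite -restrict_EFin -integrable_mkcond.
have ik' : leb.-integrable setT (EFin \o (k \_ D)).
  by rewrite -restrict_EFin -integrable_mkcond.
have mg' : measurable_fun setT (g \_ D) by apply/measurable_EFinP; exact: measurable_int ig'.
have mk' : measurable_fun setT (k \_ D) by apply/measurable_EFinP; exact: measurable_int ik'.
pose f (p : measurableTypeR R * measurableTypeR R) := (g \_ D) p.1 * (((p.1 : R) <= p.2)%R%:R * (k \_ D) p.2).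
have mf : measurable_fun setT (EFin \o f).
  apply/measurable_EFinP; apply: measurable_funM; first exact: (measurableT_comp mg').
  apply: measurable_funM; last exact: (measurableT_comp mk').
  have -> : (fun p : measurableTypeR R * measurableTypeR R => ((p.1 : R) <= p.2)%R%:R : R) =
      \1_((fun p : measurableTypeR R * measurableTypeR R => (p.1 : R) <= p.2) @^-1` [set true]).
    apply/funext => x; rewrite indicE; congr (nat_of_bool _)%:R.
    by apply/idP/idP; rewrite inE.
  apply: measurable_indic; rewrite -[X in measurable X]setTI.
  by apply: measurable_fun_ler => //.
have intf : (leb \x leb)%E.-integrable setT (EFin \o f).
  apply/(integrable12ltyP leb leb mf).
  have [_ fg] := integrableP _ _ _ ig'; have [_ fk] := integrableP _ _ _ ik'.
  apply: (@le_lt_trans _ _ (\int[leb]_x (`|(g \_ D) x|%:E * \int[leb]_y `|(k \_ D) y|%:E))%E).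
    apply: ge0_le_integral => //.
    - by move=> x _; exact: integral_ge0.
    - apply: (measurable_fun_fubini_tonelli_F (abse \o (EFin \o f))) => //.
      + by apply: measurableT_comp mf.
      + by move=> z; exact: abse_ge0.
    - apply: emeasurable_funM => //; apply/measurable_EFinP; exact: measurableT_comp mg'.
    move=> x _; rewrite -ge0_integralZl//; last first.
      by apply/measurable_EFinP; exact: measurableT_comp mk'.
    apply: ge0_le_integral => //.
    - by apply: measurableT_comp => //; have := measurable_fun_pair2 x mf.
    - by apply: measurable_funeM; apply/measurable_EFinP; exact: measurableT_comp mk'.
    move=> y _; rewrite /f/= -EFinM lee_fin normrM ler_wpM2l// normrM.
    by rewrite ger0_norm// ler_piMl// lern1 leq_b1.
  rewrite ge0_integralZr//; first last.
  - exact: integral_ge0.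
  - by apply/measurable_EFinP; exact: measurableT_comp mg'.
  by rewrite lte_mul_pinfty// ?integral_ge0// ge0_fin_numE// integral_ge0.
have := Rintegral12 intf; rewrite -(Rintegral21 intf) /f/= => E.
transitivity (\int[leb]_x \int[leb]_y ((g \_ D) x * (((x : R) <= y)%R%:R * (k \_ D) y))).
  rewrite [LHS]Rintegral_mkcond; apply: eq_Rintegral => t _; rewrite patchE.
  case: ifPn => tD; last first.
    by symmetry; apply: Rintegral0_eq => y _; rewrite patchE (negbTE tD) mul0r.
  move: tD; rewrite mem_setE in_itv/= => /andP[at_ tb].
  rewrite -[LHS]RintegralZl//; last first.
    by apply: integrableS ik => // s /=; rewrite !in_itv/= => /andP[/(le_trans at_) -> ->].
  rewrite [LHS]Rintegral_mkcond; apply: eq_Rintegral => s _.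
  rewrite !patchE !mem_setE !in_itv/= at_ tb/=.
  case: (leP t s) => ts/=; last by rewrite !mul0r mulr0.
  by rewrite (le_trans at_ ts)/= mul1r; case: ifP; rewrite ?mulr0.
rewrite E; symmetry.
  rewrite [LHS]Rintegral_mkcond; apply: eq_Rintegral => s _; rewrite patchE.
  case: ifPn => tD; last first.
    by symmetry; apply: Rintegral0_eq => y _; rewrite [(k \_ D) _]patchE (negbTE tD) !mulr0.
  move: tD; rewrite mem_setE in_itv/= => /andP[at_ tb].
  rewrite -[LHS]RintegralZl//; last first.
    by apply: integrableS ig => // t /=; rewrite !in_itv/= => /andP[-> /le_trans ->].
  rewrite [LHS]Rintegral_mkcond; apply: eq_Rintegral => t _.
  rewrite !patchE !mem_setE !in_itv/= at_ tb/=.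
  case: (leP t s) => ts/=; last by rewrite andbF !mul0r mulr0.
  by rewrite (le_trans ts tb) !andbT mul1r; case: ifP; rewrite ?mul0r// mulrC.
Qed.

(** The product rule for absolutely continuous functions, which need not be differentiable
    everywhere. In [triangle_fubini] the inner integrals are K(b) - K(t) and F(s) - F(a);
    rearranging gives the increment of F K. *)
Lemma acpM F G K k : acp F G -> acp K k ->
  acp (fun x => F x * K x) (fun x => F x * k x + K x * G x).
Proof.
move=> aF aK; have [lG HF] := aF; have [lk HK] := aK.
have lFk : locint (fun x => F x * k x).
  by apply: locintM_cont lk => x; exact: acp_continuous aF.
have lKG : locint (fun x => K x * G x).
  by apply: locintM_cont lG => x; exact: acp_continuous aK.
split; first exact: locintD.
move=> a b a0 ab; have b0 := lt_le_trans a0 ab.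
have iG := lG a b a0; have ik := lk a b a0.
have := triangle_fubini iG ik.
rewrite (_ : \int[leb]_(t in `[a, b]) (G t * _) = \int[leb]_(t in `[a, b]) (K b * G t - K t * G t)); last first.
  apply: eq_Rintegral => t; rewrite inE/= in_itv/= => /andP[at_ tb].
  by rewrite -HK//; [ring|exact: lt_le_trans at_].
rewrite (_ : \int[leb]_(s in `[a, b]) (k s * _) = \int[leb]_(s in `[a, b]) (F s * k s - F a * k s)); last first.
  apply: eq_Rintegral => t; rewrite inE/= in_itv/= => /andP[at_ tb].
  by rewrite -HF//; ring.
rewrite !RintegralB//; last 4 first.
- exact: lFk.
- exact: (locintZ (F a) lk).
- exact: (locintZ (K b) lG).
- exact: lKG.
rewrite !RintegralZl// RintegralD//; last 2 first.
- exact: lFk.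
- exact: lKG.
by rewrite -HF// -HK//; lra.
Qed.

Lemma acpZ c F G : acp F G -> acp (fun x => c * F x) (fun x => c * G x).
Proof.
move=> [lG H]; split; first exact: locintZ.
move=> a b a0 ab; rewrite RintegralZl//; last exact: lG.
by rewrite -H// mulrBr.
Qed.

Lemma acpD F G F' G' : acp F G -> acp F' G' -> acp (fun x => F x + F' x) (fun x => G x + G' x).
Proof.
move=> [lG H] [lG' H']; split; first exact: locintD.
move=> a b a0 ab; rewrite RintegralD//; [|exact: lG|exact: lG'].
by rewrite -H// -H'//; ring.
Qed.

Lemma test1_derive eta : test1 eta -> test1 (eta^`())%classic.
Proof.
move=> [seta [a [b [a0 hab]]]]; split; first exact: smooth_derive.
exists a, b; split=> // t tab; rewrite derive1E (near_eq_derive (g := cst 0)) ?derive_cst//.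
have oU : open (~` `[a, b]) by apply: closed_openC; exact: itv_closed.
apply: (eq_on_near oU); first by rewrite /= in_itv/=; exact/negP.
by move=> y; rewrite /= in_itv/= => /negP; exact: hab.
Qed.

Lemma acp_smooth f : smooth [set x | 0 < x] f -> acp f (f^`())%classic.
Proof.
move=> sf; apply: acp_C1 => [x x0|x x0]; last exact: (smooth_derive sf 0%N).
by apply: DeriveDef; [exact: smooth_derivable sf _|rewrite derive1E].
Qed.

Lemma acp_byparts F G E e a b : acp F G -> acp E e -> 0 < a ->
  (forall t, ~~ (a <= t <= b) -> E t = 0) -> (forall t, ~~ (a <= t <= b) -> e t = 0) ->
  \int[leb]_x (F x * e x) = - \int[leb]_x (G x * E x).
Proof.
move=> aF aE a0 hE he; have [lG _] := aF; have [le _] := aE.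
have [_ H] := acpM aF aE.
(* a/2 and [b'] lie strictly outside the support of [E], so the boundary terms vanish; the maximum
   covers the case b < a. *)
set b' := Num.max a b + 1.
have ab' : a / 2 < b'.
  by rewrite (@lt_trans _ _ a) ?ltr_pdivrMr ?ltr_pMr ?ltr1n// ltr_pwDr// le_max lexx.
have a20 : 0 < a / 2 by rewrite divr_gt0.
have := H (a / 2) b' a20 (ltW ab').
rewrite !hE ?mulr0 ?subrr; last 2 first.
- by rewrite negb_and -!ltNge ltr_pdivrMr// ltr_pMr// ltr1n.
- by rewrite negb_and -!ltNge [b < _]ltr_pwDr ?orbT// le_max lexx orbT.
have hout t : ~~ (a / 2 <= t <= b') -> ~~ (a <= t <= b).
  apply: contraNN => /andP[at_ tb]; rewrite (le_trans _ at_) ?(le_trans tb)//.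
    by rewrite ler_wpDr// le_max lexx orbT.
  by rewrite ler_pdivrMr// ler_pMr// ler1n.
have hT (h1 h2 : R -> R) : (forall t, ~~ (a / 2 <= t <= b') -> h2 t = 0) ->
    \int[leb]_(x in `[a / 2, b']) (h1 x * h2 x) = \int[leb]_x (h1 x * h2 x).
  move=> h20; rewrite Rintegral_mkcond; apply: eq_Rintegral => x _.
  by rewrite patchE mem_setE in_itv/=; case: ifPn => // /h20 ->; rewrite mulr0.
under [in RHS]eq_Rintegral do rewrite [X in _ + X]mulrC.
rewrite RintegralD//; first last.
- have := locintM_cont (fun x => @acp_continuous _ _ x aE) lG.
  by under eq_fun do rewrite mulrC; apply.
- by apply: (locintM_cont (fun x => @acp_continuous _ _ x aF) le).
rewrite (hT F e) => [|t /hout /he//]; rewrite (hT G E) => [|t /hout /hE//].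
by move/esym/eqP; rewrite addr_eq0 => /eqP.
Qed.

Lemma acp_byparts_test1 F G eta : acp F G -> test1 eta ->
  \int[leb]_x (F x * (eta^`())%classic x) = - \int[leb]_x (G x * eta x).
Proof.
move=> aF teta.
have [seta [a [b [a0 hab]]]] := teta.
have aE : acp eta (eta^`())%classic by apply: acp_smooth => k; apply: Cn_sub (seta k).
apply: (acp_byparts aF aE a0 hab) => t tab.
rewrite derive1E (near_eq_derive (g := cst 0)) ?derive_cst//.
have oU : open (~` `[a, b]) by apply: closed_openC; exact: itv_closed.
apply: (eq_on_near oU); first by rewrite /= in_itv/=; exact/negP.
by move=> y; rewrite /= in_itv/= => /negP; exact: hab.
Qed.

(** f minus a primitive of g has weak derivative 0, hence is constant by [dubois1]. This is how
    every absolutely continuous representative is produced later. *)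
Lemma weak_acp f g : locint f -> locint g ->
  (forall eta, test1 eta -> \int[leb]_x (f x * (eta^`())%classic x) = - \int[leb]_x (g x * eta x)) ->
  exists F, acp F g /\ {ae leb, forall x, 0 < x -> f x = F x}.
Proof.
move=> lf lg H.
have al := acp_lint lg; have ll := acp_locint al.
have [c hc] : exists c : R, {ae leb, forall x, 0 < x -> f x - lint g x = c}.
  apply: dubois1 => [|eta teta].
    have := locintD lf (locintZ (-1) ll).
    by under [X in locint X]eq_fun do rewrite mulN1r.
  under eq_Rintegral do rewrite mulrBl.
  have td := test1_derive teta.
  rewrite RintegralB//; [|exact: integrable_test1 lf td|exact: integrable_test1 ll td].
  by rewrite H// (acp_byparts_test1 al teta) subrr.
exists (fun x => lint g x + c); split.
  split=> // a b a0 ab; have [_ <-//] := al; ring.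
by apply: ae_leb_imp hc => x h /h <-; rewrite addrC subrK.
Qed.

Lemma itv_integrable_cst a b (c : R) : leb.-integrable `[a, b] (EFin \o (fun=> c)).
Proof.
apply: measurable_bounded_integrable => //.
- by rewrite /= lebesgue_measure_itv/=; case: ifPn => _; rewrite -?EFinB ltry.
- by exists `|c|%R; split; [exact: num_real|move=> M cM x _ /=; exact: ltW].
Qed.

(** Cauchy-Schwarz against the constant 1: the integral of (|g| - mean of |g|)^2 is nonnegative. *)
Lemma Rint_CS g a b : a < b -> leb.-integrable `[a, b] (EFin \o g) ->
  leb.-integrable `[a, b] (fun x => (g x ^+ 2)%:E) ->
  (\int[leb]_(t in `[a, b]) `|g t|) ^+ 2 <= (b - a) * \int[leb]_(t in `[a, b]) (g t ^+ 2).
Proof.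
move=> ab ig ig2.
set I := \int[leb]_(t in _) `|g t|; set E := \int[leb]_(t in _) _.
have ba0 : 0 < b - a by rewrite subr_gt0.
have ia : leb.-integrable `[a, b] (EFin \o (fun x => `|g x|)) by have /integrable_abse := ig.
have : 0 <= \int[leb]_(t in `[a, b]) (`|g t| - I / (b - a)) ^+ 2.
  by apply: Rintegral_ge0 => t _; exact: sqr_ge0.
have -> : \int[leb]_(t in `[a, b]) (`|g t| - I / (b - a)) ^+ 2 =
   \int[leb]_(t in `[a, b]) (g t ^+ 2 + (- (2 * (I / (b - a))) * `|g t| + (I / (b - a)) ^+ 2)).
  by apply: eq_Rintegral => t _; rewrite -(real_normK (num_real (g t))); ring.
have ic c : leb.-integrable `[a, b] (EFin \o (fun=> c)) by exact: itv_integrable_cst.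
have i1 c : leb.-integrable `[a, b] (EFin \o (fun x => c * `|g x|)).
  have -> : EFin \o (fun x => c * `|g x|) = (fun x => c%:E * (EFin \o (fun x => `|g x|)%R) x)%E by [].
  exact: integrableZl.
rewrite RintegralD//; last first.
  have -> : EFin \o (fun x => - (2 * (I / (b - a))) * `|g x| + (I / (b - a)) ^+ 2) =
    ((EFin \o (fun x => - (2 * (I / (b - a))) * `|g x|)%R) \+ (EFin \o (fun=> (I / (b - a)) ^+ 2)%R))%E by [].
  exact: integrableD.
rewrite RintegralD// RintegralZl// Rintegral_cst//= lebesgue_measure_itv/= lte_fin ab -EFinB/=.
rewrite -/I -/E => h.
have : 0 <= E - I ^+ 2 / (b - a).
  by apply: le_trans h _; rewrite le_eqVlt; apply/orP; left; apply/eqP; field; rewrite gt_eqF.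
by rewrite subr_ge0 ler_pdivrMr// mulrC.
Qed.

Lemma locint_measurable f : locint f -> measurable_fun (`]0, +oo[%classic : set R) f.
Proof.
move=> lf.
have -> : `]0, +oo[%classic = \bigcup_k `[k.+1%:R^-1, k.+1%:R]%classic :> set R.
  apply/seteqP; split=> x; rewrite /= in_itv/= andbT.
    by move=> /chi_neq0[m]; rewrite chi_gt0 => /andP[mt tm]; exists m => //=; rewrite in_itv/= !ltW.
  by move=> [k _ /=]; rewrite in_itv/= => /andP[+ _]; apply: lt_le_trans; rewrite invr_gt0.
apply/measurable_fun_bigcup => [k|k]; first exact: measurable_itv.
by apply/measurable_EFinP; apply: measurable_int (lf _ _ _); rewrite invr_gt0.
Qed.

(** A local Sobolev inequality on [x, 2 x]. There d(x)^2 <= 2 d(r)^2 + 2 x E2, with E2 the integral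
    of e^2, by [Rint_CS]. Averaging over r gives d(x)^2 <= (2/x + 2 x) times the integral of d^2 +
    e^2, and r >= x trades one more factor 1/x for the weight r. It provides both the continuity of
    traces and the decay at infinity. *)
Lemma acp_pointwise d e (x : R) : acp d e -> 0 < x ->
  ((d x ^+ 2)%:E <= (2 / x ^+ 2 + 2)%:E *
    \int[leb]_(r in `[x, +oo[) (r * (d r ^+ 2 + e r ^+ 2))%:E)%E.
Proof.
move=> ade x0; have [le H] := ade.
set M := (\int[leb]_(r in _) _)%E; set C := 2 / x ^+ 2 + 2.
have C0 : 0 < C by rewrite addr_gt0// divr_gt0// exprn_gt0.
have sx : (`[x, +oo[%classic : set R) `<=` `]0, +oo[.
  by move=> r /=; rewrite !in_itv/= !andbT; exact: lt_le_trans.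
have md : measurable_fun (`[x, +oo[%classic : set R) d.
  by apply: measurable_funS sx _ => //; exact: locint_measurable (acp_locint ade).
have me : measurable_fun (`[x, +oo[%classic : set R) e.
  by apply: measurable_funS sx _ => //; exact: locint_measurable le.
have mde : measurable_fun (`[x, +oo[%classic : set R) (fun r => (r * (d r ^+ 2 + e r ^+ 2))%:E).
  apply/measurable_EFinP; apply: measurable_funM => //.
  by apply: measurable_funD; exact: measurable_funX.
have sI : `[x, 2 * x]%classic `<=` (`[x, +oo[%classic : set R).
  by move=> r /=; rewrite !in_itv/= andbT => /andP[].
have hM : (x%:E * (\int[leb]_(r in `[x, (2 * x)%R]) (d r ^+ 2 + e r ^+ 2)%:E) <= M)%E.
  rewrite -ge0_integralZl//; last 3 first.
  - apply/measurable_EFinP; apply: measurable_funD; apply: measurable_funX; exact: measurable_funS sI _.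
  - by move=> r _; rewrite lee_fin addr_ge0// sqr_ge0.
  - by rewrite lee_fin ltW.
  apply: (@le_trans _ _ (\int[leb]_(r in `[x, (2 * x)%R]) (r * (d r ^+ 2 + e r ^+ 2))%:E)%E).
    apply: ge0_le_integral => //.
    - by move=> r _; rewrite -EFinM lee_fin mulr_ge0 ?addr_ge0 ?sqr_ge0// ltW.
    - apply: measurable_funeM; apply/measurable_EFinP; apply: measurable_funD; apply: measurable_funX; exact: measurable_funS sI _.
    - exact: measurable_funS sI mde.
    - move=> r /=; rewrite in_itv/= => /andP[xr _].
      by rewrite -EFinM lee_fin ler_wpM2r// addr_ge0// sqr_ge0.
  apply: ge0_subset_integral => //.
  by move=> r /sx /=; rewrite in_itv/= andbT => r0; rewrite lee_fin mulr_ge0 ?addr_ge0 ?sqr_ge0// ltW.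
have [->|Moo] := eqVneq M +oo%E; first by rewrite gt0_muley ?lte_fin// leey.
have x2x : x < 2 * x by rewrite ltr_pMl// ltr1n.
have intde : leb.-integrable `[x, 2 * x] (fun r => (d r ^+ 2 + e r ^+ 2)%:E).
  apply/integrableP; split.
    apply/measurable_EFinP; apply: measurable_funD; apply: measurable_funX; exact: measurable_funS sI _.
  under eq_integral do rewrite gee0_abs ?lee_fin ?addr_ge0 ?sqr_ge0//.
  rewrite ltey; apply: contra_neq Moo => h; apply/eqP; rewrite -leye_eq -{1}(gt0_muley (x := x%:E)) ?lte_fin//.
  by rewrite -[X in (x%:E * X)%E]h.
have intd : leb.-integrable `[x, 2 * x] (fun r => (d r ^+ 2)%:E).
  apply: le_integrable intde => //.
    apply/measurable_EFinP; apply: measurable_funX; exact: measurable_funS sI _.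
  by move=> r _; rewrite lee_fin !ger0_norm ?addr_ge0 ?sqr_ge0// lerDl sqr_ge0.
have inte : leb.-integrable `[x, 2 * x] (fun r => (e r ^+ 2)%:E).
  apply: le_integrable intde => //.
    apply/measurable_EFinP; apply: measurable_funX; exact: measurable_funS sI _.
  by move=> r _; rewrite lee_fin !ger0_norm ?addr_ge0 ?sqr_ge0// lerDr sqr_ge0.
have ie : leb.-integrable `[x, 2 * x] (EFin \o e) by exact: le.
have CS := Rint_CS x2x ie inte.
set E2 := \int[leb]_(t in _) (e t ^+ 2) in CS.
pose D2 := \int[leb]_(t in `[x, 2 * x]) (d t ^+ 2).
have pt r : x <= r <= 2 * x -> d x ^+ 2 <= 2 * d r ^+ 2 + 2 * (x * E2).
  move=> /andP[xr r2x].
  have h1 : `|d r - d x| <= \int[leb]_(t in `[x, 2 * x]) `|e t|.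
    have sr : `[x, r]%classic `<=` (`[x, 2 * x]%classic : set R).
      by apply: subset_itvl; rewrite bnd_simp.
    have ia : leb.-integrable `[x, 2 * x] (EFin \o (fun t => `|e t|)) by have /integrable_abse := ie.
    rewrite H//; apply: le_trans (le_normr_Rintegral _ _) _ => //; first exact: le.
    rewrite (Rint_chasles ia xr r2x) lerDl.
    by apply: Rintegral_ge0.
  have h2 : (d r - d x) ^+ 2 <= x * E2.
    apply: le_trans (_ : _ <= (2 * x - x) * E2) _; last by rewrite mulr_natl mulr2n addrK.
    apply: le_trans CS; rewrite -(real_normK (num_real (d r - d x))) ler_sqr ?nnegrE//.
    by apply: Rintegral_ge0.
  have : 0 <= (2 * d r - d x) ^+ 2 by exact: sqr_ge0.
  by move: h2; nra.
have ic c : leb.-integrable `[x, 2 * x] (EFin \o (fun=> c)) by exact: itv_integrable_cst.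
have Rcst (c : R) : \int[leb]_(r in `[x, 2 * x]) c = x * c.
  rewrite Rintegral_cst//= lebesgue_measure_itv/= lte_fin x2x -EFinB/=.
  by rewrite mulrC mulr_natl mulr2n addrK.
have i2d : leb.-integrable `[x, 2 * x] (EFin \o (fun r => 2 * d r ^+ 2)).
  have -> : EFin \o (fun r => 2 * d r ^+ 2) = (fun r => 2%:E * (d r ^+ 2)%:E)%E by [].
  exact: integrableZl.
have : x * d x ^+ 2 <= 2 * D2 + 2 * (x * (x * E2)).
  rewrite -Rcst [leRHS](_ : _ = \int[leb]_(r in `[x, 2 * x]) (2 * d r ^+ 2 + 2 * (x * E2))).
    apply: le_Rintegral => //.
      by apply: integrableD i2d (ic (2 * (x * E2))).
  by rewrite RintegralD// RintegralZl// Rcst mulrCA.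
have DE : (x * (D2 + E2))%:E = (x%:E * \int[leb]_(r in `[x, (2 * x)%R]) (d r ^+ 2 + e r ^+ 2)%:E)%E.
  by rewrite -RintegralD// EFinM /Rintegral fineK//; exact: integrable_fin_num.
move=> fin; rewrite -DE in hM.
apply: (@le_trans _ _ (C%:E * (x * (D2 + E2))%:E)%E); last by rewrite lee_pmul2l.
rewrite -EFinM lee_fin.
have D20 : 0 <= D2 by apply: Rintegral_ge0 => t _; exact: sqr_ge0.
have E20 : 0 <= E2 by apply: Rintegral_ge0 => t _; exact: sqr_ge0.
rewrite -(ler_pM2l x0); apply: le_trans fin _.
have -> : x * (C * (x * (D2 + E2))) = 2 * D2 + 2 * (x * (x * E2)) + 2 * E2 + 2 * (x * (x * D2)).
  by rewrite /C; field; rewrite gt_eqF.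
by rewrite -addrA lerDl addr_ge0// ?mulr_ge0// ltW.
Qed.

End ac.

(** * Directional derivatives of C^1 functions *)

Section rays.
Context {R : realType}.
Notation leb := (@lebesgue_measure R).

Lemma MVT_abs (f df : R -> R) (h : R) : (forall x : R, is_derive x 1 f (df x)) ->
  exists2 c, `|c| <= `|h| & f h - f 0 = df c * h.
Proof.
move=> fd.
have cf : continuous f.
  by move=> x; apply: differentiable_continuous; apply/derivable1_diffP; have [] := fd x.
have cw (a b : R) : {within `[a, b], continuous f} by apply: continuous_subspaceT.
have [h0|h0] := leP 0 h.
  have [c] := @MVT_segment R f df 0 h h0 (fun x _ => fd x) (cw _ _).
  by rewrite in_itv/= subr0 => /andP[c0 ch] E; exists c => //; rewrite !ger0_norm.
have [c] := @MVT_segment R f df h 0 (ltW h0) (fun x _ => fd x) (cw _ _).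
rewrite in_itv/= sub0r => /andP[hc c0] E; exists c.
  by rewrite !ler0_norm// ?lerN2// ltW.
by rewrite -[LHS]opprB E mulrN opprK.
Qed.

Lemma is_derive_lineT n (v : 'rV[R]_n -> R) (e y : 'rV[R]_n) :
  (forall x, derivable v x e) ->
  forall s : R, is_derive s 1 (fun t => v (t *: e + y)) ('D_e v (s *: e + y)).
Proof.
move=> dv s; apply/is_derive_line.
have /is_derive_line : is_derive (s *: e + y) e v ('D_e v (s *: e + y)) by exact: DeriveDef.
congr (is_derive _ _ _ _); apply/funext => t.
by rewrite [t%:A]mulr1 scalerDl addrA.
Qed.

(* Mean value theorem in the direction [e], after a step along [w]. *)
Lemma is_derive_addline n (v : 'rV[R]_n -> R) (w e x : 'rV[R]_n) d :
  (forall x, derivable v x e) -> {for x, continuous ('D_e v)} ->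
  is_derive x w v d -> forall c, is_derive x (c *: e + w) v (c * 'D_e v x + d).
Proof.
move=> de ce dw c.
have [s hs] : {s : R -> R & forall h, `|s h| <= `|h * c| /\
    v ((h * c) *: e + (h *: w + x)) - v (h *: w + x) = 'D_e v (s h *: e + (h *: w + x)) * (h * c)}.
  apply: (@boolp.choice _ _ (fun h s => `|s| <= `|h * c| /\
    v ((h * c) *: e + (h *: w + x)) - v (h *: w + x) = 'D_e v (s *: e + (h *: w + x)) * (h * c))) => h.
  have [t ht E] := MVT_abs (h * c) (is_derive_lineT (h *: w + x) de).
  by exists t; split=> //; rewrite -E scale0r add0r.
have s0 : s h @[h --> 0^'] --> (0 : R).
  have h0 : h @[h --> (0 : R)^'] --> (0 : R) by exact: nbhs_dnbhs.
  have hc0 : `|h * c| @[h --> (0 : R)^'] --> (0 : R).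
    have h1 : h * c @[h --> (0 : R)^'] --> (0 * c : R) by apply: cvgM h0 _; exact: cvg_cst.
    by apply/norm_cvg0P; move: h1; rewrite mul0r.
  apply: (@squeeze_cvgr _ _ _ _ (fun h => - `|h * c|) (fun h => `|h * c|)).
  - by near=> h; have [+ _] := hs h; rewrite ler_norml.
  - have h2 : - `|h * c| @[h --> (0 : R)^'] --> (- 0 : R) by exact: (cvgN hc0).
    by move: h2; rewrite oppr0.
  - exact: hc0.
have cv : h^-1 *: ((v \o shift x) (h *: (c *: e + w)) - v x) @[h --> 0^'] --> c * 'D_e v x + d.
  have E : {near (0 : R)^', (fun h => c * 'D_e v (s h *: e + (h *: w + x)) + h^-1 *: ((v \o shift x) (h *: w) - v x)) =1
      (fun h => h^-1 *: ((v \o shift x) (h *: (c *: e + w)) - v x))}.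
    near=> h; have [_ hh] := hs h.
    have hn0 : h != 0 by near: h; exact: nbhs_dnbhs_neq.
    have -> : (v \o shift x) (h *: (c *: e + w)) = v (h *: w + x) + 'D_e v (s h *: e + (h *: w + x)) * (h * c).
      by rewrite -hh [RHS]addrC subrK /= scalerDr scalerA addrA.
    rewrite /=; move: ('D_e v _) (v (h *: w + x)) => D V.
    by rewrite /GRing.scale/=; field.
  apply: cvg_trans (near_eq_cvg E) _; apply: cvgD; last first.
    by have [dv <-] := dw; exact: dv.
  apply: cvgMr; apply: (continuous_cvg _ ce).
  have L : s h *: e + (h *: w + x) @[h --> 0^'] --> 0 *: e + (0 *: w + x).
    apply: cvgD; first exact: cvgZl s0.
    by apply: cvgD; [apply: cvgZl; exact: nbhs_dnbhs|exact: cvg_cst].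
  by move: L; rewrite !scale0r !add0r.
by apply: DeriveDef; [apply/cvg_ex; exists (c * 'D_e v x + d)|exact: cvg_lim cv].
Unshelve. all: by end_near. Qed.

(** Continuous partial derivatives give a derivative in every direction: the direction is assembled
    one coordinate at a time with [is_derive_addline]. *)
Lemma is_derive_grad n (v : 'rV[R]_n -> R) (x w : 'rV[R]_n) : Ck 1 v ->
  is_derive x w v (\sum_i w ord0 i * partial i v x).
Proof.
move=> [_ cv].
have H (r : seq 'I_n) : is_derive x (\sum_(i <- r) w ord0 i *: delta_mx ord0 i) v
    (\sum_(i <- r) w ord0 i * partial i v x).
  elim: r => [|i r IH]; first by rewrite !big_nil; apply/is_derive_line;
    under [X in is_derive _ _ X]eq_fun do rewrite scaler0 add0r; exact: is_derive_cst.
  rewrite !big_cons; apply: is_derive_addline => //.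
    by have [+ _] := cv i.
  by have [_ ci] := cv i; exact: (ci x).
by have := H (index_enum 'I_n); rewrite -row_sum_delta.
Qed.
End rays.

(** * Polar coordinates *)

Section polar_signed.
Context {R : realType} (n : nat).
Notation leb := (@lebesgue_measure R).
Notation mu := (@lebesgue_rV R n).
Context (n0 : (0 < n)%N).

(* The surface measure of the unit sphere is [n] times the image of Lebesgue measure
   on [ball01] under [y |-> y / |y|]; this [n] is part of the radial weight [polw]. *)
Definition ball01 : set 'rV[R]_n := [set y | 0 < enorm y < 1].
Definition ray (r : R) (y : 'rV[R]_n) : 'rV[R]_n := (r / enorm y) *: y.
Definition polw (r : R) : R := n%:R * r ^+ n.-1.
(** The integrand of polar coordinates, extended by zero to the full product space so that Fubini
    can be used without domains. *)
Definition polK (F : 'rV[R]_n -> R) (p : measurableTypeR R * 'rV[R]_n) : R :=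
  if ((0 : R) < p.1) && (0 < enorm p.2 < 1) then polw p.1 * F (ray p.1 p.2) else 0.

Lemma enorm_ray r y : 0 <= r -> 0 < enorm y -> enorm (ray r y) = r.
Proof. by move=> r0 y0; rewrite /ray enormZ ger0_norm ?divr_ge0// ?enorm_ge0// divfK// gt_eqF. Qed.

Lemma polw_ge0 r : 0 <= r -> 0 <= polw r.
Proof. by move=> r0; rewrite mulr_ge0// exprn_ge0. Qed.

Lemma polw_gt0 r : 0 < r -> 0 < polw r.
Proof. by move=> r0; rewrite mulr_gt0 ?ltr0n// exprn_gt0. Qed.

Lemma measurable_ball01 : measurable ball01.
Proof.
have -> : ball01 = (@enorm R n) @^-1` `]0, 1[%classic.
  by apply/seteqP; split=> y /=; rewrite in_itv.
by rewrite -[X in measurable X]setTI; exact: (@measurable_enorm R n).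
Qed.

Lemma measurable_ray : measurable_fun setT (fun p : measurableTypeR R * 'rV[R]_n => ray p.1 p.2).
Proof.
apply: measurable_scale_rV => //.
apply: measurable_funM => //; apply: (measurableT_comp measurable_inv).
exact: (measurableT_comp (@measurable_enorm R n) measurable_snd).
Qed.

Lemma measurable_rayl y : measurable_fun setT (fun r : measurableTypeR R => ray r y).
Proof. exact: measurableT_comp measurable_ray (measurable_pair2 y). Qed.

Lemma measurable_rayr r : measurable_fun setT (ray r).
Proof. exact: measurableT_comp measurable_ray (measurable_pair1 r). Qed.

Lemma measurable_polw : measurable_fun setT polw.
Proof. by apply: measurable_funM => //; exact: measurable_funX. Qed.

Lemma measurable_polK F : measurable_fun setT F -> measurable_fun setT (polK F).
Proof.
move=> mF.
have me : measurable_fun setT (fun p : measurableTypeR R * 'rV[R]_n => enorm p.2).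
  exact: (measurableT_comp (@measurable_enorm R n) measurable_snd).
apply: measurable_fun_ifT => //.
  by apply: measurable_and; last apply: measurable_and; apply: measurable_fun_ltr.
apply: measurable_funM; first exact: measurableT_comp measurable_polw measurable_fst.
exact: measurableT_comp mF measurable_ray.
Qed.

Lemma polK_ge0 F p : (forall x, 0 <= F x) -> 0 <= polK F p.
Proof. by move=> F0; rewrite /polK; case: ifPn => // /andP[p0 _]; rewrite mulr_ge0// polw_ge0// ltW. Qed.

Lemma polar_prod (F : 'rV[R]_n -> R) : measurable_fun setT F -> (forall x, 0 <= F x) ->
  (\int[(leb \x mu)%E]_p (polK F p)%:E = \int[mu]_x (F x)%:E)%E.
Proof.
move=> mF F0.
have mK := measurable_polK mF.
have K0 p : (0 <= (EFin \o polK F) p)%E by rewrite lee_fin polK_ge0.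
rewrite (@fubini_tonelli2 _ _ _ _ _ _ _ (EFin \o polK F))//; last exact/measurable_EFinP.
have mE : measurable_fun setT (EFin \o F) by exact/measurable_EFinP.
have E0 x : (0 <= (EFin \o F) x)%E by rewrite lee_fin.
rewrite [RHS](polar n0 mE E0).
rewrite [RHS]integral_mkcond; apply: eq_integral => y _; rewrite /fubini_G patchE.
case: ifPn => yO.
  rewrite [RHS]integral_mkcond; apply: eq_integral => r _; rewrite patchE mem_setE in_itv/= andbT.
  move: yO; rewrite inE /= => yO; rewrite /polK/= yO andbT; case: ifPn => // r0.
rewrite integral0_eq// => r _; rewrite /polK/=; case: ifPn => // /andP[_ yO'].
by move: yO; rewrite notin_setE.
Qed.

Lemma polK_abs F p : `|polK F p| = polK (fun x => `|F x|) p.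
Proof.
rewrite /polK; case: ifPn => [/andP[p0 _]|]; last by rewrite normr0.
by rewrite normrM ger0_norm// polw_ge0// ltW.
Qed.

Lemma polar_integrable F : mu.-integrable setT (EFin \o F) ->
  (leb \x mu)%E.-integrable setT (EFin \o polK F).
Proof.
move=> /integrableP[/measurable_EFinP mF iF]; apply/integrableP; split.
  by apply/measurable_EFinP; exact: measurable_polK.
apply: le_lt_trans iF; rewrite -polar_prod//; last exact: measurableT_comp.
by under eq_integral do rewrite /= polK_abs.
Qed.

Lemma polar_int (F : 'rV[R]_n -> R) : mu.-integrable setT (EFin \o F) ->
  fine (\int[(leb \x mu)%E]_p (polK F p)%:E) = \int[mu]_x F x.
Proof.
move=> iF; have /integrableP[/measurable_EFinP mF _] := iF.
rewrite /Rintegral; congr fine; rewrite [LHS]integralE [RHS]integralE; congr (_ - _)%E.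
- under eq_integral => p _.
    rewrite (_ : _ p = (polK (fun x => Num.max (F x) 0) p)%:E)%E; last first.
      rewrite funeposE /polK; case: ifPn => [/andP[p0 _]|_]; last by rewrite maxxx.
      by rewrite -EFin_max maxr_pMr ?mulr0// polw_ge0// ltW.
    over.
  rewrite polar_prod//; last first.
  + by move=> x; rewrite le_max lexx orbT.
  + exact: measurable_maxr.
  by apply: eq_integral => x _; rewrite funeposE EFin_max.
- under eq_integral => p _.
    rewrite (_ : _ p = (polK (fun x => Num.max (- F x) 0) p)%:E)%E; last first.
      rewrite funenegE /polK; case: ifPn => [/andP[p0 _]|_]; last by rewrite oppe0 maxxx.
      by rewrite -EFin_max -mulrN maxr_pMr ?mulr0// polw_ge0// ltW.
    over.
  rewrite polar_prod//; last first.
  + by move=> x; rewrite le_max lexx orbT.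
  + by apply: measurable_maxr => //; exact: measurableT_comp.
  by apply: eq_integral => x _; rewrite funenegE EFin_max.
Qed.

Lemma polar_yr F : mu.-integrable setT (EFin \o F) ->
  \int[mu]_x F x = \int[mu]_y \int[leb]_r polK F (r, y).
Proof. by move=> iF; rewrite -polar_int// -Rintegral21//; exact: polar_integrable. Qed.

Lemma ball01_fin : (mu ball01 < +oo)%E.
Proof.
apply: (@le_lt_trans _ _ (mu [set x : 'rV[R]_n | (0 <= enorm x <= 1)%R])%E).
  apply: le_measure; rewrite ?inE; [exact: measurable_ball01|exact: compact_measurable_rV (@compact_annulus _ _ _ _)|].
  by move=> y /= /andP[/ltW -> /ltW ->].
exact: compact_lebesgue_fin (@compact_annulus _ _ _ _).
Qed.

Definition ball01_mass : R := fine (mu ball01).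

Lemma ball01_massE : mu ball01 = ball01_mass%:E.
Proof. by rewrite fineK// ge0_fin_numE// ball01_fin. Qed.

Lemma polar_radial (H : R -> \bar R) : measurable_fun setT H -> (forall r, 0 <= H r)%E ->
  (\int[mu]_x H (enorm x) = ball01_mass%:E * \int[leb]_(r in `]0%R, +oo[) ((polw r)%:E * H r))%E.
Proof.
move=> mH H0; have mHe : measurable_fun setT (H \o @enorm R n) by exact: measurableT_comp mH (@measurable_enorm R n).
rewrite (@polar R n (H \o @enorm R n) n0 mHe (fun x => H0 _)).
transitivity (\int[mu]_(y in ball01) \int[leb]_(r in `]0%R, +oo[) ((polw r)%:E * H r))%E.
  apply: eq_integral => y; rewrite inE/= => /andP[y0 y1].
  apply: eq_integral => r; rewrite inE/= in_itv/= andbT => r0.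
  by rewrite -/(ray r y) enorm_ray// ltW.
by rewrite (integral_cst _ measurable_ball01) muleC; congr (_ * _)%E; exact: ball01_massE.
Qed.

Lemma ge0_integral0_ae d (T : measurableType d) (nu : {measure set T -> \bar R}) (f : T -> \bar R) :
  measurable_fun setT f -> (forall x, 0 <= f x)%E -> (\int[nu]_x f x = 0)%E ->
  {ae nu, forall x, f x = 0%E}.
Proof.
move=> mf f0 h.
have /(ae_eq_integral_abs nu measurableT mf) : (\int[nu]_x `|f x| = 0)%E.
  by rewrite -h; apply: eq_integral => x _; rewrite gee0_abs.
by apply: filterS => x /(_ I).
Qed.

(** The points whose radius lies in a null set form a null set: [polar_radial] is applied to the
    indicator of that set of radii. *)
Lemma ae_radial (Q : R -> Prop) : {ae leb, forall r, 0 < r -> Q r} ->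
  {ae mu, forall x : 'rV[R]_n, Q (enorm x)}.
Proof.
move=> [Z [mZ Z0 sZ]].
have mZ' : measurable (@enorm R n @^-1` Z).
  by rewrite -[X in measurable X]setTI; exact: (@measurable_enorm R n).
have h0 : (\int[mu]_x (\1_(@enorm R n @^-1` Z) x)%:E = 0)%E.
  have := @polar_radial (fun r => (\1_Z r)%:E).
  rewrite /= => -> //; last first.
    by apply/measurable_EFinP; exact: measurable_indic.
  rewrite (_ : \int[_]_(r in _) _ = 0)%E ?mule0//.
  rewrite -[RHS](integral0 leb (`]0, +oo[%classic : set R)); apply: ge0_ae_eq_integral => //.
  - apply: emeasurable_funM; apply/measurable_EFinP; first exact: measurable_funTS measurable_polw.
    exact: measurable_indic.
  - by move=> r /=; rewrite in_itv/= andbT => r0; rewrite -EFinM lee_fin mulr_ge0// polw_ge0// ltW.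
  exists Z; split=> // r /= h; apply: contrapT => rZ; apply: h => _.
  by rewrite indicE memNset// mule0.
have N1 : mu.-negligible (@enorm R n @^-1` Z).
  by exists (@enorm R n @^-1` Z); split=> //; move: h0; rewrite integral_indic// setIT; exact.
have N0 : mu.-negligible [set 0].
  exists [set 0]; split=> //; first exact: compact_measurable_rV (@compact_set1 _ _).
  exact: lebesgue_rV0.
apply: negligibleS (negligibleU N0 N1).
move=> x /= nQ; have [->|x0] := eqVneq x 0; first by left.
by right; apply: sZ => /= h; apply: nQ; apply: h; rewrite enorm_gt0.
Qed.

(** The disintegration of a null set: almost every sphere meets it in a null set of directions. *)
Lemma ae_ray (P : 'rV[R]_n -> Prop) : {ae mu, forall x, P x} ->
  {ae leb, forall r, 0 < r -> {ae mu, forall y, ball01 y -> P (ray r y)}}.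
Proof.
move=> [Z [mZ Z0 sZ]].
have m1 : measurable_fun setT (\1_Z : 'rV[R]_n -> R) by exact: measurable_indic.
have K0 p : (0 <= (EFin \o polK (\1_Z)) p)%E by rewrite lee_fin polK_ge0.
have := polar_prod m1 (fun x => ler0n _ (x \in Z)).
have -> : (\int[mu]_x (\1_Z x)%:E = 0)%E by rewrite integral_indic// setIT; exact: Z0.
rewrite (@fubini_tonelli1 _ _ _ _ _ _ _ (EFin \o polK (\1_Z)))//; last first.
  by apply/measurable_EFinP; exact: measurable_polK.
have mK : measurable_fun setT (EFin \o polK (\1_Z)) by apply/measurable_EFinP; exact: measurable_polK.
move=> /ge0_integral0_ae h.
have {h} := h (measurable_fun_fubini_tonelli_F _ mK K0) (fun x => integral_ge0 _ (fun y _ => K0 (x, y))).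
apply: ae_leb_imp => r + r0.
move=> /ge0_integral0_ae h; have {h} := h (measurable_fun_pair2 r mK) (fun y => K0 (r, y)).
apply: filterS => y; rewrite /polK/= r0/= => + y01.
have -> : 0 < enorm y < 1 by exact: y01.
move=> /eqP; rewrite eqe mulf_eq0 gt_eqF ?polw_gt0//= indicE pnatr_eq0 eqb0 => /negP nZ.
by apply: contrapT => nP; apply: nZ; rewrite inE; exact: sZ.
Qed.

(** The average of f over the sphere of radius r, multiplied by [ball01_mass]. *)
Definition smean (f : 'rV[R]_n -> R) (r : R) : R := \int[mu]_(y in ball01) f (ray r y).

Lemma measurable_smean f : measurable_fun setT f -> measurable_fun setT (smean f).
Proof.
move=> mf; apply: measurableT_comp => //.
pose K (p : measurableTypeR R * 'rV[R]_n) := ((f (ray p.1 p.2))%:E * (\1_ball01 p.2)%:E)%E.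
have mK : measurable_fun setT K.
  apply: emeasurable_funM; apply/measurable_EFinP; first exact: measurableT_comp mf measurable_ray.
  by apply: measurableT_comp measurable_snd; exact: measurable_indic measurable_ball01.
have -> : (fun r => \int[mu]_(y in ball01) (f (ray r y))%:E)%E =
    (fun r => \int[mu]_y K^\+ (r, y) - \int[mu]_y K^\- (r, y))%E.
  apply/funext => r; rewrite integral_mkcond.
  have -> : ((fun y => (f (ray r y))%:E) \_ ball01)%E = (fun y => K (r, y)).
    by apply/funext => y; rewrite /K/= patchE indicE; case: (y \in ball01); rewrite ?mule1 ?mule0.
  by rewrite [LHS]integralE; congr (_ - _)%E; apply: eq_integral => y _; rewrite ?funeposE ?funenegE.
apply: emeasurable_funB.
- by apply: measurable_fun_fubini_tonelli_F => //; exact: measurable_funepos.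
- by apply: measurable_fun_fubini_tonelli_F => //; exact: measurable_funeneg.
Qed.

Lemma smean_weight (f : 'rV[R]_n -> R) (k : R -> R) : measurable_fun setT f -> measurable_fun setT k ->
  mu.-integrable setT (fun x => (f x * k (enorm x))%:E) ->
  leb.-integrable `]0, +oo[ (fun r => (polw r * k r * smean f r)%:E) /\
  \int[mu]_x (f x * k (enorm x)) = \int[leb]_(r in `]0, +oo[) (polw r * k r * smean f r).
Proof.
move=> mf mk iF; have iK := polar_integrable iF.
have ae1 : {ae leb, forall r, True -> (fubini_F mu (EFin \o polK (fun x => (f x * k (enorm x))%R)) r =
    ((fun r => (polw r * k r * smean f r)%:E) \_ `]0%R, +oo[) r)%E}.
  apply: filterS (ae_integrable1 iK) => r ir _; rewrite /fubini_F patchE mem_setE in_itv/= andbT.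
  case: ifPn => r0; last by rewrite integral0_eq// => y _; rewrite /polK/= (negbTE r0).
  have E y : polK (fun x => f x * k (enorm x)) (r, y) = ((fun y => polw r * k r * f (ray r y)) \_ ball01) y.
    rewrite /polK/= r0 patchE; case: ifPn => yO.
      rewrite mem_set//; rewrite enorm_ray//; first by ring.
        exact: ltW.
      by have /and3P[] := yO.
    by rewrite memNset//; exact/negP.
  (* Where the weight vanishes, integrability of f on the sphere cannot be recovered from the slice,
     but then both sides are 0. *)
  have [z|nz] := eqVneq (polw r * k r) 0.
    rewrite z mul0r integral0_eq// => y _; rewrite /= E patchE z; case: ifP => //.
    by rewrite mul0r.
  have ir' : mu.-integrable ball01 (fun y => (polw r * k r * f (ray r y))%:E).
    apply/integrable_mkcond; first exact: measurable_ball01.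
    move: ir; congr (is_true (mu.-integrable _ _)); apply/funext => y.
    by rewrite /= E !patchE; case: ifP.
  have ir2 : mu.-integrable ball01 (fun y => (f (ray r y))%:E).
    have := integrableZl measurable_ball01 (polw r * k r)^-1 ir'.
    congr (is_true (mu.-integrable _ _)); apply/funext => y.
    by rewrite -EFinM mulKf.
  transitivity (\int[mu]_(y in ball01) ((polw r * k r)%:E * (f (ray r y))%:E))%E.
    rewrite [RHS]integral_mkcond; apply: eq_integral => y _; rewrite /= E !patchE.
    by case: ifP => //; rewrite EFinM.
  rewrite integralZl//; last exact: measurable_ball01.
  rewrite /smean /Rintegral [RHS]EFinM fineK//.
  by apply: integrable_fin_num ir2; exact: measurable_ball01.
have msm : measurable_fun setT (fun r => polw r * k r * smean f r).
  apply: measurable_funM; last exact: measurable_smean.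
  by apply: measurable_funM => //; exact: measurable_polw.
have mR : measurable_fun setT ((fun r => (polw r * k r * smean f r)%:E) \_ `]0%R, +oo[).
  apply/(measurable_restrictT _ (measurable_itv _)); apply: measurable_funTS.
  exact/measurable_EFinP.
have iR : leb.-integrable setT ((fun r => (polw r * k r * smean f r)%:E) \_ `]0%R, +oo[).
  have /integrableP[mF iF'] := integrable_fubini_F iK.
  apply/integrableP; split=> //; apply: le_lt_trans iF'; rewrite le_eqVlt; apply/orP; left; apply/eqP.
  apply: ge0_ae_eq_integral => //.
  - exact: measurableT_comp.
  - exact: measurableT_comp.
  - by apply: filterS ae1 => r h _; rewrite -h.
split; first by apply/integrable_mkcond.
rewrite -polar_int// -(integral12_prod_meas1 iK) /Rintegral [in RHS]integral_mkcond.
have mFF := measurable_fubini_F iK.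
by congr fine; apply: ae_eq_integral.
Qed.

Lemma locally_integrable_measurable (f : 'rV[R]_n -> R) : Defs.locally_integrable punctured f -> measurable_fun setT f.
Proof.
move=> lf.
have m0 : measurable [set (0 : 'rV[R]_n)] by exact: compact_measurable_rV (@compact_set1 _ _).
have mA (k : nat) : measurable [set x : 'rV[R]_n | k.+1%:R^-1 <= enorm x <= k.+1%:R].
  exact: compact_measurable_rV (@compact_annulus _ _ _ _).
have -> : [set: 'rV[R]_n] = [set 0] `|` \bigcup_k [set x | k.+1%:R^-1 <= enorm x <= k.+1%:R].
  apply/seteqP; split=> // x _; have [->|x0] := eqVneq x 0; [by left|right].
  rewrite -enorm_gt0 in x0; have [m] := chi_neq0 x0.
  by rewrite chi_gt0 => /andP[mt tm]; exists m => //=; rewrite !ltW.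
apply/measurable_funU => //; first exact: bigcupT_measurable.
split.
  apply: (eq_measurable_fun (cst (f 0))); last exact: measurable_cst.
  by move=> x; rewrite inE => ->.
apply/measurable_fun_bigcup => // k.
apply/measurable_EFinP; apply: measurable_int (lf _ _ _); first exact: compact_annulus.
by move=> x /= /andP[+ _] x0; rewrite x0 enorm0 leNgt invr_gt0 ltr0n.
Qed.

Lemma locint_ext (f g : R -> R) : (forall r, 0 < r -> f r = g r) -> locint f -> locint g.
Proof.
move=> fg lf a b a0; apply: eq_integrable (lf a b a0) => //.
by move=> x; rewrite inE/= in_itv/= => /andP[ax _]; rewrite fg// (lt_le_trans a0).
Qed.

Lemma locint_smean f : Defs.locally_integrable punctured f -> locint (smean f).
Proof.
move=> lf; have mf := locally_integrable_measurable lf.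
have cw (r : R) : 0 < r -> {for r, continuous (fun r => (polw r)^-1)}.
  move=> r0; apply: continuousV; first by rewrite gt_eqF// polw_gt0.
  by apply: continuousM; [exact: cst_continuous|exact: exprn_continuous].
apply: (@locint_ext (fun r => (polw r)^-1 * (polw r * smean f r))).
  by move=> r r0; rewrite mulKf// gt_eqF// polw_gt0.
apply: locintM_cont cw _ => a b a0.
pose k := \1_(`[a, b]%classic : set R) : R -> R.
have mk : measurable_fun setT k by exact: measurable_indic.
have iK : mu.-integrable setT (fun x => (f x * k (enorm x))%:E).
  apply: (@integrable_restrictM _ _ _ _ [set x | a <= enorm x <= b] f (k \o enorm) 1).
  - exact: compact_measurable_rV (@compact_annulus _ _ _ _).
  - apply: lf; first exact: compact_annulus.
    by move=> x /= /andP[+ _] x0; rewrite x0 enorm0 leNgt a0.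
  - by apply: measurable_funTS; apply: measurableT_comp mk (@measurable_enorm R n).
  - by move=> x; rewrite /k/= indicE ger0_norm// lern1 leq_b1.
  - by move=> x nx; rewrite /k/= indicE memNset//= in_itv.
have [ik _] := smean_weight mf mk iK.
have sab : `[a, b]%classic `<=` (`]0, +oo[%classic : set R).
  by move=> x /=; rewrite !in_itv/= andbT => /andP[ax _]; exact: lt_le_trans ax.
have ik' : leb.-integrable `[a, b] (fun r => (polw r * k r * smean f r)%:E) by apply: integrableS ik.
apply: eq_integrable ik' => //.
by move=> x; rewrite inE => xab; rewrite /k indicE mem_set// mulr1.
Qed.

End polar_signed.

(** * Radial weakly differentiable functions *)

Section radial_structure.
Context {R : realType} (n : nat).
Notation leb := (@lebesgue_measure R).
Notation mu := (@lebesgue_rV R n).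
Notation P := (@punctured R n).
Context (n0 : (0 < n)%N).

Lemma ae_leb_imp2 (P1 P2 Q : R -> Prop) : (forall x, P1 x -> P2 x -> Q x) ->
  {ae leb, forall x, P1 x} -> {ae leb, forall x, P2 x} -> {ae leb, forall x, Q x}.
Proof.
move=> PQ h1 h2; apply: negligibleS (negligibleU h1 h2) => x /= nQ.
by apply: contrapT => /not_orP[/contrapT p1 /contrapT p2]; exact/nQ/PQ.
Qed.

Lemma exprnS1 (r : R) : r ^+ n = r ^+ n.-1 * r.
Proof. by rewrite -exprSr prednK. Qed.

Lemma acp_ext (F F' G G' : R -> R) : (forall x, 0 < x -> F x = F' x) -> (forall x, 0 < x -> G x = G' x) ->
  acp F G -> acp F' G'.
Proof.
move=> FF GG [lG H]; split; first exact: locint_ext GG lG.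
move=> a b a0 ab; rewrite -!FF ?H//; last exact: lt_le_trans ab.
by apply: eq_Rintegral => x; rewrite inE/= in_itv/= => /andP[ax _]; rewrite GG// (lt_le_trans a0).
Qed.

(* [dotx (grad v) x] is [|x|] times the radial derivative of [v]. *)
Definition dotx (g : 'rV[R]_n -> 'rV[R]_n) (x : 'rV[R]_n) : R := \sum_i x ord0 i * g x ord0 i.

Lemma is_derive_ray (v : 'rV[R]_n -> R) y (r : R) : Ck 1 v -> 0 < enorm y -> 0 < r ->
  is_derive r 1 (fun r => v (ray r y)) (dotx (grad v) (ray r y) / r).
Proof.
move=> cv y0 r0; apply/is_derive_line.
have /is_derive_line := is_derive_grad (ray r y) ((enorm y)^-1 *: y) cv.
have -> : (fun t : R => v (t *: ((enorm y)^-1 *: y) + ray r y)) = (fun t => v (ray (t *: 1 + r) y)).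
  by apply/funext => t; rewrite /ray scalerA -scalerDl [t%:A]mulr1 mulrDl.
congr (is_derive _ _ _ _); rewrite /dotx mulr_suml; apply: eq_bigr => i _.
by rewrite !mxE; field; rewrite !gt_eqF.
Qed.

Lemma continuous_ray (y : 'rV[R]_n) : continuous (fun r : R => ray r y).
Proof.
move=> r; rewrite /ray.
have := @cvgZl _ _ R (nbhs r) _ (fun r => r / enorm y) (r / enorm y) y.
by apply; apply: cvgM; [exact: cvg_id|exact: cvg_cst].
Qed.

Lemma acp_ray v y : Ck 1 v -> 0 < enorm y ->
  acp (fun r => v (ray r y)) (fun r => dotx (grad v) (ray r y) / r).
Proof.
move=> cv y0; apply: acp_C1 => [r r0|r r0]; first exact: is_derive_ray.
have [_ cp] := cv.
apply: continuousM; last by apply: continuousV; [rewrite gt_eqF|exact: cvg_id].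
rewrite /dotx; apply: continuous_bigsum => i x.
apply: continuousM.
  by apply: (@continuous_comp _ _ _ (fun r => ray r y) (fun x : 'rV[R]_n => x ord0 i) x (@continuous_ray y x)); exact: coord_continuous.
have -> : (fun r => grad v (ray r y) ord0 i) = (fun r => partial i v (ray r y)).
  by apply/funext => t; rewrite mxE.
by apply: (@continuous_comp _ _ _ (fun r => ray r y) (partial i v) x (@continuous_ray y x)); have [_ c] := cp i; exact: c.
Qed.

Lemma Rint_sum d (T : measurableType d) (nu : {measure set T -> \bar R}) (I : Type) (r : seq I) (F : I -> T -> R) :
  (forall i, nu.-integrable setT (EFin \o F i)) ->
  nu.-integrable setT (EFin \o (fun x => \sum_(i <- r) F i x)) /\
  \int[nu]_x (\sum_(i <- r) F i x) = \sum_(i <- r) \int[nu]_x F i x.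
Proof.
move=> iF; elim: r => [|i r [ir E]].
  have -> : (fun x => \sum_(i <- [::]) F i x) = cst 0 by apply/funext => x; rewrite big_nil.
  by rewrite big_nil Rintegral_cst// mul0r; split=> //; exact: integrable0.
have -> : (fun x => \sum_(j <- i :: r) F j x) = (fun x => F i x + \sum_(j <- r) F j x).
  by apply/funext => x; rewrite big_cons.
split; first by apply: integrableD (iF i) ir.
by rewrite big_cons RintegralD// E.
Qed.

Lemma test_fun_Ck O (phi : 'rV[R]_n -> R) k : test_fun O phi -> Ck k phi.
Proof. by case. Qed.

(* The weak gradient tested against the vector field [phi(x) x]. *)
Lemma wgrad_euler f g phi : is_wgrad f g -> test_fun P phi ->
  \int[mu]_x (f x * (n%:R * phi x + dotx (grad phi) x)) = - \int[mu]_x (dotx g x * phi x).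
Proof.
move=> [lf lg H] tphi.
have tc i : test_fun P (fun x => x ord0 i * phi x).
  by apply: test_funM (@open_punctured R n) tphi _ => k; exact: Ck_on_coord.
have ig i : mu.-integrable setT (EFin \o (fun x => g x ord0 i * (x ord0 i * phi x))).
  exact: integrable_test (lg i) (tc i).
have jf i : mu.-integrable setT (EFin \o (fun x => f x * partial i (fun x => x ord0 i * phi x) x)).
  exact: integrable_test lf (test_fun_partial i (tc i)).
have [_ Eg] := Rint_sum (index_enum 'I_n) ig.
have [_ Ef] := Rint_sum (index_enum 'I_n) jf.
transitivity (\int[mu]_x \sum_i (f x * partial i (fun x => x ord0 i * phi x) x)).
  apply: eq_Rintegral => x _; rewrite -mulr_sumr; congr (_ * _).
  under [RHS]eq_bigr => i _.
    rewrite (partialM (a := fun x => x ord0 i)); last 2 first.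
    - by have [] := is_derive_coord x (delta_mx ord0 i) i.
    - exact: test_derivable tphi.
    rewrite [partial i (fun x => x ord0 i) x](_ : _ = 1); last first.
      by rewrite /partial; have [_ ->] := is_derive_coord x (delta_mx ord0 i) i; rewrite mxE !eqxx.
    rewrite mulr1 addrC; over.
  rewrite big_split/= sumr_const card_ord mulr_natl; congr (_ + _).
  by apply: eq_bigr => i _; rewrite mxE.
rewrite Ef; under eq_bigr do rewrite H//.
rewrite sumrN -Eg; congr (- _); apply: eq_Rintegral => x _; rewrite /dotx mulr_suml.
by apply: eq_bigr => i _; ring.
Qed.

Lemma dotx_radial (psi : R -> R) x : smooth setT psi -> x != 0 ->
  dotx (grad (fun x => psi (enorm x))) x = enorm x * (psi^`())%classic (enorm x).
Proof.
move=> spsi x0; rewrite /dotx.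
have e0 : 0 < enorm x by rewrite enorm_gt0.
transitivity (\sum_i (x ord0 i ^+ 2 * ((psi^`())%classic (enorm x) / enorm x))).
  apply: eq_bigr => i _; rewrite mxE /partial.
  have dpsi : is_derive (enorm x) 1 psi ((psi^`())%classic (enorm x)).
    by apply: DeriveDef; [exact: smooth_derivable spsi _|rewrite derive1E].
  have [_ ->] := is_derive_comp1 (partial_enorm i x0) dpsi.
  by field; rewrite gt_eqF.
by rewrite -mulr_suml -sqr_enorm; field; rewrite gt_eqF.
Qed.

Lemma locally_integrable_dotx (g : 'rV[R]_n -> 'rV[R]_n) : (forall i, Defs.locally_integrable P (fun x => g x ord0 i)) ->
  Defs.locally_integrable P (dotx g).
Proof.
move=> lg; rewrite /dotx; elim: (index_enum _) => [|i r IH].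
  under [X in Defs.locally_integrable _ X]eq_fun do rewrite big_nil.
  exact: locally_integrable_cst.
under [X in Defs.locally_integrable _ X]eq_fun do rewrite big_cons.
apply: locally_integrableD IH; apply: locally_integrableM (lg i); first exact: open_punctured.
by move=> x _; exact: coord_continuous.
Qed.

Lemma lebesgue_rV_setT k : (0 < @lebesgue_rV R k setT)%E.
Proof.
elim: k => [|k IH]; first by rewrite /= diracT lte01.
have -> : lebesgue_rV k.+1 setT = (\int[@lebesgue_rV R k.+1]_x (cst 1%:E x))%E.
  by rewrite integral_cst// mul1e.
rewrite (integral_rVS (F := cst 1%:E))//.
under eq_integral do rewrite integral_cst// mul1e.
rewrite integral_cst//; apply: mule_gt0 => //.
apply: (@lt_le_trans _ _ (leb `[0%R, 1%R])).
  by rewrite /= lebesgue_measure_itv/= lte_fin ltr01 -EFinB subr0 lte_fin ltr01.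
by apply: le_measure; rewrite ?inE.
Qed.

(** By [polar_radial] applied to the constant 1, mass 0 would make the whole space null. *)
Lemma ball01_mass_gt0 : 0 < ball01_mass (R := R) n.
Proof.
have m0 : 0 <= ball01_mass (R := R) n by rewrite fine_ge0.
rewrite lt_neqAle m0 andbT; apply/negP => /eqP m00.
have := @polar_radial R n n0 (cst 1%:E) (@measurable_cst _ _ _ _ _ _) (fun=> lee01).
rewrite -m00 mul0e integral_cst// mul1e => h.
by have := lebesgue_rV_setT n; rewrite h ltxx.
Qed.

Lemma compact_sub_annulus (K : set 'rV[R]_n) : compact K -> K `<=` P ->
  exists a b : R, 0 < a /\ K `<=` [set x | a <= enorm x <= b].
Proof.
move=> cK KP.
have oK : open (~` K) by apply: closed_openC; apply: compact_closed => //; exact: norm_hausdorff.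
have : nbhs (0 : 'rV[R]_n) (~` K) by apply: open_nbhs_nbhs; split=> // /KP; apply.
move=> /nbhs_ballP[a /= a0 ha].
have : bounded_set (@enorm R n @` K).
  apply: compact_bounded; apply: continuous_compact => //.
  by apply: continuous_subspaceT; exact: continuous_enorm.
move=> [b [_ hb]]; exists a, (b + 1); split=> // x Kx /=; apply/andP; split.
  rewrite leNgt; apply/negP => xa; apply: (ha x) => //.
  by rewrite -ball_normE/= sub0r normrN (le_lt_trans (norm_le_enorm x)).
rewrite (le_trans (ler_norm _))//; apply: (hb (b + 1)); first by rewrite ltrDl.
by exists x.
Qed.

Lemma locally_integrable_radial (H : R -> R) : locint H ->
  Defs.locally_integrable P (fun x => H (enorm x)).
Proof.
move=> lH K cK KP; have [a [b [a0 Kab]]] := compact_sub_annulus cK KP.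
set A : set 'rV[R]_n := [set x | a <= enorm x <= b].
have mA : measurable A by exact: compact_measurable_rV (@compact_annulus _ _ _ _).
apply: (@integrableS _ _ _ _ A) => //; first exact: compact_measurable_rV.
pose h := H \_ `[a, b].
have ih : leb.-integrable setT (EFin \o h).
  by rewrite /h -restrict_EFin -integrable_mkcond//; exact: lH.
have /integrableP[/measurable_EFinP mh ih'] := ih.
apply/integrable_mkcond => //.
have -> : ((EFin \o (fun x => H (enorm x))) \_ A) = (EFin \o h) \o (@enorm R n).
  apply/funext => x; rewrite /h/= !patchE.
  have -> : (enorm x \in `[a, b]%classic) = (x \in A) by rewrite mem_setE in_itv/=; apply/idP/idP; rewrite inE.
  by case: ifP.
have mhe : measurable_fun setT (h \o @enorm R n) by exact: measurableT_comp mh (@measurable_enorm R n).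
apply/integrableP; split; first exact/measurable_EFinP.
have := @polar_radial R n n0 (fun r => `|(h r)%:E|%E) _ (fun=> abse_ge0 _).
rewrite /= => ->; last by apply/measurable_EFinP; exact: measurableT_comp.
apply: lte_mul_pinfty => //; first by rewrite lee_fin ltW// ball01_mass_gt0.
have pb0 : 0 <= polw n `|b| by exact: polw_ge0.
have ma : measurable_fun setT (fun r => `|(h r)%:E|%E) by apply/measurable_EFinP; exact: measurableT_comp.
apply: (@le_lt_trans _ _ (\int[leb]_r ((polw n `|b|)%:E * `|(h r)%:E|))%E); last first.
  by rewrite ge0_integralZl// lte_mul_pinfty.
rewrite integral_mkcond; apply: ge0_le_integral => //.
- move=> r _; rewrite patchE mem_setE in_itv/= andbT; case: ifPn => // r0.
  by rewrite lee_fin mulr_ge0// polw_ge0// ltW.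
- apply/(measurable_restrictT _ (measurable_itv _)); apply: measurable_funTS.
  by apply: emeasurable_funM => //; apply/measurable_EFinP; exact: measurable_polw.
- exact: measurable_funeM.
move=> r _; rewrite patchE mem_setE in_itv/= andbT; case: ifPn => r0; last first.
  by rewrite lee_fin mulr_ge0.
rewrite lee_fin /h patchE; case: ifPn => [|_]; last by rewrite normr0 !mulr0.
rewrite inE/= in_itv/= => /andP[_ rb]; rewrite ler_wpM2r// /polw ler_wpM2l//.
by rewrite lerXn2r ?nnegrE// ?(le_trans rb) ?ler_norm// ltW.
Qed.

Lemma RintegralN d (T : measurableType d) (nu : {measure set T -> \bar R}) (D : set T) (f : T -> R) :
  \int[nu]_(x in D) - f x = - \int[nu]_(x in D) f x.
Proof.
rewrite /Rintegral; under eq_integral do rewrite EFinN.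
rewrite integralE [in RHS]integralE.
rewrite (funeposN (fun x => (f x)%:E)) (funenegN (fun x => (f x)%:E)).
move: (integral _ _ _) (integral _ _ _) => [a| |] [b| |]; rewrite /= ?oppr0//.
by rewrite opprB.
Qed.

Lemma test_funD O (phi psi : 'rV[R]_n -> R) : test_fun O phi -> test_fun O psi ->
  test_fun O (fun x => phi x + psi x).
Proof.
move=> [sphi [K [cK KO phi0]]] [spsi [K' [cK' KO' psi0]]]; split.
  by move=> k; apply/Ck_on_setT; apply: Ck_onD; [exact: openT|exact/Ck_on_setT|exact/Ck_on_setT].
exists (K `|` K'); split; first exact: compactU.
  by move=> x [/KO|/KO'].
by move=> x /not_orP[nK nK']; rewrite phi0// psi0// addr0.
Qed.

Lemma test_fun_euler phi : test_fun P phi -> test_fun P (fun x => n%:R * phi x + dotx (grad phi) x).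
Proof.
move=> tphi; apply: test_funD.
  by apply: test_funM (@open_punctured R n) tphi _ => k; exact: Ck_on_cst.
rewrite /dotx; elim: (index_enum _) => [|i r IH].
  have -> : (fun x : 'rV[R]_n => \sum_(i <- [::]) x ord0 i * grad phi x ord0 i) = (fun x => 0 * phi x).
    by apply/funext => x; rewrite big_nil mul0r.
  by apply: test_funM (@open_punctured R n) tphi _ => k; exact: Ck_on_cst.
under [X in test_fun _ X]eq_fun do rewrite big_cons.
apply: test_funD IH; under [X in test_fun _ X]eq_fun do rewrite mxE.
by apply: test_funM (@open_punctured R n) (test_fun_partial i tphi) _ => k; exact: Ck_on_coord.
Qed.

(** Spherical means replace pointwise differentiation. Testing with the field psi(|x|) x
    ([wgrad_euler]) and passing to polar coordinates shows that r^n [smean f] has weak derivative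
    r^(n-1) ([smean (dotx g)] + n [smean f]), so [weak_acp] gives it an absolutely continuous
    version. Since f is radial, f0 is [smean f] divided by the mass at almost every radius, and the
    profile is that version divided by m r^n. *)
Lemma radial_acp f g f0 : is_wgrad f g -> {ae mu, forall x : 'rV[R]_n, f x = f0 (enorm x)} ->
  exists F G, acp F G /\ {ae mu, forall x : 'rV[R]_n, f x = F (enorm x)}.
Proof.
move=> wfg aef; have [lf lg _] := wfg.
have mf := locally_integrable_measurable lf.
have lS := locint_smean n0 lf; have ld := locally_integrable_dotx lg.
have lT := locint_smean n0 ld; have md := locally_integrable_measurable ld.
set m := ball01_mass (R := R) n; have m0 : 0 < m by exact: ball01_mass_gt0.
have aeF0 : {ae leb, forall r, 0 < r -> f0 r = smean f r / m}.
  have := ae_ray n0 aef.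
  apply: ae_leb_imp => r + r0; move=> /(_ r0) h.
  have -> : smean f r = \int[mu]_(y in @ball01 R n) f0 r.
    rewrite /smean /Rintegral; congr fine; apply: ae_eq_integral.
    - exact: measurable_ball01.
    - by apply: measurable_funTS; apply/measurable_EFinP; exact: measurableT_comp mf (measurable_rayr r).
    - by [].
    apply: filterS h => y h yO /=; rewrite h// enorm_ray//; first exact: ltW.
    by have /andP[] := yO.
  rewrite Rintegral_cst; last exact: measurable_ball01.
  by rewrite -/(ball01_mass n) -/m mulfK// gt_eqF.
pose p k r : R := r ^+ k.
have cp k r : 0 < r -> {for r, continuous (p k)} by move=> _; exact: exprn_continuous.
have lU := locintM_cont (cp n) lS.
have lV : locint (fun r => p n.-1 r * smean (dotx g) r + n%:R * (p n.-1 r * smean f r)).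
  by apply: locintD; [|apply: locintZ]; apply: locintM_cont => // r; exact: cp.
have [psi tpsi|Phi [aPhi ePhi]] := weak_acp lU lV.
  have td := test1_derive tpsi; have tphi := test1_radial n tpsi.
  have [spsi [a [b [a0 psi0]]]] := tpsi; have [sd [a' [b' [a'0 d0]]]] := td.
  have mc (h : R -> R) : smooth setT h -> measurable_fun setT h.
    by move=> sh; apply: continuous_measurable_fun => x; exact: (sh 0%N).
  (* The radial form of n phi + x . grad phi; multiplied by [polw] it becomes n (r^n psi)'. *)
  pose k1 r : R := n%:R * psi r + r * (psi^`())%classic r.
  have mk1 : measurable_fun setT k1.
    by apply: measurable_funD; apply: measurable_funM => //; exact: mc.
  have Ek x : n%:R * psi (enorm x) + dotx (grad (fun x => psi (enorm x))) x = k1 (enorm x).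
    rewrite /k1; congr (_ + _); have [->|x0] := eqVneq x 0; last exact: dotx_radial.
    by rewrite enorm0 mul0r /dotx big1// => i _; rewrite mxE mul0r.
  have := wgrad_euler wfg tphi.
  under [X in X = _ -> _]eq_Rintegral do rewrite Ek.
  have [|_ ->] := smean_weight n0 (f := f) (k := k1) mf mk1.
    have := integrable_test lf (test_fun_euler tphi).
    by apply: eq_integrable => // x _; rewrite /= Ek.
  have [|_ ->] := smean_weight n0 (f := dotx g) (k := psi) md (mc _ spsi).
    exact: integrable_test ld tphi.
  have j1 := integrable_test1 lU td.
  have j2 := integrable_test1 (locintZ n%:R (locintM_cont (@cp n.-1) lS)) tpsi.
  have j3 := integrable_test1 (locintM_cont (@cp n.-1) lT) tpsi.
  have neg (h : R -> R) (c d r : R) : 0 < c -> (forall t, ~~ (c <= t <= d) -> h t = 0) -> ~~ (0 < r) -> h r = 0.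
    by move=> ? h0 r0; apply: h0; rewrite negb_and -ltNge (le_lt_trans _ _ (y := 0))// leNgt.
  have -> : \int[leb]_(r in `]0, +oo[) (polw n r * k1 r * smean f r) =
      n%:R * (\int[leb]_r (p n r * smean f r * (psi^`())%classic r) +
              \int[leb]_r (n%:R * (p n.-1 r * smean f r) * psi r)).
    rewrite -RintegralD// -RintegralZl//; last by apply: integrableD j1 j2.
    rewrite Rintegral_mkcond; apply: eq_Rintegral => r _; rewrite patchE mem_setE in_itv/= andbT.
    case: ifPn => r0; last by rewrite (neg _ _ _ _ a0 psi0 r0) (neg _ _ _ _ a'0 d0 r0) !mulr0 addr0 mulr0.
    by rewrite /polw /k1 /p exprnS1; ring.
  have -> : \int[leb]_(r in `]0, +oo[) (polw n r * psi r * smean (dotx g) r) =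
      n%:R * \int[leb]_r (p n.-1 r * smean (dotx g) r * psi r).
    rewrite -RintegralZl//.
    rewrite Rintegral_mkcond; apply: eq_Rintegral => r _; rewrite patchE mem_setE in_itv/= andbT.
    case: ifPn => r0; last by rewrite (neg _ _ _ _ a0 psi0 r0) !mulr0.
    by rewrite /polw /p; ring.
  rewrite -mulrN => /(mulfI (lt0r_neq0 _)); rewrite ltr0n => /(_ n0) h.
  under [in RHS]eq_Rintegral do rewrite mulrDl.
  by rewrite RintegralD// opprD -h addrK.
have ainv : acp (fun r : R => r ^- n) (fun r : R => - (n%:R * r ^- n.+1)).
  apply: acp_C1 => r r0; first by apply: is_derive_exprN; rewrite gt_eqF.
  apply: continuousN; apply: continuousM; first exact: cst_continuous.
  by apply: continuousV; [rewrite expf_neq0// gt_eqF|exact: exprn_continuous].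
have aF := acpZ m^-1 (acpM ainv aPhi).
exists (fun x => m^-1 * (x ^- n * Phi x)); eexists; split; first exact: aF.
have : {ae leb, forall r, 0 < r -> f0 r = m^-1 * (r ^- n * Phi r)}.
  apply: (ae_leb_imp2 _ aeF0 ePhi) => r h1 h2 r0.
  by rewrite h1// -h2// /p mulKf ?expf_neq0 ?gt_eqF// mulrC.
move=> /(ae_radial n0); apply: filterS2 aef => x -> h.
exact: h.
Qed.

(** Spherical means do not suffice here: [dotx g] must be identified at almost every point. The test
    functions are therefore arbitrary, and in polar coordinates [F] is integrated by parts on each
    ray against the restriction of phi; [dubois_rV] concludes. *)
Lemma radial_wgrad f g F G : is_wgrad f g -> acp F G -> {ae mu, forall x : 'rV[R]_n, f x = F (enorm x)} ->
  {ae mu, forall x : 'rV[R]_n, dotx g x = enorm x * G (enorm x)}.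
Proof.
move=> wfg aF aef; have [lf lg _] := wfg; have [lG _] := aF.
have ld := locally_integrable_dotx lg.
have cid (r : R) : 0 < r -> {for r, continuous (fun x : R => x)} by move=> _; exact: cvg_id.
have lrG := locally_integrable_radial (locintM_cont cid lG).
have ld' : Defs.locally_integrable P (fun x => dotx g x + -1 * (enorm x * G (enorm x))).
  by apply: locally_integrableD ld _; exact: locally_integrableZ.
suff : {ae mu, forall x, dotx g x + -1 * (enorm x * G (enorm x)) = 0}.
  by apply: filterS => x /eqP; rewrite mulN1r subr_eq0 => /eqP.
apply: dubois_rV => // phi tphi.
have i1 := integrable_test ld tphi; have i2 := integrable_test lrG tphi.
under eq_Rintegral do rewrite mulN1r mulrBl.
rewrite RintegralB//.
have E1 := wgrad_euler wfg tphi.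
have tT := test_fun_euler tphi.
have i3 := integrable_test (locally_integrable_radial (acp_locint aF)) tT.
have E2 : \int[mu]_x (f x * (n%:R * phi x + dotx (grad phi) x)) =
    \int[mu]_x (F (enorm x) * (n%:R * phi x + dotx (grad phi) x)).
  rewrite /Rintegral; congr fine; apply: ae_eq_integral => //.
  - exact: measurable_int (integrable_test lf tT).
  - exact: measurable_int i3.
  by apply: filterS aef => x h _; rewrite h.
suff E3 : \int[mu]_x (F (enorm x) * (n%:R * phi x + dotx (grad phi) x)) = - \int[mu]_x (enorm x * G (enorm x) * phi x).
  by move: E1; rewrite E2 E3 => /oppr_inj ->; rewrite subrr.
rewrite (polar_yr n0 i3) (polar_yr n0 i2) -RintegralN; apply: eq_Rintegral => y _; rewrite -RintegralN.
have [y01|ny01] := boolP (0 < enorm y < 1); last first.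
  by rewrite !Rintegral0_eq// => r _; rewrite /polK (negbTE ny01) andbF ?oppr0.
have /andP[y0 _] := y01.
have cphi : Ck 1 phi by exact: test_fun_Ck tphi.
(* On the ray through y, [E] is n r^n phi, with the polar weight included, and [e] is its
   derivative. *)
pose E r : R := if 0 < r then polw n r * r * phi (ray r y) else 0.
pose e r : R := if 0 < r then polw n r * (n%:R * phi (ray r y) + dotx (grad phi) (ray r y)) else 0.
have aE : acp E e.
  have ap : acp (fun r : R => n%:R * r ^+ n) (fun r : R => n%:R * (n%:R * r ^+ n.-1)).
    apply: acpZ; apply: acp_C1 => [r r0|r r0].
      by apply: DeriveDef; [exact: exprn_derivable|rewrite exp_derive [_ *: 1]mulr1].
    by apply: continuousM; [exact: cst_continuous|exact: exprn_continuous].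
  apply: acp_ext (acpM ap (acp_ray cphi y0)) => r r0; rewrite /E /e r0 /polw.
    by rewrite exprnS1; ring.
  by rewrite [r ^+ n]exprnS1; field; rewrite gt_eqF.
have [_ [K [cK KP phi0]]] := tphi; have [a [b [a0 Kab]]] := compact_sub_annulus cK KP.
have [_ [K' [cK' KP' T0]]] := tT; have [a' [b' [a0' Kab']]] := compact_sub_annulus cK' KP'.
have hE t : ~~ (Num.min a a' <= t <= Num.max b b') -> E t = 0.
  move=> tab; rewrite /E; case: ifPn => // t0; rewrite phi0 ?mulr0// => /Kab /=.
  rewrite (enorm_ray (ltW t0) y0) => /andP[at_ tb]; move/negP: tab; apply.
  by rewrite ge_min at_ le_max tb.
have he t : ~~ (Num.min a a' <= t <= Num.max b b') -> e t = 0.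
  move=> tab; rewrite /e; case: ifPn => // t0; rewrite T0 ?mulr0// => /Kab' /=.
  rewrite (enorm_ray (ltW t0) y0) => /andP[at_ tb]; move/negP: tab; apply.
  by rewrite ge_min at_ orbT le_max tb orbT.
have aa0 : 0 < Num.min a a' by rewrite lt_min a0.
have := acp_byparts aF aE aa0 hE he; rewrite -RintegralN => h.
transitivity (\int[leb]_x (F x * e x)).
  apply: eq_Rintegral => r _; rewrite /polK/= y01 andbT /e.
  by case: ifPn => r0; rewrite ?mulr0// enorm_ray//; [ring|exact: ltW].
rewrite h; apply: eq_Rintegral => r _; rewrite /polK/= y01 andbT /E.
by case: ifPn => r0; rewrite ?mulr0// enorm_ray//; [ring|exact: ltW].
Qed.

End radial_structure.

(** * Radial representatives and their values on spheres *)

Section radial_rep.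
Context {R : realType} (n : nat).
Notation leb := (@lebesgue_measure R).
Notation mu := (@lebesgue_rV R n).
Notation P := (@punctured R n).
Context (n0 : (0 < n)%N).
Notation m := (ball01_mass (R := R) n).

(** [acp] leaves [F] and [G] free on ]-oo, 0]; global measurability is a separate field so that
    compositions with |x| are measurable. Of g only the radial component is recorded: perturbations
    are radial, and estimates pass through [dotx_CS]. *)
Record radial_rep (f : 'rV[R]_n -> R) (g : 'rV[R]_n -> 'rV[R]_n) (F G : R -> R) : Prop := RadialRep {
  rep_wgrad : is_wgrad f g;
  rep_acp : acp F G;
  rep_mF : measurable_fun setT F;
  rep_mG : measurable_fun setT G;
  rep_f : {ae mu, forall x : 'rV[R]_n, f x = F (enorm x)};
  rep_g : {ae mu, forall x : 'rV[R]_n, dotx g x = enorm x * G (enorm x)} }.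

Lemma radial_rep_acp f g F G : is_wgrad f g -> acp F G -> measurable_fun setT F -> measurable_fun setT G ->
  {ae mu, forall x : 'rV[R]_n, f x = F (enorm x)} -> radial_rep f g F G.
Proof. by move=> wfg aF mF mG fF; split=> //; exact: radial_wgrad aF fF. Qed.

Lemma ae_neq0 : {ae mu, forall x : 'rV[R]_n, x != 0}.
Proof.
exists [set 0]; split; first exact: compact_measurable_rV (@compact_set1 _ _).
  exact: lebesgue_rV0.
by move=> x /= /negP; rewrite negbK => /eqP.
Qed.

Lemma radial_rep_exists f g f0 : is_wgrad f g -> {ae mu, forall x : 'rV[R]_n, f x = f0 (enorm x)} ->
  exists F G, radial_rep f g F G.
Proof.
move=> wfg ff0; have [F [G [aF fF]]] := radial_acp n0 wfg ff0.
pose pos : set R := `]0, +oo[%classic.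
have E (h : R -> R) x : 0 < x -> (h \_ pos) x = h x.
  by move=> x0; rewrite patchE mem_setE in_itv/= x0.
have mres h : locint h -> measurable_fun setT (h \_ pos).
  by move=> lh; apply/(measurable_restrictT _ (measurable_itv _)); exact: locint_measurable.
exists (F \_ pos), (G \_ pos); apply: radial_rep_acp => //.
- by apply: acp_ext aF => x x0; rewrite E.
- exact: mres (acp_locint aF).
- by apply: mres; have [] := aF.
apply: filterS2 ae_neq0 fF => x x0 ->; rewrite E// enorm_gt0//.
Qed.

Lemma polw_weight (r : R) : 0 < r -> polw n r * r `^ (- (n%:R - 2)) = n%:R * r.
Proof.
move=> r0; rewrite /polw -mulrA; congr (_ * _).
rewrite -powR_mulrn ?ltW// -powRD; last by apply/implyP => _; rewrite gt_eqF.
have -> : n.-1%:R + - (n%:R - 2) = 1 :> R.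
  by rewrite -[in n%:R](prednK n0) -natr1; ring.
by rewrite powRr1// ltW.
Qed.

Lemma measurable_powR_enorm (a : R) : measurable_fun setT (fun x : 'rV[R]_n => enorm x `^ a).
Proof. exact: measurableT_comp (measurable_powR a) (@measurable_enorm R n). Qed.

Lemma dotx_CS (g : 'rV[R]_n -> 'rV[R]_n) x : dotx g x ^+ 2 <= enorm x ^+ 2 * enorm (g x) ^+ 2.
Proof.
have [->|x0] := eqVneq x 0.
  by rewrite enorm0 expr0n mul0r /dotx big1 ?expr0n// => i _; rewrite mxE mul0r.
set a := enorm x ^+ 2; have a0 : 0 < a by rewrite exprn_gt0// enorm_gt0.
have : 0 <= \sum_i (a * g x ord0 i - dotx g x * x ord0 i) ^+ 2.
  by apply: sumr_ge0 => i _; exact: sqr_ge0.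
have E (c d : R) : \sum_i (c * g x ord0 i - d * x ord0 i) ^+ 2 =
    c ^+ 2 * (\sum_i g x ord0 i ^+ 2) - 2 * c * d * (\sum_i x ord0 i * g x ord0 i) + d ^+ 2 * (\sum_i x ord0 i ^+ 2).
  by rewrite !mulr_sumr -sumrB -big_split/=; apply: eq_bigr => i _; ring.
rewrite E -!sqr_enorm -/a -/(dotx g x).
rewrite (_ : _ + _ = a * (a * enorm (g x) ^+ 2 - dotx g x ^+ 2)); last by ring.
by rewrite pmulr_rge0// subr_ge0.
Qed.

Lemma measurable_wvec (g : 'rV[R]_n -> 'rV[R]_n) : (forall i, Defs.locally_integrable P (fun x => g x ord0 i)) ->
  measurable_fun setT g.
Proof. by move=> lg; apply: measurable_fun_coordP => i; exact: locally_integrable_measurable (lg i). Qed.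

Lemma weighted_radial (H : R -> R) : measurable_fun setT H -> (forall r, 0 <= H r) ->
  (\int[mu]_x (enorm x `^ (- (n%:R - 2)) * H (enorm x))%:E =
   (m * n%:R)%:E * \int[leb]_(r in `]0%R, +oo[) (r * H r)%:E)%E.
Proof.
move=> mH H0.
have mw : measurable_fun setT (fun r : R => (r `^ (- (n%:R - 2)) * H r)%:E).
  by apply/measurable_EFinP; apply: measurable_funM mH; exact: measurable_powR.
rewrite (@polar_radial R n n0 (fun r => (r `^ (- (n%:R - 2)) * H r)%:E))//; last first.
  by move=> r; rewrite lee_fin mulr_ge0// powR_ge0.
rewrite EFinM -muleA; congr (_ * _)%E.
rewrite -ge0_integralZl//; first last.
- by move=> r /=; rewrite in_itv/= andbT => r0; rewrite lee_fin mulr_ge0// ltW.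
- by apply/measurable_EFinP; apply: measurable_funTS; exact: measurable_funM.
apply: eq_integral => r; rewrite inE/= in_itv/= andbT => r0.
by rewrite -!EFinM mulrA polw_weight// mulrA.
Qed.

Lemma rep_bound f g F G : radial_rep f g F G ->
  ((m * n%:R)%:E * \int[leb]_(r in `]0%R, +oo[) (r * (F r ^+ 2 + G r ^+ 2))%:E <=
   \int[mu]_x (enorm x `^ (- (n%:R - 2)) * (f x ^+ 2 + enorm (g x) ^+ 2))%:E)%E.
Proof.
move=> [wfg aF mF mG fF gG].
have mFG : measurable_fun setT (fun r => F r ^+ 2 + G r ^+ 2).
  by apply: measurable_funD; exact: measurable_funX.
rewrite -(weighted_radial mFG) => [|r]; last by rewrite addr_ge0 ?sqr_ge0.
have [lf lg _] := wfg.
apply: ae_ge0_le_integral => //.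
- by move=> x _; rewrite lee_fin mulr_ge0 ?powR_ge0// addr_ge0 ?sqr_ge0.
- apply/measurable_EFinP; apply: measurable_funM; first exact: measurable_powR_enorm.
  exact: measurableT_comp mFG (@measurable_enorm R n).
- by move=> x _; rewrite lee_fin mulr_ge0 ?powR_ge0// addr_ge0 ?sqr_ge0.
- apply/measurable_EFinP; apply: measurable_funM; first exact: measurable_powR_enorm.
  apply: measurable_funD; apply: measurable_funX; first exact: locally_integrable_measurable.
  exact: measurableT_comp (@measurable_enorm R n) (measurable_wvec lg).
apply: filterS3 ae_neq0 fF gG => x x0 fx gx _; rewrite lee_fin ler_wpM2l ?powR_ge0// fx lerD2l.
have e0 : 0 < enorm x by rewrite enorm_gt0.
have := dotx_CS g x; rewrite gx exprMn ler_pM2l ?exprn_gt0//.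
Qed.

Lemma measurable_dotx (g : 'rV[R]_n -> 'rV[R]_n) : measurable_fun setT g -> measurable_fun setT (dotx g).
Proof.
move=> mg; apply: measurable_sum => i; apply: measurable_funM; first exact: measurable_coord.
exact: measurableT_comp (measurable_coord i) mg.
Qed.

Lemma measurable_grad (v : 'rV[R]_n -> R) : Ck 1 v -> measurable_fun setT (grad v).
Proof.
move=> [_ cv]; apply: measurable_fun_coordP => i.
under eq_fun do rewrite mxE; apply: continuous_measurable_rV.
by have [] := cv i.
Qed.

(** Continuity of the trace on |x| = eps. On each ray, v - F is absolutely continuous and
    [acp_pointwise] bounds its value at eps by a weighted integral over r >= eps. Integration over
    directions turns this into the weighted integral on the whole space; the division by n undoes
    the factor in [polw_weight], and [dotx_CS] passes from the radial derivative to the full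
    gradient. *)
Lemma trace_bound f g F G v (eps : R) : radial_rep f g F G -> Ck 1 v -> 0 < eps ->
  (\int[mu]_(y in @ball01 R n) ((v (ray eps y) - F eps) ^+ 2)%:E <=
   ((2 / eps ^+ 2 + 2) / n%:R)%:E *
   \int[mu]_x (enorm x `^ (- (n%:R - 2)) * ((v x - f x) ^+ 2 + enorm (grad v x - g x) ^+ 2))%:E)%E.
Proof.
move=> [wfg aF mF mG fF gG] cv e0.
have [lf lg _] := wfg; have mg := measurable_wvec lg; have mf := locally_integrable_measurable lf.
have mgv := measurable_grad cv.
have mv : measurable_fun setT v by apply: continuous_measurable_rV; have [] := cv.
have me := @measurable_enorm R n; have mw := measurable_powR_enorm (- (n%:R - 2)).
set C := 2 / eps ^+ 2 + 2; have C0 : 0 <= C by rewrite addr_ge0// divr_ge0// exprn_ge0// ltW.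
have nR0 : 0 < n%:R :> R by rewrite ltr0n.
pose X x : R := enorm x `^ (- (n%:R - 2)) *
  ((v x - F (enorm x)) ^+ 2 + (dotx (grad v) x / enorm x - G (enorm x)) ^+ 2).
have X0 x : 0 <= X x by rewrite mulr_ge0 ?powR_ge0// addr_ge0 ?sqr_ge0.
have mX : measurable_fun setT X.
  apply: measurable_funM => //; apply: measurable_funD; apply: measurable_funX; apply: measurable_funB => //.
  - exact: measurableT_comp mF me.
  - apply: measurable_funM; first exact: measurable_dotx.
    exact: measurableT_comp measurable_inv me.
  - exact: measurableT_comp mG me.
have mXr y : measurable_fun setT (fun r : measurableTypeR R => ((polw n r)%:E * (X (ray r y))%:E)%E).
  apply/measurable_EFinP; apply: measurable_funM; first exact: measurable_polw.
  exact: measurableT_comp mX (measurable_rayl y).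
apply: (@le_trans _ _ ((C / n%:R)%:E * \int[mu]_x (X x)%:E)%E); last first.
  apply: lee_wpmul2l; first by rewrite lee_fin divr_ge0// ltW.
  apply: ae_ge0_le_integral => //.
  - by move=> x _; rewrite lee_fin.
  - exact/measurable_EFinP.
  - by move=> x _; rewrite lee_fin mulr_ge0 ?powR_ge0// addr_ge0 ?sqr_ge0.
  - apply/measurable_EFinP; apply: measurable_funM => //.
    apply: measurable_funD; apply: measurable_funX; first exact: measurable_funB.
    apply: (measurableT_comp me); apply: measurable_fun_coordP => i.
    have -> : (fun x => (grad v x - g x) ord0 i) = (fun x => grad v x ord0 i - g x ord0 i).
      by apply/funext => x; rewrite !mxE.
    by apply: measurable_funB; [exact: measurableT_comp (measurable_coord i) mgv|exact: measurableT_comp (measurable_coord i) mg].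
  apply: filterS3 ae_neq0 fF gG => x x0 fx gx _; rewrite lee_fin ler_wpM2l ?powR_ge0// fx lerD2l.
  have en0 : 0 < enorm x by rewrite enorm_gt0.
  have := dotx_CS (fun x => grad v x - g x) x.
  have -> : dotx (fun x => grad v x - g x) x = enorm x * (dotx (grad v) x / enorm x - G (enorm x)).
    rewrite mulrBr -gx mulrCA divff ?gt_eqF// mulr1 /dotx -sumrB.
    by apply: eq_bigr => i _; rewrite !mxE mulrBr.
  by rewrite exprMn ler_pM2l ?exprn_gt0.
have X0' x : (0 <= (EFin \o X) x)%E by rewrite lee_fin.
have mX' : measurable_fun setT (EFin \o X) by exact/measurable_EFinP.
have PE := @polar R n (EFin \o X) n0 mX' X0'.
rewrite (_ : \int[mu]_x (X x)%:E = \int[mu]_(y in @ball01 R n) \int[leb]_(r in `]0%R, +oo[) ((polw n r)%:E * (X (ray r y))%:E))%E; last exact: PE.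
have mY : measurable_fun setT (fun y : 'rV[R]_n => \int[leb]_(r in `]0%R, +oo[) ((polw n r)%:E * (X (ray r y))%:E))%E.
  pose K (p : measurableTypeR R * 'rV[R]_n) := ((\1_(`]0%R, +oo[%classic : set R) p.1 * (polw n p.1 * X (ray p.1 p.2)))%R%:E)%E.
  have mK : measurable_fun setT K.
    apply/measurable_EFinP; apply: measurable_funM.
      by apply: measurableT_comp measurable_fst; exact: measurable_indic.
    apply: measurable_funM; first exact: measurableT_comp (measurable_polw n) measurable_fst.
    exact: measurableT_comp mX (measurable_ray (n := n)).
  have K0 p : (0 <= K p)%E.
    rewrite lee_fin /K indicE mem_setE in_itv/= andbT; have [r0|r0] := ltP 0 p.1; last by rewrite mul0r.
    by rewrite mulr_ge0 ?ler0n// mulr_ge0// polw_ge0// ltW.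
  have := measurable_fun_fubini_tonelli_G (m1 := leb) K mK K0.
  congr (measurable_fun _ _); apply/funext => y; rewrite /fubini_G [RHS]integral_mkcond.
  apply: eq_integral => r _; rewrite patchE /K indicE mem_setE in_itv/= andbT.
  by case: (0 < r); rewrite ?mul1r ?mul0r ?EFinM.
have Y0 (y : 'rV[R]_n) : (0 <= \int[leb]_(r in `]0%R, +oo[) ((polw n r)%:E * (X (ray r y))%:E))%E.
  apply: integral_ge0 => r /=; rewrite in_itv/= andbT => r0.
  by rewrite -EFinM lee_fin mulr_ge0// polw_ge0// ltW.
rewrite -ge0_integralZl//; last 3 first.
- exact: measurable_ball01.
- exact: measurable_funTS mY.
- by rewrite lee_fin divr_ge0// ltW.
apply: ge0_le_integral.
- exact: measurable_ball01.
- by move=> y _; rewrite lee_fin sqr_ge0.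
- apply: measurable_funTS; apply/measurable_EFinP; apply: measurable_funX; apply: measurable_funB => //.
  exact: measurableT_comp mv (measurable_rayr _).
- by apply: measurable_funeM; exact: measurable_funTS mY.
move=> y /andP[y0 _].
have aD := acpD (acp_ray cv y0) (acpZ (-1) aF).
have := acp_pointwise aD e0; rewrite !mulN1r => /le_trans; apply.
rewrite EFinM -muleA; apply: lee_wpmul2l; first by rewrite lee_fin.
apply: (@le_trans _ _ (\int[leb]_(r in `]0%R, +oo[) (n%:R^-1%:E * ((polw n r)%:E * (X (ray r y))%:E)))%E); last first.
  rewrite ge0_integralZl//.
  - exact: measurable_funTS.
  - by move=> r /=; rewrite in_itv/= andbT => r0; rewrite -EFinM lee_fin mulr_ge0// polw_ge0// ltW.
have E r : 0 < r -> (r * ((v (ray r y) + -1 * F r) ^+ 2 + (dotx (grad v) (ray r y) / r + -1 * G r) ^+ 2))%:E =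
    (n%:R^-1%:E * ((polw n r)%:E * (X (ray r y))%:E))%E.
  move=> r0; rewrite -!EFinM; congr (_%:E); rewrite /X enorm_ray//; last exact: ltW.
  by rewrite [polw n r * _]mulrA polw_weight// !mulN1r -mulrA mulKf// gt_eqF.
apply: (@le_trans _ _ (\int[leb]_(r in `[eps, +oo[) (n%:R^-1%:E * ((polw n r)%:E * (X (ray r y))%:E)))%E).
  rewrite le_eqVlt; apply/orP; left; apply/eqP; apply: eq_integral => r.
  by rewrite inE/= in_itv/= andbT => er; rewrite E// (lt_le_trans e0).
apply: ge0_subset_integral => //.
- by apply: measurable_funeM; exact: measurable_funTS.
- by move=> r /=; rewrite in_itv/= andbT => r0; rewrite -!EFinM lee_fin mulr_ge0 ?invr_ge0 ?(ltW nR0)// mulr_ge0// polw_ge0// ltW.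
- by move=> r /=; rewrite !in_itv/= !andbT; exact: lt_le_trans.
Qed.

End radial_rep.

(** * The ground state substitution and traces *)

Section ground_parts.
Context {R : realType} (N : nat).
Context (N3 : (3 <= N)%N).
Notation leb := (@lebesgue_measure R).
Notation mu := (@lebesgue_rV R N).
Notation P := (@punctured R N).
Notation h := (hardy_exp R N).
Notation m := (ball01_mass (R := R) N).

Lemma N_gt0 : (0 < N)%N. Proof. exact: leq_trans N3. Qed.

Lemma hardy2 : h + h = N%:R - 2.
Proof. by rewrite /hardy_exp; field. Qed.

(** Real and imaginary parts are indexed by a Boolean, so that each statement is proved once for
    both. *)
Definition part (b : bool) (z : R[i]) : R := if b then complex.Re z else complex.Im z.
Definition part_fun b (u : 'rV[R]_N -> R[i]) (x : 'rV[R]_N) : R := part b (u x).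

Lemma partD b z w : part b (z + w) = part b z + part b w.
Proof. by case: b z w => -[a c] [a' c']. Qed.

Lemma partB b z w : part b (z - w) = part b z - part b w.
Proof. by case: b z w => -[a c] [a' c']. Qed.

Lemma part_realM b (a : R) z : part b (a%:C * z) = a * part b z.
Proof. by case: b z => -[c d]; rewrite /part/=; ring. Qed.

Lemma normc2 z : normc z ^+ 2 = part true z ^+ 2 + part false z ^+ 2.
Proof. by case: z => a b; rewrite /= sqr_sqrtr// addr_ge0// sqr_ge0. Qed.

Lemma part_sqr_le b z : part b z ^+ 2 <= normc z ^+ 2.
Proof. by rewrite normc2; case: b; [rewrite lerDl|rewrite lerDr]; exact: sqr_ge0. Qed.

Lemma part_ground b u x : part_fun b (ground u) x = enorm x `^ h * part b (u x).
Proof. exact: part_realM. Qed.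

Lemma powR_hardyV (x : 'rV[R]_N) : x != 0 -> enorm x `^ h * enorm x `^ (- h) = 1.
Proof.
rewrite -enorm_gt0 => x0; rewrite -powRD; last by apply/implyP => _; rewrite gt_eqF.
by rewrite subrr powRr0.
Qed.

Lemma powR_hardy2 (x : 'rV[R]_N) : x != 0 -> (enorm x `^ (- h)) ^+ 2 = enorm x `^ (- (N%:R - 2)).
Proof.
rewrite -enorm_gt0 => x0; rewrite expr2 -powRD; last by apply/implyP => _; rewrite gt_eqF.
by rewrite -opprD hardy2.
Qed.

Lemma wgradP b u : wdifferentiable u -> is_wgrad (part_fun b u) (wgrad (part_fun b u)).
Proof. by case: b => -[[g1 h1] [g2 h2]]; apply: xgetPex; [exists g1|exists g2]. Qed.

Lemma cmeasurable_part b u : cmeasurable setT u -> measurable_fun setT (part_fun b u).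
Proof. by case: b => -[]. Qed.

Lemma ctest_part b O v : ctest_fun O v -> test_fun O (part_fun b v).
Proof. by case: b => -[]. Qed.

Lemma grad_sq_ge b u x : enorm (wgrad (part_fun b u) x) ^+ 2 <= grad_sq u x.
Proof. by rewrite /grad_sq; case: b; [rewrite lerDl|rewrite lerDr]; exact: sqr_ge0. Qed.

Lemma grad_sq_ge0 (u : 'rV[R]_N -> R[i]) x : 0 <= grad_sq u x.
Proof. by rewrite addr_ge0// sqr_ge0. Qed.

Lemma measurable_enorm_wgrad f g : is_wgrad f g -> measurable_fun setT (fun x : 'rV[R]_N => enorm (g x) ^+ 2).
Proof.
move=> [_ lg _]; apply: measurable_funX.
exact: measurableT_comp (@measurable_enorm R N) (measurable_wvec lg).
Qed.

Lemma measurable_grad_sq (u : 'rV[R]_N -> R[i]) : wdifferentiable u -> measurable_fun setT (grad_sq u).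
Proof.
by move=> wu; apply: measurable_funD; apply: measurable_enorm_wgrad;
  [exact: (wgradP true wu)|exact: (wgradP false wu)].
Qed.

Lemma measurable_normc2 (u : 'rV[R]_N -> R[i]) : cmeasurable setT u -> measurable_fun setT (fun x => normc (u x) ^+ 2).
Proof.
move=> mu; under eq_fun do rewrite normc2.
by apply: measurable_funD; apply: measurable_funX; [exact: (cmeasurable_part true mu)|exact: (cmeasurable_part false mu)].
Qed.

Lemma smooth_Ck_on v k : (forall k, Ck k v) -> Ck_on P k v.
Proof. by move=> sv; apply: (@Ck_on_sub _ _ setT) => //; exact/Ck_on_setT. Qed.

Lemma wgrad_core_diff b w v u : (forall x, w x = (enorm x `^ (- h))%:C * v x) -> ctest_fun setT v ->
  wdifferentiable (ground u) ->
  is_wgrad (part_fun b (ground (fun x => w x - u x)))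
    (fun x => grad (part_fun b v) x - wgrad (part_fun b (ground u)) x).
Proof.
move=> wE tv wu; have [sv _] := ctest_part b tv.
have W := is_wgrad_lin 1 (-1) (is_wgrad_smooth (fun k => smooth_Ck_on k sv)) (wgradP b wu).
apply: is_wgrad_ext W => x x0; last by rewrite scale1r scaleN1r.
rewrite mul1r mulN1r !part_ground partB wE part_realM mulrBr mulrA powR_hardyV// mul1r.
by [].
Qed.

Lemma normH2_core b w v u : (forall x, w x = (enorm x `^ (- h))%:C * v x) -> ctest_fun setT v ->
  wdifferentiable (ground u) -> cmeasurable setT u ->
  (\int[mu]_x (enorm x `^ (- (N%:R - 2)) * ((part_fun b v x - part_fun b (ground u) x) ^+ 2 +
     enorm (grad (part_fun b v) x - wgrad (part_fun b (ground u)) x) ^+ 2))%:E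
   <= normH2 (fun x => (w x - u x)%R))%E.
Proof.
move=> wE tv wu mu'; have W b := wgrad_core_diff b wE tv wu.
have wd : wdifferentiable (ground (fun x => w x - u x)).
  by split; [exists (fun x => grad (part_fun true v) x - wgrad (part_fun true (ground u)) x); exact: (W true)|
    exists (fun x => grad (part_fun false v) x - wgrad (part_fun false (ground u)) x); exact: (W false)].
have mw := @measurable_powR_enorm R N (- (N%:R - 2)).
have mv c : measurable_fun setT (part_fun c v) by exact: test_fun_measurable (ctest_part c tv).
have mh a := @measurable_powR_enorm R N a.
have mg c : measurable_fun setT (part_fun c (ground u)).
  by have [lf _ _] := wgradP c wu; exact: locally_integrable_measurable.
have m1 := measurable_enorm_wgrad (W b).
under eq_integral do rewrite mulrDr EFinD.
rewrite ge0_integralD//; last 4 first.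
- by move=> x _; rewrite lee_fin mulr_ge0 ?powR_ge0 ?sqr_ge0.
- apply/measurable_EFinP; apply: measurable_funM => //; apply: measurable_funX; exact: measurable_funB.
- by move=> x _; rewrite lee_fin mulr_ge0 ?powR_ge0 ?sqr_ge0.
- by apply/measurable_EFinP; exact: measurable_funM.
rewrite /normH2 addeC; apply: leeD; apply: ae_ge0_le_integral => //.
- by move=> x _; rewrite lee_fin mulr_ge0 ?powR_ge0 ?sqr_ge0.
- by apply/measurable_EFinP; exact: measurable_funM.
- by move=> x _; rewrite lee_fin mulr_ge0 ?powR_ge0// grad_sq_ge0.
- by apply/measurable_EFinP; apply: measurable_funM => //; exact: measurable_grad_sq.
- apply: filterS (wgradE N_gt0 (W b)) => x wx _; rewrite lee_fin ler_wpM2l ?powR_ge0//.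
  by rewrite -wx grad_sq_ge.
- by move=> x _; rewrite lee_fin mulr_ge0 ?powR_ge0 ?sqr_ge0.
- by apply/measurable_EFinP; apply: measurable_funM => //; apply: measurable_funX; exact: measurable_funB.
- by move=> x _; rewrite lee_fin sqr_ge0.
- apply/measurable_EFinP; apply: measurable_normc2.
  have mpart c : measurable_fun setT (fun x => part c (w x - u x)).
    have -> : (fun x => part c (w x - u x)) = (fun x => enorm x `^ (- h) * part_fun c v x - part_fun c u x).
      by apply/funext => x; rewrite partB wE part_realM.
    by apply: measurable_funB; [exact: measurable_funM|exact: cmeasurable_part].
  by split; [exact: (mpart true)|exact: (mpart false)].
apply: filterS (ae_neq0 N_gt0) => x x0 _; rewrite lee_fin -powR_hardy2// -exprMn.
have -> : enorm x `^ (- h) * (part_fun b v x - part_fun b (ground u) x) = part b (w x - u x).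
  rewrite partB wE part_realM part_ground mulrBr mulrA [_ `^ _ * _ `^ _]mulrC.
  by rewrite powR_hardyV// mul1r.
exact: part_sqr_le.
Qed.

Lemma measurable_sphere (eps : R) : measurable [set x : 'rV[R]_N | enorm x = eps].
Proof.
have -> : [set x : 'rV[R]_N | enorm x = eps] = @enorm R N @^-1` [set eps] by [].
by rewrite -[X in measurable X]setTI; exact: (@measurable_enorm R N).
Qed.

Lemma measurable_pos : measurable [set x : 'rV[R]_N | 0 < enorm x].
Proof.
have -> : [set x : 'rV[R]_N | 0 < enorm x] = @enorm R N @^-1` `]0, +oo[%classic.
  by apply/seteqP; split=> x /=; rewrite in_itv/= andbT.
by rewrite -[X in measurable X]setTI; exact: (@measurable_enorm R N).
Qed.

(** Rescaling |x| < eps to the unit ball. Measurability is asked only after composition with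
    [ray eps], because a trace is measurable on its sphere alone. *)
Lemma sphere_integralE (eps : R) (H : 'rV[R]_N -> \bar R) : 0 < eps -> (forall x, 0 <= H x)%E ->
  measurable_fun [set x : 'rV[R]_N | 0 < enorm x] (fun x => H (ray eps x)) ->
  sphere_integral eps H = ((N%:R * eps ^+ N.-1)%:E * \int[mu]_(y in @ball01 R N) H (ray eps y))%E.
Proof.
move=> e0 H0 mH; rewrite /sphere_integral.
set D := [set x : 'rV[R]_N | 0 < enorm x < eps].
have mD : measurable D.
  have -> : D = @enorm R N @^-1` `]0, eps[%classic by apply/seteqP; split=> x /=; rewrite in_itv.
  by rewrite -[X in measurable X]setTI; exact: (@measurable_enorm R N).
pose F := ((fun x => H (ray eps x)) \_ D).
have mF : measurable_fun setT F.
  apply/(measurable_restrictT _ mD); apply: measurable_funS mH => //; first exact: measurable_pos.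
  by move=> x /andP[].
have F0 x : (0 <= F x)%E by rewrite /F patchE; case: ifP.
rewrite [X in (_ * X)%E]integral_mkcond.
rewrite -[X in (_ * X)%E]/(\int[mu]_x F x)%E (integral_rV_affine 0 e0 mF F0) muleA -EFinM.
have -> : N%:R / eps * eps ^+ N = N%:R * eps ^+ N.-1.
  by rewrite -{2}(prednK N_gt0) exprS; field; rewrite gt_eqF.
congr (_ * _)%E; rewrite [RHS]integral_mkcond; apply: eq_integral => y _.
rewrite /F !patchE addr0.
have -> : (eps *: y \in D) = (y \in @ball01 R N).
  apply/idP/idP; rewrite !inE /D /ball01/= enormZ gtr0_norm// pmulr_rgt0// gtr_pMr//.
case: ifP => //; rewrite inE => /andP[y0 _]; congr (H _).
by rewrite /ray enormZ gtr0_norm// scalerA; congr (_ *: _); field; rewrite !gt_eqF.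
Qed.

Context (u : 'rV[R]_N -> R[i]) (F G : bool -> R -> R).
Context (mu_ : cmeasurable setT u).
Context (wu : wdifferentiable (ground u)).
Context (repu : forall b, radial_rep (part_fun b (ground u)) (wgrad (part_fun b (ground u))) (F b) (G b)).

(** The constant that the trace of u on |x| = eps turns out to be almost everywhere: F(eps) with the
    ground state substitution undone. *)
Definition sphere_value (eps : R) : R[i] := (eps `^ (- h))%:C * (F true eps +i* F false eps).

Lemma part_sphere_value b eps : part b (sphere_value eps) = eps `^ (- h) * F b eps.
Proof. by rewrite part_realM; case: b. Qed.

Lemma core_measurable (w v : 'rV[R]_N -> R[i]) : (forall x, w x = (enorm x `^ (- h))%:C * v x) -> ctest_fun setT v -> cmeasurable setT w.
Proof.
move=> wE tv.
have mw b : measurable_fun setT (part_fun b w).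
  have -> : part_fun b w = fun x => enorm x `^ (- h) * part_fun b v x.
    by apply/funext => x; rewrite /part_fun wE part_realM.
  by apply: measurable_funM; [exact: measurable_powR_enorm|exact: test_fun_measurable (ctest_part b tv)].
by split; [exact: (mw true)|exact: (mw false)].
Qed.

Lemma measurable_ray_diff (w g : 'rV[R]_N -> R[i]) (eps : R) : 0 < eps -> cmeasurable setT w ->
  cmeasurable [set x | enorm x = eps] g ->
  measurable_fun [set x : 'rV[R]_N | 0 < enorm x] (fun x => (normc (w (ray eps x) - g (ray eps x)) ^+ 2)%:E).
Proof.
move=> e0 mw mg; apply/measurable_EFinP.
under [X in measurable_fun _ X]eq_fun do rewrite normc2 !partB.
have mR : measurable_fun [set x : 'rV[R]_N | 0 < enorm x] (ray eps) by apply: measurable_funTS; exact: measurable_rayr.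
have mb b : measurable_fun [set x : 'rV[R]_N | 0 < enorm x] (fun x => (part b (w (ray eps x)) - part b (g (ray eps x)))).
  apply: measurable_funB.
    by apply: measurable_funTS; exact: measurableT_comp (cmeasurable_part b mw) (measurable_rayr (n := N) eps).
  apply: (@measurable_comp _ _ _ _ _ _ [set x | enorm x = eps] (part_fun b g)) => //.
  - exact: measurable_sphere.
  - by move=> _ [x /= x0 <-]; rewrite enorm_ray// ltW.
  - by case: (b); have [] := mg.
by apply: measurable_funD; apply: measurable_funX; exact: mb.
Qed.

Lemma trace_cvg w eps : 0 < eps -> approxH w u ->
  sphere_integral eps (fun x => (normc (w k x - sphere_value eps) ^+ 2)%:E) @[k --> \oo] --> 0%E.
Proof.
move=> e0 [cw w0].
(* The first two factors come from [sphere_integralE], the square from undoing the substitution, and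
   the rest from [trace_bound] applied to both components. *)
pose C : R := N%:R * eps ^+ N.-1 * (eps `^ (- h)) ^+ 2 * (2 * ((2 / eps ^+ 2 + 2) / N%:R)).
have C0 : 0 <= C.
  have c0 : 0 <= 2 / eps ^+ 2 + 2 by rewrite addr_ge0// divr_ge0// exprn_ge0// ltW.
  have d0 : 0 <= eps ^+ N.-1 by rewrite exprn_ge0// ltW.
  by apply: mulr_ge0; rewrite mulr_ge0 ?sqr_ge0 ?mulr_ge0 ?divr_ge0.
have mc : cmeasurable [set x | enorm x = eps] (fun _ : 'rV[R]_N => sphere_value eps).
  by split; exact: measurable_cst.
apply: (@squeeze_cvge _ _ _ _ (cst 0%E) _ (fun k => C%:E * normH2 (fun x => (w k x - u x)%R))%E).
- near=> k; have [v [tv wE]] := cw k.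
  have mwk := core_measurable wE tv.
  apply/andP; split.
    apply: mule_ge0; first by rewrite lee_fin divr_ge0// ltW.
    by apply: integral_ge0 => x _; rewrite lee_fin sqr_ge0.
  rewrite sphere_integralE//; last 2 first.
  + by move=> x; rewrite lee_fin sqr_ge0.
  + exact: measurable_ray_diff e0 mwk mc.
  have mv b : measurable_fun setT (part_fun b v) by exact: test_fun_measurable (ctest_part b tv).
  have msq b : measurable_fun (@ball01 R N) (fun y => ((part_fun b v (ray eps y) - F b eps) ^+ 2)%:E).
    apply: measurable_funTS; apply/measurable_EFinP; apply: measurable_funX; apply: measurable_funB => //.
    exact: measurableT_comp (mv b) (measurable_rayr (n := N) eps).
  have -> : (\int[mu]_(y in @ball01 R N) (normc (w k (ray eps y) - sphere_value eps) ^+ 2)%:E =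
     ((eps `^ (- h)) ^+ 2)%:E * (\int[mu]_(y in @ball01 R N) ((part_fun true v (ray eps y) - F true eps) ^+ 2)%:E +
       \int[mu]_(y in @ball01 R N) ((part_fun false v (ray eps y) - F false eps) ^+ 2)%:E))%E.
    rewrite -ge0_integralD//; last first.
    + by move=> y _; rewrite lee_fin sqr_ge0.
    + by move=> y _; rewrite lee_fin sqr_ge0.
    + exact: measurable_ball01.
    rewrite -ge0_integralZl//; last first.
    + by rewrite lee_fin sqr_ge0.
    + by move=> y _; rewrite -EFinD lee_fin addr_ge0// sqr_ge0.
    + exact: emeasurable_funD.
    + exact: measurable_ball01.
    apply: eq_integral => y; rewrite inE => /andP[y0 _].
    rewrite -EFinD -EFinM normc2 !partB !part_sphere_value wE !part_realM enorm_ray//; last exact: ltW.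
    by congr (_%:E); rewrite /part_fun; ring.
  have c0 : 0 <= (2 / eps ^+ 2 + 2) / N%:R.
    by rewrite divr_ge0// addr_ge0// divr_ge0// exprn_ge0// ltW.
  have B b : (\int[mu]_(y in @ball01 R N) ((part_fun b v (ray eps y) - F b eps) ^+ 2)%:E <=
      ((2 / eps ^+ 2 + 2) / N%:R)%:E * normH2 (fun x => (w k x - u x)%R))%E.
    apply: le_trans (trace_bound N_gt0 (repu b) ((ctest_part b tv).1 1%N) e0) _.
    by apply: lee_wpmul2l; [rewrite lee_fin|exact: normH2_core].
  rewrite (EFinM (N%:R * eps ^+ N.-1 * _)) (EFinM (N%:R * eps ^+ N.-1)) -!muleA.
  apply: lee_wpmul2l; first by rewrite lee_fin mulr_ge0// exprn_ge0// ltW.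
  apply: lee_wpmul2l; first by rewrite lee_fin sqr_ge0.
  apply: le_trans (leeD (B true) (B false)) _.
  rewrite le_eqVlt; apply/orP; left; apply/eqP.
  rewrite -ge0_muleDl ?lee_fin// -EFinD; congr (_%:E * _)%E; ring.
- exact: cvg_cst.
- by rewrite -(mule0 C%:E); exact: cvgeZl.
Unshelve. all: by end_near. Qed.

Lemma normc2_split (z w c : R[i]) : normc (z - c) ^+ 2 <= 2 * normc (w - z) ^+ 2 + 2 * normc (w - c) ^+ 2.
Proof.
rewrite !normc2 !partB.
have H (p q r : R) : (p - r) ^+ 2 <= 2 * (q - p) ^+ 2 + 2 * (q - r) ^+ 2.
  have E : 2 * (q - p) ^+ 2 + 2 * (q - r) ^+ 2 - (p - r) ^+ 2 = ((q - p) + (q - r)) ^+ 2 by ring.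
  by rewrite -subr_ge0 E sqr_ge0.
by rewrite (le_trans (lerD (H _ (part true w) _) (H _ (part false w) _)))// le_eqVlt; apply/orP; left; apply/eqP; ring.
Qed.

(** [trace] is a chosen element, possibly reached along another sequence [w']. By [trace_cvg] every
    approximating sequence converges on the sphere to [sphere_value], so the two limits are at L^2
    distance 0 and agree in almost every direction. *)
Lemma trace_integral eps w : 0 < eps -> approxH w u ->
  sphere_integral eps (fun x => (normc (trace eps u x) ^+ 2)%:E) =
    (N%:R * eps ^+ N.-1 * m * ((eps `^ (- h)) ^+ 2 * (F true eps ^+ 2 + F false eps ^+ 2)))%:E.
Proof.
move=> e0 aw; set g := trace eps u; set c := sphere_value eps.
have mc : cmeasurable [set x | enorm x = eps] (fun _ : 'rV[R]_N => c).
  by split; exact: measurable_cst.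
have mball := @measurable_ball01 R N.
have [mg [w' [aw' g0]]] : is_trace eps u g.
  by apply: xgetPex; exists (fun=> c); split=> //; exists w; split=> //; exact: trace_cvg.
have c0 := trace_cvg e0 aw'.
have sub : @ball01 R N `<=` [set x | 0 < enorm x] by move=> x /andP[].
have mgr b : measurable_fun [set x : 'rV[R]_N | 0 < enorm x] (fun x => part b (g (ray eps x))).
  apply: (@measurable_comp _ _ _ _ _ _ [set x | enorm x = eps] (part_fun b g)).
  - exact: measurable_sphere.
  - by move=> _ [x /= x0 <-]; rewrite enorm_ray// ltW.
  - by case: b; have [] := mg.
  - by apply: measurable_funTS; exact: measurable_rayr.
pose S (z : 'rV[R]_N -> R[i]) := sphere_integral eps (fun x => (normc (z x) ^+ 2)%:E).
have K0 : 0 < N%:R * eps ^+ N.-1 by rewrite mulr_gt0 ?ltr0n ?N_gt0// exprn_gt0.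
have gc0 : (\int[mu]_(y in @ball01 R N) (normc (g (ray eps y) - c) ^+ 2)%:E = 0)%E.
  have mgc : measurable_fun [set x : 'rV[R]_N | 0 < enorm x] (fun x => (normc (g (ray eps x) - c) ^+ 2)%:E).
    apply/measurable_EFinP; under [X in measurable_fun _ X]eq_fun do rewrite normc2 !partB.
    by apply: measurable_funD; apply: measurable_funX; apply: measurable_funB => //; exact: mgr.
  have B k : ((N%:R * eps ^+ N.-1)%:E * \int[mu]_(y in @ball01 R N) (normc (g (ray eps y) - c) ^+ 2)%:E <=
      2%:E * S (fun x => w' k x - g x)%R + 2%:E * S (fun x => w' k x - c)%R)%E.
    have [v [tv wE]] := (aw'.1 k); have mwk := core_measurable wE tv.
    have m1 := measurable_ray_diff e0 mwk mg; have m2 := measurable_ray_diff e0 mwk mc.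
    rewrite /S !sphere_integralE//; try by move=> x; rewrite lee_fin sqr_ge0.
    rewrite !(muleCA 2%:E) -ge0_muleDr; last 2 first.
    - by apply: mule_ge0 => //; apply: integral_ge0 => x _; rewrite lee_fin sqr_ge0.
    - by apply: mule_ge0 => //; apply: integral_ge0 => x _; rewrite lee_fin sqr_ge0.
    apply: lee_wpmul2l; first by rewrite lee_fin ltW.
    have m1' := measurable_funS measurable_pos sub m1.
    have m2' := measurable_funS measurable_pos sub m2.
    rewrite -!ge0_integralZl//; try by move=> x _; rewrite lee_fin sqr_ge0.
    rewrite -ge0_integralD//; last 4 first.
    - by move=> x _; rewrite -EFinM lee_fin mulr_ge0// sqr_ge0.
    - exact: measurable_funeM.
    - by move=> x _; rewrite -EFinM lee_fin mulr_ge0// sqr_ge0.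
    - exact: measurable_funeM.
    apply: ge0_le_integral => //.
    - by move=> x _; rewrite lee_fin sqr_ge0.
    - exact: measurable_funS measurable_pos sub mgc.
    - by apply: emeasurable_funD; exact: measurable_funeM.
    by move=> x _; rewrite -!EFinM -EFinD lee_fin normc2_split.
  have L : (2%:E * S (fun x => w' k x - g x)%R + 2%:E * S (fun x => w' k x - c)%R @[k --> \oo] --> 0)%E.
    rewrite -[X in _ --> X](adde0 (0 : \bar R)%E) -{1}(mule0 2%:E) -{2}(mule0 2%:E).
    by apply: cvgeD; [by rewrite mule0|exact: cvgeZl g0|exact: cvgeZl c0].
  have le0 : ((N%:R * eps ^+ N.-1)%:E * \int[mu]_(y in @ball01 R N) (normc (g (ray eps y) - c) ^+ 2)%:E <= 0)%E.
    by apply: (lee_cvg_to (cvg_cst _) L); apply: nearW => k; exact: B.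
  apply/eqP; rewrite eq_le; apply/andP; split; last by apply: integral_ge0 => x _; rewrite lee_fin sqr_ge0.
  by move: le0; rewrite pmule_rle0// lte_fin.
have mgg : measurable_fun [set x : 'rV[R]_N | 0 < enorm x] (fun x => (normc (g (ray eps x)) ^+ 2)%:E).
  apply/measurable_EFinP; under [X in measurable_fun _ X]eq_fun do rewrite normc2.
  by apply: measurable_funD; apply: measurable_funX; exact: mgr.
rewrite sphere_integralE//; last by move=> x; rewrite lee_fin sqr_ge0.
rewrite -[(_ * m * _)%R]mulrA [RHS]EFinM; congr (_ * _)%E.
transitivity (\int[mu]_(y in @ball01 R N) (normc c ^+ 2)%:E)%E; last first.
  rewrite (integral_cst _ mball) muleC [RHS]EFinM; congr (_ * _)%E; first exact: ball01_massE.
  congr (_%:E).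
  by rewrite normc2 !part_sphere_value !exprMn mulrDr.
apply: ae_eq_integral => //.
  exact: measurable_funS measurable_pos sub mgg.
have mgc' : measurable_fun (@ball01 R N) (fun x => (normc (g (ray eps x) - c) ^+ 2)%:E).
  apply: (measurable_funS measurable_pos sub).
  apply/measurable_EFinP; under [X in measurable_fun _ X]eq_fun do rewrite normc2 !partB.
  by apply: measurable_funD; apply: measurable_funX; apply: measurable_funB => //; exact: mgr.
have /(ae_eq_integral_abs mu mball mgc') : (\int[mu]_(y in @ball01 R N) `|(normc (g (ray eps y) - c) ^+ 2)%:E| = 0)%E.
  by rewrite -[RHS]gc0; apply: eq_integral => y _; rewrite gee0_abs// lee_fin sqr_ge0.
apply: filterS => y h0 yb; congr (_%:E); have := h0 yb.
move=> [] /eqP; rewrite sqrf_eq0 => /eqP /Normc.eq0_normc /eqP.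
by rewrite subr_eq0 => /eqP ->.
Qed.

End ground_parts.

(** * The energy in terms of the ground state substitution *)

Section at_infinity.
Context {R : realType}.
Notation leb := (@lebesgue_measure R).

Lemma Rint_chaslesy (f : R -> R) a b : leb.-integrable `[a, +oo[ (EFin \o f) -> a <= b ->
  \int[leb]_(t in `[a, +oo[) f t = \int[leb]_(t in `[a, b]) f t + \int[leb]_(t in `[b, +oo[) f t.
Proof.
move=> intf ab.
have := @Rintegral_itvB R f (BLeft a) (BInfty _ false) b intf.
rewrite !bnd_simp => /(_ ab isT).
rewrite Rintegral_itv_obnd_cbnd => [<-|]; first by rewrite addrC subrK.
by apply: integrableS intf => //; apply: subset_itv; rewrite bnd_simp.
Qed.

Lemma cvg_integral_pinfty (f : R -> R) a : leb.-integrable `[a, +oo[ (EFin \o f) ->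
  \int[leb]_(t in `[a, a + k%:R]) f t @[k --> \oo] --> \int[leb]_(t in `[a, +oo[) f t.
Proof.
move=> intf; have /integrableP[mf _] := intf.
pose I (k : nat) : set R := `[a, (a + k%:R)%R]%classic.
have mI k : measurable (I k) by exact: measurable_itv.
pose f_ (k : nat) (x : R) := (f x * \1_(I k) x)%:E.
have [|||||_ _] := @dominated_convergence _ _ _ leb `[a, +oo[%classic (measurable_itv _) f_ (EFin \o f) (abse \o (EFin \o f)).
- move=> k; apply/measurable_EFinP; apply: measurable_funM; first exact/measurable_EFinP.
  have mi : measurable_fun setT (\1_(I k) : R -> R) by exact: measurable_indic.
  exact: measurable_funTS mi.
- exact: mf.
- apply: aeW => x /=; rewrite in_itv/= andbT => ax.
  apply: cvg_near_cst; exists (Num.bound (x - a)) => // k /= hk.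
  rewrite /f_ indicE mem_setE in_itv/= ax/= -lerBlDl ltW ?mulr1// (lt_le_trans (archi_boundP _)) ?subr_ge0//.
  by rewrite ler_nat.
- exact: integrable_abse.
- apply: aeW => x k _ /=; rewrite /f_ lee_fin normrM indicE ler_piMr//.
  by case: (x \in I k); rewrite ?normr1 ?normr0.
move=> c; rewrite -(fineK (integrable_fin_num _ intf)) in c => //.
have -> : (fun k => \int[leb]_(t in `[a, a + k%:R]) f t) =
    fine \o (fun k => \int[leb]_(x in `[a, +oo[) f_ k x)%E.
  apply/funext => k /=; congr fine; rewrite [LHS]integral_mkcond [RHS]integral_mkcond.
  apply: eq_integral => x _; rewrite !patchE /f_ indicE !mem_setE !in_itv/= andbT.
  by case: (leP a x) => ax //=; case: ifP; rewrite ?mulr1 ?mulr0.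
exact: fine_cvg c.
Qed.

(** F G is half the derivative of F^2, so the point is that F^2 tends to 0 at infinity: by
    [acp_pointwise], F(eps + k)^2 is at most a constant times the tail of a convergent integral. *)
Lemma acp_infty (F G : R -> R) (eps : R) : acp F G -> 0 < eps ->
  (\int[leb]_(r in `]0%R, +oo[) (r * (F r ^+ 2 + G r ^+ 2))%:E < +oo)%E ->
  leb.-integrable `[eps, +oo[ (fun r => (F r * G r)%:E) /\
  \int[leb]_(r in `[eps, +oo[) (F r * G r) = - (F eps ^+ 2 / 2).
Proof.
move=> aF e0 fin; have [lG HF] := aF.
have sx : (`[eps, +oo[%classic : set R) `<=` `]0, +oo[.
  by move=> r /=; rewrite !in_itv/= !andbT; exact: lt_le_trans.
have mF : measurable_fun (`]0, +oo[%classic : set R) F by exact: locint_measurable (acp_locint aF).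
have mG : measurable_fun (`]0, +oo[%classic : set R) G by exact: locint_measurable lG.
pose Q r := r * (F r ^+ 2 + G r ^+ 2).
have Q0 r : 0 < r -> 0 <= Q r by move=> r0; rewrite mulr_ge0 ?addr_ge0 ?sqr_ge0// ltW.
have iQ : leb.-integrable `]0, +oo[ (EFin \o Q).
  apply/integrableP; split.
    apply/measurable_EFinP; apply: measurable_funM => //.
    by apply: measurable_funD; exact: measurable_funX.
  apply: le_lt_trans fin; rewrite le_eqVlt; apply/orP; left; apply/eqP.
  apply: eq_integral => r; rewrite inE/= in_itv/= andbT => r0.
  by rewrite /= ger0_norm// Q0.
have iQe : leb.-integrable `[eps, +oo[ (EFin \o Q) by apply: integrableS iQ.
have iFG : leb.-integrable `[eps, +oo[ (fun r => (F r * G r)%:E).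
  apply: (le_integrable _ _ _ (integrableZl _ eps^-1 iQe)) => //.
    apply/measurable_EFinP; apply: (measurable_funS _ sx) => //; exact: measurable_funM.
  move=> r /=; rewrite in_itv/= andbT => er; rewrite lee_fin [leRHS]ger0_norm; last first.
    by rewrite mulr_ge0 ?invr_ge0 ?(ltW e0)// Q0// (lt_le_trans e0).
  apply: (@le_trans _ _ (F r ^+ 2 + G r ^+ 2)).
    rewrite ler_norml; have := sqr_ge0 (F r + G r); have := sqr_ge0 (F r - G r).
    have := sqr_ge0 (F r); have := sqr_ge0 (G r); nra.
  by rewrite /Q mulrA ler_peMl ?addr_ge0 ?sqr_ge0// mulrC ler_pdivlMr// mul1r.
split=> //.
have c1 := cvg_integral_pinfty iFG.
have c2 := cvg_integral_pinfty iQe.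
have c3 : F (eps + k%:R) ^+ 2 @[k --> \oo] --> (0 : R).
  apply: (@squeeze_cvgr _ _ _ _ (cst 0) (fun k => (2 / eps ^+ 2 + 2) *
     (\int[leb]_(t in `[eps, +oo[) Q t - \int[leb]_(t in `[eps, eps + k%:R]) Q t))).
  - apply: nearW => k; rewrite sqr_ge0/=.
    have x0 : 0 < eps + k%:R by rewrite ltr_pwDl.
    have ex : eps <= eps + k%:R by rewrite lerDl.
    have := acp_pointwise aF x0.
    have iQx : leb.-integrable `[eps + k%:R, +oo[ (EFin \o Q).
      by apply: integrableS iQe => //; apply: subset_itvr; rewrite bnd_simp.
    rewrite -[X in (_ <= _ * X)%E]/(\int[leb]_(r in `[(eps + k%:R)%R, +oo[) (Q r)%:E)%E.
    rewrite -[X in (_ <= _ * X)%E]fineK; last exact: integrable_fin_num.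
    rewrite -EFinM lee_fin => /le_trans; apply.
    rewrite (Rint_chaslesy iQe ex) [X in _ * (X - _)]addrC addrK.
    rewrite ler_wpM2r//; first by apply: Rintegral_ge0 => r /=; rewrite in_itv/= andbT => xr; rewrite Q0// (lt_le_trans x0).
    rewrite lerD2r ler_wpM2l// lef_pV2 ?posrE ?exprn_gt0// lerXn2r ?nnegrE// ltW//.
  - exact: cvg_cst.
  - set J := \int[leb]_(t in `[eps, +oo[) Q t.
    have L : (2 / eps ^+ 2 + 2) * (J - \int[leb]_(t in `[eps, eps + k%:R]) Q t) @[k --> \oo] --> (2 / eps ^+ 2 + 2) * (J - J).
      by apply: cvgM; [exact: cvg_cst|apply: cvgB c2; exact: cvg_cst].
    by move: L; rewrite subrr mulr0.
have c4 : F (eps + k%:R) ^+ 2 @[k --> \oo] --> F eps ^+ 2 + 2 * \int[leb]_(r in `[eps, +oo[) (F r * G r).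
  have E (k : nat) : F (eps + k%:R) ^+ 2 = F eps ^+ 2 + 2 * \int[leb]_(t in `[eps, eps + k%:R]) (F t * G t).
    have [_ H2] := acpM aF aF.
    have := H2 eps (eps + k%:R) e0; rewrite lerDl ler0n => /(_ isT).
    have -> : \int[leb]_(t in `[eps, eps + k%:R]) (F t * G t + F t * G t) = \int[leb]_(t in `[eps, eps + k%:R]) (2 * (F t * G t)).
      by apply: eq_Rintegral => t _; ring.
    rewrite RintegralZl//; last first.
      by apply: integrableS iFG => //; apply: subset_itvl; rewrite bnd_simp.
    by rewrite !expr2 => <-; ring.
  under eq_fun do rewrite E.
  by apply: cvgD; [exact: cvg_cst|apply: cvgM => //; exact: cvg_cst].
have E : 0 = F eps ^+ 2 + 2 * \int[leb]_(r in `[eps, +oo[) (F r * G r) by exact: cvg_unique c3 c4.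
by move: E; move: (Rintegral _ _ _) (F eps ^+ 2) => X Y; lra.
Qed.

End at_infinity.

Section energy_formula.
Context {R : realType} (N : nat).
Context (N3 : (3 <= N)%N).
Notation leb := (@lebesgue_measure R).
Notation mu := (@lebesgue_rV R N).
Notation P := (@punctured R N).
Notation h := (hardy_exp R N).
Notation m := (ball01_mass (R := R) N).
Implicit Types (u : 'rV[R]_N -> R[i]).

Lemma polar_radial_signed (k : R -> R) : measurable_fun setT k ->
  leb.-integrable `]0, +oo[ (fun r => (polw N r * k r)%:E) ->
  mu.-integrable setT (fun x => (k (enorm x))%:E) /\
  \int[mu]_x k (enorm x) = m * \int[leb]_(r in `]0, +oo[) (polw N r * k r).
Proof.
move=> mk ik; have n0 := N_gt0 N3; have /integrableP[mpk fk] := ik.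
have mke : measurable_fun setT (fun x : 'rV[R]_N => k (enorm x)) by exact: measurableT_comp mk (@measurable_enorm R N).
have ike : mu.-integrable setT (fun x => (k (enorm x))%:E).
  apply/integrableP; split; first exact/measurable_EFinP.
  have := @polar_radial R N n0 (fun r => `|(k r)%:E|%E) _ (fun=> abse_ge0 _).
  rewrite /= => ->; last by apply/measurable_EFinP; exact: measurableT_comp.
  apply: lte_mul_pinfty => //; first by rewrite lee_fin ltW// ball01_mass_gt0.
  apply: le_lt_trans fk; rewrite le_eqVlt; apply/orP; left; apply/eqP.
  apply: eq_integral => r; rewrite inE/= in_itv/= andbT => r0.
  by rewrite -EFinM normrM ger0_norm// polw_ge0// ltW.
split=> //.
have i1 : mu.-integrable setT (fun x => (cst 1 x * k (enorm x))%:E) by under eq_fun do rewrite mul1r.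
have m1 : measurable_fun setT (cst 1 : 'rV[R]_N -> R) by exact: measurable_cst.
have [i2 E] := @smean_weight R N n0 (cst 1) k m1 mk i1.
have s1 r : smean (cst 1 : 'rV[R]_N -> R) r = m.
  by rewrite /smean Rintegral_cst ?mul1r//; exact: measurable_ball01.
rewrite (_ : \int[mu]_x k (enorm x) = \int[mu]_x (cst 1 x * k (enorm x))); last first.
  by apply: eq_Rintegral => x _; rewrite mul1r.
rewrite E -RintegralZl//; apply: eq_Rintegral => r _; rewrite s1; ring.
Qed.

Lemma grad_powR_enorm (a : R) x : x != 0 ->
  grad (fun x : 'rV[R]_N => enorm x `^ a) x = (a * enorm x `^ (a - 2)) *: x.
Proof.
move=> x0; have e0 : 0 < enorm x by rewrite enorm_gt0.
apply/rowP => i; rewrite !mxE /partial.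
have [_ ->] := is_derive_comp1 (partial_enorm i x0) (is_derive1_powR a e0).
have -> : enorm x `^ (a - 1) = enorm x `^ (a - 2) * enorm x.
  rewrite -[X in _ * X]powRr1 ?ltW// -powRD; last by apply/implyP => _; rewrite gt_eqF.
  by congr (_ `^ _); ring.
by field; rewrite gt_eqF.
Qed.

(* Undoing the ground state substitution [f = |x|^h part_fun b u]. *)
Lemma wgrad_part b u g : is_wgrad (part_fun b (ground u)) g ->
  is_wgrad (part_fun b u)
    (fun x => enorm x `^ (- h) *: g x + (- h * enorm x `^ (- h - 2) * part_fun b (ground u) x) *: x).
Proof.
move=> wg; have sa k := @Ck_on_radial R N _ k (smooth_powR (R := R) (- h)).
apply: is_wgrad_ext (is_wgrad_mul sa wg) => x x0.
  by rewrite part_ground mulrA [_ `^ _ * _ `^ _]mulrC powR_hardyV// mul1r.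
by rewrite grad_powR_enorm// scalerA [_ * (_ * _)]mulrC.
Qed.

Lemma enorm_comb (a c : R) (g : 'rV[R]_N -> 'rV[R]_N) x :
  enorm (a *: g x + c *: x) ^+ 2 = a ^+ 2 * enorm (g x) ^+ 2 + 2 * a * c * dotx g x + c ^+ 2 * enorm x ^+ 2.
Proof.
rewrite !sqr_enorm /dotx !mulr_sumr -!big_split/=; apply: eq_bigr => i _.
by rewrite !mxE; ring.
Qed.

(** Summed over [b] and integrated over |x| >= eps, the last term is the Hardy term that [I_ext]
    subtracts, and the middle one is an exact radial derivative whose boundary value at eps is
    [Lambda]. *)
Lemma wgrad_part_sqr b u (F G : R -> R) : radial_rep (part_fun b (ground u)) (wgrad (part_fun b (ground u))) F G ->
  {ae mu, forall x, enorm (wgrad (part_fun b u) x) ^+ 2 =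
    enorm x `^ (- (N%:R - 2)) * enorm (wgrad (part_fun b (ground u)) x) ^+ 2
    - 2 * h * (enorm x `^ (- (N%:R - 2)) * (F (enorm x) * G (enorm x)) / enorm x)
    + h ^+ 2 * (enorm x `^ (- (N%:R - 2)) * F (enorm x) ^+ 2 / enorm x ^+ 2)}.
Proof.
move=> [wg _ _ _ fF gG]; have n0 := N_gt0 N3.
apply: filterS2 (filterI (ae_neq0 n0) (wgradE n0 (wgrad_part wg))) (filterI fF gG) => x [x0 ->] [fx gx].
have e0 : 0 < enorm x by rewrite enorm_gt0.
rewrite enorm_comb fx gx -powR_hardy2//.
have -> : enorm x `^ (- h - 2) = enorm x `^ (- h) / enorm x ^+ 2.
  rewrite powRD; last by apply/implyP => _; rewrite gt_eqF.
  by rewrite [X in _ * X]powRN powR_mulrn// ltW.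
by field; rewrite gt_eqF.
Qed.

Section fixed_u.
Context (u : 'rV[R]_N -> R[i]) (F G : bool -> R -> R).
Context (mu_ : cmeasurable setT u).
Context (wu : wdifferentiable (ground u)).
Context (finu : (normH2 u < +oo)%E).
Context (repu : forall b, radial_rep (part_fun b (ground u)) (wgrad (part_fun b (ground u))) (F b) (G b)).

Let n0 := N_gt0 N3.

Lemma mN_gt0 : 0 < m * N%:R.
Proof. by rewrite mulr_gt0 ?ball01_mass_gt0 ?ltr0n// n0. Qed.

Lemma normH2_part b :
  (\int[mu]_x (enorm x `^ (- (N%:R - 2)) * (part_fun b (ground u) x ^+ 2 +
     enorm (wgrad (part_fun b (ground u)) x) ^+ 2))%:E <= normH2 u)%E.
Proof.
have mw := @measurable_powR_enorm R N (- (N%:R - 2)).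
have mg c : measurable_fun setT (part_fun c (ground u)).
  by have [lf _ _] := wgradP c wu; exact: locally_integrable_measurable.
have m1 := measurable_enorm_wgrad (wgradP b wu).
under eq_integral do rewrite mulrDr EFinD.
rewrite ge0_integralD//; last 4 first.
- by move=> x _; rewrite lee_fin mulr_ge0 ?powR_ge0 ?sqr_ge0.
- by apply/measurable_EFinP; apply: measurable_funM => //; apply: measurable_funX.
- by move=> x _; rewrite lee_fin mulr_ge0 ?powR_ge0 ?sqr_ge0.
- by apply/measurable_EFinP; exact: measurable_funM.
rewrite /normH2 addeC; apply: leeD; apply: ae_ge0_le_integral => //.
- by move=> x _; rewrite lee_fin mulr_ge0 ?powR_ge0 ?sqr_ge0.
- by apply/measurable_EFinP; exact: measurable_funM.
- by move=> x _; rewrite lee_fin mulr_ge0 ?powR_ge0// grad_sq_ge0.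
- by apply/measurable_EFinP; apply: measurable_funM => //; exact: measurable_grad_sq.
- by apply: aeW => x _; rewrite lee_fin ler_wpM2l ?powR_ge0// grad_sq_ge.
- by move=> x _; rewrite lee_fin mulr_ge0 ?powR_ge0 ?sqr_ge0.
- by apply/measurable_EFinP; apply: measurable_funM => //; apply: measurable_funX.
- by move=> x _; rewrite lee_fin sqr_ge0.
- by apply/measurable_EFinP; exact: measurable_normc2.
apply: filterS (ae_neq0 n0) => x x0 _; rewrite lee_fin -powR_hardy2// -exprMn part_ground mulrA.
by rewrite [_ `^ _ * _ `^ _]mulrC powR_hardyV// mul1r part_sqr_le.
Qed.

Lemma rep_finite b : (\int[leb]_(r in `]0%R, +oo[) (r * (F b r ^+ 2 + G b r ^+ 2))%:E < +oo)%E.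
Proof.
have := le_lt_trans (le_trans (rep_bound n0 (repu b)) (normH2_part b)) finu.
rewrite ltey => h1; rewrite ltey; apply: contra h1 => /eqP ->.
by rewrite gt0_muley// lte_fin mN_gt0.
Qed.

Definition energyW (x : 'rV[R]_N) : R := enorm x `^ (- (N%:R - 2)) * grad_sq (ground u) x.

Lemma energyW_ge0 x : 0 <= energyW x.
Proof. by rewrite mulr_ge0 ?powR_ge0// grad_sq_ge0. Qed.

Lemma integrable_energyW : mu.-integrable setT (EFin \o energyW).
Proof.
apply/integrableP; split.
  apply/measurable_EFinP; apply: measurable_funM; first exact: measurable_powR_enorm.
  exact: measurable_grad_sq.
under eq_integral do rewrite gee0_abs ?lee_fin ?energyW_ge0//.
apply: le_lt_trans finu; rewrite /normH2 leeDl//.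
by apply: integral_ge0 => x _; rewrite lee_fin sqr_ge0.
Qed.

Lemma measurable_outer (eps : R) : measurable [set x : 'rV[R]_N | eps <= enorm x].
Proof.
have -> : [set x : 'rV[R]_N | eps <= enorm x] = @enorm R N @^-1` `[eps, +oo[%classic.
  by apply/seteqP; split=> x /=; rewrite in_itv/= andbT.
by rewrite -[X in measurable X]setTI; exact: (@measurable_enorm R N).
Qed.

Lemma cvg_outer_energy :
  (\int[mu]_(x in [set x | (eps <= enorm x)%R]) (energyW x)%:E)%E @[eps --> (0 : R)^'+] -->
  (\int[mu]_x (energyW x)%:E)%E.
Proof.
have iW := integrable_energyW.
rewrite -(fineK (integrable_fin_num _ iW))//; apply/cvge_at_rightP => v [v0 vc].
rewrite fineK; last by apply: integrable_fin_num iW.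
have /integrableP[/measurable_EFinP mW _] := iW.
pose f_ (k : nat) (x : 'rV[R]_N) := (energyW x * \1_[set x : 'rV[R]_N | v k <= enorm x] x)%:E.
have [|||||_ _] := @dominated_convergence _ _ _ mu setT measurableT f_ (EFin \o energyW) (abse \o (EFin \o energyW)).
- move=> k; apply/measurable_EFinP; apply: measurable_funM => //.
  exact: measurable_indic (measurable_outer _).
- exact/measurable_EFinP.
- apply: filterS (ae_neq0 n0) => x x0 _; apply: cvg_near_cst.
  have e0 : 0 < enorm x by rewrite enorm_gt0.
  have := vc _ (lt_nbhsl e0); rewrite /= => [[k _ hk]]; exists k => // l /hk /= vl.
  have -> : f_ l x = (energyW x * (x \in [set x : 'rV[R]_N | (v l <= enorm x)%R])%:R)%:E by [].
  have xl : x \in [set x : 'rV[R]_N | (v l <= enorm x)%R] by rewrite inE/= ltW.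
  by rewrite xl mulr1.
- exact: integrable_abse.
- apply: aeW => x k _ /=; rewrite /f_ lee_fin normrM indicE ler_piMr//.
  by case: (x \in _); rewrite ?normr1 ?normr0.
have E (k : nat) : (\int[mu]_x f_ k x = \int[mu]_(x in [set x | (v k <= enorm x)%R]) (energyW x)%:E)%E.
  rewrite [RHS]integral_mkcond; apply: eq_integral => x _; rewrite patchE /f_ indicE.
  by case: (x \in _); rewrite ?mulr1 ?mulr0.
by under eq_fun do rewrite E.
Qed.

(** In polar coordinates all powers of r cancel and N F G remains, which [acp_infty] integrates. *)
Lemma cross_integral b (eps : R) : 0 < eps ->
  mu.-integrable [set x | eps <= enorm x]
    (fun x => (enorm x `^ (- (N%:R - 2)) * (F b (enorm x) * G b (enorm x)) / enorm x)%:E) /\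
  \int[mu]_(x in [set x | eps <= enorm x])
    (enorm x `^ (- (N%:R - 2)) * (F b (enorm x) * G b (enorm x)) / enorm x) =
  - (m * N%:R * (F b eps ^+ 2 / 2)).
Proof.
move=> e0; have [wg aF mF mG _ _] := repu b.
have [iFG EFG] := acp_infty aF e0 (rep_finite b).
pose k r := r `^ (- (N%:R - 2)) * (F b r * G b r) / r * \1_(`[eps, +oo[%classic : set R) r.
have mk : measurable_fun setT k.
  apply: measurable_funM; last exact: measurable_indic.
  apply: measurable_funM; last exact: measurable_inv.
  by apply: measurable_funM; [exact: measurable_powR|exact: measurable_funM].
have mke : measurable_fun setT (fun x : 'rV[R]_N => k (enorm x)) by exact: measurableT_comp mk (@measurable_enorm R N).
have kE r : 0 < r -> polw N r * k r = N%:R * ((F b r * G b r) * \1_(`[eps, +oo[%classic : set R) r).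
  by move=> r0; rewrite /k !mulrA polw_weight ?n0//; field; rewrite gt_eqF.
have sx : (`[eps, +oo[%classic : set R) `<=` `]0, +oo[.
  by move=> r /=; rewrite !in_itv/= !andbT; exact: lt_le_trans.
have res (H : R -> R) r : ((fun r => (H r * \1_(`[eps, +oo[%classic : set R) r)) \_ `]0, +oo[) r = (H \_ `[eps, +oo[) r.
  rewrite !patchE indicE !mem_setE !in_itv/= !andbT; case: (leP eps r) => er; rewrite ?mulr1 ?mulr0.
    by rewrite (lt_le_trans e0).
  by case: ifP.
have i1 : leb.-integrable `]0, +oo[ (fun r => ((F b r * G b r) * \1_(`[eps, +oo[%classic : set R) r)%:E).
  rewrite (_ : (fun r => _) = EFin \o (fun r => (F b r * G b r) * \1_(`[eps, +oo[%classic : set R) r))//.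
  apply/integrable_mkcond => //; rewrite restrict_EFin (funext (res (fun r => F b r * G b r))) -restrict_EFin.
  by rewrite -integrable_mkcond.
have ik : leb.-integrable `]0, +oo[ (fun r => (polw N r * k r)%:E).
  apply: eq_integrable (integrableZl _ N%:R i1) => //.
  by move=> r; rewrite inE/= in_itv/= andbT => r0; rewrite kE.
have [ike E] := polar_radial_signed mk ik.
have mo := measurable_outer eps.
have kx (x : 'rV[R]_N) : k (enorm x) = ((fun x => enorm x `^ (- (N%:R - 2)) * (F b (enorm x) * G b (enorm x)) / enorm x) \_ [set x | eps <= enorm x]) x.
  rewrite patchE /k indicE mem_setE in_itv/= andbT.
  have -> : (x \in [set x | eps <= enorm x]) = (eps <= enorm x) by apply/idP/idP; rewrite inE.
  by case: ifP; rewrite ?mulr1 ?mulr0.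
split.
  apply/(integrable_mkcond (EFin \o _) mo); rewrite restrict_EFin.
  by move: ike; under eq_fun do rewrite kx.
rewrite [LHS]Rintegral_mkcond -(funext kx) E.
transitivity (m * \int[leb]_(r in `]0, +oo[) (N%:R * ((F b r * G b r) * \1_(`[eps, +oo[%classic : set R) r))).
  by congr (_ * _); apply: eq_Rintegral => r; rewrite inE/= in_itv/= andbT => r0; rewrite kE.
rewrite RintegralZl// [X in N%:R * X]Rintegral_mkcond (funext (res (fun r => F b r * G b r))) -Rintegral_mkcond EFG.
by rewrite mulrN mulrN mulrA.
Qed.

Lemma normc2_rep : {ae mu, forall x : 'rV[R]_N, normc (u x) ^+ 2 =
  enorm x `^ (- (N%:R - 2)) * (F true (enorm x) ^+ 2 + F false (enorm x) ^+ 2)}.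
Proof.
apply: filterS3 (ae_neq0 n0) (rep_f (repu true)) (rep_f (repu false)) => x x0 ft ff.
rewrite -ft -ff !part_ground !exprMn -mulrDr mulrA -normc2 -powR_hardy2// -exprMn.
by rewrite [_ `^ _ * _ `^ _]mulrC powR_hardyV// expr1n mul1r.
Qed.

(** The cancellation is exact for every eps, so the limit in the energy is a mere exhaustion of the
    space. Each term is first shown to be finite, which legitimises the subtractions of extended
    reals. *)
Lemma outer_energy w eps : 0 < eps -> approxH w u ->
  (I_ext eps u - Lambda eps u = \int[mu]_(x in [set x | (eps <= enorm x)%R]) (energyW x)%:E)%E.
Proof.
move=> e0 aw; have mo := measurable_outer eps.
set D := [set x : 'rV[R]_N | (eps <= enorm x)%R].
have wu0 : wdifferentiable u.
  have W b := wgrad_part (wgradP b wu).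
  by split; [eexists; exact: (W true)|eexists; exact: (W false)].
pose k1 b x := enorm (x : 'rV[R]_N) `^ (- (N%:R - 2)) * (F b (enorm x) * G b (enorm x)) / enorm x.
pose k2 x := enorm (x : 'rV[R]_N) `^ (- (N%:R - 2)) * (F true (enorm x) ^+ 2 + F false (enorm x) ^+ 2) / enorm x ^+ 2.
have me := @measurable_enorm R N.
have mFe b : measurable_fun setT (fun x : 'rV[R]_N => F b (enorm x)).
  by apply: measurableT_comp me; have [] := repu b.
have mk2 : measurable_fun setT k2.
  apply: measurable_funM; last by apply: (measurableT_comp measurable_inv); exact: measurable_funX.
  apply: measurable_funM; first exact: measurable_powR_enorm.
  by apply: measurable_funD; apply: measurable_funX.
have [i1 E1] := cross_integral true e0; have [i1' E1'] := cross_integral false e0.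
have iW : mu.-integrable D (EFin \o energyW) by apply: integrableS integrable_energyW.
have mn : measurable_fun setT (fun x => normc (u x) ^+ 2 / enorm x ^+ 2).
  apply: measurable_funM; first exact: measurable_normc2.
  by apply: (measurableT_comp measurable_inv); exact: measurable_funX.
have in2 : mu.-integrable D (fun x => (normc (u x) ^+ 2 / enorm x ^+ 2)%:E).
  have iu : mu.-integrable D (fun x => (normc (u x) ^+ 2)%:E).
    apply/integrableP; split; first by apply/measurable_EFinP; apply: measurable_funTS; exact: measurable_normc2.
    apply: (@le_lt_trans _ _ (\int[mu]_x (normc (u x) ^+ 2)%:E)%E).
      apply: (@le_trans _ _ (\int[mu]_x `|(normc (u x) ^+ 2)%:E|)%E).
        apply: ge0_subset_integral => //.
        by apply/measurable_EFinP; apply: measurableT_comp => //; exact: measurable_normc2.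
      by under eq_integral do rewrite gee0_abs ?lee_fin ?sqr_ge0//.
    apply: le_lt_trans finu; rewrite /normH2 leeDr//.
    by apply: integral_ge0 => x _; rewrite lee_fin energyW_ge0.
  apply: (le_integrable _ _ _ (integrableZl _ (eps ^- 2) iu)) => //.
    by apply/measurable_EFinP; exact: measurable_funTS.
  move=> x ex; have x0 : 0 < enorm x by exact: lt_le_trans ex.
  have p1 : 0 <= normc (u x) ^+ 2 / enorm x ^+ 2 by rewrite divr_ge0 ?sqr_ge0.
  have p2 : 0 <= eps ^- 2 * normc (u x) ^+ 2 by rewrite mulr_ge0 ?invr_ge0 ?sqr_ge0.
  rewrite lee_fin (ger0_norm p1) (ger0_norm p2) mulrC ler_wpM2r ?sqr_ge0//.
  by rewrite lef_pV2 ?posrE ?exprn_gt0// lerXn2r ?nnegrE// ltW.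
have aek2 : {ae mu, forall x : 'rV[R]_N, normc (u x) ^+ 2 / enorm x ^+ 2 = k2 x}.
  by apply: filterS normc2_rep => x ->.
have ik2 : mu.-integrable D (EFin \o k2).
  apply/integrableP; split; first by apply/measurable_EFinP; exact: measurable_funTS.
  have /integrableP[_] := in2; apply: le_lt_trans; rewrite le_eqVlt; apply/orP; left; apply/eqP.
  apply: ae_eq_integral => //.
  - by apply/measurable_EFinP; apply: measurable_funTS; exact: measurableT_comp.
  - by apply/measurable_EFinP; apply: measurable_funTS; exact: measurableT_comp.
  by apply: filterS aek2 => x h _; rewrite /= h.
have Ek2 : (\int[mu]_(x in D) (normc (u x) ^+ 2 / enorm x ^+ 2)%:E = (\int[mu]_(x in D) k2 x)%:E)%E.
  rewrite fineK; last by apply: integrable_fin_num ik2.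
  apply: ae_eq_integral => //.
  - by apply/measurable_EFinP; exact: measurable_funTS.
  - by apply/measurable_EFinP; exact: measurable_funTS.
  by apply: filterS aek2 => x h _; rewrite h.
have j1 : mu.-integrable D (EFin \o (fun x => k1 true x + k1 false x)) by apply: integrableD i1 i1'.
have j2 : mu.-integrable D (EFin \o (fun x => - (2 * h) * (k1 true x + k1 false x))).
  by apply: (integrableZl _ (- (2 * h)) j1).
have j3 : mu.-integrable D (EFin \o (fun x => h ^+ 2 * k2 x)) by apply: (integrableZl _ (h ^+ 2) ik2).
have j4 : mu.-integrable D (EFin \o (fun x => - (2 * h) * (k1 true x + k1 false x) + h ^+ 2 * k2 x)).
  by apply: integrableD j2 j3.
have j5 : mu.-integrable D (EFin \o (fun x => energyW x + (- (2 * h) * (k1 true x + k1 false x) + h ^+ 2 * k2 x))).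
  by apply: integrableD iW j4.
have Eg : (\int[mu]_(x in D) (grad_sq u x)%:E =
   (\int[mu]_(x in D) energyW x - 2 * h * (\int[mu]_(x in D) k1 true x + \int[mu]_(x in D) k1 false x)
     + h ^+ 2 * \int[mu]_(x in D) k2 x)%:E)%E.
  have -> : \int[mu]_(x in D) energyW x - 2 * h * (\int[mu]_(x in D) k1 true x + \int[mu]_(x in D) k1 false x)
     + h ^+ 2 * \int[mu]_(x in D) k2 x =
     \int[mu]_(x in D) (energyW x + (- (2 * h) * (k1 true x + k1 false x) + h ^+ 2 * k2 x)).
    rewrite (RintegralD mo iW j4) (RintegralD mo j2 j3) !RintegralZl// (RintegralD mo i1 i1').
    by rewrite mulNr addrA.
  rewrite fineK; last by apply: integrable_fin_num j5.
  apply: ae_eq_integral => //.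
  - by apply/measurable_EFinP; apply: measurable_funTS; exact: measurable_grad_sq.
  - exact: measurable_int j5.
  apply: filterS2 (wgrad_part_sqr (repu true)) (wgrad_part_sqr (repu false)) => x ht hf _.
  congr (_%:E); rewrite /energyW /k1 /k2 {1}/grad_sq.
  rewrite [enorm (wgrad (Re_fun u) x) ^+ 2]ht [enorm (wgrad (Im_fun u) x) ^+ 2]hf /grad_sq.
  rewrite -[Re_fun (ground u)]/(part_fun true (ground u)) -[Im_fun (ground u)]/(part_fun false (ground u)).
  move: (enorm (wgrad _ x)) (enorm (wgrad _ x)) (enorm x `^ _) => y1 y2 y3.
  by ring.
rewrite /I_ext -/D Eg Ek2 /Lambda (trace_integral N3 mu_ wu repu e0 aw) [\int[mu]_(x in D) k1 true x]E1 [\int[mu]_(x in D) k1 false x]E1'.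
rewrite -[RHS]fineK; last by apply: integrable_fin_num iW.
rewrite -[fine _]/(\int[mu]_(x in D) energyW x) -!EFinM -!EFinB; congr (_%:E).
(* The powers of eps in the sphere integral reduce to eps, which the factor 1/eps of [Lambda]
   cancels; only F(eps)^2 depends on eps. *)
have Q : eps ^+ N.-1 * (eps `^ (- h)) ^+ 2 = eps.
  have nz : N%:R != 0 :> R by rewrite pnatr_eq0 -lt0n n0.
  have /(mulfI nz) W : N%:R * (eps ^+ N.-1 * eps `^ (- (N%:R - 2))) = N%:R * eps.
    by rewrite mulrA; exact: polw_weight.
  rewrite -[RHS]W; congr (_ * _); rewrite expr2 -powRD; last by apply/implyP => _; rewrite gt_eqF.
  by rewrite -opprD hardy2.
have -> : h * eps^-1 * (N%:R * eps ^+ N.-1 * m * ((eps `^ (- h)) ^+ 2 * (F true eps ^+ 2 + F false eps ^+ 2))) =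
    h * N%:R * m * (F true eps ^+ 2 + F false eps ^+ 2) * (eps^-1 * (eps ^+ N.-1 * (eps `^ (- h)) ^+ 2)) by ring.
by rewrite Q mulVf ?gt_eqF//; field.
Qed.

Lemma energyE q w : approxH w u ->
  (energy q u = (2^-1)%:E * \int[mu]_x (energyW x)%:E - (q^-1)%:E * \int[mu]_x (normc (u x) `^ q)%:E)%E.
Proof.
move=> aw; rewrite /energy; congr (_ * _ - _)%E; apply/cvg_lim => //.
apply: cvg_trans cvg_outer_energy; apply: near_eq_cvg; near=> eps.
by rewrite (outer_energy _ aw).
Unshelve. all: by end_near. Qed.

End fixed_u.

End energy_formula.

(** * Integrability of the nonlinear term *)

Section bounds.
Context {R : realType}.
Notation leb := (@lebesgue_measure R).

Lemma acp_powR (a : R) : acp (fun r : R => r `^ a) (fun r => a * r `^ (a - 1)).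
Proof.
apply: acp_C1 => r r0.
apply: continuousM; first exact: cst_continuous.
exact: (@smooth_powR R (a - 1) 0%N r r0).
Qed.

Lemma Rint_powR (a x y : R) : a != -1 -> 0 < x -> x <= y ->
  \int[leb]_(t in `[x, y]) t `^ a = (y `^ (a + 1) - x `^ (a + 1)) / (a + 1).
Proof.
move=> a1 x0 xy; have a10 : a + 1 != 0 by rewrite addr_eq0.
have [la H] := acp_powR (a + 1).
rewrite H//; have -> : (fun t : R => (a + 1) * t `^ (a + 1 - 1)) = (fun t => (a + 1) * t `^ a).
  by apply/funext => t; rewrite addrK.
rewrite RintegralZl//; first by rewrite mulrC mulKf.
have := locintZ (a + 1)^-1 la; move=> /(_ x y x0); apply: eq_integrable => // t _ /=.
by rewrite addrK mulKf.
Qed.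

Lemma integral_near0 (f : R -> R) (K : R) : measurable_fun (`]0, 1]%classic : set R) f ->
  (forall r, 0 < r <= 1 -> 0 <= f r) ->
  (forall a, 0 < a <= 1 -> (\int[leb]_(r in `[a, 1%R]) (f r)%:E <= K%:E)%E) ->
  (\int[leb]_(r in `]0%R, 1%R]) (f r)%:E <= K%:E)%E.
Proof.
move=> mf f0 H.
pose I (k : nat) : set R := `[k.+1%:R^-1, 1%R]%classic.
pose f_ (k : nat) (x : R) := (f x * \1_(I k) x)%:E.
have mI0 k : measurable (I k) by exact: measurable_itv.
have mI k : measurable_fun setT (\1_(I k) : R -> R) by exact: measurable_indic.
have mf_ k : measurable_fun (`]0, 1]%classic : set R) (f_ k).
  by apply/measurable_EFinP; apply: measurable_funM mf _; exact: measurable_funTS (mI k).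
have f_0 k x : (`]0, 1]%classic : set R) x -> (0 <= f_ k x)%E.
  by rewrite /= in_itv/= => x01; rewrite lee_fin mulr_ge0 ?f0.
have f_homo x : (`]0, 1]%classic : set R) x -> {homo f_^~ x : k l / (k <= l)%N >-> (k <= l)%E}.
  rewrite /= in_itv/= => x01 k l kl; rewrite lee_fin ler_wpM2l ?f0//.
  rewrite /I !indicE !mem_setE !in_itv/=; case: (leP k.+1%:R^-1 x) => //= kx.
  by rewrite (le_trans _ kx)// lef_pV2 ?posrE// ler_nat.
have c := @cvg_monotone_convergence _ _ _ leb _ (measurable_itv _) f_ mf_ f_0 f_homo.
have E : (\int[leb]_(x in `]0%R, 1%R]) (limn (f_^~ x)) = \int[leb]_(x in `]0%R, 1%R]) (f x)%:E)%E.
  apply: eq_integral => x; rewrite inE/= in_itv/= => /andP[x0 x1].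
  apply/cvg_lim => //; apply: cvg_near_cst; exists (Num.bound x^-1) => // k /= hk.
  rewrite /f_ indicE mem_setE in_itv/= x1 andbT.
  have -> : k.+1%:R^-1 <= x.
    rewrite -[x]invrK lef_pV2 ?posrE ?invr_gt0// ltW// (lt_trans (archi_boundP _)) ?invr_ge0 ?(ltW x0)//.
    by rewrite ltr_nat ltnS.
  by rewrite mulr1.
rewrite -E; have /cvg_lim <- // := c; apply: lime_le; first by apply/cvg_ex; eexists; exact: c.
apply: nearW => k.
apply: le_trans (H k.+1%:R^-1 _); last by rewrite invr_gt0 ltr0n invf_le1// ler1n.
rewrite le_eqVlt; apply/orP; left; apply/eqP; rewrite [LHS]integral_mkcond [RHS]integral_mkcond.
apply: eq_integral => x _; rewrite !patchE /f_ indicE !mem_setE !in_itv/=.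
case: (ltP 0 x) => x0 /=; first by case: (x <= 1); rewrite ?andbT ?andbF//; case: ifP; rewrite ?mulr1 ?mulr0.
by rewrite leNgt (le_lt_trans x0)// invr_gt0.
Qed.

(** |G| <= t G^2 + 1/t, and 1/t <= t^(-d-1) on ]0, 1]. Integrated over [r, 1], the first part is at
    most the finite weighted integral and the second at most r^(-d) / d. *)
Lemma acp_near0 (F G : R -> R) (d : R) : acp F G -> 0 < d ->
  (\int[leb]_(r in `]0%R, +oo[) (r * (F r ^+ 2 + G r ^+ 2))%:E < +oo)%E ->
  exists C, forall r, 0 < r <= 1 -> `|F r| <= C * r `^ (- d).
Proof.
move=> aF d0 fin; have [lG HF] := aF.
set T := (\int[leb]_(r in _) _)%E in fin.
have mF : measurable_fun (`]0, +oo[%classic : set R) F by exact: locint_measurable (acp_locint aF).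
have mG : measurable_fun (`]0, +oo[%classic : set R) G by exact: locint_measurable lG.
have mQ : measurable_fun (`]0, +oo[%classic : set R) (fun r => r * (F r ^+ 2 + G r ^+ 2)).
  by apply: measurable_funM => //; apply: measurable_funD; exact: measurable_funX.
have T0 : (0 <= T)%E.
  apply: integral_ge0 => r /=; rewrite in_itv/= andbT => r0.
  by rewrite lee_fin mulr_ge0 ?addr_ge0 ?sqr_ge0// ltW.
have Tfin : T \is a fin_num by rewrite ge0_fin_numE.
exists (`|F 1| + (fine T + d^-1)) => r /andP[r0 r1].
have rd1 : 1 <= r `^ (- d).
  by rewrite -(powRr0 r) ger_powR ?r0 ?r1// oppr_le0 ltW.
have iG : leb.-integrable `[r, 1] (EFin \o G) by exact: lG.
have iaG : leb.-integrable `[r, 1] (EFin \o (fun t => `|G t|)) by have /integrable_abse := iG.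
have h1 : `|F 1 - F r| <= \int[leb]_(t in `[r, 1]) `|G t|.
  by rewrite HF//; exact: le_normr_Rintegral.
have sub : `[r, 1]%classic `<=` (`]0, +oo[%classic : set R).
  by move=> t /=; rewrite !in_itv/= andbT => /andP[rt _]; exact: lt_le_trans rt.
have iQ0 : leb.-integrable `]0, +oo[ (EFin \o (fun t => t * (F t ^+ 2 + G t ^+ 2))).
  apply/integrableP; split; first exact/measurable_EFinP.
  apply: le_lt_trans fin; rewrite le_eqVlt; apply/orP; left; apply/eqP.
  apply: eq_integral => t; rewrite inE/= in_itv/= andbT => t0.
  by rewrite /= ger0_norm// mulr_ge0 ?addr_ge0 ?sqr_ge0// ltW.
have iQ : leb.-integrable `[r, 1] (EFin \o (fun t => t * (F t ^+ 2 + G t ^+ 2))).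
  by apply: integrableS iQ0.
have iP : leb.-integrable `[r, 1] (EFin \o (fun t => t `^ (- d - 1))).
  by have := acp_locint (acp_powR (- d - 1)); exact.
have h2 : \int[leb]_(t in `[r, 1]) `|G t| <= \int[leb]_(t in `[r, 1]) (t * (F t ^+ 2 + G t ^+ 2) + t `^ (- d - 1)).
  apply: le_Rintegral => //.
    by apply: integrableD iQ iP.
  move=> t /=; rewrite in_itv/= => /andP[rt t1].
  have t0 : 0 < t by exact: lt_le_trans rt.
  have tt : t^-1 <= t `^ (- d - 1).
    rewrite powRD; last by apply/implyP => _; rewrite gt_eqF.
    rewrite powR_inv1 ?(ltW t0)// ler_peMl ?invr_ge0 ?(ltW t0)//.
    by rewrite -(powRr0 t) ger_powR ?t0 ?t1// oppr_le0 ltW.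
  apply: (@le_trans _ _ (t * G t ^+ 2 + t^-1)); last by rewrite lerD// ler_wpM2l ?(ltW t0)// lerDr sqr_ge0.
  rewrite -(ler_pM2l t0) mulrDr divff ?gt_eqF// -[G t ^+ 2]real_normK ?num_real//.
  by have := sqr_ge0 (t * `|G t| - 1); have : 0 <= t * `|G t| by [rewrite mulr_ge0// ltW]; nra.
have h3 : \int[leb]_(t in `[r, 1]) (t * (F t ^+ 2 + G t ^+ 2) + t `^ (- d - 1)) <= fine T + d^-1 * r `^ (- d).
  rewrite RintegralD//; apply: lerD.
    apply: fine_le => //; first exact: integrable_fin_num iQ.
    apply: ge0_subset_integral => //; first exact/measurable_EFinP.
    by move=> t /=; rewrite in_itv/= andbT => t0; rewrite lee_fin mulr_ge0 ?addr_ge0 ?sqr_ge0// ltW.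
  rewrite Rint_powR//; last by rewrite subr_eq addNr oppr_eq0 gt_eqF.
  rewrite subrK powR1 invrN mulrN -mulNr opprB mulrC ler_wpM2l ?invr_ge0 ?(ltW d0)//.
  by rewrite gerBl.
have : `|F r| <= `|F 1| + `|F 1 - F r|.
  by rewrite -[F r in leLHS](subKr (F 1)) (le_trans (ler_normB _ _)).
move=> /le_trans; apply; rewrite mulrDl; apply: lerD; first by rewrite ler_peMr.
apply: le_trans h1 (le_trans h2 (le_trans h3 _)); rewrite mulrDl; apply: lerD => //.
by rewrite ler_peMr// fine_ge0.
Qed.

Lemma acp_far (F G : R -> R) : acp F G ->
  (\int[leb]_(r in `]0%R, +oo[) (r * (F r ^+ 2 + G r ^+ 2))%:E < +oo)%E ->
  exists C, forall r, 1 <= r -> F r ^+ 2 <= C.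
Proof.
move=> aF fin; have [lG _] := aF.
set T := (\int[leb]_(r in _) _)%E in fin.
have mF : measurable_fun (`]0, +oo[%classic : set R) F by exact: locint_measurable (acp_locint aF).
have mG : measurable_fun (`]0, +oo[%classic : set R) G by exact: locint_measurable lG.
have T0 : (0 <= T)%E.
  apply: integral_ge0 => r /=; rewrite in_itv/= andbT => r0.
  by rewrite lee_fin mulr_ge0 ?addr_ge0 ?sqr_ge0// ltW.
have Tfin : T \is a fin_num by rewrite ge0_fin_numE.
(* 4 bounds the factor 2 / r^2 + 2 of [acp_pointwise] for r >= 1. *)
exists (4 * fine T) => r r1; have r0 : 0 < r by exact: lt_le_trans r1.
rewrite -lee_fin [X in (_ <= X)%E]EFinM fineK//; apply: le_trans (acp_pointwise aF r0) _.
have nn : (0 <= \int[leb]_(x in `[r, +oo[) (x * (F x ^+ 2 + G x ^+ 2))%:E)%E.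
  apply: integral_ge0 => x /=; rewrite in_itv/= andbT => rx.
  by rewrite lee_fin mulr_ge0 ?addr_ge0 ?sqr_ge0// ltW// (lt_le_trans r0).
apply: (@le_trans _ _ (4%:E * \int[leb]_(x in `[r, +oo[) (x * (F x ^+ 2 + G x ^+ 2))%:E)%E).
  apply: lee_wpmul2r => //; rewrite lee_fin.
  have : r ^- 2 <= 1 by rewrite invf_le1 ?exprn_gt0// exprn_ege1.
  by move: (r ^- 2) => X; lra.
apply: lee_wpmul2l; first by rewrite lee_fin.
apply: ge0_subset_integral => //.
- by apply/measurable_EFinP; apply: measurable_funM => //; apply: measurable_funD; exact: measurable_funX.
- by move=> x /=; rewrite in_itv/= andbT => x0; rewrite lee_fin mulr_ge0 ?addr_ge0 ?sqr_ge0// ltW.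
- by move=> x /=; rewrite !in_itv/= !andbT; exact: lt_le_trans.
Qed.

(* Subcriticality enters here: the weight has exponent [s > -1] and [s - 1 <= 0]. *)
Lemma subcritical_integrable (F G : bool -> R -> R) (s p : R) : (forall b, acp (F b) (G b)) ->
  (forall b, measurable_fun setT (F b)) -> -1 < s -> s <= 1 -> 1 < p ->
  (forall b, \int[leb]_(r in `]0%R, +oo[) (r * (F b r ^+ 2 + G b r ^+ 2))%:E < +oo)%E ->
  leb.-integrable `]0, +oo[ (fun r => (r `^ s * (F true r ^+ 2 + F false r ^+ 2) `^ p)%:E).
Proof.
move=> aF mF s1 s2 p1 fin.
pose X r := F true r ^+ 2 + F false r ^+ 2.
have X0 r : 0 <= X r by rewrite addr_ge0 ?sqr_ge0.
have mX : measurable_fun setT X by apply: measurable_funD; exact: measurable_funX.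
have p0 : 0 < p by exact: lt_trans p1.
have mI : measurable_fun setT (fun r : R => r `^ s * X r `^ p).
  apply: measurable_funM; first exact: measurable_powR.
  exact: measurableT_comp (measurable_powR p) mX.
have I0 r : 0 <= r `^ s * X r `^ p by rewrite mulr_ge0 ?powR_ge0.
have E : (`]0, +oo[%classic : set R) = `]0, 1] `|` `]1, +oo[.
  apply/seteqP; split=> r /=; rewrite !in_itv/= !andbT.
    by move=> r0; case: (leP r 1) => r1; [left; rewrite r0|right].
  by case=> [/andP[]//|]; exact: lt_trans.
suff h : (\int[leb]_(r in `]0%R, +oo[) (r `^ s * X r `^ p)%:E < +oo)%E.
  apply/integrableP; split; first by apply/measurable_EFinP; exact: measurable_funTS.
  apply: le_lt_trans h; rewrite le_eqVlt; apply/orP; left; apply/eqP.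
  by apply: eq_integral => r _; rewrite /= ger0_norm.
rewrite E ge0_integral_setU//; last 3 first.
- by rewrite -E; apply/measurable_EFinP; exact: measurable_funTS.
- by move=> r _; rewrite lee_fin.
- apply/disj_setPLR => r /=; rewrite !in_itv/= andbT => /andP[_ r1].
  by apply/negP; rewrite -leNgt.
have lo : (\int[leb]_(r in `]0%R, 1%R]) (r `^ s * X r `^ p)%:E < +oo)%E.
  (* Chosen so that s - 2 d p = (s - 1) / 2, the midpoint of -1 and s, still an integrable exponent
     at 0. *)
  pose d := (s + 1) / (4 * p).
  have d0 : 0 < d by rewrite divr_gt0 ?mulr_gt0// -ltrBlDr sub0r.
  have [C1 H1] := acp_near0 (aF true) d0 (fin true).
  have [C2 H2] := acp_near0 (aF false) d0 (fin false).
  pose K := C1 ^+ 2 + C2 ^+ 2.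
  have K0 : 0 <= K by rewrite addr_ge0 ?sqr_ge0.
  have e0 : 0 < (s + 1) / 2 by rewrite divr_gt0// -ltrBlDr sub0r.
  have bd r : 0 < r <= 1 -> r `^ s * X r `^ p <= K `^ p * r `^ ((s - 1) / 2).
    move=> r01; have /andP[r0 r1] := r01.
    have sq b C : `|F b r| <= C * r `^ (- d) -> F b r ^+ 2 <= C ^+ 2 * r `^ (- (2 * d)).
      move=> h; rewrite -[F b r ^+ 2]real_normK ?num_real//.
      have -> : C ^+ 2 * r `^ (- (2 * d)) = (C * r `^ (- d)) ^+ 2.
        rewrite exprMn [X in _ = _ * X]expr2 -powRD; last by apply/implyP => _; rewrite gt_eqF.
        by rewrite -opprD -mulr2n mulr_natl.
      by rewrite lerXn2r ?nnegrE// (le_trans _ h).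
    have XK : X r <= K * r `^ (- (2 * d)) by rewrite mulrDl lerD ?sq ?H1 ?H2.
    have Xp : X r `^ p <= (K * r `^ (- (2 * d))) `^ p.
      by apply: ge0_ler_powR => //; rewrite ?nnegrE ?mulr_ge0 ?powR_ge0// ltW.
    apply: le_trans (ler_wpM2l (powR_ge0 _ _) Xp) _.
    rewrite powRM ?powR_ge0// -powRrM mulrCA -powRD; last by apply/implyP => _; rewrite gt_eqF.
    have -> // : s + - (2 * d) * p = (s - 1) / 2.
    by rewrite /d; field; rewrite gt_eqF.
  apply: (@le_lt_trans _ _ ((K `^ p * ((s + 1) / 2)^-1)%:E)); last exact: ltry.
  apply: integral_near0 => [|r r01|a /andP[a0 a1]] //; first exact: measurable_funTS.
  have iP : leb.-integrable `[a, 1] (EFin \o (fun t => t `^ ((s - 1) / 2))).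
    by have := acp_locint (acp_powR ((s - 1) / 2)); exact.
  have iP' : leb.-integrable `[a, 1] (EFin \o (fun t => K `^ p * t `^ ((s - 1) / 2))).
    by apply: (integrableZl _ (K `^ p) iP).
  apply: (@le_trans _ _ (\int[leb]_(r in `[a, 1%R]) (K `^ p * r `^ ((s - 1) / 2))%:E)%E).
    apply: ge0_le_integral => //.
    - by move=> r _; rewrite lee_fin.
    - by apply/measurable_EFinP; exact: measurable_funTS.
    - exact: measurable_int iP'.
    move=> r /=; rewrite in_itv/= => /andP[ar r1]; rewrite lee_fin bd// r1 andbT.
    exact: lt_le_trans ar.
  rewrite -[X in (X <= _)%E]fineK; last by apply: integrable_fin_num iP'.
  rewrite lee_fin -[fine _]/(\int[leb]_(r in `[a, 1]) (K `^ p * r `^ ((s - 1) / 2))).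
  rewrite RintegralZl// Rint_powR//; last by rewrite -subr_eq0 opprK gt_eqF//; move: e0; lra.
  apply: ler_wpM2l; first exact: powR_ge0.
  have -> : (s - 1) / 2 + 1 = (s + 1) / 2 by field.
  by rewrite ler_pdivrMr// mulVf ?gt_eqF// powR1 gerBl powR_ge0.
apply: lte_add_pinfty => //.
have [C1 H1] := acp_far (aF true) (fin true).
have [C2 H2] := acp_far (aF false) (fin false).
pose K := C1 + C2.
(* Far out, r^s <= r because s <= 1, and boundedness of [X] lowers the power p to 1; what remains is
   controlled by the weighted integral. *)
have bd r : 1 <= r -> r `^ s * X r `^ p <= K `^ (p - 1) * (r * X r).
  move=> r1; have XK : X r <= K by rewrite lerD ?H1 ?H2.
  have r0 : 0 < r by exact: lt_le_trans r1.
  have K0 : 0 <= K by exact: le_trans XK.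
  have rs : r `^ s <= r by rewrite -[leRHS]powRr1 ?(ltW r0)// ler_powR.
  have Xp : X r `^ p <= K `^ (p - 1) * X r.
    have [->|X1] := eqVneq (X r) 0; first by rewrite powR0 ?gt_eqF// mulr0.
    rewrite -(@mulr_powRB1 _ (X r) p)// mulrC ler_wpM2r// ge0_ler_powR ?nnegrE ?subr_ge0//.
    exact: ltW.
  by rewrite mulrCA ler_pM// ?powR_ge0.
have T b : (\int[leb]_(r in `]1%R, +oo[) (r * (F b r ^+ 2))%:E < +oo)%E.
  apply: le_lt_trans (fin b).
  have mG : measurable_fun (`]0, +oo[%classic : set R) (G b) by exact: locint_measurable (aF b).1.
  have mQ : measurable_fun (`]0, +oo[%classic : set R) (fun r => r * (F b r ^+ 2 + G b r ^+ 2)).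
    by apply: measurable_funM => //; apply: measurable_funD; apply: measurable_funX => //; exact: measurable_funTS.
  have sub : (`]1, +oo[%classic : set R) `<=` `]0, +oo[.
    by move=> r /=; rewrite !in_itv/= !andbT; exact: lt_trans.
  apply: (@le_trans _ _ (\int[leb]_(r in `]1%R, +oo[) (r * (F b r ^+ 2 + G b r ^+ 2))%:E)%E).
    apply: ge0_le_integral => //.
    - move=> r /=; rewrite in_itv/= andbT => r1; rewrite lee_fin mulr_ge0 ?sqr_ge0//.
      by rewrite ltW// (lt_trans _ r1).
    - apply/measurable_EFinP; apply: measurable_funTS; apply: measurable_funM => //.
      exact: (measurable_funX 2 (mF b)).
    - by apply/measurable_EFinP; exact: measurable_funS mQ.
    move=> r /=; rewrite in_itv/= andbT => r1; rewrite lee_fin ler_wpM2l ?lerDl ?sqr_ge0//.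
    by rewrite ltW// (lt_trans _ r1).
  apply: ge0_subset_integral => //; first exact/measurable_EFinP.
  by move=> r /=; rewrite in_itv/= andbT => r0; rewrite lee_fin mulr_ge0 ?addr_ge0 ?sqr_ge0// ltW.
have mr b : measurable_fun (`]1, +oo[%classic : set R) (fun r => r * F b r ^+ 2).
  by apply: measurable_funTS; apply: measurable_funM => //; exact: (measurable_funX 2 (mF b)).
have mr' b : measurable_fun (`]1, +oo[%classic : set R) (fun r => (r * F b r ^+ 2)%:E).
  exact/measurable_EFinP.
have nr b r : (`]1, +oo[%classic : set R) r -> 0 <= r * F b r ^+ 2.
  by rewrite /= in_itv/= andbT => r1; rewrite mulr_ge0 ?sqr_ge0// ltW// (lt_trans _ r1).
apply: (@le_lt_trans _ _ (\int[leb]_(r in `]1%R, +oo[) ((K `^ (p - 1))%:E * ((r * F true r ^+ 2)%:E + (r * F false r ^+ 2)%:E)))%E).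
  apply: ge0_le_integral => //.
  - by move=> r _; rewrite lee_fin.
  - by apply/measurable_EFinP; exact: measurable_funTS.
  - apply: measurable_funeM; exact: emeasurable_funD (mr' true) (mr' false).
  move=> r /=; rewrite in_itv/= andbT => r1; rewrite -EFinD -EFinM lee_fin -mulrDr bd//; exact: ltW.
rewrite ge0_integralZl//; last 3 first.
- exact: emeasurable_funD (mr' true) (mr' false).
- by move=> r r1; rewrite adde_ge0// lee_fin nr.
- by rewrite lee_fin powR_ge0.
rewrite ge0_integralD//; last 4 first.
- by move=> r r1; rewrite lee_fin nr.
- exact: mr' true.
- by move=> r r1; rewrite lee_fin nr.
- exact: mr' false.
have t0 b : (0 <= \int[leb]_(r in `]1%R, +oo[) (r * (F b r ^+ 2))%:E)%E.
  by apply: integral_ge0 => r r1; rewrite lee_fin nr.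
by rewrite lte_mul_pinfty ?lee_fin ?powR_ge0// lte_add_pinfty.
Qed.

End bounds.

(** * Competitors *)

Section competitor.
Context {R : realType} (N : nat) (N3 : (3 <= N)%N).
Notation leb := (@lebesgue_measure R).
Notation mu := (@lebesgue_rV R N).
Notation P := (@punctured R N).
Notation h := (hardy_exp R N).
Notation m := (ball01_mass (R := R) N).
Let n0 := N_gt0 N3.

Lemma grad_radial (e : R -> R) x : smooth setT e -> x != 0 ->
  grad (fun x : 'rV[R]_N => e (enorm x)) x = ((e^`())%classic (enorm x) / enorm x) *: x.
Proof.
move=> se x0; apply/rowP => i; rewrite !mxE /partial.
have de : is_derive (enorm x) 1 e ((e^`())%classic (enorm x)).
  by rewrite derive1E; apply: DeriveDef => //; exact: (smooth_derivable se).
have [_ ->] := is_derive_comp1 (partial_enorm i x0) de.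
by rewrite mulrA mulrAC.
Qed.

Lemma test1_le0 (e : R -> R) (r : R) : test1 e -> r <= 0 -> e r = 0.
Proof.
move=> [_ [a [b [a0 H]]]] r0; apply: H; apply/negP => /andP[ar _].
by move: (lt_le_trans a0 (le_trans ar r0)); rewrite ltxx.
Qed.

Lemma test1_measurable (e : R -> R) : test1 e -> measurable_fun setT e.
Proof.
by move=> [se _]; apply: continuous_measurable_fun => x; exact: (se 0%N).
Qed.

Lemma radial_test (K k e : R -> R) : measurable_fun setT K -> locint k -> test1 e ->
  (forall r, 0 < r -> polw N r * K r = N%:R * k r) ->
  mu.-integrable setT (fun x => (K (enorm x) * e (enorm x))%:E) /\
  \int[mu]_x (K (enorm x) * e (enorm x)) = m * N%:R * \int[leb]_x (k x * e x).
Proof.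
move=> mK lk te Kk.
have ik := integrable_test1 lk te.
have me := test1_measurable te.
have i1 : leb.-integrable `]0, +oo[ (fun r => (polw N r * (K r * e r))%:E).
  have : leb.-integrable `]0, +oo[ (fun r => (N%:R)%:E * (k r * e r)%:E)%E.
    by apply: integrableZl => //; apply: integrableS ik.
  apply: eq_integrable => // r; rewrite inE/= in_itv/= andbT => r0.
  by rewrite mulrA Kk// -EFinM mulrA.
have [|H1 H2] := polar_radial_signed N3 (k := fun r => K r * e r) _ i1; first exact: measurable_funM.
split=> //; rewrite H2 -mulrA; congr (_ * _).
rewrite -RintegralZl// [LHS]Rintegral_mkcond; apply: eq_Rintegral => r _.
rewrite patchE mem_setE in_itv/= andbT; case: ltP => r0; first by rewrite mulrA Kk// mulrA.
by rewrite (test1_le0 te r0) !mulr0.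
Qed.

(** A convex function lies above its tangent. The inequality is extracted from Young's inequality
    for Y and X^(p-1) with exponents p and p/(p-1), so X = 0 needs no separate treatment. *)
Lemma powR_tangent (X Y p : R) : 0 <= X -> 0 <= Y -> 1 < p ->
  X `^ p + p * (X `^ (p - 1) * (Y - X)) <= Y `^ p.
Proof.
move=> X0 Y0 p1; have p0 : 0 < p by exact: lt_trans p1.
have pm : 0 < p - 1 by rewrite subr_gt0.
have q0 : 0 < p / (p - 1) by rewrite divr_gt0.
have Hq : p^-1 + (p / (p - 1))^-1 = 1 by field; rewrite !gt_eqF.
have := conjugate_powR Y0 (powR_ge0 X (p - 1)) p0 q0 Hq.
rewrite -powRrM.
have -> : (p - 1) * (p / (p - 1)) = p by field; rewrite gt_eqF.
have <- : X * X `^ (p - 1) = X `^ p by exact: mulr_powRB1.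
move: (X `^ (p - 1)) (Y `^ p) => A B H.
have {}H : p * (Y * A) <= B + X * A * (p - 1).
  rewrite -ler_pdivlMl//; apply: le_trans H _.
  rewrite le_eqVlt; apply/orP; left; apply/eqP; field.
  by rewrite !gt_eqF.
have -> : X * A + p * (A * (Y - X)) = p * (Y * A) - X * A * (p - 1) by ring.
by rewrite lerBlDr.
Qed.

Lemma normc_ge0 (z : R[i]) : 0 <= normc z.
Proof. by case: z => a b; exact: sqrtr_ge0. Qed.

Lemma enormZ2 (c : R) (x : 'rV[R]_N) : enorm (c *: x) ^+ 2 = c ^+ 2 * enorm x ^+ 2.
Proof. by rewrite enormZ exprMn real_normK ?num_real. Qed.

Lemma wdifferentiableP (u : 'rV[R]_N -> R[i]) (g : bool -> 'rV[R]_N -> 'rV[R]_N) :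
  (forall b, is_wgrad (part_fun b u) (g b)) -> wdifferentiable u.
Proof. by move=> W; split; [exists (g true); exact: (W true)|exists (g false); exact: (W false)]. Qed.

Lemma cmeasurableP (u : 'rV[R]_N -> R[i]) :
  (forall b, measurable_fun setT (part_fun b u)) -> cmeasurable setT u.
Proof. by move=> H; split; [exact: (H true)|exact: (H false)]. Qed.

Lemma grad_sqE (u : 'rV[R]_N -> R[i]) x :
  grad_sq u x = enorm (wgrad (part_fun true u) x) ^+ 2 + enorm (wgrad (part_fun false u) x) ^+ 2.
Proof. by []. Qed.

Lemma wgrad_groundZ b (c : R) (f : 'rV[R]_N -> R[i]) : wdifferentiable (ground f) ->
  is_wgrad (part_fun b (ground (fun x => c%:C * f x))) (fun x => c *: wgrad (part_fun b (ground f)) x).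
Proof.
move=> wf; have W := is_wgrad_lin c 0 (wgradP b wf) (wgradP b wf).
apply: is_wgrad_ext W => x x0; last by rewrite scale0r addr0.
by rewrite mul0r addr0 !part_ground part_realM mulrCA.
Qed.

Lemma normH2Z (c : R) (f : 'rV[R]_N -> R[i]) : cmeasurable setT f -> wdifferentiable (ground f) ->
  normH2 (fun x => c%:C * f x) = ((c ^+ 2)%:E * normH2 f)%E.
Proof.
move=> mf wf; have W b := wgrad_groundZ b c wf.
have wcf := wdifferentiableP W.
have mw := @measurable_powR_enorm R N (- (N%:R - 2)).
rewrite /normH2 ge0_muleDr; last 2 first.
- by apply: integral_ge0 => x _; rewrite lee_fin mulr_ge0 ?powR_ge0// grad_sq_ge0.
- by apply: integral_ge0 => x _; rewrite lee_fin sqr_ge0.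
rewrite -!ge0_integralZl//; last 6 first.
- by apply/measurable_EFinP; exact: measurable_normc2.
- by move=> x _; rewrite lee_fin sqr_ge0.
- by rewrite lee_fin sqr_ge0.
- by apply/measurable_EFinP; apply: measurable_funM => //; exact: measurable_grad_sq.
- by move=> x _; rewrite lee_fin mulr_ge0 ?powR_ge0// grad_sq_ge0.
- by rewrite lee_fin sqr_ge0.
congr (_ + _)%E; last first.
  by apply: eq_integral => x _; rewrite -EFinM !normc2 !part_realM !exprMn mulrDr.
apply: ae_eq_integral => //.
- by apply/measurable_EFinP; apply: measurable_funM => //; exact: measurable_grad_sq.
- apply: measurable_funeM; apply/measurable_EFinP; apply: measurable_funM => //; exact: measurable_grad_sq.
apply: filterS2 (wgradE n0 (W true)) (wgradE n0 (W false)) => x wt wf' _.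
have E : grad_sq (ground (fun x => c%:C * f x)) x = c ^+ 2 * grad_sq (ground f) x.
  transitivity (enorm (c *: wgrad (part_fun true (ground f)) x) ^+ 2 +
                enorm (c *: wgrad (part_fun false (ground f)) x) ^+ 2).
    by apply: (congr2 (fun a b => enorm a ^+ 2 + enorm b ^+ 2)); [exact: wt|exact: wf'].
  exact: etrans (congr2 +%R (enormZ2 _ _) (enormZ2 _ _)) (esym (mulrDr _ _ _)).
by rewrite -EFinM E mulrCA.
Qed.

Section varied.
Context (u : 'rV[R]_N -> R[i]) (F G : bool -> R -> R) (eta : bool -> R -> R).
Context (mu_ : cmeasurable setT u).
Context (wu : wdifferentiable (ground u)).
Context (finu : (normH2 u < +oo)%E).
Context (repu : forall b, radial_rep (part_fun b (ground u)) (wgrad (part_fun b (ground u))) (F b) (G b)).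
Context (teta : forall b, test1 (eta b)).

(** The substitution turns this perturbation into the pair of radial test functions [eta], one for
    each component, supported away from the origin. *)
Definition bumpH (x : 'rV[R]_N) : R[i] :=
  (enorm x `^ (- h))%:C * (eta true (enorm x) +i* eta false (enorm x)).
Definition varied (c t : R) (x : 'rV[R]_N) : R[i] := c%:C * (u x + t%:C * bumpH x).

Lemma part_bumpH b x : part b (bumpH x) = enorm x `^ (- h) * eta b (enorm x).
Proof. by rewrite /bumpH part_realM; case: b. Qed.

Lemma part_varied b c t x : part b (varied c t x) = c * (part b (u x) + t * (enorm x `^ (- h) * eta b (enorm x))).
Proof. by rewrite /varied part_realM partD part_realM part_bumpH. Qed.

Lemma part_ground_varied b c t x : x != 0 ->
  part_fun b (ground (varied c t)) x = c * part_fun b (ground u) x + c * t * eta b (enorm x).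
Proof.
move=> x0; rewrite !part_ground part_varied.
have H := powR_hardyV x0.
rewrite -[X in _ = _ + _ * X](mul1r (eta b _)) -H.
by ring.
Qed.

Lemma wgrad_varied b c t : is_wgrad (part_fun b (ground (varied c t)))
  (fun x => c *: wgrad (part_fun b (ground u)) x + (c * t * (((eta b)^`())%classic (enorm x) / enorm x)) *: x).
Proof.
have se : forall k, Ck_on P k (fun x : 'rV[R]_N => eta b (enorm x)).
  move=> k; apply: Ck_on_radial => j; apply: Cn_sub (proj1 (teta b) j); exact: subsetT.
have W := is_wgrad_lin c (c * t) (wgradP b wu) (is_wgrad_smooth se).
apply: is_wgrad_ext W => x x0; first by rewrite part_ground_varied.
by rewrite grad_radial ?scalerA//; exact: (proj1 (teta b)).
Qed.

Lemma wdifferentiable_varied c t : wdifferentiable (ground (varied c t)).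
Proof. exact: wdifferentiableP (fun b => wgrad_varied b c t). Qed.

Lemma cmeasurable_varied c t : cmeasurable setT (varied c t).
Proof.
apply: cmeasurableP => b.
have -> : part_fun b (varied c t) = fun x => c * (part_fun b u x + t * (enorm x `^ (- h) * eta b (enorm x))).
  by apply/funext => x; rewrite /part_fun part_varied.
apply: measurable_funM => //; apply: measurable_funD; first exact: cmeasurable_part.
apply: measurable_funM => //; apply: measurable_funM; first exact: measurable_powR_enorm.
exact: measurableT_comp (test1_measurable (teta b)) (@measurable_enorm R N).
Qed.

Lemma rep_varied b c t :
  radial_rep (part_fun b (ground (varied c t))) (wgrad (part_fun b (ground (varied c t))))
    (fun r => c * F b r + c * t * eta b r) (fun r => c * G b r + c * t * ((eta b)^`())%classic r).
Proof.
have [se _] := teta b.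
apply: (radial_rep_acp n0 (wgradP b (wdifferentiable_varied c t))).
- apply: acpD; first exact: acpZ (rep_acp (repu b)).
  apply: acpZ; apply: acp_smooth => j; apply: Cn_sub (se j); exact: subsetT.
- apply: measurable_funD; apply: measurable_funM => //; first exact: rep_mF (repu b).
  exact: test1_measurable.
- apply: measurable_funD; apply: measurable_funM => //; first exact: rep_mG (repu b).
  exact: test1_measurable (test1_derive (teta b)).
apply: filterS2 (ae_neq0 n0) (rep_f (repu b)) => x x0 fx.
by rewrite part_ground_varied// fx.
Qed.

(** Since [eta] vanishes near 0, its composite with |x| is a test function on the whole space, so
    the perturbation stays inside the core. *)
Lemma core_varied c t w : coreH w -> coreH (fun x => c%:C * (w x + t%:C * bumpH x)).
Proof.
move=> [v [tv wE]].
pose v' x := c%:C * (v x + t%:C * (eta true (enorm x) +i* eta false (enorm x))).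
have pv' b x : part b (v' x) = c * (part b (v x) + t * eta b (enorm x)).
  by rewrite /v' part_realM partD part_realM; case: b.
exists v'; split; last first.
  by move=> x; rewrite wE /bumpH /v'; ring.
have tfZ (a : R) (f : 'rV[R]_N -> R) : test_fun setT f -> test_fun setT (fun x => a * f x).
  by move=> tf; apply: test_funM => //; [exact: openT|move=> k; exact: Ck_on_cst].
have tb b : test_fun setT (fun x => part b (v' x)).
  have -> : (fun x => part b (v' x)) = (fun x => c * (part_fun b v x + t * eta b (enorm x))).
    by apply/funext => x; rewrite pv'.
  apply: (tfZ); apply: test_funD; first exact: ctest_part.
  apply: tfZ; apply: test_fun_sub (test1_radial N (teta b)); exact: subsetT.
by split; [exact: (tb true)|exact: (tb false)].
Qed.

(** The same perturbation is added to u and to its approximations; it cancels in the difference, and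
    the norm is only multiplied by c^2. *)
Lemma approx_varied c t w : approxH w u ->
  approxH (fun k x => c%:C * (w k x + t%:C * bumpH x)) (varied c t).
Proof.
move=> [cw lw]; split; first by move=> k; exact: core_varied.
have E k : normH2 (fun x => c%:C * (w k x + t%:C * bumpH x) - varied c t x) =
    ((c ^+ 2)%:E * normH2 (fun x => (w k x - u x)%R))%E.
  have [v [tv wE]] := cw k.
  rewrite -normH2Z.
  - by congr normH2; apply/funext => x; rewrite /varied; ring.
  - apply: cmeasurableP => b.
    have -> : part_fun b (fun x => w k x - u x) = fun x => part_fun b (w k) x - part_fun b u x.
      by apply/funext => x; rewrite /part_fun partB.
    apply: measurable_funB; apply: cmeasurable_part => //.
    exact: core_measurable wE tv.
  exact: wdifferentiableP (fun b => wgrad_core_diff b wE tv wu).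
have := cvgeZl (isT : (c ^+ 2)%:E \is a fin_num) lw; rewrite mule0.
by under eq_fun do rewrite -E.
Qed.

Lemma radial_varied c t : radial u -> radial (varied c t).
Proof.
move=> [f fu]; exists (fun r => c%:C * (f r + t%:C * ((r `^ (- h))%:C * (eta true r +i* eta false r)))).
by apply: filterS fu => x ux; rewrite /varied /bumpH ux.
Qed.

Definition sum2 (f : bool -> R) : R := f true + f false.

(** The gradient of the perturbation points along x, so the cross term sees only the radial
    derivative [G] of the ground state transform. *)
Lemma energyW_varied c t : {ae mu, forall x : 'rV[R]_N, energyW (varied c t) x =
  c ^+ 2 * (energyW u x
    + 2 * t * sum2 (fun b => enorm x `^ (- (N%:R - 2)) * G b (enorm x) * ((eta b)^`())%classic (enorm x))
    + t ^+ 2 * sum2 (fun b => enorm x `^ (- (N%:R - 2)) * ((eta b)^`())%classic (enorm x) * ((eta b)^`())%classic (enorm x)))}.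
Proof.
have H b : {ae mu, forall x : 'rV[R]_N, enorm (wgrad (part_fun b (ground (varied c t))) x) ^+ 2 =
    c ^+ 2 * (enorm (wgrad (part_fun b (ground u)) x) ^+ 2 +
      2 * t * (G b (enorm x) * ((eta b)^`())%classic (enorm x)) + t ^+ 2 * ((eta b)^`())%classic (enorm x) ^+ 2)}.
  apply: filterS3 (ae_neq0 n0) (wgradE n0 (wgrad_varied b c t)) (rep_g (repu b)) => x x0 -> gx.
  rewrite enorm_comb gx; field.
  by rewrite gt_eqF// enorm_gt0.
apply: filterS2 (H true) (H false) => x ht hf.
have -> : energyW (varied c t) x = enorm x `^ (- (N%:R - 2)) * (_ + _) := congr1 _ (congr2 +%R ht hf).
rewrite /energyW (grad_sqE (ground u)) /sum2.
move: (wgrad (part_fun true (ground u)) x) (wgrad (part_fun false (ground u)) x) => w1 w2.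
move: (enorm w1) (enorm w2) (enorm x) => e1 e2 e; move: (e `^ _) => k; ring.
Qed.

Lemma normc2_varied c t : {ae mu, forall x : 'rV[R]_N, normc (varied c t x) ^+ 2 =
  c ^+ 2 * (normc (u x) ^+ 2
    + 2 * t * sum2 (fun b => enorm x `^ (- (N%:R - 2)) * F b (enorm x) * eta b (enorm x))
    + t ^+ 2 * sum2 (fun b => enorm x `^ (- (N%:R - 2)) * eta b (enorm x) * eta b (enorm x)))}.
Proof.
have repz b := rep_varied b c t.
apply: filterS2 (normc2_rep N3 repu) (normc2_rep N3 repz) => x -> ->.
by rewrite /sum2; ring.
Qed.

Let w2 (r : R) := r `^ (- (N%:R - 2)).

Lemma weight2_test (f e : R -> R) : measurable_fun setT f -> locint (fun r => r * f r) -> test1 e ->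
  mu.-integrable setT (fun x => (enorm x `^ (- (N%:R - 2)) * f (enorm x) * e (enorm x))%:E) /\
  \int[mu]_x (enorm x `^ (- (N%:R - 2)) * f (enorm x) * e (enorm x)) = m * N%:R * \int[leb]_r (r * f r * e r).
Proof.
move=> mf lf te; apply: (radial_test (K := fun r => w2 r * f r) (k := fun r => r * f r)) => //.
  by apply: measurable_funM => //; exact: measurable_powR.
by move=> r r0; rewrite mulrA polw_weight// mulrA.
Qed.

Lemma sum2_integral (k : bool -> 'rV[R]_N -> R) : (forall b, mu.-integrable setT (EFin \o k b)) ->
  mu.-integrable setT (EFin \o (fun x => sum2 (k^~ x))) /\
  \int[mu]_x sum2 (k^~ x) = sum2 (fun b => \int[mu]_x k b x).
Proof.
move=> ik; split; first by apply: integrableD (ik true) (ik false).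
by rewrite /sum2 RintegralD.
Qed.

Lemma locint_mulr (f : R -> R) : locint f -> locint (fun r => r * f r).
Proof. by move=> lf; apply: (locintM_cont _ lf) => x _; exact: cvg_id. Qed.

Lemma test1_locint (e : R -> R) : test1 e -> locint e.
Proof. by move=> [se _]; apply: continuous_locint => x _; exact: (se 0%N). Qed.

Definition quad (a b c t : R) := a + 2 * t * b + t ^+ 2 * c.

Lemma quad_integral (k0 : 'rV[R]_N -> R) (k1 k2 : bool -> 'rV[R]_N -> R) c t :
  mu.-integrable setT (EFin \o k0) -> (forall b, mu.-integrable setT (EFin \o k1 b)) ->
  (forall b, mu.-integrable setT (EFin \o k2 b)) ->
  mu.-integrable setT (EFin \o (fun x => c ^+ 2 * (k0 x + 2 * t * sum2 (k1^~ x) + t ^+ 2 * sum2 (k2^~ x)))) /\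
  \int[mu]_x (c ^+ 2 * (k0 x + 2 * t * sum2 (k1^~ x) + t ^+ 2 * sum2 (k2^~ x))) =
  c ^+ 2 * quad (\int[mu]_x k0 x) (sum2 (fun b => \int[mu]_x k1 b x)) (sum2 (fun b => \int[mu]_x k2 b x)) t.
Proof.
move=> i0 i1 i2; have [s1 E1] := sum2_integral i1; have [s2 E2] := sum2_integral i2.
have j1 : mu.-integrable setT (EFin \o (fun x => 2 * t * sum2 (k1^~ x))) by apply: (integrableZl _ (2 * t) s1).
have j2 : mu.-integrable setT (EFin \o (fun x => t ^+ 2 * sum2 (k2^~ x))) by apply: (integrableZl _ (t ^+ 2) s2).
have j01 : mu.-integrable setT (EFin \o (fun x => k0 x + 2 * t * sum2 (k1^~ x))) by apply: integrableD i0 j1.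
have j : mu.-integrable setT (EFin \o (fun x => k0 x + 2 * t * sum2 (k1^~ x) + t ^+ 2 * sum2 (k2^~ x))).
  by apply: integrableD j01 j2.
split; first by apply: (integrableZl _ (c ^+ 2) j).
by rewrite RintegralZl// (RintegralD _ j01 j2)// (RintegralD _ i0 j1)// !RintegralZl// E1 E2.
Qed.

(* Coefficients in [t] of the energy ([A1], [A2]) and of the mass ([M1], [M2]) of
   [u + t bumpH]; [B1] below is the one of its L^q term. *)
Definition A1 : R := m * N%:R * sum2 (fun b => \int[leb]_r (r * G b r * ((eta b)^`())%classic r)).
Definition M1 : R := m * N%:R * sum2 (fun b => \int[leb]_r (r * F b r * eta b r)).
Definition A2 : R := m * N%:R * sum2 (fun b => \int[leb]_r (r * ((eta b)^`())%classic r * ((eta b)^`())%classic r)).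
Definition M2 : R := m * N%:R * sum2 (fun b => \int[leb]_r (r * eta b r * eta b r)).

Lemma ae_Rintegral (f g : 'rV[R]_N -> R) : measurable_fun setT f ->
  mu.-integrable setT (EFin \o g) -> {ae mu, forall x, f x = g x} ->
  (\int[mu]_x (f x)%:E = (\int[mu]_x g x)%:E)%E.
Proof.
move=> mf ig fg; rewrite fineK; last exact: integrable_fin_num ig.
apply: ae_eq_integral => //; first exact/measurable_EFinP.
  exact: measurable_int ig.
by apply: filterS fg => x fx _; rewrite /= fx.
Qed.

Lemma int_energyW_varied c t :
  (\int[mu]_x (energyW (varied c t) x)%:E = (c ^+ 2 * quad (\int[mu]_x energyW u x) A1 A2 t)%:E)%E.
Proof.
have T1 b := weight2_test (rep_mG (repu b)) (locint_mulr (proj1 (rep_acp (repu b)))) (test1_derive (teta b)).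
have T2 b := weight2_test (test1_measurable (test1_derive (teta b)))
  (locint_mulr (test1_locint (test1_derive (teta b)))) (test1_derive (teta b)).
have [i E] := quad_integral c t (integrable_energyW wu finu) (fun b => proj1 (T1 b)) (fun b => proj1 (T2 b)).
rewrite (ae_Rintegral _ i (energyW_varied c t)).
  rewrite E /A1 /A2 /sum2 !(proj2 (T1 _)) !(proj2 (T2 _)).
  by rewrite -!mulrDr.
apply: measurable_funM; first exact: measurable_powR_enorm.
exact: measurable_grad_sq (wdifferentiable_varied c t).
Qed.

Context (fin2 : (\int[mu]_x (normc (u x) ^+ 2)%:E < +oo)%E).

Lemma int_normc2_varied c t :
  (\int[mu]_x (normc (varied c t x) ^+ 2)%:E =
   (c ^+ 2 * quad (\int[mu]_x (normc (u x) ^+ 2)) M1 M2 t)%:E)%E.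
Proof.
have lF b : locint (fun r => r * F b r) by apply: locint_mulr; exact: acp_locint (rep_acp (repu b)).
have T1 b := weight2_test (rep_mF (repu b)) (lF b) (teta b).
have T2 b := weight2_test (test1_measurable (teta b)) (locint_mulr (test1_locint (teta b))) (teta b).
have i0 : mu.-integrable setT (EFin \o (fun x => normc (u x) ^+ 2)).
  apply/integrableP; split; first by apply/measurable_EFinP; exact: measurable_normc2.
  by apply: le_lt_trans fin2; under eq_integral do rewrite /= ger0_norm ?sqr_ge0//.
have [i E] := quad_integral c t i0 (fun b => proj1 (T1 b)) (fun b => proj1 (T2 b)).
rewrite (ae_Rintegral _ i (normc2_varied c t)).
  rewrite E /M1 /M2 /sum2 !(proj2 (T1 _)) !(proj2 (T2 _)).
  by rewrite -!mulrDr.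
exact: measurable_normc2 (cmeasurable_varied c t).
Qed.

(** * First variation of the L^q term *)

Section subcritical.
Context (q : R).
Context (q2 : 2 < q) (qN : q < 4 / N%:R + 2).

(** The exponent s: the surface element gives r^(N-1) and |u|^q gives r^(-h q). *)
Definition qexp : R := N%:R - 1 - h * q.
(** This is |F|^(q-2) for the pair F, written as X^(p-1) with X = |F|^2 and p = q/2, the form
    produced by [powR_tangent]. *)
Definition qdens (r : R) : R := (F true r ^+ 2 + F false r ^+ 2) `^ (q / 2 - 1).

(** At q = 4/N + 2 one has h q = N - 4/N, so below it the exponent exceeds 4/N - 1. *)
Lemma qexp_gt : -1 < qexp.
Proof.
have NR : 3 <= N%:R :> R by rewrite ler_nat.
have Np : 0 < N%:R :> R by rewrite ltr0n.
rewrite /qexp /hardy_exp.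
have : (N%:R - 2) / 2 * q < (N%:R - 2) / 2 * (4 / N%:R + 2) by rewrite ltr_pM2l// divr_gt0//; lra.
have -> : (N%:R - 2) / 2 * (4 / N%:R + 2) = N%:R - 4 / N%:R :> R by field; rewrite gt_eqF.
have : 0 < 4 / N%:R :> R by rewrite divr_gt0.
move: (4 / N%:R) ((N%:R - 2) / 2 * q) => A B; lra.
Qed.

Lemma qexp_le : qexp <= 1.
Proof.
have NR : 3 <= N%:R :> R by rewrite ler_nat.
rewrite /qexp /hardy_exp.
have : (N%:R - 2) / 2 * 2 <= (N%:R - 2) / 2 * q by rewrite ler_pM2l ?ltW// divr_gt0//; lra.
rewrite divfK//; move: ((N%:R - 2) / 2 * q) => A; lra.
Qed.

Lemma polw_qexp (r : R) : 0 < r -> polw N r * r `^ (- (h * q)) = N%:R * r `^ qexp.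
Proof.
move=> r0; rewrite /polw /qexp -mulrA; congr (_ * _).
rewrite powRD; last by apply/implyP => _; rewrite gt_eqF.
congr (_ * _); rewrite -[N%:R - 1]/(N%:R - 1%:R) -natrB// subn1 powR_mulrn//; exact: ltW.
Qed.

Lemma powR_sqr (a : R) : 0 <= a -> a `^ q = (a ^+ 2) `^ (q / 2).
Proof. by move=> a0; rewrite -powR_mulrn// -powRrM mulrC divfK. Qed.

Lemma weight_pow (x : 'rV[R]_N) (X : R) : 0 <= X ->
  (enorm x `^ (- (N%:R - 2)) * X) `^ (q / 2) = enorm x `^ (- (h * q)) * X `^ (q / 2).
Proof.
move=> X0; rewrite powRM ?powR_ge0// -powRrM; congr (_ `^ _ * _).
by rewrite /hardy_exp; field.
Qed.

Let p := q / 2.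
Let p1 : 1 < p. Proof. by rewrite ltr_pdivlMr// mul1r. Qed.
Let X (r : R) := F true r ^+ 2 + F false r ^+ 2.
Let X0 r : 0 <= X r. Proof. by rewrite addr_ge0 ?sqr_ge0. Qed.
Let mX : measurable_fun setT X.
Proof. by apply: measurable_funD; apply: measurable_funX; [exact: rep_mF (repu true)|exact: rep_mF (repu false)]. Qed.

Lemma normq_rep : {ae mu, forall x : 'rV[R]_N, normc (u x) `^ q = enorm x `^ (- (h * q)) * X (enorm x) `^ p}.
Proof.
apply: filterS (normc2_rep N3 repu) => x ux.
by rewrite (powR_sqr (normc_ge0 _)) ux weight_pow//; exact: X0.
Qed.

Lemma integrable_normq_rep : mu.-integrable setT (EFin \o (fun x : 'rV[R]_N => enorm x `^ (- (h * q)) * X (enorm x) `^ p)).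
Proof.
pose k r := r `^ (- (h * q)) * X r `^ p.
have mk : measurable_fun setT k.
  by apply: measurable_funM; [exact: measurable_powR|exact: measurableT_comp (measurable_powR p) mX].
suff ik : leb.-integrable `]0, +oo[ (fun r => (polw N r * k r)%:E).
  by have [] := polar_radial_signed N3 mk ik.
have i := subcritical_integrable (fun b => rep_acp (repu b)) (fun b => rep_mF (repu b)) qexp_gt qexp_le p1
  (rep_finite N3 mu_ wu finu repu).
have : leb.-integrable `]0, +oo[ (fun r => N%:R%:E * (r `^ qexp * X r `^ p)%:E)%E by exact: integrableZl.
apply: eq_integrable => // r; rewrite inE/= in_itv/= andbT => r0.
by rewrite /k mulrA polw_qexp// -EFinM mulrA.
Qed.

Lemma measurable_normq (z : 'rV[R]_N -> R[i]) : cmeasurable setT z -> measurable_fun setT (fun x => normc (z x) `^ q).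
Proof.
move=> mz.
have -> : (fun x => normc (z x) `^ q) = (fun x => (normc (z x) ^+ 2) `^ (q / 2)).
  by apply/funext => x; rewrite powR_sqr ?normc_ge0.
exact: measurableT_comp (measurable_powR (q / 2)) (measurable_normc2 mz).
Qed.

Definition B0 : R := \int[mu]_x (normc (u x) `^ q).
Definition B1 : R := q * (m * N%:R * sum2 (fun b => \int[leb]_r (r `^ qexp * qdens r * F b r * eta b r))).

Lemma int_normq : (\int[mu]_x (normc (u x) `^ q)%:E = B0%:E)%E.
Proof.
have E := ae_Rintegral (measurable_normq mu_) integrable_normq_rep normq_rep.
rewrite /B0 fineK// E.
by [].
Qed.

Lemma locint_qdens b : locint (fun r => r `^ qexp * qdens r * F b r).
Proof.
have aF b' := rep_acp (repu b').
have cX r : 0 < r -> {for r, continuous X}.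
  by move=> r0; apply: cvgD; apply: cvgM; apply: acp_continuous (aF _) r0.
move=> a c a0; have [ca|ac] := ltP c a.
  have -> : `[a, c]%classic = (set0 : set R) by apply/seteqP; split=> r //=; rewrite in_itv/= => /andP[ar rc]; move: (le_lt_trans (le_trans ar rc) ca); rewrite ltxx.
  exact: integrable_set0.
have seg : compact `[a, c]%classic := @segment_compact R a c.
have [C HC] : exists C, forall r, r \in `[a, c] -> X r <= C.
  have cwX : {within `[a, c], continuous X}.
    apply: continuous_in_subspaceT => x; rewrite inE/= in_itv/= => /andP[ax _].
    by apply: cX; exact: lt_le_trans ax.
  by have [z _ Hz] := EVT_max ac cwX; exists (X z).
have C0 : 0 <= C by apply: le_trans (HC a _); rewrite ?X0// in_itv/= lexx.
have l1 : locint (fun r => r `^ qexp * F b r).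
  by apply: locintM_cont (acp_locint (aF b)) => x x0; exact: (@smooth_powR R qexp 0%N x x0).
have i1 := l1 a c a0.
have i2 : leb.-integrable `[a, c] (fun r => ((C `^ (p - 1))%:E * (r `^ qexp * F b r)%:E)%E) by exact: integrableZl.
apply: (le_integrable _ _ _ i2) => //.
  apply/measurable_EFinP; apply: measurable_funTS; apply: measurable_funM; last exact: rep_mF (repu b).
  apply: measurable_funM; first exact: measurable_powR.
  exact: measurableT_comp (measurable_powR (p - 1)) mX.
move=> r rac; rewrite -EFinM lee_fin !normrM -mulrA mulrCA ler_wpM2r//.
rewrite !ger0_norm ?powR_ge0// /qdens -/(X r); apply: ge0_ler_powR; rewrite ?nnegrE ?X0//.
  by rewrite subr_ge0 ltW.
exact: HC.
Qed.

(** A one-sided first-order estimate, in the direction that the minus sign in the energy calls for.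
    It is [powR_tangent] at X = |F|^2, after which the square of the increment t eta is
    discarded. *)
Lemma int_normq_varied c t : 0 <= c ->
  ((c `^ q * (B0 + t * B1))%:E <= \int[mu]_x (normc (varied c t x) `^ q)%:E)%E.
Proof.
move=> c0.
pose K b (r : R) := r `^ (- (h * q)) * (qdens r * F b r).
have mK b : measurable_fun setT (K b).
  apply: measurable_funM; first exact: measurable_powR.
  apply: measurable_funM; last exact: rep_mF (repu b).
  exact: measurableT_comp (measurable_powR (p - 1)) mX.
have T b : mu.-integrable setT (fun x => (K b (enorm x) * eta b (enorm x))%:E) /\
    \int[mu]_x (K b (enorm x) * eta b (enorm x)) = m * N%:R * \int[leb]_r (r `^ qexp * qdens r * F b r * eta b r).
  apply: radial_test (mK b) (locint_qdens b) (teta b) _ => r r0.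
  by rewrite /K mulrA polw_qexp// !mulrA.
have [i1 E1] := sum2_integral (fun b => proj1 (T b)).
have i0 := integrable_normq_rep.
pose k0 x := enorm (x : 'rV[R]_N) `^ (- (h * q)) * X (enorm x) `^ p.
pose k1 x := sum2 (fun b => K b (enorm (x : 'rV[R]_N)) * eta b (enorm x)).
have j1 : mu.-integrable setT (EFin \o (fun x => t * q * k1 x)) by apply: (integrableZl _ (t * q) i1).
have j2 : mu.-integrable setT (EFin \o (fun x => k0 x + t * q * k1 x)) by apply: integrableD i0 j1.
have j3 : mu.-integrable setT (EFin \o (fun x => c `^ q * (k0 x + t * q * k1 x))) by apply: (integrableZl _ (c `^ q) j2).
have EL : (c `^ q * (B0 + t * B1))%:E = (\int[mu]_x (c `^ q * (k0 x + t * q * k1 x))%:E)%E.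
  have EB : \int[mu]_x k0 x = B0.
    by apply: EFin_inj; rewrite -int_normq (ae_Rintegral (measurable_normq mu_) i0 normq_rep).
  rewrite -[RHS]fineK; last by apply: integrable_fin_num j3.
  rewrite -[fine _]/(\int[mu]_x (c `^ q * (k0 x + t * q * k1 x))).
  rewrite RintegralZl// (RintegralD _ i0 j1)// RintegralZl// E1 EB /B1 /sum2 !(proj2 (T _)).
  by congr (_%:E); ring.
rewrite EL integralE.
(* The affine minorant may be negative; dropping its negative part reduces the claim to a comparison
   of nonnegative integrands. *)
have le0 : (0 <= \int[mu]_x ((fun x => (c `^ q * (k0 x + t * q * k1 x))%:E)^\- x))%E by exact: integral_ge0.
apply: (@le_trans _ _ (\int[mu]_x ((fun x => (c `^ q * (k0 x + t * q * k1 x))%:E)^\+ x))%E).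
  by rewrite -[leRHS]sube0 leeB.
apply: ae_ge0_le_integral => //.
- by apply: measurable_funepos; exact: measurable_int j3.
- by move=> x _; rewrite lee_fin powR_ge0.
- by apply/measurable_EFinP; exact: measurable_normq (cmeasurable_varied c t).
have repz b := rep_varied b c t.
apply: filterS (normc2_rep N3 repz) => x zx _.
rewrite funeposE ge_max; apply/andP; split; last by rewrite lee_fin powR_ge0.
rewrite lee_fin (powR_sqr (normc_ge0 _)) zx.
set r := enorm x.
pose Y := (F true r + t * eta true r) ^+ 2 + (F false r + t * eta false r) ^+ 2.
have Y0 : 0 <= Y by rewrite addr_ge0 ?sqr_ge0.
have -> : (c * F true r + c * t * eta true r) ^+ 2 + (c * F false r + c * t * eta false r) ^+ 2 = c ^+ 2 * Y.
  by rewrite /Y; ring.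
rewrite weight_pow ?mulr_ge0 ?sqr_ge0// powRM ?sqr_ge0// -powR_sqr// mulrCA ler_wpM2l ?powR_ge0//.
have -> : k0 x + t * q * k1 x = r `^ (- (h * q)) * (X r `^ p + p * (X r `^ (p - 1) * (2 * t * sum2 (fun b => F b r * eta b r)))).
  by rewrite /k0 /k1 /K /sum2 /qdens -/(X _) -/p -/r /p; field.
rewrite ler_wpM2l ?powR_ge0//; apply: le_trans (powR_tangent (X0 r) Y0 p1).
rewrite lerD2l ler_wpM2l ?(ltW (lt_trans ltr01 p1))// ler_wpM2l ?powR_ge0//.
(* Y - X exceeds its linear part by t^2 |eta|^2. *)
rewrite /Y /X /sum2 -subr_ge0.
have -> : (F true r + t * eta true r) ^+ 2 + (F false r + t * eta false r) ^+ 2 - (F true r ^+ 2 + F false r ^+ 2) -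
   2 * t * (F true r * eta true r + F false r * eta false r) = (t * eta true r) ^+ 2 + (t * eta false r) ^+ 2 by ring.
by rewrite addr_ge0 ?sqr_ge0.
Qed.

End subcritical.

End varied.

End competitor.

(** * The Euler-Lagrange equation *)

Section euler_lagrange.
Context {R : realType}.
Notation leb := (@lebesgue_measure R).

Implicit Types (f g : R -> R) (x a b : R).

Let dM f g x a b : is_derive x 1 f a -> is_derive x 1 g b ->
  is_derive x 1 (fun t => f t * g t) (f x * b + g x * a).
Proof. by move=> df dg; exact: (is_deriveM df dg). Qed.

Let dD f g x a b : is_derive x 1 f a -> is_derive x 1 g b ->
  is_derive x 1 (fun t => f t + g t) (a + b).
Proof. by move=> df dg; exact: (is_deriveD df dg). Qed.

Let dZ f x a (k : R) : is_derive x 1 f a -> is_derive x 1 (fun t => k * f t) (k * a).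
Proof. by move=> df; exact: (is_deriveZ k df). Qed.

Let dX x : is_derive x 1 (fun t : R => t) 1.
Proof. exact: is_derive_id. Qed.

Let dC (k : R) x : is_derive x 1 (fun=> k) 0.
Proof. exact: is_derive_cst. Qed.

Let dE f g x a b : is_derive x 1 f a -> f = g -> a = b -> is_derive x 1 g b.
Proof. by move=> ? <- <-. Qed.

Lemma is_derive_quad (a b c t : R) : is_derive t 1 (quad a b c) (2 * b + 2 * t * c).
Proof.
apply: (dE (dD (dD (dC a t) (dZ (2 * b) (dX t))) (dZ c (dM (dX t) (dX t))))); last by ring.
by apply/funext => s; rewrite /quad; ring.
Qed.

Lemma is_derive_normalized (g b1 b2 t : R) : 0 < g -> 0 < quad g b1 b2 t ->
  is_derive t 1 (fun t => g / quad g b1 b2 t) (- (g * (2 * b1 + 2 * t * b2) / quad g b1 b2 t ^+ 2)).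
Proof.
move=> g0 Q0; have dQ := is_derive_quad g b1 b2 t.
apply: (dE (dZ g (is_deriveV (lt0r_neq0 Q0) dQ))) => //.
by rewrite /GRing.scale/= -exprVn; ring.
Qed.

(* [a0 - q^-1 * b0] is the energy of [u], [quad g m1 m2 t] the mass of [u + t psi]. *)
Lemma stationary (g a0 a1 a2 m1 m2 b0 b1 q d : R) : 0 < g -> 2 < q -> 0 < d ->
  (forall t, `|t| < d -> 0 < quad g m1 m2 t) ->
  (forall t, `|t| < d -> 2^-1 * a0 - q^-1 * b0 <=
     2^-1 * (g / quad g m1 m2 t * quad a0 a1 a2 t) -
     q^-1 * ((g / quad g m1 m2 t) `^ (q / 2) * (b0 + t * b1))) ->
  a1 - b1 / q = (a0 - b0) / g * m1.
Proof.
move=> g0 q2 d0 Qp Hmin; have q0 : 0 < q by exact: lt_trans q2.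
pose D t := g / quad g m1 m2 t.
(* phi(0) is the energy of u and, by hypothesis, phi is nowhere smaller on ]-d, d[; so its
   derivative at 0 vanishes, and that equation is the conclusion. *)
pose phi t := 2^-1 * (D t * quad a0 a1 a2 t) - q^-1 * (D t `^ (q / 2) * (b0 + t * b1)).
pose D' t := - (g * (2 * m1 + 2 * t * m2) / quad g m1 m2 t ^+ 2).
pose phi' t := 2^-1 * (D t * (2 * a1 + 2 * t * a2) + quad a0 a1 a2 t * D' t) -
  q^-1 * (D t `^ (q / 2) * b1 + (b0 + t * b1) * (q / 2 * D t `^ (q / 2 - 1) * D' t)).
have dphi (t : R) : `|t| < d -> is_derive t 1 phi (phi' t).
  move=> td; have Q0 := Qp _ td; have D0 : 0 < D t by rewrite divr_gt0.
  have dD' : is_derive t 1 D (D' t) by exact: is_derive_normalized.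
  have dP : is_derive t 1 (fun t => D t `^ (q / 2)) (q / 2 * D t `^ (q / 2 - 1) * D' t).
    exact: (is_derive1_comp (is_derive1_powR (q / 2) D0) dD').
  have dA := is_derive_quad a0 a1 a2 t.
  have dB : is_derive t 1 (fun t : R => b0 + t * b1) b1.
    by apply: (dE (dD (dC b0 t) (dZ b1 (dX t)))); [apply/funext => s; ring|ring].
  apply: (dE (dD (dZ 2^-1 (dM dD' dA)) (dZ (- q^-1) (dM dP dB)))) => //.
    by apply/funext => s; rewrite mulNr.
  by rewrite mulNr.
have E0 : phi 0 = 2^-1 * a0 - q^-1 * b0.
  by rewrite /phi /D /quad !(mul0r, mulr0, expr0n, addr0)/= divff ?gt_eqF// powR1 !mul1r.
have h0 : 0 \in `]- d, d[ by rewrite in_itv/= oppr_lt0 d0.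
have abs t : t \in `]- d, d[ -> `|t| < d by rewrite in_itv/= ltr_norml.
have := @derive1_at_min R phi (- d) d 0 _ _ h0 _.
case; first by rewrite ge0_cp ?ltW.
- by move=> t /abs td; have [] := dphi t td.
- by move=> t /abs td; rewrite E0; exact: Hmin.
move=> _ v0; have [_ v1] := dphi 0 (abs _ h0).
move: v0; rewrite v1 /phi' /D' /D /quad !(mul0r, mulr0, expr0n, addr0)/= divff ?gt_eqF// !powR1.
move=> H; have qn : q != 0 by rewrite gt_eqF.
have gn : g != 0 by rewrite gt_eqF.
apply/eqP; rewrite -subr_eq0; apply/eqP; rewrite -[RHS]H; field.
by rewrite qn gn.
Qed.

End euler_lagrange.

(** * The weak radial equation of a minimizer *)

Section minimizer.
Context {R : realType} (N : nat) (N3 : (3 <= N)%N) (q gamma : R).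
Context (q2 : 2 < q) (qN : q < 4 / N%:R + 2) (gamma0 : 0 < gamma).
Context (u : 'rV[R]_N -> R[i]) (F G : bool -> R -> R).
Context (umin : radial_minimizer q gamma u).
Context (repu : forall b, radial_rep (part_fun b (ground u)) (wgrad (part_fun b (ground u))) (F b) (G b)).
Notation leb := (@lebesgue_measure R).
Notation mu := (@lebesgue_rV R N).
Notation m := (ball01_mass (R := R) N).

(** The Lagrange multiplier of the mass constraint; its value comes from differentiating the
    normalisation gamma / Q(t) at t = 0. *)
Definition multiplier : R := (\int[mu]_x energyW u x - B0 u q) / gamma.

Lemma first_variation (eta : bool -> R -> R) : (forall b, test1 (eta b)) ->
  A1 N G eta - B1 N F eta q / q = multiplier * M1 N F eta.
Proof.
move=> teta; have [[[mu_ wu finu [w aw]] Ku] ru Hmin] := umin.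
have fin2 : (\int[mu]_x (normc (u x) ^+ 2)%:E < +oo)%E by rewrite Ku ltry.
have Kr : \int[mu]_x (normc (u x) ^+ 2) = gamma by rewrite -[LHS]/(fine _) Ku.
pose Q := quad gamma (M1 N F eta) (M2 N eta).
have Q0 : Q 0 = gamma by rewrite /Q /quad !(mul0r, mulr0, expr0n, addr0)/=.
have cQ : {for 0, continuous Q}.
  apply: differentiable_continuous; apply/derivable1_diffP.
  by have [] := is_derive_quad gamma (M1 N F eta) (M2 N eta) 0.
(* For small t the perturbed function still has positive mass and can be renormalised. *)
have /nbhs_ballP[d /= d0 Hd] : \forall t \near (0 : R), 0 < Q t.
  by apply: (cvgr_gt _ cQ); rewrite Q0.
have Qp t : `|t| < d -> 0 < Q t by move=> td; apply: Hd; rewrite /ball/= sub0r normrN.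
apply: (@stationary _ gamma _ _ (A2 N eta) _ (M2 N eta) _ _ q d) => // t td.
have Qt := Qp t td; have D0 : 0 < gamma / Q t by rewrite divr_gt0.
(* The factor that brings the mass back to gamma. *)
pose c := Num.sqrt (gamma / Q t).
have c0 : 0 <= c by exact: sqrtr_ge0.
have c2 : c ^+ 2 = gamma / Q t by rewrite sqr_sqrtr// ltW.
pose z := varied u eta c t.
have Kz : (\int[mu]_x (normc (z x) ^+ 2)%:E = gamma%:E)%E.
  by rewrite (int_normc2_varied N3 mu_ wu repu teta fin2) c2 Kr -/(Q t) divfK// gt_eqF.
have Az := int_energyW_varied N3 wu finu repu teta c t.
have mz := cmeasurable_varied mu_ teta c t.
have wz := wdifferentiable_varied wu teta c t.
have finz : (normH2 z < +oo)%E.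
  by rewrite /normH2 Kz -[X in (X + _)%E]/(\int[mu]_x (energyW z x)%:E)%E Az ltry.
have az := approx_varied N3 mu_ wu teta c t aw.
have Gz : Gamma gamma z by split=> //; split=> //; eexists; exact: az.
have := Hmin z Gz (radial_varied eta c t ru).
rewrite (energyE N3 mu_ wu finu repu q aw).
rewrite (energyE N3 mz wz finz (fun b => rep_varied N3 wu repu teta b c t) q az).
rewrite [X in (_ - _ * X <= _)%E](int_normq N3 mu_ wu finu repu q2 qN).
rewrite [X in (_ <= _ * X - _)%E]Az.
have -> : (\int[mu]_x (energyW u x)%:E = (\int[mu]_x energyW u x)%:E)%E.
  by rewrite fineK//; apply: integrable_fin_num (integrable_energyW wu finu).
have Bz := int_normq_varied N3 mu_ wu finu repu teta q2 qN t c0.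
rewrite (powR_sqr q c0) c2 -/Q in Bz *.
move=> H; rewrite -/Q -lee_fin; apply: le_trans H _.
rewrite [leRHS]EFinB -EFinM; apply: leeB => //.
by rewrite [leLHS]EFinM lee_wpmul2l// lee_fin invr_ge0 ltW// (lt_trans _ q2).
Qed.

(** Each component is varied alone, the other test function being 0. The signs on the right are
    those that [weak_acp] expects, so the bracketed function is the weak derivative of r G. *)
Lemma euler_lagrange b (e : R -> R) : test1 e ->
  \int[leb]_r (r * G b r * (e^`())%classic r) =
  - \int[leb]_r (- (r `^ qexp N q * qdens F q r * F b r + multiplier * (r * F b r)) * e r).
Proof.
move=> te.
pose eta b' := if b' == b then e else fun=> 0.
have t0 : test1 (fun=> 0 : R).
  by split; [exact: smooth_cst|exists 1, 1].
have teta b' : test1 (eta b') by rewrite /eta; case: ifP.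
have := first_variation teta; rewrite /A1 /B1 /M1.
have S (k : bool -> R -> R) (L : (R -> R) -> R -> R) : (forall r, L (fun=> 0) r = 0) ->
    sum2 (fun b' => \int[leb]_r (k b' r * L (eta b') r)) = \int[leb]_r (k b r * L e r).
  move=> L0; have Z b' : \int[leb]_r (k b' r * L (fun=> 0) r) = 0.
    by apply: Rintegral0_eq => r _; rewrite L0 mulr0.
  by rewrite /sum2 /eta; case: (b) => /=; rewrite Z ?addr0 ?add0r.
have d0 r : ((fun=> 0 : R)^`())%classic r = 0 by rewrite derive1_cst.
rewrite (S (fun b r => r * G b r) (fun f => (f^`())%classic) d0).
rewrite (S (fun b r => r `^ qexp N q * qdens F q r * F b r) id (fun=> erefl)).
rewrite (S (fun b r => r * F b r) id (fun=> erefl)).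
have q0 : q != 0 by rewrite gt_eqF// (lt_trans _ q2).
have mN : m * N%:R != 0 by rewrite gt_eqF// mN_gt0.
have l1 := locint_qdens repu q2 b.
have i1 := integrable_test1 l1 te.
have i2 : leb.-integrable setT (EFin \o (fun r => r * F b r * e r)).
  by apply: integrable_test1 te; apply: locint_mulr; exact: acp_locint (rep_acp (repu b)).
have i3 : leb.-integrable setT (EFin \o (fun r => multiplier * (r * F b r * e r))).
  by apply: (integrableZl _ multiplier i2).
set IG := \int[leb]_r _; set IQ := \int[leb]_r _; set IF := \int[leb]_r (r * F b r * e r).
have -> : \int[leb]_r (- (r `^ qexp N q * qdens F q r * F b r + multiplier * (r * F b r)) * e r) =
    - (IQ + multiplier * IF).
  rewrite /IF -RintegralZl// /IQ -(RintegralD _ i1 i3)//.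
  rewrite -RintegralN; apply: eq_Rintegral => r _ /=.
  by ring.
rewrite opprK => H; apply: (mulfI mN).
have -> : m * N%:R * (IQ + multiplier * IF) = m * N%:R * IQ + multiplier * (m * N%:R * IF) by ring.
by rewrite -H; field.
Qed.

End minimizer.

(** * The radial equation near the origin *)

Section singular_ode.
Context {R : realType}.
Notation leb := (@lebesgue_measure R).
Implicit Types (f g : R -> R).

Lemma acp_bound f g (C sg a b : R) : acp f g -> sg != -1 -> 0 < a -> a <= b ->
  (forall r, a <= r <= b -> `|g r| <= C * r `^ sg) ->
  `|f b - f a| <= C * ((b `^ (sg + 1) - a `^ (sg + 1)) / (sg + 1)).
Proof.
move=> [lg fg] sg1 a0 ab H; rewrite fg//.
have ig : leb.-integrable `[a, b] (EFin \o g) by exact: lg.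
have iag : leb.-integrable `[a, b] (EFin \o (fun t => `|g t|)) by have /integrable_abse := ig.
have ip : leb.-integrable `[a, b] (EFin \o (fun t => t `^ sg)).
  by have := acp_locint (acp_powR sg); exact.
have ip' : leb.-integrable `[a, b] (EFin \o (fun t => C * t `^ sg)) by apply: (integrableZl _ C ip).
apply: (@le_trans _ _ (\int[leb]_(t in `[a, b]) `|g t|)); first exact: le_normr_Rintegral.
rewrite -Rint_powR// -RintegralZl//; exact: le_Rintegral.
Qed.

(** Convergence to 0 at the origin from the right; rho <= 1 is built in so that powers of r can be
    compared on ]0, rho]. *)
Definition vanishes0 f := forall e : R, 0 < e -> exists rho, [/\ 0 < rho, rho <= 1 &
  forall r, 0 < r <= rho -> `|f r| <= e].

Lemma vanishes0_powR f (C t rho : R) : 0 < t -> 0 < rho ->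
  (forall r, 0 < r <= rho -> `|f r| <= C * r `^ t) -> vanishes0 f.
Proof.
move=> t0 rho0 H e e0.
pose D := `|C| + 1.
have D0 : 0 < D by rewrite ltr_wpDl.
pose d := (e / D) `^ t^-1.
have d0 : 0 < d by rewrite powR_gt0// divr_gt0.
exists (Num.min 1 (Num.min rho d)); split; first by rewrite !lt_min ltr01 rho0.
  by rewrite ge_min lexx.
move=> r /andP[r0]; rewrite !le_min => /and3P[_ rr rd].
have rt : r `^ t <= e / D.
  have -> : e / D = d `^ t by rewrite /d -powRrM mulVf ?gt_eqF// powRr1// divr_ge0 ?ltW.
  by apply: ge0_ler_powR => //; rewrite ?nnegrE ltW.
apply: le_trans (H r _) _; first by rewrite r0.
apply: (@le_trans _ _ (D * r `^ t)).
  by rewrite ler_wpM2r ?powR_ge0// (le_trans (ler_norm C))// lerDl.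
by rewrite mulrC -ler_pdivlMr.
Qed.

(** With C' = C / (sg + 1), the function f + C' r^(sg+1) is nondecreasing and f - C' r^(sg+1)
    nonincreasing on ]0, rho]. The infimum of the former is the limit, caught between the two at
    every r. *)
Lemma acp_decay f g (C sg rho : R) : acp f g -> -1 < sg -> 0 < rho ->
  (forall r, 0 < r <= rho -> `|g r| <= C * r `^ sg) ->
  exists c, forall r, 0 < r <= rho -> `|f r - c| <= C / (sg + 1) * r `^ (sg + 1).
Proof.
move=> afg sg1 rho0 H.
have t0 : 0 < sg + 1 by rewrite -ltrBlDr sub0r.
pose C' := C / (sg + 1).
have C0 : 0 <= C'.
  rewrite divr_ge0 ?(ltW t0)//.
  have := le_trans (normr_ge0 _) (H rho _); rewrite rho0 lexx => /(_ isT).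
  by rewrite pmulr_lge0// powR_gt0.
have B a b : 0 < a -> a <= b -> b <= rho -> `|f b - f a| <= C' * b `^ (sg + 1) - C' * a `^ (sg + 1).
  move=> a0 ab br; rewrite -mulrBr /C' mulrAC -mulrA; apply: (acp_bound afg) => //.
    by rewrite gt_eqF.
  move=> r /andP[ar rb]; apply: H; rewrite (lt_le_trans a0 ar)/=; exact: le_trans br.
pose S := [set f r + C' * r `^ (sg + 1) | r in [set r | 0 < r <= rho]].
have lbS r : 0 < r <= rho -> lbound S (f r - C' * r `^ (sg + 1)).
  move=> /andP[r0 rr] _ [a /andP[a0 ar] <-].
  have [ra|ra] := leP r a.
    have := B r a r0 ra ar; rewrite ler_norml => /andP[+ _].
    have : 0 <= C' * r `^ (sg + 1) by rewrite mulr_ge0 ?powR_ge0.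
    by move: (C' * _) (C' * _) => x y; lra.
  have := B a r a0 (ltW ra) rr; rewrite ler_norml => /andP[_].
  have : 0 <= C' * a `^ (sg + 1) by rewrite mulr_ge0 ?powR_ge0.
  by move: (C' * _) (C' * _) => x y; lra.
exists (inf S) => r rr.
have h1 : f r - C' * r `^ (sg + 1) <= inf S.
  apply: lb_le_inf; last exact: lbS.
  by exists (f r + C' * r `^ (sg + 1)); exists r.
have h2 : inf S <= f r + C' * r `^ (sg + 1).
  by apply: ge_inf; [exists (f r - C' * r `^ (sg + 1)); exact: lbS|exists r].
by rewrite -/C' ler_norml; move: (C' * _) h1 h2 => x; lra.
Qed.

Lemma acp_decay0 f g (C sg rho : R) : acp f g -> -1 < sg -> vanishes0 f ->
  (forall r, 0 < r <= rho -> `|g r| <= C * r `^ sg) ->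
  forall r, 0 < r <= rho -> `|f r| <= C / (sg + 1) * r `^ (sg + 1).
Proof.
move=> afg sg1 f0 H r /andP[r0 rr].
have rho0 : 0 < rho by exact: lt_le_trans rr.
have [c Hc] := acp_decay afg sg1 rho0 H.
have t0 : 0 < sg + 1 by rewrite -ltrBlDr sub0r.
have fc0 := vanishes0_powR t0 rho0 Hc.
suff -> : f r = f r - c by apply: Hc; rewrite r0.
suff -> : c = 0 by rewrite subr0.
apply/eqP; rewrite -normr_le0; apply/ler_addgt0Pl => e e0; rewrite addr0.
have e2 : 0 < e / 2 by rewrite divr_gt0.
have [x [x0 _ Hx]] := f0 _ e2; have [y [y0 _ Hy]] := fc0 _ e2.
pose z := Num.min x y.
have z0 : 0 < z by rewrite lt_min x0.
have h1 : `|f z| <= e / 2 by apply: Hx; rewrite z0 ge_min lexx.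
have h2 : `|f z - c| <= e / 2 by apply: Hy; rewrite z0 ge_min lexx orbT.
have -> : c = f z - (f z - c) by ring.
by apply: le_trans (ler_normB _ _) _; move: (`|_|) (`|_|) h1 h2 => a b; lra.
Qed.

Lemma acp_ae f g g' : acp f g -> locint g' -> {ae leb, forall r, 0 < r -> g r = g' r} -> acp f g'.
Proof.
move=> [lg fg] lg' gg; split=> // a b a0 ab; rewrite fg//; congr fine.
apply: ae_eq_integral => //.
- exact: measurable_int (lg a b a0).
- exact: measurable_int (lg' a b a0).
apply: (ae_leb_imp _ gg) => r H; rewrite /= in_itv/= => /andP[ar _].
by rewrite H//; exact: lt_le_trans ar.
Qed.

Lemma acp_ln : acp (@ln R) (fun r => r^-1).
Proof.
by apply: acp_C1 => r r0; apply: inv_continuous; rewrite gt_eqF.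
Qed.

(* [1 / r] is not integrable at [0]. *)
Lemma vanishes0_weighted f (c C t rho : R) : measurable_fun (`]0, +oo[%classic : set R) f ->
  0 < t -> 0 < rho -> (forall r, 0 < r <= rho -> `|f r - c| <= C * r `^ t) ->
  (\int[leb]_(r in `]0%R, +oo[) (f r ^+ 2 / r)%:E < +oo)%E -> c = 0.
Proof.
move=> mf t0 rho0 H fin; apply/eqP/negPn/negP => c0.
have e0 : 0 < `|c| / 2 by rewrite divr_gt0// normr_gt0.
have [d [d0 _ Hd]] := vanishes0_powR t0 rho0 H e0.
set T := (\int[leb]_(r in _) _)%E in fin.
have T0 : (0 <= T)%E.
  apply: integral_ge0 => r /=; rewrite in_itv/= andbT => r0.
  by rewrite lee_fin divr_ge0 ?sqr_ge0// ltW.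
have Tf : T \is a fin_num by rewrite ge0_fin_numE.
have k0 : 0 < (c ^+ 2 / 4) by rewrite divr_gt0// exprn_even_gt0.
(* Near 0 one has f^2 >= c^2 / 4. With a = d e^(-M) the integral of 1/r over [a, d] is M, so the
   weighted integral would be at least (c^2 / 4) M = T + 1, more than its value T. *)
pose M := (fine T + 1) / (c ^+ 2 / 4).
have M0 : 0 < M by rewrite divr_gt0// ltr_wpDl// fine_ge0.
pose a := d * expR (- M).
have a0 : 0 < a by rewrite mulr_gt0// expR_gt0.
have ad : a <= d by rewrite ger_pMr// expR_le1 oppr_le0 ltW.
have [linv Hinv] := acp_ln.
have I1 : \int[leb]_(r in `[a, d]) r^-1 = M.
  by rewrite -Hinv// lnM ?posrE ?expR_gt0// expRK opprD opprK addNKr.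
have sub : `[a, d]%classic `<=` (`]0, +oo[%classic : set R).
  by move=> r /=; rewrite !in_itv/= andbT => /andP[ar _]; exact: lt_le_trans ar.
have mq : measurable_fun (`]0, +oo[%classic : set R) (fun r => f r ^+ 2 / r).
  apply: measurable_funM; first exact: measurable_funX.
  by apply: measurable_funTS; exact: measurable_inv.
have ii : leb.-integrable `[a, d] (EFin \o (fun r => c ^+ 2 / 4 * r^-1)).
  by apply: (integrableZl _ (c ^+ 2 / 4) (linv a d a0)).
have : ((c ^+ 2 / 4 * M)%:E <= T)%E.
  apply: (@le_trans _ _ (\int[leb]_(r in `[a, d]) (c ^+ 2 / 4 * r^-1)%:E)%E).
    rewrite -[leRHS]fineK; last by apply: integrable_fin_num ii.
    rewrite lee_fin -[fine _]/(\int[leb]_(r in `[a, d]) (c ^+ 2 / 4 * r^-1)) RintegralZl//; last exact: linv.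
    by rewrite I1.
  apply: (@le_trans _ _ (\int[leb]_(r in `[a, d]) (f r ^+ 2 / r)%:E)%E).
    apply: ge0_le_integral => //.
    - by move=> r rad; have := sub _ rad; rewrite /= in_itv/= andbT => r0; rewrite lee_fin mulr_ge0 ?invr_ge0 ?(ltW r0)// ltW.
    - exact: measurable_int ii.
    - by apply/measurable_EFinP; exact: measurable_funS mq.
    move=> r rad; have := sub _ rad; rewrite /= in_itv/= andbT => r0.
    rewrite lee_fin ler_wpM2r ?invr_ge0 ?(ltW r0)//.
    have : `|f r - c| <= `|c| / 2 by apply: Hd; rewrite r0; move: rad; rewrite /= in_itv/= => /andP[].
    have h1 : `|c| <= `|f r| + `|f r - c|.
      have -> : c = f r - (f r - c) by ring.
      rewrite -[X in _ <= _ + `|X - _|]/(f r) (le_trans (ler_normB _ _))//.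
      by have -> : f r - (f r - (f r - c)) = f r - c by ring.
    move=> h2; have h3 : `|c| / 2 <= `|f r|.
      by move: h1 h2; move: (`|c|) (`|f r|) (`|f r - c|) => x y z; lra.
    have -> : c ^+ 2 / 4 = (`|c| / 2) ^+ 2 by rewrite expr_div_n real_normK ?num_real// -natrX.
    by rewrite -[leRHS]real_normK ?num_real// lerXn2r ?nnegrE// ltW.
  apply: ge0_subset_integral => //; first exact/measurable_EFinP.
  by move=> r /=; rewrite in_itv/= andbT => r0; rewrite lee_fin divr_ge0 ?sqr_ge0// ltW.
rewrite -[T]fineK// lee_fin /M mulrC divfK ?gt_eqF//.
by rewrite leNgt ltrDl ltr01.
Qed.

(** * The first-order system for F and Q = r F' *)

Section system.
Context (F Q : bool -> R -> R) (s p lam : R).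
Let X r := F true r ^+ 2 + F false r ^+ 2.
Let K b r := - (r `^ s * X r `^ (p - 1) * F b r + lam * (r * F b r)).
Context (aF : forall b, acp (F b) (fun r => Q b r / r)) (aQ : forall b, acp (Q b) (K b)).
Context (s1 : -1 < s) (s2 : s <= 1) (p1 : 1 < p).
Context (fin : forall b, (\int[leb]_(r in `]0%R, +oo[) (r * (F b r ^+ 2 + (Q b r / r) ^+ 2))%:E < +oo)%E).

Lemma rhs_le b (r g : R) : 0 < r -> (forall b', `|F b' r| <= g) ->
  `|K b r| <= (r `^ s * (2 * g ^+ 2) `^ (p - 1) + `|lam| * r) * g.
Proof.
move=> r0 Fg; have g0 : 0 <= g by exact: le_trans (Fg b).
have Fg2 b' : F b' r ^+ 2 <= g ^+ 2 by rewrite -[leLHS]real_normK ?num_real// lerXn2r ?nnegrE.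
have Xg : X r `^ (p - 1) <= (2 * g ^+ 2) `^ (p - 1).
  apply: ge0_ler_powR; rewrite ?nnegrE ?subr_ge0 ?(ltW p1)//.
  - by rewrite addr_ge0 ?sqr_ge0.
  - by rewrite mulr_ge0 ?sqr_ge0.
  - by rewrite mulr2n mulrDl mul1r lerD.
have -> : K b r = - ((r `^ s * X r `^ (p - 1) + lam * r) * F b r) by rewrite /K; ring.
rewrite normrN normrM ler_pM//; apply: le_trans (ler_normD _ _) _.
rewrite !normrM (gtr0_norm r0) !(ger0_norm (powR_ge0 _ _)) lerD2r.
by rewrite ler_wpM2l ?powR_ge0.
Qed.

Lemma rhs_near0 : exists sg C : R, [/\ -1 < sg, 0 <= C & forall b r, 0 < r <= 1 -> `|K b r| <= C * r `^ sg].
Proof.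
have t0 : 0 < s + 1 by rewrite -ltrBlDr sub0r.
have k0 : 0 < 2 * p - 1 by move: p1; lra.
(* Chosen so that s - 2 d (p - 1) - d = (s - 1) / 2, halfway between -1 and s. The linear term has
   exponent 1 - d, which is at least as large because s <= 1. *)
pose d := (s + 1) / (2 * (2 * p - 1)).
have d0 : 0 < d by rewrite divr_gt0// mulr_gt0.
have [C1 H1] := acp_near0 (aF true) d0 (fin true).
have [C2 H2] := acp_near0 (aF false) d0 (fin false).
pose C := `|C1| + `|C2|.
have C0 : 0 <= C by rewrite addr_ge0.
have FC b r : 0 < r <= 1 -> `|F b r| <= C * r `^ (- d).
  move=> r01; case: b; [apply: le_trans (H1 r r01) _|apply: le_trans (H2 r r01) _];
    rewrite ler_wpM2r ?powR_ge0//.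
    by rewrite (le_trans (ler_norm _))// lerDl.
  by rewrite (le_trans (ler_norm _))// lerDr.
exists ((s - 1) / 2), ((2 * C ^+ 2) `^ (p - 1) * C + `|lam| * C); split.
- by lra.
- by rewrite addr_ge0 ?mulr_ge0 ?powR_ge0.
move=> b r r01; have /andP[r0 r1] := r01; apply: le_trans (rhs_le b r0 (fun b' => FC b' r r01)) _.
have powD (x y : R) : r `^ (x + y) = r `^ x * r `^ y.
  by rewrite powRD//; apply/implyP => _; rewrite gt_eqF.
have -> : (2 * (C * r `^ (- d)) ^+ 2) `^ (p - 1) = (2 * C ^+ 2) `^ (p - 1) * r `^ (- (2 * d) * (p - 1)).
  have -> : - (2 * d) = - d + - d by ring.
  have -> : 2 * (C * r `^ (- d)) ^+ 2 = 2 * C ^+ 2 * r `^ (- d + - d) by rewrite powD; ring.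
  by rewrite powRM ?mulr_ge0 ?sqr_ge0 ?powR_ge0// [in RHS]powRrM.
rewrite mulrDl [leRHS]mulrDl; apply: lerD.
  have E1 : s + - (2 * d) * (p - 1) + - d = (s - 1) / 2.
    rewrite /d; field.
    by rewrite gt_eqF.
  rewrite -E1 !powD le_eqVlt; apply/orP; left; apply/eqP; ring.
have -> : `|lam| * r * (C * r `^ (- d)) = `|lam| * C * (r * r `^ (- d)) by ring.
rewrite ler_wpM2l ?mulr_ge0// -{1}(powRr1 (ltW r0)) -powD ger_powR ?r0//.
rewrite /d; have : (s + 1) / (2 * (2 * p - 1)) <= (s + 1) / 2.
  by rewrite ler_wpM2l ?(ltW t0)// lef_pV2 ?posrE ?mulr_gt0//; move: p1; lra.
by move: s2; move: ((s + 1) / (2 * _)) => y; lra.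
Qed.

Lemma vanishes0_Q b : vanishes0 (Q b).
Proof.
have [sg [C [sg1 C0 HK]]] := rhs_near0.
have [c Hc] := acp_decay (aQ b) sg1 ltr01 (fun r r01 => HK b r r01).
have t0 : 0 < sg + 1 by rewrite -ltrBlDr sub0r.
have mQ : measurable_fun (`]0, +oo[%classic : set R) (Q b) by exact: locint_measurable (acp_locint (aQ b)).
have mF : measurable_fun (`]0, +oo[%classic : set R) (F b) by exact: locint_measurable (acp_locint (aF b)).
suff c0 : c = 0 by apply: (vanishes0_powR t0 ltr01) => r r01; have := Hc r r01; rewrite c0 subr0; exact.
apply: (vanishes0_weighted mQ t0 ltr01 Hc).
apply: le_lt_trans (fin b).
have mi : measurable_fun (`]0, +oo[%classic : set R) (@GRing.inv R) by apply: measurable_funTS; exact: measurable_inv.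
apply: ge0_le_integral => //.
- by move=> r /=; rewrite in_itv/= andbT => r0; rewrite lee_fin divr_ge0 ?sqr_ge0// ltW.
- by apply/measurable_EFinP; apply: measurable_funM => //; exact: measurable_funX.
- apply/measurable_EFinP; apply: measurable_funM => //; apply: measurable_funD; apply: measurable_funX => //.
  exact: measurable_funM.
move=> r /=; rewrite in_itv/= andbT => r0; rewrite lee_fin mulrDr.
have -> : r * (Q b r / r) ^+ 2 = Q b r ^+ 2 / r by field; rewrite gt_eqF.
by rewrite lerDr mulr_ge0 ?sqr_ge0// ltW.
Qed.

Lemma Q_div_le b (C sg rho : R) : -1 < sg -> (forall r, 0 < r <= rho -> `|K b r| <= C * r `^ sg) ->
  forall r, 0 < r <= rho -> `|Q b r / r| <= C / (sg + 1) * r `^ sg.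
Proof.
move=> sg1 HK r r01; have /andP[r0 _] := r01.
have := acp_decay0 (aQ b) sg1 (@vanishes0_Q b) HK r01.
rewrite powRD; last by apply/implyP => _; rewrite gt_eqF.
by rewrite powRr1 ?(ltW r0)// mulrA normrM normfV (gtr0_norm r0) ler_pdivrMr.
Qed.

Lemma system_limit : exists c : bool -> R, forall b, vanishes0 (fun r => F b r - c b).
Proof.
have [sg [C [sg1 C0 HK]]] := rhs_near0.
have t0 : 0 < sg + 1 by rewrite -ltrBlDr sub0r.
have D b := acp_decay (aF b) sg1 ltr01 (Q_div_le sg1 (HK b)).
have [ct Ht] := D true; have [cf Hf] := D false.
exists (fun b => if b then ct else cf); case; [exact: vanishes0_powR t0 ltr01 Ht|exact: vanishes0_powR t0 ltr01 Hf].
Qed.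

(* On a short interval [0, rho] the integral operator is a contraction for the sup norm. *)
Lemma system_zero_near : (forall b, vanishes0 (F b)) ->
  exists2 rho, 0 < rho & forall b r, 0 < r <= rho -> F b r = 0 /\ Q b r = 0.
Proof.
move=> F0; have t0 : 0 < s + 1 by rewrite -ltrBlDr sub0r.
(* While both components are at most g <= 1 and r <= 1, the right-hand side is at most L r^s g; here
   r <= r^s because s <= 1. *)
pose L := 2 `^ (p - 1) + `|lam|.
have L0 : 0 <= L by rewrite addr_ge0 ?powR_ge0.
have [x1 [x10 x11 Hx1]] := F0 true _ ltr01.
have [x2 [x20 _ Hx2]] := F0 false _ ltr01.
have half0 : 0 < 2^-1 :> R by rewrite invr_gt0.
(* Each of the two integrations, from [K] to [Q] and from Q / r to [F], gives a factor 1 / (s +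
   1). *)
pose D := L / (s + 1) / (s + 1).
have D0 : 0 <= D by rewrite !divr_ge0 ?(ltW t0).
have [x3 [x30 _ Hx3]] : exists rho, [/\ 0 < rho, rho <= 1 & forall r, 0 < r <= rho -> `|D * r `^ (s + 1)| <= 2^-1].
  apply: (@vanishes0_powR _ D (s + 1) 1) half0 => // r _.
  by rewrite ger0_norm// mulr_ge0// powR_ge0.
pose rho := Num.min x1 (Num.min x2 x3).
have rho0 : 0 < rho by rewrite !lt_min x10 x20.
have [rx1 rx2 rx3] : [/\ rho <= x1, rho <= x2 & rho <= x3] by rewrite /rho !ge_min !lexx !orbT.
(* One supremum for both components, since the system couples them. It is at most 1 by the choice of
   rho, and the estimate sup S <= sup S / 2 forces it to be 0. *)
pose S := [set y | exists b r, [/\ 0 < r, r <= rho & y = `|F b r|]].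
have Sne : S !=set0 by exists `|F true rho|; exists true, rho.
have Sle : ubound S 1.
  move=> _ [[] [r [r0 rr ->]]]; [apply: Hx1|apply: Hx2]; rewrite r0/=; exact: le_trans rr _.
have hS : has_sup S by split=> //; exists 1.
have FS b r : 0 < r <= rho -> `|F b r| <= sup S.
  by move=> /andP[r0 rr]; apply: (ub_le_sup (proj2 hS)); exists b, r.
have S1 : sup S <= 1 by exact: ge_sup.
have S0 : 0 <= sup S by apply: le_trans (FS true rho _); rewrite ?rho0 ?lexx.
have KS b r : 0 < r <= rho -> `|K b r| <= L * sup S * r `^ s.
  move=> r01; have /andP[r0 rr] := r01.
  apply: le_trans (rhs_le b r0 (fun b' => FS b' r r01)) _.
  have -> : L * sup S * r `^ s = (L * r `^ s) * sup S by ring.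
  rewrite ler_wpM2r// /L [leRHS]mulrDl; apply: lerD.
    rewrite mulrC ler_wpM2r ?powR_ge0//; apply: ge0_ler_powR; rewrite ?nnegrE ?subr_ge0 ?(ltW p1)//.
      by rewrite mulr_ge0 ?sqr_ge0.
    by rewrite ler_piMr// expr_le1.
  rewrite ler_wpM2l// -[leLHS](powRr1 (ltW r0)) ger_powR// r0/=.
  exact: le_trans rr (le_trans rx1 x11).
have Half b r : 0 < r <= rho -> `|F b r| <= sup S / 2.
  move=> r01; apply: le_trans (acp_decay0 (aF b) s1 (F0 b) (Q_div_le s1 (KS b)) r01) _.
  have /andP[r0 rr] := r01.
  have -> : L * sup S / (s + 1) / (s + 1) * r `^ (s + 1) = sup S * (D * r `^ (s + 1)) by rewrite /D; ring.
  by rewrite ler_wpM2l// (le_trans (ler_norm _))// Hx3// r0 (le_trans rr).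
have Sz : sup S = 0.
  apply/eqP; rewrite eq_le S0 andbT.
  have : sup S <= sup S / 2.
    by apply: ge_sup => // _ [b [r [r0 rr ->]]]; apply: Half; rewrite r0.
  by lra.
exists rho => // b r r01; split.
  by apply/eqP; rewrite -normr_le0 -Sz FS.
have := Q_div_le s1 (KS b) r01; rewrite Sz mulr0 !mul0r normr_le0 mulf_eq0 invr_eq0.
by have /andP[r0 _] := r01; rewrite (gt_eqF r0) orbF => /eqP.
Qed.

(** On [a, c] the solution itself bounds |F|^2, so the system can be read as a linear one with
    bounded coefficients. Then y = |F|^2 + |Q|^2 satisfies y' <= L y, and e^(-L r) y does not rise
    from its value 0 at a. *)
Lemma system_unique (a : R) : 0 < a -> (forall b, F b a = 0 /\ Q b a = 0) ->
  forall b r, a <= r -> F b r = 0.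
Proof.
move=> a0 z b c ac.
have cF b' r : 0 < r -> {for r, continuous (F b')} by move=> r0; exact: acp_continuous (aF b') r0.
have cX r : 0 < r -> {for r, continuous X}.
  by move=> r0; apply: cvgD; apply: cvgM; exact: cF.
have cwX : {within `[a, c], continuous X}.
  apply: continuous_in_subspaceT => x; rewrite inE/= in_itv/= => /andP[ax _].
  by apply: cX; exact: lt_le_trans ax.
have [xm _ HX] := EVT_max ac cwX.
have [ym _ Hs] : exists2 x, x \in `[a, c] & forall t, t \in `[a, c] -> t `^ s <= x `^ s.
  apply: (EVT_max ac); apply: continuous_in_subspaceT => x; rewrite inE/= in_itv/= => /andP[ax _].
  exact: (@smooth_powR R s 0%N x (lt_le_trans a0 ax)).
(* [L] bounds |1/r - k| on [a, c], the coefficient of 2 F Q in y'. *)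
pose L := a^-1 + ym `^ s * X xm `^ (p - 1) + `|lam| * c.
pose y r := F true r ^+ 2 + F false r ^+ 2 + (Q true r ^+ 2 + Q false r ^+ 2).
pose y' r := 2 * (F true r * (Q true r / r)) + 2 * (F false r * (Q false r / r)) +
  (2 * (Q true r * K true r) + 2 * (Q false r * K false r)).
have sq f g : acp f g -> acp (fun r => f r ^+ 2) (fun r => 2 * (f r * g r)).
  by move=> afg; apply: acp_ext (acpM afg afg) => r _; [rewrite expr2|ring].
have ay : acp y y' by apply: acpD; apply: acpD; apply: sq.
have aE : acp (fun r : R => expR (- L * r)) (fun r => - L * expR (- L * r)).
  apply: acp_C1 => r r0.
    have -> : - L * expR (- L * r) = expR (- L * r) * (- L * 1) by rewrite mulr1 mulrC.
    exact: (is_derive1_comp (is_derive_expR _) (is_deriveZ (- L) (is_derive_id r 1))).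
  apply: continuousM; first exact: cst_continuous.
  apply: (@continuous_comp _ _ _ (fun r => - L * r) (@expR R)); last exact: continuous_expR.
  by apply: continuousM; [exact: cst_continuous|exact: cvg_id].
have [_ H] := acpM ay aE.
have := H a c a0 ac.
have -> : y a = 0 by rewrite /y !(proj1 (z _)) !(proj2 (z _)) expr0n/= !addr0.
rewrite mul0r subr0 => yc.
have yle : y c * expR (- L * c) <= 0.
  rewrite yc -oppr_ge0 -RintegralN; apply: Rintegral_ge0 => r; rewrite /= in_itv/= => /andP[ar rc].
  have r0 : 0 < r by exact: lt_le_trans ar.
  have rac : r \in `[a, c] by rewrite in_itv/= ar rc.
  have -> : - (y r * (- L * expR (- L * r)) + expR (- L * r) * y' r) = expR (- L * r) * (L * y r - y' r) by ring.
  rewrite mulr_ge0 ?expR_ge0// subr_ge0.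
  have X0 t : 0 <= X t by rewrite addr_ge0 ?sqr_ge0.
  pose k := r `^ s * X r `^ (p - 1) + lam * r.
  have Kk b' : K b' r = - (k * F b' r) by rewrite /K /k; ring.
  have ri : r^-1 <= a^-1 by rewrite lef_pV2.
  have kL : `|k| <= ym `^ s * X xm `^ (p - 1) + `|lam| * c.
    apply: le_trans (ler_normD _ _) _; apply: lerD.
      rewrite ger0_norm ?mulr_ge0 ?powR_ge0// ler_pM ?powR_ge0 ?Hs//.
      by apply: ge0_ler_powR; rewrite ?nnegrE ?X0 ?subr_ge0 ?(ltW p1) ?HX.
    by rewrite normrM (gtr0_norm r0) ler_wpM2l.
  have key b' : 2 * (F b' r * (Q b' r / r)) + 2 * (Q b' r * K b' r) <= L * (F b' r ^+ 2 + Q b' r ^+ 2).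
    rewrite Kk.
    have -> : 2 * (F b' r * (Q b' r / r)) + 2 * (Q b' r * - (k * F b' r)) = 2 * (F b' r * Q b' r) * (r^-1 - k) by ring.
    have h1 : `|r^-1 - k| <= L.
      apply: le_trans (ler_normB _ _) _; rewrite (gtr0_norm (_ : 0 < r^-1)) ?invr_gt0// /L -addrA lerD//.
    have h2 : `|2 * (F b' r * Q b' r)| <= F b' r ^+ 2 + Q b' r ^+ 2.
      rewrite ler_norml; have := sqr_ge0 (F b' r + Q b' r); have := sqr_ge0 (F b' r - Q b' r).
      by move: (F b' r) (Q b' r) => f g; nra.
    apply: le_trans (ler_norm _) _; rewrite normrM mulrC ler_pM//.
  have := key true; have := key false; rewrite /y /y'.
  by move: (2 * (_ * (_ / _))) (2 * (_ * K true r)) (2 * (F false r * _)) (2 * (_ * K false r)) => x1 x2 x3 x4; lra.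
have y0 : y c <= 0 by move: yle; rewrite pmulr_lle0 ?expR_gt0.
have : F b c ^+ 2 <= 0.
  apply: le_trans y0; rewrite /y.
  have := sqr_ge0 (F true c); have := sqr_ge0 (F false c); have := sqr_ge0 (Q true c); have := sqr_ge0 (Q false c).
  by case: (b); lra.
by rewrite exprn_even_le0//= => /eqP.
Qed.

Lemma system_nonzero : (exists b r, 0 < r /\ F b r != 0) ->
  exists2 c : bool -> R, (exists b, c b != 0) & forall b, vanishes0 (fun r => F b r - c b).
Proof.
move=> [b [r [r0 Fr]]]; have [c Hc] := system_limit; exists c => //.
have [ct|ct] := eqVneq (c true) 0; last by exists true.
have [cf|cf] := eqVneq (c false) 0; last by exists false.
have F0 b' : vanishes0 (F b').
  move=> e e0; have [rho [h0 h1 h2]] := Hc b' e e0; exists rho; split=> // t /h2.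
  by case: b' {Hc h2} => /=; rewrite ?ct ?cf subr0.
have [rho rho0 H] := system_zero_near F0.
exfalso; move/eqP: Fr; apply; have [rr|rr] := leP r rho; first by apply: (proj1 (H b r _)); rewrite r0.
by apply: (system_unique rho0) (ltW rr) => b'; apply: H; rewrite rho0 lexx.
Qed.

End system.

End singular_ode.

(** * Behaviour of minimizers *)

Section conclusion.
Context {R : realType} (N : nat) (N3 : (3 <= N)%N) (q gamma : R).
Context (q2 : 2 < q) (qN : q < 4 / N%:R + 2) (gamma0 : 0 < gamma).
Context (u : 'rV[R]_N -> R[i]).
Context (umin : radial_minimizer q gamma u).
Notation leb := (@lebesgue_measure R).
Notation mu := (@lebesgue_rV R N).
Notation h := (hardy_exp R N).
Let n0 := N_gt0 N3.

Lemma minimizer_rep : exists F G : bool -> R -> R,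
  forall b, radial_rep (part_fun b (ground u)) (wgrad (part_fun b (ground u))) (F b) (G b).
Proof.
have [[[_ wu _ _] _] [f uf] _] := umin.
have H b : exists F G, radial_rep (part_fun b (ground u)) (wgrad (part_fun b (ground u))) F G.
  apply: (radial_rep_exists (f0 := fun r => r `^ h * part b (f r)) n0 (wgradP b wu)).
  by apply: filterS uf => x ux; rewrite part_ground ux.
have [Ft [Gt Ht]] := H true; have [Ff [Gf Hf]] := H false.
by exists (fun b => if b then Ft else Ff), (fun b => if b then Gt else Gf); case.
Qed.

Context (F G : bool -> R -> R).
Context (repu : forall b, radial_rep (part_fun b (ground u)) (wgrad (part_fun b (ground u))) (F b) (G b)).

Lemma minimizer_nonzero : exists b r, 0 < r /\ F b r != 0.
Proof.
apply/not_existsP => H.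
have F0 b r : 0 < r -> F b r = 0.
  by move=> r0; apply/eqP/negPn/negP => Fr; apply: (H b); exists r.
have [[[mu_ wu _ _] Ku] _ _] := umin.
have : (\int[mu]_x (normc (u x) ^+ 2)%:E = 0)%E.
  rewrite (ae_eq_integral (fun=> 0%E))//; first exact: integral0.
    by apply/measurable_EFinP; exact: measurable_normc2.
  apply: filterS2 (ae_neq0 n0) (normc2_rep N3 repu) => x x0 ux _.
  by rewrite ux !F0 ?enorm_gt0// expr0n/= addr0 mulr0.
rewrite Ku => /(@EFin_inj R) H0; have := gamma0.
by rewrite H0 ltxx.
Qed.

(** By [euler_lagrange], r G has weak derivative [K]; its absolutely continuous version [Q] puts the
    equation in the form of the first-order system. *)
Lemma minimizer_limit : exists2 c : bool -> R, (exists b, c b != 0) &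
  forall b, vanishes0 (fun r => F b r - c b).
Proof.
have [[[mu_ wu finu _] _] _ _] := umin.
pose lam := multiplier q gamma u.
pose K b r := - (r `^ qexp N q * qdens F q r * F b r + lam * (r * F b r)).
have lF b : locint (F b) by exact: acp_locint (rep_acp (repu b)).
have lK b : locint (K b).
  have := locintZ (-1) (locintD (locint_qdens repu q2 b) (locintZ lam (locint_mulr (lF b)))).
  by apply: locint_ext => r _; rewrite /K mulN1r.
have lG b : locint (G b) by have [] := rep_acp (repu b).
have HQ b := weak_acp (locint_mulr (lG b)) (lK b) 
  (fun e => @euler_lagrange _ _ N3 q gamma q2 qN gamma0 u F G umin repu b e).
have [Qt [aQt eQt]] := HQ true; have [Qf [aQf eQf]] := HQ false.
pose Q b := if b then Qt else Qf.
have aQ b : acp (Q b) (K b) by case: b.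
have eQ b : {ae leb, forall r, 0 < r -> G b r = Q b r / r}.
  have : {ae leb, forall r, 0 < r -> r * G b r = Q b r} by case: b.
  apply: ae_leb_imp => r H r0; rewrite -H// mulrC mulKf//.
  by rewrite gt_eqF.
have lQ b : locint (fun r => Q b r / r).
  apply: continuous_locint => r r0; apply: continuousM; first exact: acp_continuous (aQ b) r0.
  by apply: inv_continuous; rewrite gt_eqF.
(* Q / r differs from [G] only on a null set of radii, so [F] is a primitive of it as well. *)
have aF b := acp_ae (rep_acp (repu b)) (lQ b) (eQ b).
have finQ b : (\int[leb]_(r in `]0%R, +oo[) (r * (F b r ^+ 2 + (Q b r / r) ^+ 2))%:E < +oo)%E.
  apply: le_lt_trans (rep_finite N3 mu_ wu finu repu b).
  have mF : measurable_fun (`]0, +oo[%classic : set R) (F b) by exact: locint_measurable.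
  have mm (k : R -> R) : locint k -> measurable_fun (`]0, +oo[%classic : set R) (fun r => (r * (F b r ^+ 2 + k r ^+ 2))%:E).
    move=> /locint_measurable mk; apply/measurable_EFinP; apply: measurable_funM => //.
    by apply: measurable_funD; exact: measurable_funX.
  rewrite le_eqVlt; apply/orP; left; apply/eqP; apply: ae_eq_integral => //; [exact: mm|exact: mm|].
  by apply: (ae_leb_imp _ (eQ b)) => r H /=; rewrite in_itv/= andbT => r0; rewrite H.
have p1 : 1 < q / 2 by rewrite ltr_pdivlMr// mul1r.
exact: (@system_nonzero R F Q (qexp N q) (q / 2) lam aF aQ (qexp_gt N3 qN) (qexp_le N3 q2) p1 finQ minimizer_nonzero).
Qed.

End conclusion.

Unset Implicit Arguments.
Theorem theorem1p2 (R : realType) (N : nat) (q gamma : R)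
    (hN : (3 <= N)%N) (hq2 : 2 < q) (hqN : q < 4 / N%:R + 2)
    (hgamma : 0 < gamma) (u : 'rV[R]_N -> R[i]) :
  radial_minimizer q gamma u ->
  exists2 c : R[i], c != 0 &
    exists2 u' : 'rV[R]_N -> R[i],
      {ae lebesgue_rV N, forall x, u x = u' x} &
      normc ((enorm x `^ ((N%:R - 2) / 2))%:C * u' x - c)
        @[x --> (0 : 'rV[R]_N)^'] --> (0 : R).
Proof.
move=> umin; have [F [G repu]] := minimizer_rep hN umin.
have [c [b cb] Hc] := minimizer_limit hN hq2 hqN hgamma umin repu.
exists (c true +i* c false).
  by apply: contra cb => /eqP[c1 c2]; case: (b); rewrite ?c1 ?c2.
(* u is given up to a null set only; the limit is taken along this representative, which is
   continuous off the origin. *)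
exists (fun x => (enorm x `^ (- hardy_exp R N))%:C * (F true (enorm x) +i* F false (enorm x))).
  apply: filterS3 (ae_neq0 (N_gt0 hN)) (rep_f (repu true)) (rep_f (repu false)) => x x0 ft ff.
  have P b' : part_fun b' (ground u) x = F b' (enorm x) -> part b' (u x) = enorm x `^ (- hardy_exp R N) * F b' (enorm x).
    by move=> <-; rewrite part_ground mulrA [_ `^ _ * _ `^ _]mulrC powR_hardyV// mul1r.
  move: (P true ft) (P false ff); rewrite /part; case: (u x) => a1 a2 /= -> ->.
  by apply/eqP; rewrite eq_complex/= !mul0r subr0 addr0 !eqxx.
apply/cvgr0Pnorm_le => e e0.
have e2 : 0 < e / 2 by rewrite divr_gt0.
have [r1 [r10 _ H1]] := Hc true _ e2; have [r2 [r20 _ H2]] := Hc false _ e2.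
have small (r : R) : 0 < r -> \forall x \near (0 : 'rV[R]_N)^', enorm x < r.
  move=> r0; apply: nbhs_dnbhs; have ce := @continuous_enorm R N 0.
  by apply: (cvgr_lt _ ce); rewrite enorm0.
near=> x.
have x0 : x != 0 by near: x; exact: nbhs_dnbhs_neq.
have ex : 0 < enorm x by rewrite enorm_gt0.
have xr1 : enorm x < r1 by near: x; exact: small.
have xr2 : enorm x < r2 by near: x; exact: small.
rewrite ger0_norm ?normc_ge0// mulrA -rmorphM powR_hardyV// mul1r.
have h1 := H1 (enorm x) _; have h2 := H2 (enorm x) _.
rewrite ex (ltW xr1) in h1; rewrite ex (ltW xr2) in h2.
have {}h1 := h1 isT; have {}h2 := h2 isT.
rewrite /normc/=; move: h1 h2; move: (F true _ - _) (F false _ - _) => y1 y2 h1 h2.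
apply: (@le_trans _ _ (Num.sqrt ((`|y1| + `|y2|) ^+ 2))).
  rewrite ler_sqrt ?sqr_ge0// -[y1 ^+ 2]real_normK ?num_real// -[y2 ^+ 2]real_normK ?num_real//.
  rewrite sqrrD addrAC lerDl.
  by rewrite mulrn_wge0// mulr_ge0.
rewrite sqrtr_sqr ger0_norm ?addr_ge0//; move: h1 h2; move: (`|y1|) (`|y2|) => z1 z2; lra.
Unshelve. all: by end_near. Qed.
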